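(* There is a deterministic parallel algorithm that, for allocation instances with additive valuations whose induced hypergraph has rank $r=O(1)$ and edge degree at most $\Delta$, computes an $\mathsf{EF1}$ allocation in $O(\Delta\log^4 m)$ depth and $O(m^{r+1})$ work, where $m$ is the number of goods.
   Context: An allocation instance has a set $M$ of $m$ goods, a set of agents, and additive valuations $v_i:2^M\to\mathbb{R}_{\ge0}$, $v_i(S)=\sum_{g\in S}v_i(g)$. Its induced hypergraph has a vertex for each agent and, for each good $g$, a hyperedge consisting of the agents that value $g$ positively (goods with the same set of positively-valuing agents give parallel copies of the same hyperedge). The rank is the maximum hyperedge size. The edge degree is the maximum degree in the graph whose vertices are the distinct hyperedges, two being adjacent iff they intersect. An allocation is $\mathsf{EF1}$ if for all agents $i,j$ there is $s\in\mathcal{A}(j)$ with $v_i(\mathcal{A}(i))\ge v_i(\mathcal{A}(j)\setminus\{s\})$. Depth and work are measured in the binary fork-join work-depth model. *)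

(* Defs.v *)
From HB Require Import structures.
From mathcomp Require Import all_boot all_order all_algebra reals.

Set Implicit Arguments.
Unset Strict Implicit.
Unset Printing Implicit Defensive.

Import Order.TTheory GRing.Theory Num.Theory.

(** * Allocation instances

    Agents are ['I_n], goods are ['I_m], and [v i g] is the value of the good
    [g] for the agent [i]. *)

Section Allocation.
Context {R : realType} {n m : nat}.
Implicit Types (v : 'I_n -> 'I_m -> R) (A : {ffun 'I_m -> 'I_n}).

Definition value v (i : 'I_n) (S : {set 'I_m}) : R := (\sum_(g in S) v i g)%R.

Definition hyperedge v (g : 'I_m) : {set 'I_n} := [set i | (0 < v i g)%R].

(** The distinct hyperedges: parallel copies are identified. *)
Definition hyperedges v : {set {set 'I_n}} := [set hyperedge v g | g : 'I_m].

Definition rank v : nat := \max_(e in hyperedges v) #|e|.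

Definition edge_degree v : nat :=
  \max_(e in hyperedges v)
     #|[set f in hyperedges v | (f != e) && (e :&: f != set0)]|.

(** An allocation is complete: every good [g] has an owner [A g]. *)
Definition bundle A (i : 'I_n) : {set 'I_m} := [set g | A g == i].

(** No good can be removed from an empty bundle, and nobody envies one, so the
    condition is only imposed on nonempty bundles. *)
Definition EF1 v A : Prop :=
  forall i j : 'I_n, bundle A j != set0 ->
    exists2 s, s \in bundle A j &
      (value v i (bundle A j :\ s) <= value v i (bundle A i))%R.

End Allocation.

(** * The binary fork-join machine

    A thread has integer registers and real registers; all threads share an
    integer memory and a real memory.  A program mentions finitely many
    registers, so that a thread has O(1) of them and copying them at a call or
    a fork is a constant-time operation. *)

Definition reg := nat.

Inductive iop := IAdd | ISub | IMul | IDiv | IMod.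
Inductive rop := RAdd | RSub | RMul | RDiv.

(** The destination register always comes first.  [ILoad d a] and [RLoad d a]
    read the cell whose address is in the integer register [a]; [IStore a b]
    and [RStore a b] write the register [b] to that cell.  [ROfInt] is the only
    passage from integers to reals; in the other direction, a program can only
    branch on comparisons of reals. *)
Inductive instr :=
  | IConst of reg & nat
  | IBin of iop & reg & reg & reg
  | ILoad of reg & reg
  | IStore of reg & reg
  | ROfInt of reg & reg
  | RBin of rop & reg & reg & reg
  | RLoad of reg & reg
  | RStore of reg & reg.

Inductive test := ILt of reg & reg | RLe of reg & reg.

Inductive com :=
  | Skip
  | Do of instr
  | Seq of com & com
  | If of test & com & com
  | While of test & com
  | Call of nat
  | Fork of com & com.

(** A list of procedure bodies; execution starts with [Call 0]. *)
Definition program := seq com.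

Definition eval_iop (o : iop) : nat -> nat -> nat :=
  match o with
  | IAdd => addn | ISub => subn | IMul => muln | IDiv => divn | IMod => modn
  end.

Definition eval_rop (R : realType) (o : rop) (x y : R) : R :=
  match o with
  | RAdd => x + y | RSub => x - y | RMul => x * y | RDiv => x / y
  end%R.

Record state (R : realType) := State {
  ireg : nat -> nat;
  rreg : nat -> R;
  imem : nat -> nat;
  rmem : nat -> R }.

(** A cell of the integer memory ([inl]) or of the real memory ([inr]). *)
Definition cell : eqType := (nat + nat)%type.

Record cost := Cost {
  work : nat;
  depth : nat;
  reads : seq cell;
  writes : seq cell }.

Definition unit_cost (rs ws : seq cell) : cost := Cost 1 1 rs ws.
Definition tick : cost := unit_cost [::] [::].

Definition seq_cost (k1 k2 : cost) : cost :=
  Cost (work k1 + work k2) (depth k1 + depth k2)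
       (reads k1 ++ reads k2) (writes k1 ++ writes k2).

Definition par_cost (k1 k2 : cost) : cost :=
  Cost (work k1 + work k2) (maxn (depth k1) (depth k2))
       (reads k1 ++ reads k2) (writes k1 ++ writes k2).

(** Neither branch writes to a cell that the other one reads or writes. *)
Definition race_free (k1 k2 : cost) : bool :=
  ~~ has (mem (reads k2 ++ writes k2)) (writes k1)
  && ~~ has (mem (reads k1)) (writes k2).

Section Semantics.
Context {R : realType}.
Implicit Types s : state R.

Definition set_ireg s d x :=
  State [eta ireg s with d |-> x] (rreg s) (imem s) (rmem s).
Definition set_rreg s d x :=
  State (ireg s) [eta rreg s with d |-> x] (imem s) (rmem s).
Definition set_imem s a x :=
  State (ireg s) (rreg s) [eta imem s with a |-> x] (rmem s).
Definition set_rmem s a x :=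
  State (ireg s) (rreg s) (imem s) [eta rmem s with a |-> x].

Definition step (c : instr) s : state R :=
  match c with
  | IConst d x => set_ireg s d x
  | IBin o d a b => set_ireg s d (eval_iop o (ireg s a) (ireg s b))
  | ILoad d a => set_ireg s d (imem s (ireg s a))
  | IStore a b => set_imem s (ireg s a) (ireg s b)
  | ROfInt d a => set_rreg s d ((ireg s a)%:R)%R
  | RBin o d a b => set_rreg s d (eval_rop o (rreg s a) (rreg s b))
  | RLoad d a => set_rreg s d (rmem s (ireg s a))
  | RStore a b => set_rmem s (ireg s a) (rreg s b)
  end.

Definition instr_cost (c : instr) s : cost :=
  match c with
  | ILoad _ a => unit_cost [:: inl (ireg s a)] [::]
  | IStore a _ => unit_cost [::] [:: inl (ireg s a)]
  | RLoad _ a => unit_cost [:: inr (ireg s a)] [::]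
  | RStore a _ => unit_cost [::] [:: inr (ireg s a)]
  | _ => tick
  end.

(** Integers are machine words: an instruction can only be executed if the
    integer that it puts in a register is smaller than [W]. *)
Definition in_range (W : nat) (c : instr) s : bool :=
  match c with
  | IConst d _ | IBin _ d _ _ | ILoad d _ => ireg (step c s) d < W
  | _ => true
  end.

Definition holds (t : test) s : bool :=
  match t with
  | ILt a b => ireg s a < ireg s b
  | RLe a b => (rreg s a <= rreg s b)%R
  end.

(** A callee starts with a copy of the registers of its caller; on return, the
    caller recovers its own registers, except that its registers [0] receive
    the values of the registers [0] of the callee. *)
Definition after_call s s1 : state R :=
  State [eta ireg s with 0 |-> ireg s1 0] [eta rreg s with 0 |-> rreg s1 0]
        (imem s1) (rmem s1).

(** Likewise, both branches of a fork start with a copy of the registers of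
    their parent, whose registers [0] and [1] receive, at the join, the
    registers [0] of the left and of the right branch respectively. *)
Definition with_mem s s1 : state R :=
  State (ireg s) (rreg s) (imem s1) (rmem s1).

Definition after_join s s1 s2 : state R :=
  State [eta ireg s with 0 |-> ireg s1 0, 1 |-> ireg s2 0]
        [eta rreg s with 0 |-> rreg s1 0, 1 |-> rreg s2 0]
        (imem s2) (rmem s2).

(** [exec P W c s s' k]: the command [c] leads from [s] to [s'] at cost [k].
    A fork is only executable if its branches do not race; hence all their
    interleavings have the same outcome, which is the one obtained by running
    the left branch and then the right one. *)
Inductive exec (P : program) (W : nat) :
    com -> state R -> state R -> cost -> Prop :=
  | exec_skip s : exec P W Skip s s tick
  | exec_do c s :
      in_range W c s -> exec P W (Do c) s (step c s) (instr_cost c s)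
  | exec_seq c1 c2 s s1 s2 k1 k2 :
      exec P W c1 s s1 k1 -> exec P W c2 s1 s2 k2 ->
      exec P W (Seq c1 c2) s s2 (seq_cost k1 k2)
  | exec_if t c1 c2 s s1 k :
      exec P W (if holds t s then c1 else c2) s s1 k ->
      exec P W (If t c1 c2) s s1 (seq_cost tick k)
  | exec_while t c s s1 k :
      exec P W (if holds t s then Seq c (While t c) else Skip) s s1 k ->
      exec P W (While t c) s s1 (seq_cost tick k)
  | exec_call f s s1 k :
      exec P W (nth Skip P f) s s1 k ->
      exec P W (Call f) s (after_call s s1) (seq_cost tick k)
  | exec_fork c1 c2 s s1 s2 k1 k2 :
      exec P W c1 s s1 k1 -> exec P W c2 (with_mem s s1) s2 k2 ->
      race_free k1 k2 ->
      exec P W (Fork c1 c2) s (after_join s s1 s2)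
           (seq_cost tick (par_cost k1 k2)).

Lemma exec_deterministic P W c s s1 s2 k1 k2 :
  exec P W c s s1 k1 -> exec P W c s s2 k2 -> s1 = s2 /\ k1 = k2.
Proof.
move=> H; elim: H s2 k2 => {c s s1 k1}.
- by move=> s s2 k2 H; inversion H.
- by move=> c s _ s2 k2 H; inversion H.
- move=> c1 c2 s s1 s2 k1 k2 _ IH1 _ IH2 s3 k3 H.
  inversion H as [| |d1 d2 t t1 t2 l1 l2 H1 H2| | | |]; subst.
  by case: (IH1 _ _ H1) => ? ?; subst; case: (IH2 _ _ H2) => -> ->.
- move=> t c1 c2 s s1 k _ IH s2 k2 H.
  inversion H as [| | |u d1 d2 q q1 l H1| | |]; subst.
  by case: (IH _ _ H1) => -> ->.
- move=> t c s s1 k _ IH s2 k2 H.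
  inversion H as [| | | |u d q q1 l H1| |]; subst.
  by case: (IH _ _ H1) => -> ->.
- move=> f s s1 k _ IH s2 k2 H.
  inversion H as [| | | | |g q q1 l H1|]; subst.
  by case: (IH _ _ H1) => -> ->.
move=> c1 c2 s s1 s2 k1 k2 _ IH1 _ IH2 _ s3 k3 H.
inversion H as [| | | | | |d1 d2 t t1 t2 l1 l2 H1 H2 _]; subst.
by case: (IH1 _ _ H1) => ? ?; subst; case: (IH2 _ _ H2) => -> ->.
Qed.

End Semantics.

(** * Input and output of allocation algorithms *)

Section InputOutput.
Context {R : realType} {n m : nat}.
Implicit Types (v : 'I_n -> 'I_m -> R) (A : {ffun 'I_m -> 'I_n}).

(** The pairs (agent, good) with a positive value, good by good. *)
Definition incidences v : seq ('I_n * 'I_m) :=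
  [seq (i, g) | g <- enum 'I_m, i <- enum (hyperedge v g)].

Definition offset v (k : nat) : nat := \sum_(g < m | g < k) #|hyperedge v g|.

(** The instance is given in sparse form: the integer memory contains [n], [m],
    the offsets of the [m] goods and their total, and then the agents of all
    incidences; the real memory contains the values of the incidences.  Thus
    the agents of the good [g] are in the cells from [m + 3 + offset v g] to
    [m + 3 + offset v g.+1], excluded.  The other cells and the registers are
    initially null. *)
Definition input v : state R :=
  State (fun=> 0) (fun=> 0%R)
    (nth 0 (n :: m :: [seq offset v k | k <- iota 0 m.+1]
                   ++ [seq val p.1 | p <- incidences v]))
    (nth 0%R [seq v p.1 p.2 | p <- incidences v]).

(** The owners of the goods are in [m] consecutive cells, the first of which is
    pointed to by the integer register [0]. *)
Definition output (s : state R) A : Prop :=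
  forall g : 'I_m, imem s (ireg s 0 + g) = A g.

Definition computes (P : program) (W : nat) v A (k : cost) : Prop :=
  exists2 s, exec P W (Call 0) (input v) s k & output s A.

End InputOutput.

(* Submission.v *)
(* Merge parallel goods into classes.  Colour the graph of distinct hyperedges
   with at most Delta + 1 colours: blocks of 2^t hyperedges are coloured
   separately, and merging two blocks only requires recolouring one of them,
   colour by colour, so that a colour class, being independent, is recoloured in
   one parallel step.  The colour classes are then processed in turn.

   In a phase, the agents of an active hyperedge first exchange their bundles:
   among the permutations of the bundles that harm none of these agents, one of
   maximal welfare has an envy graph without cycles, so that the agents can be
   ordered in such a way that nobody envies an earlier one.  Then the goods of
   the class are allotted by a round robin in this order: whoever is favoured by
   picking first was not envied by those who pick later.  The hyperedges
   of a phase are pairwise disjoint, hence the phases preserve EF1.  The agents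
   are O(1) in number, so that both the permutation and the order are found by
   exhaustive search.

   The round robin is a path in a graph whose states record, for each agent, the
   shortest prefix of his preferences that contains all his picks: there are
   O(k^r) of them for a class of k goods, and pointer jumping follows the path in
   O(log k) steps of depth O(log k) and work O(k^r) each.

   Programs are written as expressions, whose reductions are compiled into
   balanced trees of forks and whose parallel tables write pairwise distinct
   cells that they never read. *)
Require Import Defs.
From mathcomp Require Import all_boot all_order all_algebra reals.
From mathcomp Require Import fingroup perm zify.

Set Implicit Arguments.
Unset Strict Implicit.
Unset Printing Implicit Defensive.

Import Order.TTheory GRing.Theory Num.Theory.

(** * A language of parallel expressions *)

(** Two constraints shape the proof. Forks must not race, so a table never reads the region that it
    fills: each stage of an iteration is a new version of its table, in a fresh region. And the work
    must not depend on the number of agents, which [m] does not bound: agents are handled through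
    their positions in hyperedges, bundles exist only through the owners of the goods, and memory is
    used sparsely, untouched cells being 0.

    The exponent [r + 1] of the work comes from the round robin: the classes have O(m^r) states in
    total, and the pick made in a state is found by a search among O(m) goods. Recolouring fits in
    this bound: at level [t], a hyperedge tests each colour against the [2 ^ (t + 1)] members of its
    merged block, once per level, and the number of colours is at most [m ^ (r - 1)]; for rank 1
    this holds because distinct hyperedges are then disjoint.

    The depth is governed by the nested loop of the colouring: O(log m) levels, each with as many
    rounds as there are colours, each round being one table of depth O(log m). *)

Definition upd T (f : nat -> T) x v : nat -> T :=
  fun y => if y == x then v else f y.

Inductive red : bool -> Type :=
  | Sum : red false
  | Max : red false
  | Prod : red false
  | RSum : red true.

(* [exp true] denotes reals and [exp false] integers.  The tag of a reduction
   [ERed o tag N x e] tells which of three bounds its range [N] obeys. *)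
Inductive exp : bool -> Type :=
  | EVar : nat -> exp false
  | ECst : nat -> exp false
  | EBin : iop -> exp false -> exp false -> exp false
  | ELd : exp false -> exp false
  | ELet s : nat -> exp false -> exp s -> exp s
  | ELt s : exp false -> exp false -> exp s -> exp s -> exp s
  | ELe s : exp true -> exp true -> exp s -> exp s -> exp s
  | ERed s : red s -> nat -> exp false -> nat -> exp s -> exp s
  | ESt : exp false -> exp false -> exp false
  | ERd : exp false -> exp true
  | ERz : exp true.

(** There is no copy instruction, so a copy is an addition to a cleared register; hence [d] and [a]
    must differ. The real version clears through register 1. *)
Definition mov d a := Seq (Do (IConst d 0)) (Do (IBin IAdd d d a)).
Definition rmov d a :=
  Seq (Do (IConst 1 0)) (Seq (Do (ROfInt d 1)) (Do (RBin RAdd d d a))).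

Definition combine s (o : red s) : com :=
  match o with
  | Sum => Do (IBin IAdd 0 0 1)
  | Max => Seq (Do (IBin ISub 1 1 0)) (Do (IBin IAdd 0 0 1))
  | Prod => Do (IBin IMul 0 0 1)
  | RSum => Do (RBin RAdd 0 0 1)
  end.

Definition set_unit s (o : red s) : com :=
  match o with
  | Sum | Max => Do (IConst 0 0)
  | Prod => Do (IConst 0 1)
  | RSum => Seq (Do (IConst 0 0)) (Do (ROfInt 0 0))
  end.

(* The interval that remains to be reduced is between the registers [t.+1]
   (included) and [t] (excluded). *)
Definition redproc s (o : red s) x t f body : com :=
  Seq (Do (IConst t.+2 1)) (Seq (Do (IBin IAdd t.+2 t.+1 t.+2))
  (If (ILt t.+2 t)
    (Seq (Do (IConst 0 2)) (Seq (Do (IBin IAdd t.+2 t.+1 t))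
    (Seq (Do (IBin IDiv t.+2 t.+2 0))
    (Seq (Fork (Seq (mov t t.+2) (Call f)) (Seq (mov t.+1 t.+2) (Call f)))
         (combine o)))))
    (If (ILt t.+1 t) (Seq (mov x t.+1) body) (set_unit o)))).

(** One procedure per [ELet], so that returning from its call restores the old value of the bound
    variable, and one per [ERed], which is recursive. *)
Fixpoint np s (e : exp s) : nat :=
  match e with
  | EVar _ | ECst _ | ERz => 0
  | EBin _ a b | ESt a b => np a + np b
  | ELd a | ERd a => np a
  | ELet _ _ a b => (np a + np b).+1
  | ELt _ a b c d => np a + np b + np c + np d
  | ELe _ a b c d => np a + np b + np c + np d
  | ERed _ _ _ N _ b => (np N + np b).+1
  end.

(* [t] is the first free temporary, [f] the first free procedure. *)
Fixpoint code s (e : exp s) (t f : nat) : com :=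
  match e with
  | EVar x => mov 0 x
  | ECst c => Do (IConst 0 c)
  | EBin o a b => Seq (code a t f) (Seq (mov t 0)
      (Seq (code b t.+1 (f + np a)) (Do (IBin o 0 t 0))))
  | ELd a => Seq (code a t f) (Do (ILoad 0 0))
  | ELet _ _ a b => Seq (code a t f) (Seq (mov t 0) (Call (f + np a)))
  | ELt _ a b c d => Seq (code a t f) (Seq (mov t 0)
      (Seq (code b t.+1 (f + np a)) (If (ILt t 0)
        (code c t.+1 (f + np a + np b)) (code d t.+1 (f + np a + np b + np c)))))
  | ELe _ a b c d => Seq (code a t f) (Seq (rmov t 0)
      (Seq (code b t.+1 (f + np a)) (If (RLe t 0)
        (code c t.+1 (f + np a + np b)) (code d t.+1 (f + np a + np b + np c)))))
  | ERed _ _ _ N _ _ => Seq (code N t f) (Seq (mov t 0)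
      (Seq (Do (IConst t.+1 0)) (Call (f + np N))))
  | ESt a b => Seq (code a t f) (Seq (mov t 0)
      (Seq (code b t.+1 (f + np a)) (Do (IStore t 0))))
  | ERd a => Seq (code a t f) (Do (RLoad 0 0))
  | ERz => Seq (Do (IConst 0 0)) (Do (ROfInt 0 0))
  end.

Fixpoint procs s (e : exp s) (t f : nat) : seq com :=
  match e with
  | EVar _ | ECst _ | ERz => [::]
  | EBin _ a b | ESt a b => procs a t f ++ procs b t.+1 (f + np a)
  | ELd a | ERd a => procs a t f
  | ELet _ x a b => procs a t f ++
      Seq (mov x t) (code b t.+1 (f + np a).+1) :: procs b t.+1 (f + np a).+1
  | ELt _ a b c d => procs a t f ++ procs b t.+1 (f + np a) ++
      procs c t.+1 (f + np a + np b) ++ procs d t.+1 (f + np a + np b + np c)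
  | ELe _ a b c d => procs a t f ++ procs b t.+1 (f + np a) ++
      procs c t.+1 (f + np a + np b) ++ procs d t.+1 (f + np a + np b + np c)
  | ERed _ o _ N x b => procs N t f ++
      redproc o x t (f + np N) (code b t.+3 (f + np N).+1)
        :: procs b t.+3 (f + np N).+1
  end.

Lemma size_procs s (e : exp s) t f : size (procs e t f) = np e.
Proof.
elim: e t f => //=.
- by move=> o a IHa b IHb t f; rewrite size_cat IHa IHb.
- by move=> s' x a IHa b IHb t f; rewrite size_cat /= IHa IHb addnS.
- by move=> s' a IHa b IHb c IHc d IHd t f;
    rewrite !size_cat IHa IHb IHc IHd !addnA.
- by move=> s' a IHa b IHb c IHc d IHd t f;
    rewrite !size_cat IHa IHb IHc IHd !addnA.
- by move=> s' o g N IHN x b IHb t f; rewrite size_cat /= IHN IHb addnS.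
- by move=> a IHa b IHb t f; rewrite size_cat IHa IHb.
Qed.

(* Registers from [vmax] on are temporaries. *)
Definition vmax := 64.
Definition isvar x := (1 < x) && (x < vmax).

(** A product must carry the tag 0, whose ranges are bounded in terms of the rank: a product over a
    range growing with the instance could exceed every fixed power of [X], hence the word size. *)
Fixpoint wf s (e : exp s) : bool :=
  match e with
  | EVar x => isvar x
  | ECst _ | ERz => true
  | EBin _ a b | ESt a b => wf a && wf b
  | ELd a | ERd a => wf a
  | ELet _ x a b => [&& isvar x, wf a & wf b]
  | ELt _ a b c d => [&& wf a, wf b, wf c & wf d]
  | ELe _ a b c d => [&& wf a, wf b, wf c & wf d]
  | ERed _ o g N x b => [&& isvar x, wf N, wf b &
      match o with Prod => g == 0 | _ => true end]
  end.

(** Static bound on the depth, [lm] bounding the logarithms of the ranges. *)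
Fixpoint dpb lm s (e : exp s) : nat :=
  match e with
  | EVar _ | ERz => 2
  | ECst _ => 1
  | EBin _ a b | ESt a b => dpb lm a + dpb lm b + 3
  | ELd a | ERd a => dpb lm a + 1
  | ELet _ _ a b => dpb lm a + dpb lm b + 5
  | ELt _ a b c d => dpb lm a + dpb lm b + maxn (dpb lm c) (dpb lm d) + 3
  | ELe _ a b c d => dpb lm a + dpb lm b + maxn (dpb lm c) (dpb lm d) + 4
  | ERed _ _ _ N _ b => dpb lm N + dpb lm b + 12 * lm + 10
  end.

(** Separates the depth into a constant of the program text and the logarithm of the ranges. *)
Lemma dpb_linear s (e : exp s) lm : dpb lm e <= dpb 1 e * lm.+1.
Proof.
elim: e => //=; try lia.
all: move=> *; repeat match goal with H : is_true (dpb _ _ <= _) |- _ =>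
  move: H end; nia.
Qed.

(** Static bounds on the work: the work of [e] is at most [wkb q0 e] times
    [q1 ^ nest 1 e * q2 ^ nest 2 e]. *)
Fixpoint nest g s (e : exp s) : nat :=
  match e with
  | EVar _ | ERz | ECst _ => 0
  | EBin _ a b | ESt a b => maxn (nest g a) (nest g b)
  | ELd a | ERd a => nest g a
  | ELet _ _ a b => maxn (nest g a) (nest g b)
  | ELt _ a b c d => maxn (maxn (nest g a) (nest g b)) (maxn (nest g c) (nest g d))
  | ELe _ a b c d => maxn (maxn (nest g a) (nest g b)) (maxn (nest g c) (nest g d))
  | ERed _ _ h N _ b => maxn (nest g N) (nest g b + (h == g))
  end.

(** Ranges with the tag 0 multiply the constant; those with the tags 1 and 2 are accounted for by
    the exponents [nest]. Since a reduction tree has fewer inner nodes than leaves, its overhead is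
    charged to the leaves, 21 for each. *)
Fixpoint wkb q0 s (e : exp s) : nat :=
  match e with
  | EVar _ | ERz => 2
  | ECst _ => 1
  | EBin _ a b | ESt a b => wkb q0 a + wkb q0 b + 3
  | ELd a | ERd a => wkb q0 a + 1
  | ELet _ _ a b => wkb q0 a + wkb q0 b + 5
  | ELt _ a b c d => wkb q0 a + wkb q0 b + wkb q0 c + wkb q0 d + 3
  | ELe _ a b c d => wkb q0 a + wkb q0 b + wkb q0 c + wkb q0 d + 4
  | ERed _ _ g N _ b =>
      wkb q0 N + (if g is 0 then q0 else 1) * (wkb q0 b + 21) + 10
  end.

Section Degrees.
Context (dm r0 : nat).

(** Integer values are smaller than [X ^ deg dv e] if each variable [x] is
    smaller than [X ^ dv x], memory cells are smaller than [X ^ dm], and the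
    ranges of products are at most [r0]. *)
Fixpoint deg (dv : nat -> nat) s (e : exp s) : nat :=
  match e with
  | EVar x => dv x
  | ECst c => c.+1
  | EBin o a b =>
      match o with
      | IAdd => (maxn (deg dv a) (deg dv b)).+1
      | IMul => deg dv a + deg dv b
      | _ => deg dv a
      end
  | ELd _ => dm
  | ELet _ x a b => deg (upd dv x (deg dv a)) b
  | ELt _ _ _ c d => maxn (deg dv c) (deg dv d)
  | ELe _ _ _ c d => maxn (deg dv c) (deg dv d)
  | ERed _ o _ N x b =>
      let d := deg (upd dv x (deg dv N)) b in
      match o with
      | Sum => deg dv N + d
      | Max => d
      | Prod => (d * r0).+1
      | RSum => 0
      end
  | ESt _ b => deg dv b
  | ERd _ | ERz => 0
  end.

(** Bounds the intermediate words as well as the result. In a reduction, the two extra degrees on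
    the range leave room for the sum of the ends of an interval, which is formed before it is
    halved. *)
Fixpoint mdeg (dv : nat -> nat) s (e : exp s) : nat :=
  match e with
  | EVar x => (dv x).+1
  | ECst c => c.+1
  | EBin _ a b => maxn (deg dv e) (maxn (mdeg dv a) (mdeg dv b))
  | ELd a => maxn dm (mdeg dv a)
  | ELet _ x a b => maxn (mdeg dv a) (mdeg (upd dv x (deg dv a)) b)
  | ELt _ a b c d =>
      maxn (maxn (mdeg dv a) (mdeg dv b)) (maxn (mdeg dv c) (mdeg dv d))
  | ELe _ a b c d =>
      maxn (maxn (mdeg dv a) (mdeg dv b)) (maxn (mdeg dv c) (mdeg dv d))
  | ERed _ o _ N x b =>
      maxn (deg dv N).+2 (maxn (deg dv e) (maxn (mdeg dv N)
        (mdeg (upd dv x (deg dv N)) b)))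
  | ESt a b => maxn (mdeg dv a) (mdeg dv b)
  | ERd a => mdeg dv a
  | ERz => 1
  end.

Lemma deg_mdeg dv s (e : exp s) : deg dv e <= mdeg dv e.
Proof.
elim: e dv => //=; try lia.
all: move=> *; repeat match goal with H : forall dv : nat -> nat, is_true (deg dv ?e <= _)
   |- context [deg ?d ?e] => move: (H d); clear H end; lia.
Qed.

End Degrees.

Definition valT (R : realType) (s : bool) : Type := if s then (R : Type) else nat.

Definition redop (R : realType) s (o : red s) : valT R s -> valT R s -> valT R s :=
  match o in red s return valT R s -> valT R s -> valT R s with
  | Sum => addn | Max => maxn | Prod => muln | RSum => +%R
  end.

Definition redidx (R : realType) s (o : red s) : valT R s :=
  match o in red s return valT R s with
  | Sum => 0 | Max => 0 | Prod => 1 | RSum => 0%R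
  end.

Lemma red_cat (R : realType) s (o : red s) (F : nat -> valT R s) lo mid hi :
  lo <= mid -> mid <= hi ->
  \big[redop o/redidx R o]_(lo <= i < hi) F i =
  redop o (\big[redop o/redidx R o]_(lo <= i < mid) F i)
          (\big[redop o/redidx R o]_(mid <= i < hi) F i).
Proof. by move=> h1 h2; case: o F => F; rewrite (big_cat_nat h1 h2). Qed.

Lemma red_nil (R : realType) s (o : red s) (F : nat -> valT R s) lo :
  \big[redop o/redidx R o]_(lo <= i < lo) F i = redidx R o.
Proof. by rewrite big_geq. Qed.

Lemma red_one (R : realType) s (o : red s) (F : nat -> valT R s) lo :
  \big[redop o/redidx R o]_(lo <= i < lo.+1) F i = F lo.
Proof. by case: o F => F; rewrite big_nat1. Qed.

(** * Semantics of expressions: value, writes, work, side conditions *)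

Section Denotation.
Context (R : realType) (mem : nat -> nat) (rm : nat -> R) (X dm : nat)
        (F : pred nat).

Fixpoint den (rho : nat -> nat) s (e : exp s) : valT R s :=
  match e in exp s return valT R s with
  | EVar x => rho x
  | ECst c => c
  | EBin o a b => eval_iop o (den rho a) (den rho b)
  | ELd a => mem (den rho a)
  | ELet _ x a b => den (upd rho x (den rho a)) b
  | ELt _ a b c d => if den rho a < den rho b then den rho c else den rho d
  | ELe _ a b c d => if (den rho a <= den rho b)%R then den rho c else den rho d
  | ERed _ o _ N x b =>
      \big[redop o/redidx R o]_(0 <= i < den rho N) den (upd rho x i) b
  | ESt a b => den rho b
  | ERd a => rm (den rho a)
  | ERz => 0%R
  end.

Fixpoint wr (rho : nat -> nat) s (e : exp s) : seq (nat * nat) :=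
  match e with
  | EVar _ | ECst _ | ERz => [::]
  | EBin _ a b => wr rho a ++ wr rho b
  | ELd a | ERd a => wr rho a
  | ELet _ x a b => wr rho a ++ wr (upd rho x (den rho a)) b
  | ELt _ a b c d => wr rho a ++ wr rho b ++
      (if den rho a < den rho b then wr rho c else wr rho d)
  | ELe _ a b c d => wr rho a ++ wr rho b ++
      (if (den rho a <= den rho b)%R then wr rho c else wr rho d)
  | ERed _ o _ N x b => wr rho N ++
      flatten [seq wr (upd rho x i) b | i <- index_iota 0 (den rho N)]
  | ESt a b => wr rho a ++ wr rho b ++ [:: (den rho a, den rho b)]
  end.

Fixpoint wk (rho : nat -> nat) s (e : exp s) : nat :=
  match e with
  | EVar _ | ERz => 2
  | ECst _ => 1
  | EBin _ a b | ESt a b => wk rho a + wk rho b + 3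
  | ELd a | ERd a => wk rho a + 1
  | ELet _ x a b => wk rho a + wk (upd rho x (den rho a)) b + 5
  | ELt _ a b c d => wk rho a + wk rho b +
      (if den rho a < den rho b then wk rho c else wk rho d) + 3
  | ELe _ a b c d => wk rho a + wk rho b +
      (if (den rho a <= den rho b)%R then wk rho c else wk rho d) + 4
  | ERed _ _ _ N x b => wk rho N +
      \sum_(0 <= i < den rho N) (wk (upd rho x i) b + 21) + 10
  end.

(** Loads are from cells in [F], and ranges obey the bounds [q]. *)
Fixpoint ok (q : nat -> nat) (rho : nat -> nat) s (e : exp s) : Prop :=
  match e with
  | EVar _ | ECst _ | ERz => True
  | EBin _ a b | ESt a b => ok q rho a /\ ok q rho b
  | ELd a => [/\ ok q rho a, F (den rho a) & mem (den rho a) < X ^ dm]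
  | ERd a => ok q rho a
  | ELet _ x a b => ok q rho a /\ ok q (upd rho x (den rho a)) b
  | ELt _ a b c d => [/\ ok q rho a, ok q rho b &
      if den rho a < den rho b then ok q rho c else ok q rho d]
  | ELe _ a b c d => [/\ ok q rho a, ok q rho b &
      if (den rho a <= den rho b)%R then ok q rho c else ok q rho d]
  | ERed _ _ g N x b => [/\ ok q rho N, den rho N <= q g &
      forall i, i < den rho N -> ok q (upd rho x i) b]
  end.

Lemma ok_mono q q' rho s (e : exp s) :
  (forall g, q g <= q' g) -> ok q rho e -> ok q' rho e.
Proof.
move=> le_q; elim: e rho => //=.
- by move=> o a IHa b IHb rho [/IHa ? /IHb ?].
- by move=> a IHa rho [/IHa].
- by move=> s' x a IHa b IHb rho [/IHa ? /IHb ?].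
- move=> s' a IHa b IHb c IHc d IHd rho [/IHa ? /IHb ?].
  by case: ifP => _ ?; split=> //; [apply: IHc | apply: IHd].
- move=> s' a IHa b IHb c IHc d IHd rho [/IHa ? /IHb ?].
  by case: ifP => _ ?; split=> //; [apply: IHc | apply: IHd].
- move=> s' o g N IHN x b IHb rho [/IHN ? le_N okb]; split => //.
    exact: leq_trans le_N (le_q g).
  by move=> i /okb /IHb.
- by move=> a IHa b IHb rho [/IHa ? /IHb ?].
Qed.

Lemma wk_wkb q rho s (e : exp s) : 0 < q 1 -> 0 < q 2 -> wf e ->
  (forall g, 2 < g -> q g = 1) ->
  ok q rho e -> wk rho e <= wkb (q 0) e * (q 1 ^ nest 1 e * q 2 ^ nest 2 e).
Proof.
move=> q1 q2 + q3.
have le2 a1 a2 b1 b2 : a1 <= b1 -> a2 <= b2 ->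
    q 1 ^ a1 * q 2 ^ a2 <= q 1 ^ b1 * q 2 ^ b2.
  by move=> h1 h2; rewrite leq_mul // leq_pexp2l.
have pos a b : 0 < q 1 ^ a * q 2 ^ b by rewrite muln_gt0 !expn_gt0 q1 q2.
have wide k a1 a2 b1 b2 w : w <= k * (q 1 ^ a1 * q 2 ^ a2) ->
    a1 <= b1 -> a2 <= b2 -> w <= k * (q 1 ^ b1 * q 2 ^ b2).
  move=> h h1 h2; apply: leq_trans h _; rewrite leq_mul2l le2 ?orbT //.
elim: e rho => //=.
- by move=> o a IHa b IHb rho /andP[wa wb] [/(IHa _ wa) ha /(IHb _ wb) hb];
    have := wide _ _ _ _ _ _ ha (leq_maxl _ (nest 1 b)) (leq_maxl _ (nest 2 b));
    have := wide _ _ _ _ _ _ hb (leq_maxr (nest 1 a) _) (leq_maxr (nest 2 a) _);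
    have := pos (maxn (nest 1 a) (nest 1 b)) (maxn (nest 2 a) (nest 2 b)); nia.
- by move=> a IHa rho wa [/(IHa _ wa) ha _ _]; have := pos (nest 1 a) (nest 2 a); nia.
- move=> s' x a IHa b IHb rho /and3P[_ wa wb] [/(IHa _ wa) ha /(IHb _ wb) hb].
  have := wide _ _ _ _ _ _ ha (leq_maxl _ (nest 1 b)) (leq_maxl _ (nest 2 b)).
  have := wide _ _ _ _ _ _ hb (leq_maxr (nest 1 a) _) (leq_maxr (nest 2 a) _).
  by have := pos (maxn (nest 1 a) (nest 1 b)) (maxn (nest 2 a) (nest 2 b)); nia.
- move=> s' a IHa b IHb c IHc d IHd rho /and4P[wa wb wc wd].
  move=> [/(IHa _ wa) ha /(IHb _ wb) hb hcd].
  set m1 := maxn (maxn (nest 1 a) _) _; set m2 := maxn (maxn (nest 2 a) _) _.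
  have {ha} := wide _ _ _ m1 m2 _ ha ltac:(lia) ltac:(lia).
  have {hb} := wide _ _ _ m1 m2 _ hb ltac:(lia) ltac:(lia).
  have := pos m1 m2.
  case: ifP hcd => _ => [/(IHc _ wc) h | /(IHd _ wd) h];
    have {h} := wide _ _ _ m1 m2 _ h ltac:(lia) ltac:(lia); nia.
- move=> s' a IHa b IHb c IHc d IHd rho /and4P[wa wb wc wd].
  move=> [/(IHa _ wa) ha /(IHb _ wb) hb hcd].
  set m1 := maxn (maxn (nest 1 a) _) _; set m2 := maxn (maxn (nest 2 a) _) _.
  have {ha} := wide _ _ _ m1 m2 _ ha ltac:(lia) ltac:(lia).
  have {hb} := wide _ _ _ m1 m2 _ hb ltac:(lia) ltac:(lia).
  have := pos m1 m2.
  case: ifP hcd => _ => [/(IHc _ wc) h | /(IHd _ wd) h];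
    have {h} := wide _ _ _ m1 m2 _ h ltac:(lia) ltac:(lia); nia.
- move=> s' o g N IHN x b IHb rho /and4P[_ wN wb _] [/(IHN _ wN) hN leN okb].
  set m1 := maxn (nest 1 N) _; set m2 := maxn (nest 2 N) _.
  have {hN} := wide _ _ _ m1 m2 _ hN ltac:(lia) ltac:(lia).
  have := pos m1 m2; set Q := _ * _ => posQ hN.
  suff: \sum_(0 <= i < den rho N) (wk (upd rho x i) b + 21) <=
      (if g is 0 then q 0 else 1) * (wkb (q 0) b + 21) * Q by nia.
  set Qb := q 1 ^ nest 1 b * q 2 ^ nest 2 b.
  have posb : 0 < Qb by exact: pos.
  apply: (@leq_trans (\sum_(0 <= i < den rho N) ((wkb (q 0) b + 21) * Qb))).
    rewrite big_nat_cond [leqRHS]big_nat_cond; apply: leq_sum => i /andP[/andP[_ lti] _].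
    have := IHb _ wb (okb _ lti); rewrite -/Qb; nia.
  rewrite sum_nat_const_nat subn0 mulnCA [leqRHS]mulnAC [leqRHS]mulnC leq_mul2l.
  apply/orP; right.
  apply: leq_trans (_ : q g * Qb <= _); first by rewrite leq_mul2r leN orbT.
  case: g leN @m1 @m2 @Q posQ hN => [|[|[|g]]] leN m1 m2 Q posQ hN.
  + by rewrite leq_mul2l le2 ?orbT //; rewrite /m1 /m2; lia.
  + by rewrite mul1n mulnA -expnS le2 //; rewrite /m1 /m2; lia.
  + by rewrite mul1n mulnCA -expnS le2 //; rewrite /m1 /m2; lia.
  + by rewrite q3 // leq_mul // ?le2 //; rewrite /m1 /m2; lia.
- by move=> a IHa b IHb rho /andP[wa wb] [/(IHa _ wa) ha /(IHb _ wb) hb];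
    have := wide _ _ _ _ _ _ ha (leq_maxl _ (nest 1 b)) (leq_maxl _ (nest 2 b));
    have := wide _ _ _ _ _ _ hb (leq_maxr (nest 1 a) _) (leq_maxr (nest 2 a) _);
    have := pos (maxn (nest 1 a) (nest 1 b)) (maxn (nest 2 a) (nest 2 b)); nia.
- by move=> a IHa rho wa /(IHa _ wa) ha; have := pos (nest 1 a) (nest 2 a); nia.
Qed.

Definition small s d (v : valT R s) : Prop :=
  (if s return valT R s -> Prop then fun=> True else fun v : nat => v < X ^ d) v.

Lemma small_red s (o : red s) (f : nat -> valT R s) N dN d r0 lo hi :
  1 < X -> lo <= hi -> hi <= N -> N < X ^ dN ->
  (forall i, i < N -> small d (f i)) ->
  is_true (if o is Prod then N <= r0 else true) ->
  small (match o with Sum => dN + d | Max => d | Prod => (d * r0).+1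
         | RSum => 0 end)
    (\big[redop o/redidx R o]_(lo <= i < hi) f i) \/ (N = 0).
Proof.
move=> X1 lehi leN ltN; case: N leN ltN => [|N]; first by right.
move=> leN ltN hf hr; left; move: f hf.
have X0 a : 0 < X ^ a by rewrite expn_gt0 (ltnW X1).
case: o hr => //= hr f hf.
- apply: (@leq_ltn_trans (\sum_(lo <= i < hi) (X ^ d))).
    rewrite big_nat_cond [leqRHS]big_nat_cond; apply: leq_sum => i.
    by rewrite andbT => /andP[_ h]; apply: ltnW; apply: hf; lia.
  rewrite sum_nat_const_nat expnD ltn_pmul2r //; lia.
- rewrite big_nat_cond; elim/big_ind: _ => [|x y hx hy|i].
  + exact: X0.
  + by rewrite /= gtn_max hx hy.
  + by rewrite andbT => /andP[_ h]; apply: hf; lia.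
- apply: (@leq_ltn_trans (\prod_(lo <= i < hi) (X ^ d))).
    rewrite big_nat_cond [leqRHS]big_nat_cond; apply: leq_prod => i.
    by rewrite andbT => /andP[_ h]; apply: ltnW; apply: hf; lia.
  rewrite prod_nat_const_nat -expnM ltn_exp2l // ltnS leq_mul2l.
  by apply/orP; right; lia.
Qed.

Lemma den_small r0 q dv rho s (e : exp s) : 1 < X -> q 0 <= r0 ->
  (forall x, rho x < X ^ dv x) -> wf e -> ok q rho e ->
  small (deg dm r0 dv e) (den rho e).
Proof.
move=> X1 q0; have X0 a : 0 < X ^ a by rewrite expn_gt0 (ltnW X1).
elim: e dv rho => //=.
- by move=> c dv rho _ _ _; apply: (ltn_trans (ltn_expl c X1)); rewrite ltn_exp2l.
- move=> o a IHa b IHb dv rho hd /andP[wa wb] [oa ob].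
  have /= ha := IHa _ _ hd wa oa; have /= hb := IHb _ _ hd wb ob.
  case: o => /=.
  + rewrite expnS; set m := maxn _ _.
    have := leq_pexp2l (ltnW X1) (leq_maxl (deg dm r0 dv a) (deg dm r0 dv b)).
    have := leq_pexp2l (ltnW X1) (leq_maxr (deg dm r0 dv a) (deg dm r0 dv b)).
    rewrite -/m => h1 h2; apply: (@leq_trans (2 * X ^ m)); first lia.
    by rewrite leq_mul2r X1 orbT.
  + exact: leq_ltn_trans (leq_subr _ _) ha.
  + rewrite expnD; move: ha hb; set u := den _ _; set w := den _ _ => ha hb.
    by apply: ltn_mul.
  + exact: leq_ltn_trans (leq_div _ _) ha.
  + exact: leq_ltn_trans (leq_mod _ _) ha.
- by move=> a IHa dv rho hd wa [].
- move=> s' x a IHa b IHb dv rho hd /and3P[_ wa wb] [oa ob].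
  apply: IHb => //; move=> y; rewrite /upd; case: eqP => // _.
  exact: IHa.
- move=> s' a IHa b IHb c IHc d IHd dv rho hd /and4P[wa wb wc wd] [_ _ h].
  have up d1 d2 (v : valT R s') : d1 <= d2 -> small d1 v -> small d2 v.
    case: s' v {c IHc wc d IHd wd h} => //= v le12 lt1.
    by apply: leq_trans lt1 _; rewrite leq_pexp2l // ltnW.
  case: ifP h => _ h; first by apply: up (IHc _ _ hd wc h); rewrite leq_maxl.
  by apply: up (IHd _ _ hd wd h); rewrite leq_maxr.
- move=> s' a IHa b IHb c IHc d IHd dv rho hd /and4P[wa wb wc wd] [_ _ h].
  have up d1 d2 (v : valT R s') : d1 <= d2 -> small d1 v -> small d2 v.
    case: s' v {c IHc wc d IHd wd h} => //= v le12 lt1.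
    by apply: leq_trans lt1 _; rewrite leq_pexp2l // ltnW.
  case: ifP h => _ h; first by apply: up (IHc _ _ hd wc h); rewrite leq_maxl.
  by apply: up (IHd _ _ hd wd h); rewrite leq_maxr.
- move=> s' o g N IHN x b IHb dv rho hd /and4P[_ wN wb wp] [oN leN okb].
  have hN : den rho N < X ^ deg dm r0 dv N by exact: IHN.
  have hb i : i < den rho N ->
      small (deg dm r0 (upd dv x (deg dm r0 dv N)) b) (den (upd rho x i) b).
    move=> lti; apply: IHb => //; last exact: okb.
    by move=> y; rewrite /upd; case: eqP => // _; apply: ltn_trans lti hN.
  have hp : is_true (if o is Prod then den rho N <= r0 else true).
    clear IHb wb okb hb; case: o b wp => // b /eqP g0.
    by apply: leq_trans leN _; rewrite g0.
  have [//|N0] := small_red X1 (leq0n _) (leqnn _) hN hb hp.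
  move: N0 => /= ->; rewrite red_nil.
  clear IHb wb okb hb hp wp; case: o b => b //=; try exact: X0.
  by rewrite -{1}(expn0 X) ltn_exp2l.
- by move=> a IHa b IHb dv rho hd /andP[wa wb] [oa ob]; apply: IHb.
Qed.

End Denotation.

(** * Correctness of the compilation *)

Fixpoint upds (mem : nat -> nat) (ws : seq (nat * nat)) : nat -> nat :=
  if ws is p :: ws' then upds (upd mem p.1 p.2) ws' else mem.

Definition keys (ws : seq (nat * nat)) : seq nat := [seq p.1 | p <- ws].

Lemma upds_cat mem ws1 ws2 : upds mem (ws1 ++ ws2) = upds (upds mem ws1) ws2.
Proof. by elim: ws1 mem => //= p ws IH mem. Qed.

Lemma eq_upds mem mem' ws : mem =1 mem' -> upds mem ws =1 upds mem' ws.
Proof.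
elim: ws mem mem' => //= p ws IH mem mem' E; apply: IH => a.
by rewrite /upd E.
Qed.

Lemma upds_out mem ws a : a \notin keys ws -> upds mem ws a = mem a.
Proof.
elim: ws mem => //= p ws IH mem; rewrite in_cons negb_or => /andP[ap aw].
by rewrite IH // /upd (negPf ap).
Qed.

Lemma upds_in mem ws a v : uniq (keys ws) -> (a, v) \in ws -> upds mem ws a = v.
Proof.
elim: ws mem => //= p ws IH mem /andP[pn un]; rewrite in_cons => /orP[/eqP E|h].
  by case: p E pn => a' v' [<- <-] /= pn; rewrite upds_out // /upd eqxx.
exact: IH.
Qed.

Section Machine.
Context (R : realType) (P : program) (W : nat) (F : pred nat).
Implicit Types s : state R.

(** Compiled code never writes to the real memory, so any of its cells may be read. *)
Definition readable (c : cell) : bool := if c is inl a then F a else true.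

(** The cells in [F] may be read, and [ws] lists the integer cells written; keeping [ws] outside [F]
    is what prevents races. Registers 0 and 1 are not preserved, being the channels through which
    calls and joins return values. *)
Record post t s s' (k : cost) (ws : seq (nat * nat)) w d : Prop := Post {
  post_ireg : forall x, 1 < x < t -> ireg s' x = ireg s x;
  post_rreg : forall x, 1 < x < t -> rreg s' x = rreg s x;
  post_imem : imem s' =1 upds (imem s) ws;
  post_rmem : rmem s' = rmem s;
  post_work : work k <= w;
  post_depth : depth k <= d;
  post_reads : all readable (reads k);
  post_writes : {subset writes k <= [seq inl a | a <- keys ws]} }.

Definition Run c t s s' ws w d :=
  exists2 k, exec P W c s s' k & post t s s' k ws w d.

Lemma Run_weaken c t t' s s' ws w w' d d' :
  Run c t s s' ws w d -> t' <= t -> w <= w' -> d <= d' ->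
  Run c t' s s' ws w' d'.
Proof.
move=> [k E [h1 h2 h3 h4 h5 h6 h7 h8]] let' lew led; exists k => //; split=> //.
- by move=> x hx; apply: h1; lia.
- by move=> x hx; apply: h2; lia.
- exact: leq_trans h5 lew.
- exact: leq_trans h6 led.
Qed.

Lemma Run_seq c1 c2 t s s1 s2 ws1 w1 d1 ws2 w2 d2 :
  Run c1 t s s1 ws1 w1 d1 -> Run c2 t s1 s2 ws2 w2 d2 ->
  Run (Seq c1 c2) t s s2 (ws1 ++ ws2) (w1 + w2) (d1 + d2).
Proof.
move=> [k1 E1 [a1 a2 a3 a4 a5 a6 a7 a8]] [k2 E2 [b1 b2 b3 b4 b5 b6 b7 b8]].
exists (seq_cost k1 k2); first exact: exec_seq E1 E2.
split=> /=.
- by move=> x hx; rewrite b1 // a1.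
- by move=> x hx; rewrite b2 // a2.
- by move=> x; rewrite b3 upds_cat; apply: eq_upds.
- by rewrite b4.
- exact: leq_add.
- exact: leq_add.
- by rewrite all_cat a7.
- move=> c; rewrite mem_cat /keys !map_cat mem_cat => /orP[/a8 -> //|/b8 ->].
  by rewrite orbT.
Qed.

Definition regonly t c :=
  match c with
  | IConst d _ | IBin _ d _ _ | ROfInt d _ | RBin _ d _ _ => (d < 2) || (t <= d)
  | _ => false
  end.

Lemma Run_reg c t s : in_range W c s -> regonly t c ->
  Run (Do c) t s (step c s) [::] 1 1.
Proof.
move=> rg ro; exists (instr_cost c s); first exact: exec_do.
by case: c rg ro => //= [d x|o d a b|d a|o d a b] _ hd; split=> //= x' hx;
  case: eqP => // E; move: hd; rewrite -E; lia.
Qed.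

Lemma Run_load t s : F (ireg s 0) -> imem s (ireg s 0) < W ->
  Run (Do (ILoad 0 0)) t s (step (ILoad 0 0) s) [::] 1 1.
Proof.
move=> hF hW; exists (instr_cost (ILoad 0 0) s); first exact: exec_do.
split=> //=; last by rewrite hF.
by case=> // x /andP[].
Qed.

Lemma Run_rload t s :
  Run (Do (RLoad 0 0)) t s (step (RLoad 0 0) s) [::] 1 1.
Proof.
exists (instr_cost (RLoad 0 0) s); first exact: exec_do.
split=> //=; by case=> // x /andP[].
Qed.

Lemma Run_store a b t s :
  Run (Do (IStore a b)) t s (step (IStore a b) s) [:: (ireg s a, ireg s b)] 1 1.
Proof. by exists (instr_cost (IStore a b) s); [exact: exec_do | split]. Qed.

Lemma Run_if u c1 c2 t s s' ws w d :
  Run (if holds u s then c1 else c2) t s s' ws w d ->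
  Run (If u c1 c2) t s s' ws w.+1 d.+1.
Proof.
move=> [k E [a1 a2 a3 a4 a5 a6 a7 a8]]; exists (seq_cost tick k); first exact: exec_if.
by split.
Qed.

Lemma Run_call f t s s' ws w d :
  Run (nth Skip P f) 2 s s' ws w d ->
  Run (Call f) t s (after_call s s') ws w.+1 d.+1.
Proof.
move=> [k E [a1 a2 a3 a4 a5 a6 a7 a8]]; exists (seq_cost tick k); first exact: exec_call.
by split=> //=; case=> // x /andP[].
Qed.

(** Both branches read inside [F] and write outside it, so no read meets a write; distinct keys keep
    the writes of the two branches apart. *)
Lemma Run_fork c1 c2 t s s1 s2 ws1 w1 d1 ws2 w2 d2 :
  Run c1 2 s s1 ws1 w1 d1 -> Run c2 2 (with_mem s s1) s2 ws2 w2 d2 ->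
  uniq (keys (ws1 ++ ws2)) -> all (predC F) (keys (ws1 ++ ws2)) ->
  Run (Fork c1 c2) t s (after_join s s1 s2) (ws1 ++ ws2)
    (w1 + w2).+1 (maxn d1 d2).+1.
Proof.
move=> [k1 E1 [a1 a2 a3 a4 a5 a6 a7 a8]] [k2 E2 [b1 b2 b3 b4 b5 b6 b7 b8]].
rewrite /keys map_cat cat_uniq all_cat -/keys => /and3P[_ disj _] /andP[n1 n2].
have inj : injective (inl : nat -> cell) by move=> x y [].
exists (seq_cost tick (par_cost k1 k2)).
  apply: exec_fork E1 E2 _; apply/andP; split; apply/hasPn => c /=.
  - move/a8 => /mapP[x xin ->]; rewrite mem_cat negb_or; apply/andP; split.
      apply/negP => /(allP b7) /= Fx; move/allP: n1 => /(_ _ xin) /=.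
      by rewrite Fx.
    apply/negP => /b8; rewrite mem_map // => xin2.
    by move/hasPn: disj => /(_ _ xin2); rewrite /= xin.
  - move/b8 => /mapP[x xin ->].
    apply/negP => /(allP a7) /= Fx; move/allP: n2 => /(_ _ xin) /=.
    by rewrite Fx.
split=> /=.
- by case=> [|[|x]] //; case/andP.
- by case=> [|[|x]] //; case/andP.
- by move=> x; rewrite b3 upds_cat; apply: eq_upds.
- by rewrite b4.
- by rewrite add1n ltnS leq_add.
- by rewrite add1n ltnS; lia.
- by rewrite all_cat a7.
- move=> c; rewrite mem_cat /keys !map_cat mem_cat => /orP[/a8 -> //|/b8 ->].
  by rewrite orbT.
Qed.

Lemma Run_mov d a t s : d != a -> (d < 2) || (t <= d) -> ireg s a < W ->
  exists2 s', Run (mov d a) t s s' [::] 2 2 &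
    [/\ forall x, ireg s' x = if x == d then ireg s a else ireg s x,
        rreg s' = rreg s, imem s' = imem s & rmem s' = rmem s].
Proof.
move=> da hd hW; eexists.
  apply: (Run_seq (ws1 := [::]) (ws2 := [::]) (w1 := 1) (d1 := 1)).
    by apply: Run_reg; rewrite //= eqxx; lia.
  by apply: Run_reg; rewrite //= ?eqxx /= ?(negPf da) //= eq_sym (negPf da) add0n.
split=> //= x; case: (x == d) => //.
by rewrite eqxx eq_sym (negPf da).
Qed.

Lemma Run_rmov d a t s : d != a -> (d < 2) || (t <= d) -> 0 < W ->
  exists2 s', Run (rmov d a) t s s' [::] 3 3 &
    [/\ forall x, 1 < x -> ireg s' x = ireg s x,
        forall x, rreg s' x = (if x == d then rreg s a else rreg s x),
        imem s' = imem s & rmem s' = rmem s].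
Proof.
move=> da hd hW; eexists.
  apply: (Run_seq (ws1 := [::]) (ws2 := [::]) (w1 := 1) (d1 := 1) (w2 := 2) (d2 := 2)).
    by apply: Run_reg; rewrite //= eqxx.
  by apply: (Run_seq (ws1 := [::]) (ws2 := [::]) (w1 := 1) (d1 := 1)); apply: Run_reg.
split=> //= x; first by case: x => [|[|x]].
case: (x == d) => //.
by rewrite eqxx eq_sym (negPf da) GRing.add0r.
Qed.

(** Memory is compared on [F] only, so that an expression is evaluated in the memory it started from
    although it is writing elsewhere. *)
Definition agree (rho mem : nat -> nat) (rm : nat -> R) s : Prop :=
  [/\ forall x, isvar x -> ireg s x = rho x,
      forall a, F a -> imem s a = mem a & rmem s = rm].

Lemma agree_run c rho mem rm t s s' ws w d : vmax <= t ->
  Run c t s s' ws w d -> all (predC F) (keys ws) ->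
  agree rho mem rm s -> agree rho mem rm s'.
Proof.
move=> ht [k _ [a1 _ a3 a4 _ _ _ _]] /allP nF [e1 e2 e3]; split.
- by move=> x /[dup] /andP[x1 x2] hx; rewrite a1 ?e1 //; lia.
- move=> a Fa; rewrite a3 upds_out ?e2 //.
  by apply/negP => /nF /=; rewrite Fa.
- by rewrite a4.
Qed.

Definition subproc f (ps : seq com) : Prop :=
  forall i, i < size ps -> nth Skip P (f + i) = nth Skip ps i.

Lemma subproc_cat f ps1 ps2 :
  subproc f (ps1 ++ ps2) -> subproc f ps1 /\ subproc (f + size ps1) ps2.
Proof.
move=> h; split=> i hi.
  by rewrite h ?nth_cat ?hi // size_cat; lia.
rewrite -addnA h ?size_cat ?ltn_add2l // nth_cat ltnNge leq_addr /=.
by rewrite addKn.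
Qed.

Lemma subproc_cons f c ps :
  subproc f (c :: ps) -> nth Skip P f = c /\ subproc f.+1 ps.
Proof.
move=> h; split; first by have := h 0 isT; rewrite addn0.
by move=> i hi; have := h i.+1 hi; rewrite addnS addSn.
Qed.

Definition getv b s : valT R b :=
  match b return valT R b with true => rreg s 0 | false => ireg s 0 end.

Definition below b (v : valT R b) : Prop :=
  (if b return valT R b -> Prop then fun=> True else fun v : nat => v < W) v.

End Machine.

Section Compilation.
Context (R : realType) (P : program) (W : nat) (F : pred nat).
Context (mem : nat -> nat) (rm : nat -> R).
Implicit Types s : state R.

Lemma agree_reg rho c s : regonly vmax c ->
  agree F rho mem rm s -> agree F rho mem rm (step c s).
Proof.
move=> h [a1 a2 a3]; split; [|by case: c h|by case: c h].
by case: c h => //= [d x|o d a b] hd y hy; rewrite (a1 y) //;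
  case: (y =P d) => // E; move: hd hy; rewrite -E /isvar /vmax; lia.
Qed.

Lemma agree_with_mem rho s s1 :
  agree F rho mem rm s -> agree F rho mem rm s1 ->
  agree F rho mem rm (with_mem s s1).
Proof. by move=> [a1 _ _] [_ b2 b3]; split. Qed.

Lemma Run_combine b (o : red b) t s (v1 v2 : valT R b) :
  match b return valT R b -> valT R b -> Prop with
  | true => fun v1 v2 => rreg s 0 = v1 /\ rreg s 1 = v2
  | false => fun v1 v2 => ireg s 0 = v1 /\ ireg s 1 = v2
  end v1 v2 ->
  below W v2 -> below W (redop o v1 v2) ->
  exists2 s', Run P W F (combine o) t s s' [::] 2 2 & getv b s' = redop o v1 v2.
Proof.
have one c s' : Run P W F (Do c) t s s' [::] 1 1 -> Run P W F (Do c) t s s' [::] 2 2.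
  by move=> /Run_weaken; apply.
case: o v1 v2 => v1 v2 [h1 h2] hv1 hv.
- by eexists; [apply/one/Run_reg; rewrite //= h1 h2|rewrite /= h1 h2].
- eexists.
    apply: (Run_seq (ws1 := [::]) (ws2 := [::]) (w1 := 1) (d1 := 1)); apply: Run_reg => //=.
      by rewrite h1 h2; apply: leq_ltn_trans (leq_subr _ _) hv1.
    by rewrite h1 h2 -maxnE.
  by rewrite /= h1 h2 -maxnE.
- by eexists; [apply/one/Run_reg; rewrite //= h1 h2|rewrite /= h1 h2].
- by eexists; [apply/one/Run_reg|rewrite /= h1 h2].
Qed.

Lemma join_getv b s s1 s2 s3 s4 :
  match b return valT R b -> valT R b -> Prop with
  | true => fun v1 v2 => rreg (after_join s (after_call s1 s2) (after_call s3 s4)) 0 = v1 /\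
                         rreg (after_join s (after_call s1 s2) (after_call s3 s4)) 1 = v2
  | false => fun v1 v2 => ireg (after_join s (after_call s1 s2) (after_call s3 s4)) 0 = v1 /\
                         ireg (after_join s (after_call s1 s2) (after_call s3 s4)) 1 = v2
  end (getv b s2) (getv b s4).
Proof. by case: b. Qed.

Lemma getv_call b s s1 : getv b (after_call s s1) = getv b s1.
Proof. by case: b. Qed.

Lemma Run_set_unit b (o : red b) t s : 1 < W ->
  exists2 s', Run P W F (set_unit o) t s s' [::] 2 2 & getv b s' = redidx R o.
Proof.
move=> W1; have W0 := ltnW W1.
have one c s' : Run P W F (Do c) t s s' [::] 1 1 -> Run P W F (Do c) t s s' [::] 2 2.
  by move=> /Run_weaken; apply.
case: o; last 1 first.
  eexists.
    by apply: (Run_seq (ws1 := [::]) (ws2 := [::]) (w1 := 1) (d1 := 1)); apply: Run_reg.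
  by [].
all: by eexists; [apply/one/Run_reg|].
Qed.

(** * Correctness and cost of a reduction tree *)

Section Reduction.
Context (b : bool) (o : red b) (x t f : nat) (cb : com).
Context (v : nat -> valT R b) (ws : nat -> seq (nat * nat)) (w : nat -> nat).
Context (db N : nat) (rho : nat -> nat).
Hypothesis Pf : nth Skip P f = redproc o x t f cb.
Hypothesis t_max : vmax <= t.
Hypothesis x_var : isvar x.
Hypothesis W2 : 2 < W.
Hypothesis WN1 : N.+1 < W.
Hypothesis WN : N + N < W.
Hypothesis Wv : forall lo hi, lo <= hi -> hi <= N ->
  below W (\big[redop o/redidx R o]_(lo <= i < hi) v i).
Hypothesis body : forall i s, i < N -> agree F (upd rho x i) mem rm s ->
  uniq (keys (ws i)) -> all (predC F) (keys (ws i)) ->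
  exists2 s', Run P W F cb 2 s s' (ws i) (w i) db & getv b s' = v i.

Let wsum lo hi := flatten [seq ws i | i <- index_iota lo hi].

Let A := Seq (Do (IConst 0 2)) (Seq (Do (IBin IAdd t.+2 t.+1 t))
  (Seq (Do (IBin IDiv t.+2 t.+2 0))
  (Seq (Fork (Seq (mov t t.+2) (Call f)) (Seq (mov t.+1 t.+2) (Call f)))
       (combine o)))).
Let B := If (ILt t.+1 t) (Seq (mov x t.+1) cb) (set_unit o).

Lemma red_prefix lo hi s : lo <= N -> agree F rho mem rm s ->
  ireg s t = hi -> ireg s t.+1 = lo ->
  exists s2, [/\ agree F rho mem rm s2, ireg s2 t.+2 = lo.+1,
    ireg s2 t.+1 = lo, ireg s2 t = hi &
    forall s' ws' w' d, Run P W F (if lo.+1 < hi then A else B) 2 s2 s' ws' w' d ->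
      Run P W F (redproc o x t f cb) 2 s s' ws' w'.+3 d.+3].
Proof.
move=> leN ag st st1.
have e1 : (t.+1 == t.+2) = false by lia.
have e2 : (t == t.+2) = false by lia.
set s1 := step (IConst t.+2 1) s.
set s2 := step (IBin IAdd t.+2 t.+1 t.+2) s1.
have i2 : ireg s2 t.+2 = lo.+1 by rewrite /= !eqxx e1 st1 addn1.
have i1 : ireg s2 t.+1 = lo by rewrite /= !e1 st1.
have i0 : ireg s2 t = hi by rewrite /= !e2 st.
exists s2; split=> //.
  by apply: agree_reg; [rewrite /=; lia|apply: agree_reg; rewrite //=; lia].
move=> s' ws' w' d r.
rewrite -[w'.+3]/(1 + (1 + w'.+1)) -[d.+3]/(1 + (1 + d.+1)).
apply: (Run_seq (ws1 := [::]) (ws2 := ws') (s1 := s1)).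
  by apply: Run_reg; rewrite //= eqxx; lia.
apply: (Run_seq (ws1 := [::]) (ws2 := ws') (s1 := s2)).
  by apply: Run_reg; rewrite //= !eqxx e1 st1; lia.
by apply: Run_if; rewrite [holds _ _]/(ireg s2 t.+2 < ireg s2 t) i2 i0.
Qed.

Lemma red_leaf lo hi s : lo <= hi -> hi <= N -> hi <= lo.+1 ->
  agree F rho mem rm s -> ireg s t = hi -> ireg s t.+1 = lo ->
  uniq (keys (wsum lo hi)) -> all (predC F) (keys (wsum lo hi)) ->
  exists s', exists w', [/\
    Run P W F (redproc o x t f cb) 2 s s' (wsum lo hi) w' (6 + db),
    getv b s' = \big[redop o/redidx R o]_(lo <= i < hi) v i,
    lo < hi -> w' + 15 <= \sum_(lo <= i < hi) (w i + 21) &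
    lo = hi -> w' <= 6].
Proof.
move=> lelh lehN hi1 ag st st1 un nF.
have [s2 [ag2 i2 i1 i0 run]] := red_prefix (leq_trans lelh lehN) ag st st1.
have nlt : (lo.+1 < hi) = false by lia.
rewrite nlt in run.
have [lt|ge] := ltnP lo hi; last first.
  have E : hi = lo by lia.
  have [s3 r3 g3] := @Run_set_unit b o 2 s2 (ltnW W2).
  exists s3, 6; split=> //; last by rewrite g3 E red_nil.
  rewrite /wsum /index_iota E subnn /=.
  apply: (@Run_weaken _ _ _ _ _ 2 2 _ _ _ 6 6 6) => //.
  apply: (run _ _ 3 3); apply: Run_if.
  by rewrite /= i1 i0 ltnNge ge.
have E : hi = lo.+1 by lia.
have [s3 r3 [m1 m2 m3 m4]] : exists2 s3, Run P W F (mov x t.+1) 2 s2 s3 [::] 2 2 &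
    [/\ forall y, ireg s3 y = if y == x then ireg s2 t.+1 else ireg s2 y,
      rreg s3 = rreg s2, imem s3 = imem s2 & rmem s3 = rmem s2].
  by move: x_var; rewrite /isvar => xv; apply: Run_mov; rewrite ?i1; lia.
have ag3 : agree F (upd rho x lo) mem rm s3.
  case: ag2 => a1 a2 a3; split; [|by rewrite m3|by rewrite m4].
  by move=> y hy; rewrite m1 /upd i1; case: eqP => // _; exact: a1.
have wsE : wsum lo hi = ws lo.
  by rewrite /wsum /index_iota E subSnn /= cats0.
have [s4 r4 g4] := body (leq_trans lt lehN) ag3 ltac:(by rewrite -wsE) ltac:(by rewrite -wsE).
exists s4, (w lo + 6); split=> //.
- rewrite wsE; apply: (@Run_weaken _ _ _ _ _ 2 2 _ _ _ (2 + w lo).+4 _ (2 + db).+4) => //; try lia.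
  apply: run; apply: Run_if.
  rewrite /= i1 i0 lt.
  exact: (Run_seq (ws1 := [::]) r3 r4).
- by rewrite g4 E red_one.
- by rewrite E big_nat1; lia.
- by lia.
Qed.

Lemma red_split lo hi s2 : lo <= hi -> hi <= N -> agree F rho mem rm s2 ->
  ireg s2 t = hi -> ireg s2 t.+1 = lo ->
  exists s5, [/\ agree F rho mem rm s5, ireg s5 t.+2 = (lo + hi) %/ 2,
    ireg s5 t.+1 = lo, ireg s5 t = hi &
    forall c s' ws' w' d, Run P W F c 2 s5 s' ws' w' d ->
      Run P W F (Seq (Do (IConst 0 2)) (Seq (Do (IBin IAdd t.+2 t.+1 t))
        (Seq (Do (IBin IDiv t.+2 t.+2 0)) c))) 2 s2 s' ws' w'.+3 d.+3].
Proof.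
move=> lelh leN ag i0 i1.
have e1 : (t.+1 == t.+2) = false by lia.
have e2 : (t == t.+2) = false by lia.
have t0 : (t == 0) = false by move: t_max; rewrite /vmax; case: (t).
have r1 : regonly vmax (IBin IAdd t.+2 t.+1 t) by rewrite /=; lia.
have r2 : regonly 2 (IBin IAdd t.+2 t.+1 t) by rewrite /=; lia.
have ltW : lo + hi < W by lia.
have ltW2 : (lo + hi) %/ 2 < W by lia.
set s3 := step (IConst 0 2) s2.
set s4 := step (IBin IAdd t.+2 t.+1 t) s3.
set s5 := step (IBin IDiv t.+2 t.+2 0) s4.
exists s5; split.
- by do 3![apply: agree_reg; first by []].
- by rewrite /= !eqxx t0 i1 i0.
- by rewrite /= !e1 i1.
- by rewrite /= !e2 t0 i0.
move=> c s' ws' w' d r.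
rewrite -[w'.+3]/(1 + (1 + (1 + w'))) -[d.+3]/(1 + (1 + (1 + d))).
apply: (Run_seq (ws1 := [::]) (ws2 := ws') (s1 := s3)); first exact: Run_reg.
apply: (Run_seq (ws1 := [::]) (ws2 := ws') (s1 := s4)).
  by apply: Run_reg; rewrite //= ?eqxx ?t0 ?i1 ?i0.
apply: (Run_seq (ws1 := [::]) (ws2 := ws') (s1 := s5)) r.
by apply: Run_reg; rewrite //= ?eqxx ?t0 ?i1 ?i0.
Qed.

Lemma agree_mov d a s : d != a -> vmax <= d -> ireg s a < W ->
  agree F rho mem rm s ->
  exists2 s', Run P W F (mov d a) 2 s s' [::] 2 2 &
    agree F rho mem rm s' /\
    forall y, ireg s' y = if y == d then ireg s a else ireg s y.
Proof.
move=> da hd hW [a1 a2 a3].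
have d2 : (d < 2) || (2 <= d) by lia.
have [s' r [m1 m2 m3 m4]] := @Run_mov _ P W F d a 2 s da d2 hW.
exists s' => //; split=> //; split; [|by rewrite m3|by rewrite m4].
move=> y hy; rewrite m1; case: eqP => [E|_]; last exact: a1.
by move: hy hd; rewrite /isvar E; lia.
Qed.

(** Halving the interval gives a tree of height at most [l], each level adding 12 to the depth. A
    leaf costs 6 besides its body and an inner node costs 15; as there is one inner node fewer than
    leaves, the work plus 15 is at most 21 per leaf plus the bodies. The empty interval escapes this
    count and is bounded separately. *)
Lemma red_ok l lo hi s : lo <= hi -> hi <= N -> hi - lo <= 2 ^ l ->
  agree F rho mem rm s -> ireg s t = hi -> ireg s t.+1 = lo ->
  uniq (keys (wsum lo hi)) -> all (predC F) (keys (wsum lo hi)) ->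
  exists s', exists w', [/\
    Run P W F (redproc o x t f cb) 2 s s' (wsum lo hi) w' (12 * l + 6 + db),
    getv b s' = \big[redop o/redidx R o]_(lo <= i < hi) v i,
    lo < hi -> w' + 15 <= \sum_(lo <= i < hi) (w i + 21) &
    lo = hi -> w' <= 6].
Proof.
elim: l lo hi s => [|l IH] lo hi s lelh lehN size_l ag st st1 un nF.
  by rewrite expn0 in size_l; apply: red_leaf => //; lia.
have [small|big] := leqP hi lo.+1.
  have [s' [w' [r ? ? ?]]] := red_leaf lelh lehN small ag st st1 un nF.
  by exists s', w'; split=> //; apply: Run_weaken r _ _ _ => //; lia.
have [s2 [ag2 i2 i1 i0 run]] := red_prefix (leq_trans lelh lehN) ag st st1.
rewrite big in run.
have [s5 [ag5 j2 j1 j0 run5]] := red_split lelh lehN ag2 i0 i1.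
have call c s6 s7 ws7 w7 d7 : Run P W F c 2 s6 s7 ws7 w7 d7 ->
    c = redproc o x t f cb ->
    forall t', Run P W F (Call f) t' s6 (after_call s6 s7) ws7 w7.+1 d7.+1.
  by move=> r E t'; apply: Run_call; rewrite Pf -E.
move: j2; set mid := (lo + hi) %/ 2 => j2.
have expS : 2 ^ l.+1 = 2 ^ l + 2 ^ l by rewrite expnS mul2n addnn.
have [m_lo m_hi] : lo < mid /\ mid < hi by rewrite /mid; lia.
have [sz1 sz2] : mid - lo <= 2 ^ l /\ hi - mid <= 2 ^ l by rewrite /mid; lia.
have midW : mid < W by lia.
have [t2 [e1 e2]] : vmax <= t.+1 /\ (t.+1 == t) = false /\ (t == t.+1) = false.
  by lia.
have [ne1 ne2] : t != t.+2 /\ t.+1 != t.+2 by lia.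
have wsE : wsum lo hi = wsum lo mid ++ wsum mid hi.
  rewrite /wsum -flatten_cat -map_cat; congr (flatten (map _ _)).
  rewrite /index_iota -{2}(subnKC (ltnW m_lo)) -iotaD; congr iota; lia.
have lemN := leq_trans (ltnW m_hi) lehN.
move: (un) (nF); rewrite wsE => un12 nF12.
have [un1 un2] : uniq (keys (wsum lo mid)) /\ uniq (keys (wsum mid hi)).
  by move: un12; rewrite /keys map_cat cat_uniq => /and3P[].
have [nF1 nF2] : all (predC F) (keys (wsum lo mid)) /\
                 all (predC F) (keys (wsum mid hi)).
  by apply/andP; rewrite -all_cat -map_cat.
have [s6 r6 [ag6 n6]] : exists2 s', Run P W F (mov t t.+2) 2 s5 s' [::] 2 2 &
    agree F rho mem rm s' /\
    forall y, ireg s' y = if y == t then ireg s5 t.+2 else ireg s5 y.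
  by apply: agree_mov; rewrite ?j2.
have [x6 y6] : ireg s6 t = mid /\ ireg s6 t.+1 = lo by rewrite !n6 eqxx e1.
have [sl [wl [rl gl wl1 _]]] := IH lo mid s6 (ltnW m_lo) lemN sz1 ag6 x6 y6 un1 nF1.
have rL := Run_seq r6 (call _ _ _ _ _ _ rl erefl 2).
(* The right branch runs in the memory left by the left one; the two agree on [F], where nothing was
   written. *)
have agL := agree_run (leqnn _) (call _ _ _ _ _ _ rl erefl vmax) nF1 ag6.
have ag7 := agree_with_mem ag5 agL.
have [s8 r8 [ag8 n8]] : exists2 s', Run P W F (mov t.+1 t.+2) 2
      (with_mem s5 (after_call s6 sl)) s' [::] 2 2 &
    agree F rho mem rm s' /\
    forall y, ireg s' y = if y == t.+1 then ireg s5 t.+2 else ireg s5 y.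
  by apply: agree_mov; rewrite // j2.
have [x8 y8] : ireg s8 t = hi /\ ireg s8 t.+1 = mid by rewrite !n8 eqxx e2.
have [sr [w2 [rr gr w21 _]]] := IH mid hi s8 (ltnW m_hi) lehN sz2 ag8 x8 y8 un2 nF2.
have rR := Run_seq r8 (call _ _ _ _ _ _ rr erefl 2).
have rF := Run_fork 2 rL rR un12 nF12.
have [s10 r10 g10] : exists2 s', Run P W F (combine o) 2
      (after_join s5 (after_call s6 sl) (after_call s8 sr)) s' [::] 2 2 &
    getv b s' = redop o (\big[redop o/redidx R o]_(lo <= i < mid) v i)
                        (\big[redop o/redidx R o]_(mid <= i < hi) v i).
  apply: Run_combine.
  - rewrite -gl -gr; exact: join_getv.
  - by apply: Wv; [exact: ltnW|].
  - by rewrite -red_cat; [exact: Wv|exact: ltnW|exact: ltnW].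
exists s10, (12 + 3 + wl + w2); split.
- have := run _ _ _ _ (run5 _ _ _ _ _ (Run_seq rF r10)).
  by rewrite !cat0s cats0 -wsE => /Run_weaken; apply=> //; clear; lia.
- by rewrite g10 -red_cat // ltnW.
- move=> _; rewrite (big_cat_nat (ltnW m_lo) (ltnW m_hi)) /=.
  by move: (wl1 m_lo) (w21 m_hi); clear; lia.
- by move=> E; move: big; rewrite E; clear; lia.
Qed.

End Reduction.
Context (X dm r0 lm : nat) (q : nat -> nat).
Hypothesis X1 : 1 < X.
Hypothesis q_r0 : q 0 <= r0.
Hypothesis q_lm : forall g, q g <= 2 ^ lm.

Local Notation den := (den mem rm).
Local Notation wr := (wr mem rm).
Local Notation wk := (wk mem rm).
Local Notation mdeg := (mdeg dm r0).
Local Notation deg := (deg dm r0).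

Record pre b (e : exp b) t f rho dv s : Prop := Pre {
  pre_t : vmax <= t;
  pre_sub : subproc P f (procs e t f);
  pre_wf : wf e;
  pre_W : X ^ mdeg dv e <= W;
  pre_dv : forall x, rho x < X ^ dv x;
  pre_ok : ok mem rm X dm F q rho e;
  pre_agree : agree F rho mem rm s;
  pre_uniq : uniq (keys (wr rho e));
  pre_nF : all (predC F) (keys (wr rho e)) }.

Definition code_spec b (e : exp b) := forall t f rho dv s,
  pre e t f rho dv s ->
  exists2 s', Run P W F (code e t f) t s s' (wr rho e) (wk rho e) (dpb lm e) &
    getv b s' = den rho e.

Lemma X_gt0 d : 0 < X ^ d.
Proof. by rewrite expn_gt0 (ltnW X1). Qed.

Lemma le_W d d' : d <= d' -> X ^ d' <= W -> X ^ d <= W.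
Proof. by move=> le; apply: leq_trans; rewrite leq_pexp2l // ltnW. Qed.

Lemma den_ltW (e : exp false) rho dv : wf e -> X ^ mdeg dv e <= W ->
  (forall x, rho x < X ^ dv x) -> ok mem rm X dm F q rho e ->
  den rho e < X ^ deg dv e /\ den rho e < W.
Proof.
move=> we hW hd oe; have h := den_small X1 q_r0 hd we oe.
by split=> //; apply: leq_trans h (le_W (deg_mdeg _ _ _ _) hW).
Qed.

Lemma subproc2 f ps1 ps2 k : size ps1 = k -> subproc P f (ps1 ++ ps2) ->
  subproc P f ps1 /\ subproc P (f + k) ps2.
Proof. by move=> <-; apply: subproc_cat. Qed.

Lemma keys_cat ws1 ws2 : keys (ws1 ++ ws2) = keys ws1 ++ keys ws2.
Proof. exact: map_cat. Qed.

Lemma keys_split ws1 ws2 :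
  uniq (keys (ws1 ++ ws2)) -> all (predC F) (keys (ws1 ++ ws2)) ->
  [/\ uniq (keys ws1), uniq (keys ws2), all (predC F) (keys ws1) &
      all (predC F) (keys ws2)].
Proof. by rewrite keys_cat cat_uniq all_cat => /and3P[? _ ?] /andP[]. Qed.

(** Stated with an arbitrary continuation, because a compound expression first saves its first
    operand in the temporary [t] and then goes on with what remains. *)
Lemma run_one (e : exp false) t f rho dv s : code_spec e -> pre e t f rho dv s ->
  exists s2, [/\ agree F rho mem rm s2, ireg s2 t = den rho e &
    forall c s' ws w d, Run P W F c t s2 s' ws w d ->
      Run P W F (Seq (code e t f) (Seq (mov t 0) c)) t s s' (wr rho e ++ ws)
        (wk rho e + (2 + w)) (dpb lm e + (2 + d))].
Proof.
move=> spec p; have [s1 r1 g1] := spec _ _ _ _ _ p.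
case: p => tm _ we hW hd oe ag _ nF.
have ag1 := agree_run tm r1 nF ag.
have [_ ltW] := den_ltW we hW hd oe.
have t0 : t != 0 by move: tm; rewrite /vmax; case: (t).
have tt : (t < 2) || (t <= t) by rewrite leqnn orbT.
have lt0 : ireg s1 0 < W by rewrite [ireg s1 0]g1.
have [s2 r2 [m1 m2 m3 m4]] := @Run_mov _ P W F t 0 t s1 t0 tt lt0.
exists s2; split.
- case: ag1 => a1 a2 a3; split; [|by rewrite m3|by rewrite m4].
  move=> y hy; rewrite m1; case: eqP => [E|_]; last exact: a1.
  by move: hy; rewrite /isvar E; lia.
- by rewrite m1 eqxx [ireg s1 0]g1.
move=> c s' ws w d r.
exact: Run_seq r1 (Run_seq (ws1 := [::]) r2 r).
Qed.

Lemma run_rone (e : exp true) t f rho dv s : code_spec e -> pre e t f rho dv s ->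
  exists s2, [/\ agree F rho mem rm s2, rreg s2 t = den rho e &
    forall c s' ws w d, Run P W F c t s2 s' ws w d ->
      Run P W F (Seq (code e t f) (Seq (rmov t 0) c)) t s s' (wr rho e ++ ws)
        (wk rho e + (3 + w)) (dpb lm e + (3 + d))].
Proof.
move=> spec p; have [s1 r1 g1] := spec _ _ _ _ _ p.
case: p => tm _ we hW hd oe ag _ nF.
have ag1 := agree_run tm r1 nF ag.
have t0 : t != 0 by move: tm; rewrite /vmax; case: (t).
have tt : (t < 2) || (t <= t) by rewrite leqnn orbT.
have lt0 : 0 < W by apply: leq_trans (X_gt0 _) hW.
have [s2 r2 [m1 m2 m3 m4]] := @Run_rmov _ P W F t 0 t s1 t0 tt lt0.
exists s2; split.
- case: ag1 => a1 a2 a3; split; [|by rewrite m3|by rewrite m4].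
  by move=> y /[dup] /andP[y1 _] hy; rewrite m1 // a1.
- by rewrite m2 eqxx [rreg s1 0]g1.
move=> c s' ws w d r.
exact: Run_seq r1 (Run_seq (ws1 := [::]) r2 r).
Qed.

Lemma run_next b (e : exp b) t f rho dv s : code_spec e ->
  pre e t.+1 f rho dv s -> vmax <= t ->
  exists s2, [/\ agree F rho mem rm s2, getv b s2 = den rho e,
    ireg s2 t = ireg s t /\ rreg s2 t = rreg s t &
    forall c s' ws w d, Run P W F c t s2 s' ws w d ->
      Run P W F (Seq (code e t.+1 f) c) t s s' (wr rho e ++ ws)
        (wk rho e + w) (dpb lm e + d)].
Proof.
move=> spec p tm; have [s1 r1 g1] := spec _ _ _ _ _ p.
case: p => tm1 _ we hW hd oe ag _ nF.
have ag1 := agree_run tm1 r1 nF ag.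
exists s1; split=> //.
  case: r1 => k _ [a1 a2 _ _ _ _ _ _].
  have t1 : 1 < t < t.+1 by rewrite ltnSn andbT; apply: leq_trans tm.
  by rewrite a1 ?a2.
move=> c s' ws w d r; apply: Run_seq r.
exact: Run_weaken r1 _ _ _.
Qed.

Lemma small_below b d (v : valT R b) : small X d v -> X ^ d <= W -> below W v.
Proof. by case: b v => //= v; apply: leq_trans. Qed.

(** By induction on the expression. Distinctness of the written cells and their avoidance of [F]
    pass to the subexpressions, and the value of a later operand is not disturbed by the writes of
    an earlier one, since it only loads from [F]. *)
Lemma code_ok b (e : exp b) : code_spec e.
Proof.
elim: e => {b}.
- move=> x t f rho dv s [tm _ wx hW hd _ [a1 a2 a3] _ _].
  have xv := a1 _ wx.
  have x0 : 0 != x by move: wx; rewrite /= /isvar; case: (x).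
  have lt : ireg s x < W.
    rewrite xv; apply: leq_trans (hd x) _; apply: le_W hW; exact: leqnSn.
  have [s' r [m1 _ _ _]] := @Run_mov _ P W F 0 x t s x0 isT lt.
  by exists s' => //=; rewrite m1 eqxx xv.
- move=> c t f rho dv s [tm _ _ hW hd _ _ _ _].
  exists (step (IConst 0 c) s) => //.
  apply: Run_reg => //=.
  by apply: leq_trans hW; apply: (ltn_trans (ltn_expl c X1)); rewrite ltn_exp2l.
- move=> o a IHa b IHb t f rho dv s [tm sb /andP[wa wb] hW hd [oa ob] ag un nF].
  have [sba sbb] := subproc2 (size_procs a t f) sb.
  have [una unb nFa nFb] := keys_split un nF.
  have hWa : X ^ mdeg dv a <= W by apply: le_W hW => /=; rewrite !leq_max leqnn ?orbT.
  have hWb : X ^ mdeg dv b <= W by apply: le_W hW => /=; rewrite !leq_max leqnn ?orbT.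
  have [s1 [ag1 g1 r1]] := run_one IHa (Pre tm sba wa hWa hd oa ag una nFa).
  have [s2 [ag2 g2 [i2 _] r2]] := run_next IHb (Pre (leqW tm) sbb wb hWb hd ob ag1 unb nFb) tm.
  have lt : eval_iop o (ireg s2 t) (ireg s2 0) < W.
    have [] := @den_ltW (EBin o a b) rho dv _ hW hd (conj oa ob); first exact/andP.
    by rewrite /= i2 g1 [ireg s2 0]g2.
  have r3 : Run P W F (Do (IBin o 0 t 0)) t s2 (step (IBin o 0 t 0) s2) [::] 1 1.
    by apply: Run_reg; rewrite //= eqxx.
  exists (step (IBin o 0 t 0) s2); last by rewrite /= i2 g1 [ireg s2 0]g2.
  have := r1 _ _ _ _ _ (r2 _ _ _ _ _ r3); rewrite cats0.
  by move/Run_weaken; apply=> //=; clear; lia.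
- move=> a IHa t f rho dv s [tm sb wa hW hd [oa Fa mW] ag un nF].
  have hWa : X ^ mdeg dv a <= W by apply: le_W hW => /=; rewrite !leq_max leqnn ?orbT.
  have [s1 [ag1 g1 _ r1]] : exists s1, [/\ agree F rho mem rm s1,
      ireg s1 0 = den rho a, true &
      Run P W F (code a t f) t s s1 (wr rho a) (wk rho a) (dpb lm a)].
    have [s1 r1 g1] := IHa _ _ _ _ _ (@Pre _ a t f rho dv s tm sb wa hWa hd oa ag un nF).
    by exists s1; split=> //; apply: agree_run tm r1 nF ag.
  have mE : imem s1 (ireg s1 0) = mem (den rho a).
    by case: ag1 => _ m _; rewrite g1 m.
  have r2 : Run P W F (Do (ILoad 0 0)) t s1 (step (ILoad 0 0) s1) [::] 1 1.
    apply: Run_load; rewrite ?mE ?g1 //.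
    by apply: leq_trans mW (le_W _ hW); rewrite /= leq_maxl.
  exists (step (ILoad 0 0) s1); last by rewrite /= mE.
  have := Run_seq r1 r2; rewrite cats0.
  by move/Run_weaken; apply=> //=; clear; lia.
- move=> b x a IHa e IHe t f rho dv s [tm sb /and3P[xv wa we] hW hd [oa oe] ag un nF].
  have [sba /subproc_cons[Pf sbe]] := subproc2 (size_procs a t f) sb.
  have [una une nFa nFe] := keys_split un nF.
  have hWa : X ^ mdeg dv a <= W by apply: le_W hW => /=; rewrite !leq_max leqnn ?orbT.
  have hWe : X ^ mdeg (upd dv x (deg dv a)) e <= W.
    by apply: le_W hW => /=; rewrite !leq_max leqnn ?orbT.
  have [s1 [ag1 g1 r1]] := run_one IHa (Pre tm sba wa hWa hd oa ag una nFa).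
  have [av aW] := den_ltW wa hWa hd oa.
  have hd' y : upd rho x (den rho a) y < X ^ upd dv x (deg dv a) y.
    by rewrite /upd; case: eqP.
  have [s2 r2 [ag2 n2]] : exists2 s', Run P W F (mov x t) 2 s1 s' [::] 2 2 &
      agree F (upd rho x (den rho a)) mem rm s' /\ true.
    have [|||s' r [m1 m2 m3 m4]] := @Run_mov _ P W F x t 2 s1.
    + by move: xv tm; rewrite /isvar; clear; lia.
    + by move: xv; rewrite /isvar; clear; lia.
    + by rewrite g1.
    exists s' => //; split=> //; case: ag1 => a1 a2 a3.
    split; [|by rewrite m3|by rewrite m4].
    by move=> y hy; rewrite m1 /upd g1; case: eqP => // _; exact: a1.
  have [s3 r3 g3] := IHe _ _ _ _ _ (Pre (leqW tm) sbe we hWe hd' oe ag2 une nFe).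
  have r3' : Run P W F (code e t.+1 (f + np a).+1) 2 s2 s3
      (wr (upd rho x (den rho a)) e) (wk (upd rho x (den rho a)) e) (dpb lm e).
    by apply: Run_weaken r3 _ _ _ => //; apply: leq_trans (leqW tm).
  have r4 : Run P W F (Call (f + np a)) t s1 (after_call s1 s3)
      (wr (upd rho x (den rho a)) e) (2 + wk (upd rho x (den rho a)) e).+1 (2 + dpb lm e).+1.
    by apply: Run_call; rewrite Pf; apply: (Run_seq (ws1 := [::]) r2 r3').
  exists (after_call s1 s3); last exact: etrans (getv_call _ _ _) g3.
  by have := r1 _ _ _ _ _ r4; move/Run_weaken; apply=> //=; clear; lia.
- move=> b' a IHa b IHb c IHc d IHd t f rho dv s.
  move=> [tm sb /and4P[wa wb wc wd] hW hd [oa ob ocd] ag un nF].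
  have [sba sb2] := subproc2 (size_procs a t f) sb.
  have [sbb sb3] := subproc2 (size_procs b t.+1 (f + np a)) sb2.
  have [sbc sbd] := subproc2 (size_procs c t.+1 (f + np a + np b)) sb3.
  have [una un2 nFa nF2] := keys_split un nF.
  have [unb uncd nFb nFcd] := keys_split un2 nF2.
  have hWa : X ^ mdeg dv a <= W by apply: le_W hW => /=; rewrite !leq_max leqnn ?orbT.
  have hWb : X ^ mdeg dv b <= W by apply: le_W hW => /=; rewrite !leq_max leqnn ?orbT.
  have hWc : X ^ mdeg dv c <= W by apply: le_W hW => /=; rewrite !leq_max leqnn ?orbT.
  have hWd : X ^ mdeg dv d <= W by apply: le_W hW => /=; rewrite !leq_max leqnn ?orbT.
  have [s1 [ag1 g1 r1]] := run_one IHa (Pre tm sba wa hWa hd oa ag una nFa).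
  have [s2 [ag2 g2 [i2 _] r2]] := run_next IHb (Pre (leqW tm) sbb wb hWb hd ob ag1 unb nFb) tm.
  have hE : holds (ILt t 0) s2 = (den rho a < den rho b).
    by rewrite /= i2 g1 [ireg s2 0]g2.
  have [s3 r3 g3] : exists2 s3, Run P W F (if den rho a < den rho b then code c t.+1 (f + np a + np b)
        else code d t.+1 (f + np a + np b + np c)) t s2 s3
      (if den rho a < den rho b then wr rho c else wr rho d)
      (if den rho a < den rho b then wk rho c else wk rho d) (maxn (dpb lm c) (dpb lm d)) &
      getv b' s3 = if den rho a < den rho b then den rho c else den rho d.
    move: ocd uncd nFcd; case: ifP => _ ocd uncd nFcd.
      have [s3 r3 g3] := IHc _ _ _ _ _ (Pre (leqW tm) sbc wc hWc hd ocd ag2 uncd nFcd).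
      by exists s3 => //; apply: Run_weaken r3 _ _ _; rewrite ?leq_maxl.
    have [s3 r3 g3] := IHd _ _ _ _ _ (Pre (leqW tm) sbd wd hWd hd ocd ag2 uncd nFcd).
    by exists s3 => //; apply: Run_weaken r3 _ _ _; rewrite ?leq_maxr.
  exists s3 => //; move: r3; rewrite -{1}hE => r3.
  have := r1 _ _ _ _ _ (r2 _ _ _ _ _ (Run_if r3)).
  by move/Run_weaken; apply=> //=; clear; lia.
- move=> b' a IHa b IHb c IHc d IHd t f rho dv s.
  move=> [tm sb /and4P[wa wb wc wd] hW hd [oa ob ocd] ag un nF].
  have [sba sb2] := subproc2 (size_procs a t f) sb.
  have [sbb sb3] := subproc2 (size_procs b t.+1 (f + np a)) sb2.
  have [sbc sbd] := subproc2 (size_procs c t.+1 (f + np a + np b)) sb3.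
  have [una un2 nFa nF2] := keys_split un nF.
  have [unb uncd nFb nFcd] := keys_split un2 nF2.
  have hWa : X ^ mdeg dv a <= W by apply: le_W hW => /=; rewrite !leq_max leqnn ?orbT.
  have hWb : X ^ mdeg dv b <= W by apply: le_W hW => /=; rewrite !leq_max leqnn ?orbT.
  have hWc : X ^ mdeg dv c <= W by apply: le_W hW => /=; rewrite !leq_max leqnn ?orbT.
  have hWd : X ^ mdeg dv d <= W by apply: le_W hW => /=; rewrite !leq_max leqnn ?orbT.
  have [s1 [ag1 g1 r1]] := run_rone IHa (Pre tm sba wa hWa hd oa ag una nFa).
  have [s2 [ag2 g2 [_ i2] r2]] := run_next IHb (Pre (leqW tm) sbb wb hWb hd ob ag1 unb nFb) tm.
  have hE : holds (RLe t 0) s2 = ((den rho a <= den rho b)%R).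
    by rewrite /= i2 g1 [rreg s2 0]g2.
  have [s3 r3 g3] : exists2 s3, Run P W F (if (den rho a <= den rho b)%R then code c t.+1 (f + np a + np b)
        else code d t.+1 (f + np a + np b + np c)) t s2 s3
      (if (den rho a <= den rho b)%R then wr rho c else wr rho d)
      (if (den rho a <= den rho b)%R then wk rho c else wk rho d) (maxn (dpb lm c) (dpb lm d)) &
      getv b' s3 = if (den rho a <= den rho b)%R then den rho c else den rho d.
    move: ocd uncd nFcd; case: ifP => _ ocd uncd nFcd.
      have [s3 r3 g3] := IHc _ _ _ _ _ (Pre (leqW tm) sbc wc hWc hd ocd ag2 uncd nFcd).
      by exists s3 => //; apply: Run_weaken r3 _ _ _; rewrite ?leq_maxl.
    have [s3 r3 g3] := IHd _ _ _ _ _ (Pre (leqW tm) sbd wd hWd hd ocd ag2 uncd nFcd).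
    by exists s3 => //; apply: Run_weaken r3 _ _ _; rewrite ?leq_maxr.
  exists s3 => //; move: r3; rewrite -{1}hE => r3.
  have := r1 _ _ _ _ _ (r2 _ _ _ _ _ (Run_if r3)).
  by move/Run_weaken; apply=> //=; clear; lia.
- move=> b o g N IHN x e IHe t f rho dv s.
  move=> [tm sb /and4P[xv wN we wp] hW hd [oN leN oe] ag un nF].
  have [sbN /subproc_cons[Pf sbe]] := subproc2 (size_procs N t f) sb.
  have [unN une nFN nFe] := keys_split un nF.
  have hWN : X ^ mdeg dv N <= W by apply: le_W hW => /=; rewrite !leq_max leqnn ?orbT.
  have hWe : X ^ mdeg (upd dv x (deg dv N)) e <= W.
    by apply: le_W hW => /=; rewrite !leq_max leqnn ?orbT.
  have hWd : X ^ (deg dv N).+2 <= W by apply: le_W hW => /=; rewrite leq_maxl.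
  have hWr : X ^ deg dv (ERed o g N x e) <= W.
    by apply: le_W hW => /=; rewrite !leq_max leqnn ?orbT.
  have [s1 [ag1 g1 r1]] := run_one IHN (Pre tm sbN wN hWN hd oN ag unN nFN).
  have [Nv NW] := den_ltW wN hWN hd oN.
  (* Two factors [X], each at least 2, give the room needed by [n + n] and by the constant 2 of the
     midpoint. *)
  have X2 : 4 * X ^ deg dv N <= W.
    apply: leq_trans hWd; rewrite 2!expnS mulnA leq_mul2r; apply/orP; right.
    by move: X1; clear; nia.
  have Xp := X_gt0 (deg dv N).
  set n := den rho N in Nv NW oe leN g1 *.
  have [W0 [W2 [WN1 WN2]]] : 0 < W /\ 2 < W /\ n.+1 < W /\ n + n < W.
    by move: X2 Xp Nv; clear; lia.
  set s2 := step (IConst t.+1 0) s1.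
  have tm2 : vmax <= t.+2 by apply: leqW (leqW tm).
  have tm3 : vmax <= t.+3 by apply: leqW.
  have ag2 : agree F rho mem rm s2 by apply: agree_reg => //=; rewrite (leqW tm) orbT.
  have r2 : Run P W F (Do (IConst t.+1 0)) t s1 s2 [::] 1 1.
    by apply: Run_reg; rewrite //= ?eqxx // leqnSn orbT.
  have [i1 i0] : ireg s2 t.+1 = 0 /\ ireg s2 t = n.
    by rewrite /= eqxx (_ : (t == t.+1) = false) //; apply/negbTE; rewrite neq_ltn leqnn.
  have dv' i : i < n -> forall y, upd rho x i y < X ^ upd dv x (deg dv N) y.
    by move=> lt y; rewrite /upd; case: eqP => // _; apply: ltn_trans Nv.
  have body i s' : i < n -> agree F (upd rho x i) mem rm s' ->
      uniq (keys (wr (upd rho x i) e)) -> all (predC F) (keys (wr (upd rho x i) e)) ->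
      exists2 s'', Run P W F (code e t.+3 (f + np N).+1) 2 s' s''
        (wr (upd rho x i) e) (wk (upd rho x i) e) (dpb lm e) &
        getv b s'' = den (upd rho x i) e.
    move=> lt ag' un' nF'.
    have [s3 r3 g3] := IHe _ _ _ _ _ (Pre tm3 sbe we hWe (dv' i lt) (oe i lt) ag' un' nF').
    by exists s3 => //; apply: Run_weaken r3 _ _ _ => //; apply: leq_trans tm3.
  have Wv lo hi : lo <= hi -> hi <= n ->
      below W (\big[redop o/redidx R o]_(lo <= i < hi) den (upd rho x i) e).
    move=> h1 h2.
    have hb i : i < n -> small X (deg (upd dv x (deg dv N)) e) (den (upd rho x i) e).
      by move=> lt; apply: (den_small X1 q_r0 (dv' i lt) we (oe i lt)).
    have hp : is_true (if o is Prod then n <= r0 else true).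
      clear -leN wp q_r0; case: o wp => // /eqP g0.
      by apply: leq_trans leN _; rewrite g0.
    case: (small_red X1 h1 h2 Nv hb hp) => [h|n0].
      exact: small_below h hWr.
    have [-> ->] : lo = 0 /\ hi = 0 by move: h1 h2; rewrite n0; clear; lia.
    rewrite red_nil; move: W0 (ltnW W2); clear; case: o => //.
  have [s3 [w' [r3 g3 w1 w0]]] := red_ok Pf tm xv W2 WN1 WN2 Wv body (l := lm)
    (leq0n n) (leqnn n) ltac:(rewrite subn0; exact: leq_trans leN (q_lm g)) ag2 i0 i1 une nFe.
  have r4 := Run_call t (eq_ind_r (fun c => Run P W F c _ _ _ _ _ _) r3 Pf).
  exists (after_call s2 s3).
    have := r1 _ _ _ _ _ (Run_seq r2 r4).
    move/Run_weaken; apply=> //=; last by clear; lia.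
    rewrite -/n; have [n0|] := posnP n.
      by move: (w0 (esym n0)); clear; lia.
    by move=> /w1; clear; lia.
  exact: etrans (getv_call _ _ _) g3.
- move=> a IHa b IHb t f rho dv s [tm sb /andP[wa wb] hW hd [oa ob] ag un nF].
  have [sba sbb] := subproc2 (size_procs a t f) sb.
  have [una un2 nFa nF2] := keys_split un nF.
  have [unb _ nFb _] := keys_split un2 nF2.
  have hWa : X ^ mdeg dv a <= W by apply: le_W hW => /=; rewrite !leq_max leqnn ?orbT.
  have hWb : X ^ mdeg dv b <= W by apply: le_W hW => /=; rewrite !leq_max leqnn ?orbT.
  have [s1 [ag1 g1 r1]] := run_one IHa (Pre tm sba wa hWa hd oa ag una nFa).
  have [s2 [ag2 g2 [i2 _] r2]] := run_next IHb (Pre (leqW tm) sbb wb hWb hd ob ag1 unb nFb) tm.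
  have r3 := Run_store P W F t 0 t s2; rewrite i2 g1 [ireg s2 0]g2 in r3.
  exists (step (IStore t 0) s2); last by rewrite /= [ireg s2 0]g2.
  by have := r1 _ _ _ _ _ (r2 _ _ _ _ _ r3); move/Run_weaken; apply=> //=; clear; lia.
- move=> a IHa t f rho dv s [tm sb wa hW hd oa ag un nF].
  have [s1 r1 g1] := IHa _ _ _ _ _ (@Pre _ a t f rho dv s tm sb wa hW hd oa ag un nF).
  have [_ _ rE] := agree_run tm r1 nF ag.
  have := Run_seq r1 (Run_rload P W F t s1); rewrite cats0 => r2.
  exists (step (RLoad 0 0) s1); last by rewrite /= rE [ireg s1 0]g1.
  by move: r2 => /Run_weaken; apply=> //=; clear; lia.
- move=> t f rho dv s [tm _ _ hW _ _ _ _ _].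
  have W0 : 0 < W by apply: leq_trans (X_gt0 _) hW.
  exists (step (ROfInt 0 0) (step (IConst 0 0) s)) => //.
  by apply: (Run_seq (ws1 := [::]) (ws2 := [::]) (w1 := 1) (d1 := 1)); apply: Run_reg.
Qed.

End Compilation.

(** * Statements *)

Inductive stmt :=
  | SLet of nat & exp false
  | SDo of exp false
  | SSeq of stmt & stmt
  | SIf of nat & nat & stmt & stmt
  | SWhile of nat & nat & stmt.

Fixpoint snp (st : stmt) : nat :=
  match st with
  | SLet _ e | SDo e => np e
  | SSeq a b | SIf _ _ a b => snp a + snp b
  | SWhile _ _ a => snp a
  end.

Fixpoint scode (st : stmt) (f : nat) : com :=
  match st with
  | SLet x e => Seq (code e vmax f) (mov x 0)
  | SDo e => code e vmax f
  | SSeq a b => Seq (scode a f) (scode b (f + snp a))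
  | SIf x y a b => If (ILt x y) (scode a f) (scode b (f + snp a))
  | SWhile x y a => While (ILt x y) (scode a f)
  end.

Fixpoint sprocs (st : stmt) (f : nat) : seq com :=
  match st with
  | SLet _ e | SDo e => procs e vmax f
  | SSeq a b | SIf _ _ a b => sprocs a f ++ sprocs b (f + snp a)
  | SWhile _ _ a => sprocs a f
  end.

Lemma size_sprocs st f : size (sprocs st f) = snp st.
Proof.
elim: st f => //= [x e|e|a IHa b IHb|_ _ a IHa b IHb] f; try exact: size_procs.
  by rewrite size_cat IHa IHb.
by rewrite size_cat IHa IHb.
Qed.

Fixpoint pure s (e : exp s) : bool :=
  match e with
  | EVar _ | ECst _ | ERz => true
  | EBin _ a b => pure a && pure b
  | ELd a | ERd a => pure a
  | ELet _ _ a b => pure a && pure b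
  | ELt _ a b c d => [&& pure a, pure b, pure c & pure d]
  | ELe _ a b c d => [&& pure a, pure b, pure c & pure d]
  | ERed _ _ _ N _ b => pure N && pure b
  | ESt _ _ => false
  end.

Lemma wr_pure (R : realType) mem (rm : nat -> R) rho s (e : exp s) :
  pure e -> wr mem rm rho e = [::].
Proof.
elim: e rho => //=.
- by move=> o a IHa b IHb rho /andP[/IHa -> /IHb ->].
- by move=> s' x a IHa b IHb rho /andP[/IHa -> /IHb ->].
- by move=> s' a IHa b IHb c IHc d IHd rho /and4P[/IHa -> /IHb -> /IHc -> /IHd ->]; case: ifP.
- by move=> s' a IHa b IHb c IHc d IHd rho /and4P[/IHa -> /IHb -> /IHc -> /IHd ->]; case: ifP.
- move=> s' o g N IHN x b IHb rho /andP[/IHN -> pb].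
  by elim: (index_iota _ _) => //= i l IH; rewrite IHb.
Qed.

Section Triples.
Context (R : realType) (P : program) (W X dm r0 lm : nat) (rm : nat -> R).
Context (dv : nat -> nat).
Hypothesis X1 : 1 < X.
Hypothesis r0_lm : r0 <= 2 ^ lm.
Implicit Types (rho mem : nat -> nat).

(* The ranges of all the reductions are at most [2 ^ lm]. *)
Definition qmax g := if g == 0 then r0 else 2 ^ lm.

(** Total correctness with cost: a terminating run is asserted to exist. The real memory [rm] is
    constant, so the postcondition only speaks of variables and integer memory. *)
Definition triple st rho mem (Q : (nat -> nat) -> (nat -> nat) -> Prop) w d :=
  forall f s, subproc P f (sprocs st f) -> agree predT rho mem rm s ->
  exists s' k rho' mem', [/\ exec P W (scode st f) s s' k,
    work k <= w, depth k <= d, agree predT rho' mem' rm s' & Q rho' mem'].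

Lemma t_weaken st rho mem Q (Q' : _ -> _ -> Prop) w w' d d' :
  triple st rho mem Q w d ->
  (forall rho' mem', Q rho' mem' -> Q' rho' mem') -> w <= w' -> d <= d' ->
  triple st rho mem Q' w' d'.
Proof.
move=> t QQ ww dd f s sb ag.
have [s' [k [rho' [mem' [E w1 d1 a q]]]]] := t f s sb ag.
by exists s', k, rho', mem'; split; [|exact: leq_trans ww|exact: leq_trans dd|
  |exact: QQ].
Qed.

Lemma t_seq st1 st2 rho mem Q w1 d1 w2 d2 :
  triple st1 rho mem (fun rho' mem' => triple st2 rho' mem' Q w2 d2) w1 d1 ->
  triple (SSeq st1 st2) rho mem Q (w1 + w2) (d1 + d2).
Proof.
move=> t f s sb ag.
have [sb1 sb2] := subproc2 (size_sprocs st1 f) sb.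
have [s1 [k1 [rho1 [mem1 [E1 hw1 hd1 a1 t2]]]]] := t f s sb1 ag.
have [s2 [k2 [rho2 [mem2 [E2 hw2 hd2 a2 q]]]]] := t2 _ s1 sb2 a1.
exists s2, (seq_cost k1 k2), rho2, mem2; split => //.
- exact: exec_seq E1 E2.
- exact: leq_add.
- exact: leq_add.
Qed.

Lemma t_if x y st1 st2 rho mem Q w d : isvar x -> isvar y ->
  (if rho x < rho y then triple st1 rho mem Q w d else triple st2 rho mem Q w d) ->
  triple (SIf x y st1 st2) rho mem Q w.+1 d.+1.
Proof.
move=> vx vy t f s sb ag.
have [sb1 sb2] := subproc2 (size_sprocs st1 f) sb.
have hE : holds (ILt x y) s = (rho x < rho y).
  by case: ag => a _ _ /=; rewrite !a.
have [s' [k [rho' [mem' [E hw hd a q]]]]] : exists s' k rho' mem', [/\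
    exec P W (if holds (ILt x y) s then scode st1 f else scode st2 (f + snp st1)) s s' k,
    work k <= w, depth k <= d, agree predT rho' mem' rm s' & Q rho' mem'].
  by rewrite hE; move: t; case: ifP => _ t; exact: t.
by exists s', (seq_cost tick k), rho', mem'; split => //; exact: exec_if.
Qed.

(** The number [n] of iterations is known in advance, but the work [w i] depends on the iteration:
    the cost of colouring doubles from one level to the next, and only its sum is small. *)
Lemma t_while x y body (I : nat -> (nat -> nat) -> (nat -> nat) -> Prop) n w d
    rho mem : isvar x -> isvar y ->
  (forall i rho mem, i < n -> I i rho mem ->
     rho x < rho y /\ triple body rho mem (I i.+1) (w i) d) ->
  (forall rho mem, I n rho mem -> ~~ (rho x < rho y)) ->
  I 0 rho mem ->
  triple (SWhile x y body) rho mem (I n) (\sum_(0 <= i < n) (w i).+1 + 2) (n * d.+1 + 2).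
Proof.
move=> vx vy hI hN.
suff H j i rho' mem' : i + j = n -> I i rho' mem' ->
    triple (SWhile x y body) rho' mem' (I n) (\sum_(i <= u < n) (w u).+1 + 2) (j * d.+1 + 2).
  by move=> I0; apply: (H n 0).
elim: j i rho' mem' => [|j IH] i rho' mem' ij Ii f s sb ag.
all: have hE : holds (ILt x y) s = (rho' x < rho' y)
  by case: ag => a _ _ /=; rewrite !a.
  have E : i = n by rewrite -ij addn0.
  rewrite E in Ii; exists s, (seq_cost tick tick), rho', mem'; split => //.
    by apply: exec_while; rewrite hE (negPf (hN _ _ Ii)); exact: exec_skip.
  by rewrite E big_geq.
have lt : i < n by rewrite -ij; clear; lia.
have [cond t] := hI i _ _ lt Ii.
have [s1 [k1 [rho1 [mem1 [E1 w1 d1 a1 I1]]]]] := t f s sb ag.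
have [s2 [k2 [rho2 [mem2 [E2 w2 d2 a2 I2]]]]] :=
  IH i.+1 _ _ (etrans (addSnnS i j) ij) I1 f s1 sb a1.
exists s2, (seq_cost tick (seq_cost k1 k2)), rho2, mem2; split => //.
- by apply: exec_while; rewrite hE cond; exact: exec_seq E1 E2.
- by rewrite big_ltn //=; move: w1 w2; clear; lia.
- by rewrite /= mulSn; move: d1 d2; clear; lia.
Qed.

Record pre_exp (F : pred nat) b (e : exp b) rho mem : Prop := PreExp {
  pe_wf : wf e;
  pe_W : X ^ mdeg dm r0 dv e <= W;
  pe_dv : forall x, rho x < X ^ dv x;
  pe_ok : ok mem rm X dm F qmax rho e;
  pe_uniq : uniq (keys (wr mem rm rho e));
  pe_nF : all (predC F) (keys (wr mem rm rho e)) }.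

Lemma exp_run F b (e : exp b) rho mem f s : pre_exp F e rho mem ->
  subproc P f (procs e vmax f) -> agree predT rho mem rm s ->
  exists s' k, [/\ exec P W (code e vmax f) s s' k,
    work k <= wk mem rm rho e, depth k <= dpb lm e,
    agree predT rho (upds mem (wr mem rm rho e)) rm s' &
    getv b s' = den mem rm rho e].
Proof.
move=> [we hW hd oe un nF] sb [a1 a2 a3].
have q0 : qmax 0 <= r0 by [].
have ql g : qmax g <= 2 ^ lm by rewrite /qmax; case: eqP.
have agF : agree F rho mem rm s by split=> // a _; exact: a2.
have [s' [k E p] g] := code_ok X1 q0 ql (Pre (leqnn _) sb we hW hd oe agF un nF).
case: p => b1 _ b3 b4 b5 b6 _ _.
exists s', k; split=> //; split.
- by move=> x /[dup] hx /andP[x1 x2]; rewrite b1 ?x1 // a1.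
- move=> a _; rewrite b3; apply: eq_upds => c; exact: a2.
- by rewrite b4.
Qed.

Lemma t_do F e rho mem (Q : _ -> _ -> Prop) : pre_exp F e rho mem ->
  Q rho (upds mem (wr mem rm rho e)) ->
  triple (SDo e) rho mem Q (wk mem rm rho e) (dpb lm e).
Proof.
move=> p q f s sb ag.
have [s' [k [E w d a _]]] := exp_run p sb ag.
by exists s', k, rho, (upds mem (wr mem rm rho e)); split.
Qed.

Lemma t_let F x (e : exp false) rho mem (Q : _ -> _ -> Prop) : isvar x -> pure e ->
  pre_exp F e rho mem ->
  Q (upd rho x (den mem rm rho e)) mem ->
  triple (SLet x e) rho mem Q (wk mem rm rho e + 2) (dpb lm e + 2).
Proof.
move=> vx pu p q f s sb ag.
have [s1 [k1 [E1 w d a g]]] := exp_run p sb ag.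
rewrite (wr_pure _ _ _ pu) /= in a.
have x0 : x != 0 by move: vx; rewrite /isvar; case: (x).
have x2 : (x < 2) || (2 <= x) by case: ltnP.
have lt : ireg s1 0 < W.
  rewrite [ireg s1 0]g; case: p => we hW hd oe _ _.
  have q0 : qmax 0 <= r0 by [].
  apply: leq_trans (den_small X1 q0 hd we oe) _.
  by apply: leq_trans hW; rewrite leq_pexp2l ?deg_mdeg // ltnW.
have [s2 [k2 E2 p2] [m1 m2 m3 m4]] := @Run_mov _ P W predT x 0 2 s1 x0 x2 lt.
exists s2, (seq_cost k1 k2), (upd rho x (den mem rm rho e)), mem; split => //.
- exact: exec_seq E1 E2.
- by apply: leq_add => //; case: p2.
- by apply: leq_add => //; case: p2.
- case: a => a1 a2 a3; split; [|by rewrite m3|by rewrite m4].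
  by move=> y hy; rewrite m1 /upd [ireg s1 0]g; case: eqP => // _; exact: a1.
Qed.

End Triples.

(** * Values of expressions *)

Definition EAdd := EBin IAdd.
Definition ESub := EBin ISub.
Definition EMul := EBin IMul.
Definition EDiv := EBin IDiv.
Definition EMod := EBin IMod.

Section Evaluation.
Context (R : realType) (mem : nat -> nat) (rm : nat -> R) (X dm : nat) (F : pred nat).
Implicit Types (q rho : nat -> nat).

(** Value and safety are proved together, because the safety of a branch or of the body of a
    reduction depends on the values that guard it. *)
Definition Ev q rho b (e : exp b) (v : valT R b) : Prop :=
  den mem rm rho e = v /\ ok mem rm X dm F q rho e.

Lemma Ev_eq q rho b (e : exp b) (v v' : valT R b) : Ev q rho e v -> v = v' -> Ev q rho e v'.
Proof. by move=> h <-. Qed.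

Lemma Ev_var q rho x v : rho x = v -> Ev q rho (EVar x) v.
Proof. by split. Qed.

Lemma Ev_cst q rho c : Ev q rho (ECst c) c.
Proof. by split. Qed.

Lemma Ev_bin q rho o (a b : exp false) (u v : nat) :
  Ev q rho a u -> Ev q rho b v -> Ev q rho (EBin o a b) (eval_iop o u v).
Proof. by move=> [<- ?] [<- ?]; split. Qed.

Lemma Ev_add q rho (a b : exp false) (u v : nat) :
  Ev q rho a u -> Ev q rho b v -> Ev q rho (EAdd a b) (u + v).
Proof. exact: Ev_bin. Qed.

Lemma Ev_sub q rho (a b : exp false) (u v : nat) :
  Ev q rho a u -> Ev q rho b v -> Ev q rho (ESub a b) (u - v).
Proof. exact: Ev_bin. Qed.

Lemma Ev_mul q rho (a b : exp false) (u v : nat) :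
  Ev q rho a u -> Ev q rho b v -> Ev q rho (EMul a b) (u * v).
Proof. exact: Ev_bin. Qed.

Lemma Ev_div q rho (a b : exp false) (u v : nat) :
  Ev q rho a u -> Ev q rho b v -> Ev q rho (EDiv a b) (u %/ v).
Proof. exact: Ev_bin. Qed.

Lemma Ev_mod q rho (a b : exp false) (u v : nat) :
  Ev q rho a u -> Ev q rho b v -> Ev q rho (EMod a b) (u %% v).
Proof. exact: Ev_bin. Qed.

Lemma Ev_ld q rho (a : exp false) (u v : nat) : Ev q rho a u -> mem u = v -> F u -> v < X ^ dm ->
  Ev q rho (ELd a) v.
Proof. by move=> [<- ?] <- ? ?; split. Qed.

Lemma Ev_let q rho b x (a : exp false) (e : exp b) (u : nat) v :
  Ev q rho a u -> Ev q (upd rho x u) e v -> Ev q rho (ELet x a e) v.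
Proof. by move=> [<- ?] [? ?]; split. Qed.

Lemma Ev_lt q rho s (a b : exp false) (c d : exp s) (u v : nat) w1 w2 :
  Ev q rho a u -> Ev q rho b v -> (u < v -> Ev q rho c w1) ->
  (v <= u -> Ev q rho d w2) -> Ev q rho (ELt a b c d) (if u < v then w1 else w2).
Proof.
move=> [<- oa] [<- ob] hc hd; split=> /=.
  by case: ltnP => h; [case: (hc h)|case: (hd h)].
by split=> //; case: ltnP => h; [case: (hc h)|case: (hd h)].
Qed.

Lemma Ev_le q rho s (a b : exp true) (c d : exp s) (u v : R) w1 w2 :
  Ev q rho a u -> Ev q rho b v -> (u <= v -> Ev q rho c w1)%R ->
  (~~ (u <= v)%R -> Ev q rho d w2) -> Ev q rho (ELe a b c d) (if (u <= v)%R then w1 else w2).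
Proof.
move=> [<- oa] [<- ob] hc hd; split=> /=.
  by case: ifPn => h; [case: (hc h)|case: (hd h)].
by split=> //; case: ifPn => h; [case: (hc h)|case: (hd h)].
Qed.

Lemma Ev_red q rho s (o : red s) g (N : exp false) x (b : exp s) (n : nat) f :
  Ev q rho N n -> n <= q g -> (forall i, i < n -> Ev q (upd rho x i) b (f i)) ->
  Ev q rho (ERed o g N x b) (\big[redop o/redidx R o]_(0 <= i < n) f i).
Proof.
move=> [<- oN] le h; split=> /=; last by split=> // i /h[].
rewrite big_nat_cond [RHS]big_nat_cond; apply: eq_bigr => i.
by rewrite andbT => /h[].
Qed.

Lemma Ev_rd q rho (a : exp false) (u : nat) (v : R) : Ev q rho a u -> rm u = v -> Ev q rho (ERd a) v.
Proof. by move=> [<- ?] <-; split. Qed.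

Lemma Ev_rz q rho : Ev q rho ERz (0%R : R).
Proof. by split. Qed.

End Evaluation.

Definition qv r0 b1 b2 g : nat :=
  match g with 0 => r0 | 1 => b1 | 2 => b2 | _ => 1 end.

Lemma qv_other r0 b1 b2 g : 2 < g -> qv r0 b1 b2 g = 1.
Proof. by case: g => [|[|[|g]]]. Qed.

(** * Parallel tables *)

Definition vH := 5.

Definition EAddr (reg x y z : exp false) :=
  EAdd (EMul (EAdd (EMul (EAdd (EMul reg (EVar vH)) x) (EVar vH)) y) (EVar vH)) z.

(** Coordinates in radix [H], which exceeds all of them. Region numbers are positive, so every table
    lies above the input, whose addresses are below [H]. *)
Definition addr H reg x y z := ((reg * H + x) * H + y) * H + z.

(* The three coordinates of the cell being computed are in the variables
   16, 17 and 18. *)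
Definition tabE reg N1 g N2 N3 E : exp false :=
  ERed Sum 3 N1 16 (ELt (ECst 0) g
    (ERed Sum 3 N2 17 (ERed Sum 3 N3 18
      (ESt (EAddr reg (EVar 16) (EVar 17) (EVar 18)) E)))
    (ECst 0)).

Definition flat (e : exp false) := [&& wf e, pure e, nest 1 e == 0 & nest 2 e == 0].

Definition tab_wf reg N1 g N2 N3 (E : exp false) :=
  [&& flat reg, flat N1, flat g, flat N2, flat N3, wf E & pure E].

Definition tab_cost r0 (reg N1 g N2 N3 E : exp false) :=
  r0.+1 * (wkb r0 reg + wkb r0 N1 + wkb r0 g + wkb r0 N2 + wkb r0 N3 + wkb r0 E + 200).

Lemma addr_inj H reg x y z reg' x' y' z' :
  x < H -> y < H -> z < H -> x' < H -> y' < H -> z' < H ->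
  addr H reg x y z = addr H reg' x' y' z' ->
  [/\ reg = reg', x = x', y = y' & z = z'].
Proof.
have step a b a' b' : b < H -> b' < H -> a * H + b = a' * H + b' -> a = a' /\ b = b'.
  move=> hb hb' E; have H0 : 0 < H by apply: leq_ltn_trans hb.
  have Ed u w : w < H -> (u * H + w) %/ H = u.
    by move=> hw; rewrite divnMDl // divn_small // addn0.
  have Em u w : w < H -> (u * H + w) %% H = w.
    by move=> hw; rewrite modnMDl modn_small.
  by split; [rewrite -(Ed a b) // E Ed|rewrite -(Em a b) // E Em].
move=> hx hy hz hx' hy' hz' /(step _ _ _ _ hz hz')[/(step _ _ _ _ hy hy')].
by move=> [/(step _ _ _ _ hx hx')[-> ->] -> ->].
Qed.

Definition region H a := a %/ H %/ H %/ H.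

Lemma region_addr H reg x y z : x < H -> y < H -> z < H ->
  region H (addr H reg x y z) = reg.
Proof.
move=> hx hy hz; have H0 : 0 < H by apply: leq_ltn_trans hx.
have Ed u w : w < H -> (u * H + w) %/ H = u.
  by move=> hw; rewrite divnMDl // divn_small // addn0.
by rewrite /region /addr !Ed.
Qed.

Lemma uniq_flat (T : eqType) (h : nat -> seq T) s : uniq s ->
  (forall i, i \in s -> uniq (h i)) ->
  (forall i j a, i \in s -> j \in s -> a \in h i -> a \in h j -> i = j) ->
  uniq (flatten [seq h i | i <- s]).
Proof.
elim: s => //= i s IH /andP[ni us] hu hd.
rewrite cat_uniq hu ?mem_head // IH //; first last.
- by move=> j k a hj hk; apply: hd; rewrite in_cons ?hj ?hk orbT.
- by move=> j hj; apply: hu; rewrite in_cons hj orbT.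
- rewrite andbT; apply/hasPn => a /flatten_mapP[j hj aj]; apply/negP => ai.
  move: ni; rewrite (hd i j a) ?mem_head ?in_cons ?hj ?orbT //.
Qed.

Section Tables.
Context (R : realType) (P : program) (W X dm r0 lm : nat) (rm : nat -> R).
Context (dv : nat -> nat) (H : nat).
Hypothesis X1 : 1 < X.
Hypothesis r0_lm : r0 <= 2 ^ lm.
Hypothesis r0_gt0 : 0 < r0.
Implicit Types (rho mem : nat -> nat).

Local Notation upd3 rho x y z := (upd (upd (upd rho 16 x) 17 y) 18 z).

Lemma flat_wk b1 b2 mem F rho (e : exp false) (v : nat) : flat e -> 0 < b1 -> 0 < b2 ->
  Ev mem rm X dm F (qv r0 b1 b2) rho e v -> wk mem rm rho e <= wkb r0 e.
Proof.
move=> /and4P[we _ /eqP n1 /eqP n2] h1 h2 [_ o].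
have := @wk_wkb _ _ _ _ _ _ (qv r0 b1 b2) rho _ e h1 h2 we (@qv_other _ _ _) o.
by rewrite n1 n2 !expn0 !muln1.
Qed.

(** [F] withholds exactly the region being filled, so the whole table is one race-free reduction.
    The bounds depend on the row [x], and a row rejected by the guard costs a constant: the later
    sums over classes or recoloured hyperedges rely on this. The second dimension, at most [r0], is
    absorbed by the constant. *)
Lemma t_tab reg0 reg N1 g N2 N3 E rho mem (n1 : nat) (gx n2 n3 b1 b2 : nat -> nat)
    (G : nat -> nat -> nat -> nat) (Q : _ -> _ -> Prop) :
  let F a := region H a != reg0 in
  let q x := qv r0 (b1 x) (b2 x) in
  let T := tabE reg N1 g N2 N3 E in
  tab_wf reg N1 g N2 N3 E -> X ^ mdeg dm r0 dv T <= W ->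
  (forall x, rho x < X ^ dv x) -> rho vH = H ->
  (forall x, 0 < b1 x <= 2 ^ lm) -> (forall x, 0 < b2 x <= 2 ^ lm) ->
  Ev mem rm X dm F (q 0) rho N1 n1 -> n1 <= 2 ^ lm ->
  (forall x, x < n1 -> x < H /\ Ev mem rm X dm F (q x) (upd rho 16 x) g (gx x)) ->
  (forall x, x < n1 -> 0 < gx x ->
     Ev mem rm X dm F (q x) (upd rho 16 x) N2 (n2 x) /\ n2 x <= r0) ->
  (forall x y, x < n1 -> 0 < gx x -> y < n2 x -> y < H /\
     Ev mem rm X dm F (q x) (upd (upd rho 16 x) 17 y) N3 (n3 x) /\ n3 x <= 2 ^ lm) ->
  (forall x y z, x < n1 -> 0 < gx x -> y < n2 x -> z < n3 x -> z < H /\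
     Ev mem rm X dm F (q x) (upd3 rho x y z) reg reg0 /\
     Ev mem rm X dm F (q x) (upd3 rho x y z) E (G x y z)) ->
  (forall mem',
     (forall a, region H a != reg0 -> mem' a = mem a) ->
     (forall x y z, x < n1 -> 0 < gx x -> y < n2 x -> z < n3 x ->
        mem' (addr H reg0 x y z) = G x y z) ->
     Q rho mem') ->
  triple P W rm (SDo T) rho mem Q
    (tab_cost r0 reg N1 g N2 N3 E * (\sum_(0 <= x < n1)
       (1 + (0 < gx x) * (n3 x * (b1 x ^ nest 1 E * b2 x ^ nest 2 E))) + 1))
    (dpb lm T).
Proof.
move=> F q T twf hW hd rH hb1 hb2 EN1 n1b Eg EN2 EN3 EE hQ.
case/and5P: (twf) => freg fN1 fg fN2 /and3P[fN3 wE pE].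
have pflat e : flat e -> pure e by case/and4P.
have wflat e : flat e -> wf e by case/and4P.
have r1 : 0 < 2 ^ lm by rewrite expn_gt0.
have qq x g' : q x g' <= qmax r0 lm g'.
  have /andP[_ hb1'] := hb1 x; have /andP[_ hb2'] := hb2 x.
  by case: g' => [|[|[|g']]].
have okq x rho' b (e : exp b) v : Ev mem rm X dm F (q x) rho' e v ->
    ok mem rm X dm F (qmax r0 lm) rho' e.
  by case=> _; apply: ok_mono; exact: qq.
have Eaddr x y z : x < n1 -> 0 < gx x -> y < n2 x -> z < n3 x ->
    Ev mem rm X dm F (q x) (upd3 rho x y z)
      (EAddr reg (EVar 16) (EVar 17) (EVar 18)) (addr H reg0 x y z).
  move=> h1 h2 h3 h4; have [_ [Er _]] := EE x y z h1 h2 h3 h4.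
  have hv : upd3 rho x y z vH = H by [].
  by do 3!(apply: Ev_add; last exact: Ev_var; apply: Ev_mul; last exact: Ev_var).
have okT : ok mem rm X dm F (qmax r0 lm) rho T.
  rewrite /T /tabE /=; split; [exact: okq EN1|by rewrite (proj1 EN1)|].
  move=> x; rewrite (proj1 EN1) => hx; split; [by []|exact: okq (proj2 (Eg x hx))|].
  rewrite (proj1 (proj2 (Eg x hx))); case: ifP => // hg.
  have [E2 n2b] := EN2 x hx hg; rewrite (proj1 E2).
  split; [exact: okq E2|by apply: leq_trans n2b r0_lm|].
  move=> y hy; have [_ [E3 n3b]] := EN3 x y hx hg hy; rewrite (proj1 E3).
  split; [exact: okq E3|by []|]; move=> z hz.
  have [_ [_ Ez]] := EE x y z hx hg hy hz; split; last exact: okq Ez.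
  by have := okq _ _ _ _ _ (Eaddr x y z hx hg hy hz).
pose row x y := [seq (addr H reg0 x y z, G x y z) | z <- index_iota 0 (n3 x)].
pose tab x := if 0 < gx x then flatten [seq row x y | y <- index_iota 0 (n2 x)] else [::].
have wrE : wr mem rm rho T = flatten [seq tab x | x <- index_iota 0 n1].
  rewrite /T /tabE /= (wr_pure _ _ _ (pflat _ fN1)) /= (proj1 EN1).
  congr flatten; apply/eq_in_map => x; rewrite mem_index_iota /= => hx.
  rewrite (wr_pure _ _ _ (pflat _ fg)) /= (proj1 (proj2 (Eg x hx))) /tab.
  case: ifP => // hg; have [E2 _] := EN2 x hx hg.
  rewrite (wr_pure _ _ _ (pflat _ fN2)) /= (proj1 E2).
  congr flatten; apply/eq_in_map => y; rewrite mem_index_iota /= => hy.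
  have [_ [E3 _]] := EN3 x y hx hg hy.
  rewrite (wr_pure _ _ _ (pflat _ fN3)) /= (proj1 E3) /row.
  rewrite -[RHS]flatten_seq1 -map_comp.
  congr flatten; apply/eq_in_map => z; rewrite mem_index_iota /= => hz.
  have [_ [_ Ez]] := EE x y z hx hg hy hz.
  rewrite !(wr_pure _ _ _ (pflat _ freg)) !(wr_pure _ _ _ pE) /=.
  by have [/= -> _] := Eaddr x y z hx hg hy hz; rewrite (proj1 Ez).
have memwr a v : (a, v) \in wr mem rm rho T ->
    exists x y z, [/\ x < n1, 0 < gx x, y < n2 x & z < n3 x] /\
      a = addr H reg0 x y z /\ v = G x y z.
  rewrite wrE => /flatten_mapP[x]; rewrite mem_index_iota /= => hx.
  rewrite /tab; case: ifP => // hg /flatten_mapP[y]; rewrite mem_index_iota /= => hy.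
  move=> /mapP[z]; rewrite mem_index_iota /= => hz [-> ->].
  by exists x, y, z.
have lts x y z : x < n1 -> 0 < gx x -> y < n2 x -> z < n3 x ->
    [/\ x < H, y < H & z < H].
  move=> h1 h2 h3 h4; split; first by case: (Eg x h1).
    by case: (EN3 x y h1 h2 h3).
  by case: (EE x y z h1 h2 h3 h4).
have unT : uniq (keys (wr mem rm rho T)).
  (* Writes are distinct because triples of coordinates below [H] have distinct addresses. *)
  have keysE : keys (wr mem rm rho T) = flatten [seq keys (tab x) | x <- index_iota 0 n1].
    by rewrite wrE /keys map_flatten -map_comp.
  have keytab x a : x < n1 -> a \in keys (tab x) -> exists y z,
      [/\ 0 < gx x, y < n2 x & z < n3 x] /\ a = addr H reg0 x y z.
    move=> hx /mapP[[a' v'] + ->]; rewrite /tab; case: ifP => // hg.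
    move=> /flatten_mapP[y]; rewrite mem_index_iota /= => hy.
    by move=> /mapP[z]; rewrite mem_index_iota /= => hz [-> _]; exists y, z.
  rewrite keysE; apply: uniq_flat; first exact: iota_uniq.
    move=> x; rewrite mem_index_iota /= => hx; rewrite /tab; case: ifP => // hg.
    rewrite /keys map_flatten -map_comp.
    have rowE y : map fst (row x y) = [seq addr H reg0 x y z | z <- index_iota 0 (n3 x)].
      by rewrite /row -map_comp.
    apply: uniq_flat; first exact: iota_uniq.
      move=> y; rewrite mem_index_iota /= => hy; rewrite rowE map_inj_in_uniq ?iota_uniq //.
      move=> z z'; rewrite !mem_index_iota /= => hz hz' E0.
      have [l1 l2 l3] := lts x y z hx hg hy hz.
      have [_ _ l3'] := lts x y z' hx hg hy hz'.
      by case: (addr_inj l1 l2 l3 l1 l2 l3' E0).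
    move=> y y' a; rewrite !mem_index_iota /= !rowE => hy hy'.
    move=> /mapP[z]; rewrite mem_index_iota /= => hz ->.
    move=> /mapP[z']; rewrite mem_index_iota /= => hz' E0.
    have [l1 l2 l3] := lts x y z hx hg hy hz.
    have [_ l2' l3'] := lts x y' z' hx hg hy' hz'.
    by case: (addr_inj l1 l2 l3 l1 l2' l3' E0).
  move=> x x' a; rewrite !mem_index_iota /= => hx hx'.
  move=> /(keytab _ _ hx)[y [z [[hg hy hz] ->]]].
  move=> /(keytab _ _ hx')[y' [z' [[hg' hy' hz'] E0]]].
  have [l1 l2 l3] := lts x y z hx hg hy hz.
  have [l1' l2' l3'] := lts x' y' z' hx' hg' hy' hz'.
  by case: (addr_inj l1 l2 l3 l1' l2' l3' E0).
have nFT : all (predC F) (keys (wr mem rm rho T)).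
  apply/allP => a /mapP[[a' v] /memwr[x [y [z [[h1 h2 h3 h4] [Ea _]]]]]] /= ->.
  have [l1 l2 l3] := lts x y z h1 h2 h3 h4.
  by rewrite /F Ea region_addr // eqxx.
have wfT : wf T.
  by rewrite /T /tabE /= /isvar /= wE !wflat.
have pT : pre_exp W X dm r0 lm rm dv F T rho mem by split.
have memIn x y z : x < n1 -> 0 < gx x -> y < n2 x -> z < n3 x ->
    (addr H reg0 x y z, G x y z) \in wr mem rm rho T.
  move=> h1 h2 h3 h4; rewrite wrE; apply/flatten_mapP; exists x.
    by rewrite mem_index_iota.
  rewrite /tab h2; apply/flatten_mapP; exists y; first by rewrite mem_index_iota.
  by apply/mapP; exists z => //; rewrite mem_index_iota.
apply: t_weaken (t_do (P := P) (Q := Q) X1 r0_lm pT _) _ _ _ => //.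
  apply: hQ.
    move=> a ha; rewrite upds_out //; apply/negP => /(allP nFT) /=.
    by rewrite /F ha.
  by move=> x y z h1 h2 h3 h4; apply: upds_in => //; apply: memIn.
have b1p x : 0 < b1 x by case/andP: (hb1 x).
have b2p x : 0 < b2 x by case/andP: (hb2 x).
rewrite /T /tabE /= (proj1 EN1) /tab_cost.
have h1 := flat_wk fN1 (b1p 0) (b2p 0) EN1.
set K := wkb r0 reg + _ + _ + _ + _ + _ + 200.
have rowb x : x < n1 ->
    (if 0 < den mem rm (upd rho 16 x) g
     then wk mem rm (upd rho 16 x) N2 +
       \sum_(0 <= y < den mem rm (upd rho 16 x) N2)
         (wk mem rm (upd (upd rho 16 x) 17 y) N3 +
          \sum_(0 <= z < den mem rm (upd (upd rho 16 x) 17 y) N3)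
            (wk mem rm (upd3 rho x y z) (ESt (EAddr reg (EVar 16) (EVar 17) (EVar 18)) E) + 21)
          + 10 + 21) + 10
     else 1) + wk mem rm (upd rho 16 x) g + 25 <=
    r0.+1 * K * (1 + (0 < gx x) * (n3 x * (b1 x ^ nest 1 E * b2 x ^ nest 2 E))).
  move=> hx; have [_ E1] := Eg x hx; rewrite (proj1 E1).
  have hg' := flat_wk fg (b1p x) (b2p x) E1.
  case: ifP => hg; last first.
    by rewrite mul0n addn0 muln1 mulSn; move: hg'; rewrite /K; clear; lia.
  have [E2 n2b] := EN2 x hx hg; rewrite (proj1 E2).
  have h2 := flat_wk fN2 (b1p x) (b2p x) E2.
  set Qx := _ * _ ^ _.
  have Qp : 0 < Qx by rewrite muln_gt0 !expn_gt0 b1p b2p.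
  pose A := wkb r0 N3 + 31; pose B := wkb r0 reg + wkb r0 E + 80.
  apply: (@leq_trans (wkb r0 N2 + \sum_(0 <= y < n2 x) (A + n3 x * (B * Qx)) + 10 + wkb r0 g + 25)).
    do 4!(apply: leq_add => //); rewrite big_nat_cond [leqRHS]big_nat_cond; apply: leq_sum => y.
    rewrite andbT => /= hy; have [_ [E3 _]] := EN3 x y hx hg hy; rewrite (proj1 E3).
    have h3 := flat_wk fN3 (b1p x) (b2p x) E3.
    have : \sum_(0 <= z < n3 x) (wk mem rm (upd3 rho x y z)
        (ESt (EAddr reg (EVar 16) (EVar 17) (EVar 18)) E) + 21) <=
        \sum_(0 <= z < n3 x) (B * Qx).
      rewrite big_nat_cond [leqRHS]big_nat_cond; apply: leq_sum => z.
      rewrite andbT => /= hz; have [_ [Er Ez]] := EE x y z hx hg hy hz.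
      have h4 := flat_wk freg (b1p x) (b2p x) Er.
      have := wk_wkb (b1p x : 0 < q x 1) (b2p x : 0 < q x 2) wE
        (@qv_other _ _ _) (proj2 Ez).
      rewrite -/Qx.
      move: h4 Qp; rewrite /B /EAddr /=; clear; nia.
    rewrite sum_nat_const_nat subn0; move: h3; rewrite /A /=; clear; lia.
  rewrite sum_nat_const_nat subn0 mul1n.
  apply: (@leq_trans (wkb r0 N2 + r0 * (A + n3 x * (B * Qx)) + 10 + wkb r0 g + 25)).
    by rewrite !leq_add2r leq_add2l leq_mul2r n2b orbT.
  have [KA KB] : A <= K /\ B <= K by rewrite /A /B /K; clear; lia.
  have KC : wkb r0 N2 + 10 + wkb r0 g + 25 <= K by rewrite /K; clear; lia.
  move: KA KB KC; clearbody A B K Qx; clear; rewrite mulnA.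
  move: (n3 x) => k KA KB KC.
  have : r0 * (A + k * B * Qx) <= r0 * (K * (1 + k * Qx)).
    rewrite leq_mul2l; apply/orP; right; nia.
  nia.
rewrite [X in X <= _](_ : _ = wk mem rm rho N1 + 10 + \sum_(0 <= x < n1)
   ((if 0 < den mem rm (upd rho 16 x) g
     then wk mem rm (upd rho 16 x) N2 +
       \sum_(0 <= y < den mem rm (upd rho 16 x) N2)
         (wk mem rm (upd (upd rho 16 x) 17 y) N3 +
          \sum_(0 <= z < den mem rm (upd (upd rho 16 x) 17 y) N3)
            (wk mem rm (upd3 rho x y z) (ESt (EAddr reg (EVar 16) (EVar 17) (EVar 18)) E) + 21)
          + 10 + 21) + 10
     else 1) + wk mem rm (upd rho 16 x) g + 25)); last first.
  rewrite addnAC; congr (_ + _ + _); apply: eq_bigr => x _.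
  by rewrite /=; case: ifP => _; clear; lia.
rewrite mulnDr muln1 addnC; apply: leq_add; last first.
  by apply: leq_trans (leq_pmull _ _) => //; move: h1; rewrite /K; clear; lia.
rewrite big_distrr /= big_nat_cond [leqRHS]big_nat_cond; apply: leq_sum => x.
by rewrite andbT => /= hx; exact: rowb.
Qed.

End Tables.

(** * The tables *)

Record inst (R : realType) := Inst {
  nA : nat;
  nG : nat;
  sz : nat -> nat;
  ag : nat -> nat -> nat;
  vl : nat -> nat -> R }.

(* [N] if no [x < N] satisfies [p]. *)
Definition firstn N (p : nat -> bool) : nat :=
  N - \max_(0 <= x < N) (if p x then N - x else 0).

(** The digit of weight [b ^ a]: orders, permutations and tuples of prefix lengths are all coded by
    digits. *)
Definition dig b d a := (d %/ b ^ a) %% b.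

Section Spec.
Context (R : realType) (I : inst R).
Notation m := (nG I).
Notation sz := (sz I).
Notation ag := (ag I).
Notation vl := (vl I).

Definition off g := \sum_(0 <= h < g) sz h.

(** Quantifiers are written as sums compared with 0, and conjunctions as nested conditionals, to
    match the expressions of the program term by term; the same style is used for all the
    specifications below. *)
Definition same g h : bool :=
  if sz g == sz h then 0 == \sum_(0 <= a < sz g) (1 - (ag g a == ag h a)) else false.

(* The hyperedge of [g] is represented by the first parallel good. *)
Definition rep g := firstn m (same g).

Definition cnt g := \sum_(0 <= h < m) (rep h == rep g).

(** Ties are broken by the index, which makes the preferences a strict total order on a class. *)
Definition place_term g a h : nat :=
  if rep h == rep g then
    if (vl h a <= vl g a)%R then if (vl g a <= vl h a)%R then (h < g : nat) else 0 else 1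
  else 0.

(* Position of [g] in the preferences of the agent [ag g a] on the goods that
   are parallel to [g]. *)
Definition place g a := \sum_(0 <= h < m) place_term g a h.

(** Inverse of [place] on a class: positions are distinct, so at most one term of the maximum is
    nonzero. *)
Definition sl e a p :=
  \max_(0 <= g < m) (if rep g == e then if place g a == p then g else 0 else 0).

(** Prefix lengths go up to [cnt e], and [pick] returns [cnt e + 1] when no good is left; hence
    [cnt e + 2] digits. *)
Definition base e := cnt e + 2.

(* In the state [d] of a round robin, [dig (base e) d j] is the length of the
   shortest prefix of the preferences of [j] that contains what [j] took. *)
Definition taken e d g : bool :=
  0 < \sum_(0 <= j < sz e) (place g j < dig (base e) d j).

Definition pick e d a := firstn (cnt e) (fun p => 0 == taken e d (sl e a p)) + 1.

(** A state packs the turn modulo [sz e] (low part) with the code of the prefix lengths (high part),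
    and [o] codes the order of the agents. The sum and difference replace one digit by the new
    prefix length. *)
Definition nxt e o c :=
  let d := c %/ sz e in let a := dig (sz e) o (c %% sz e) in
  (c %% sz e + 1) %% sz e +
  sz e * (d + pick e d a * base e ^ a - dig (base e) d a * base e ^ a).

(** The good [g] is taken at the turn after which the prefix of the picker ends exactly at [g].
    There is one such turn, so the default 0 at the others does not disturb the maximum in [rr]. *)
Definition rr_term g o s :=
  let c := iter s (nxt (rep g) o) 0 in
  let a := dig (sz g) o (s %% sz g) in
  if place g a + 1 == dig (base g) (nxt (rep g) o c %/ sz g) a then a else 0.

Definition rr g o := \max_(0 <= s < cnt g) rr_term g o s.

Definition meet e f := \sum_(0 <= a < sz e) \sum_(0 <= b < sz f) (ag e a == ag f b).

Definition adj e f : bool :=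
  if e == f then false else
  if rep e == e then if rep f == f then 0 < meet e f else false else false.

Definition D1 := 1 + \max_(0 <= e < m) \sum_(0 <= f < m) adj e f.

(* Colours: blocks of [2 ^ t] hyperedges are coloured with [D1] colours, and
   merged two by two. *)
Definition conf pw c (old cur : nat -> nat) e x y : nat :=
  let f := e %/ (2 * pw) * (2 * pw) + y in
  if f < m then
    if cur f == x then
      if 0 == odd (f %/ pw) * (c <= old f) then (adj e f : nat) else 0
    else 0
  else 0.

(** Only the odd one of two merged blocks is recoloured. Its old colour class [c] is independent, so
    its members can choose at once; each avoids the colours of the neighbours in the even block and
    of those of old colour below [c], and ignores those that are still to be recoloured. *)
Definition colstep pw c (old cur : nat -> nat) e :=
  if odd (e %/ pw) * (old e == c) == 1 then
    firstn D1 (fun x => 0 == \sum_(0 <= y < 2 * pw) conf pw c old cur e x y)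
  else cur e.

Fixpoint collev t c (old : nat -> nat) : nat -> nat :=
  if c is c'.+1 then colstep (2 ^ t) c' old (collev t c' old) else old.

Fixpoint colt t : nat -> nat :=
  if t is t'.+1 then collev t' D1 (colt t') else fun=> 0.

Definition sval' (i g : nat) : R :=
  (\sum_(0 <= t < sz g) (if ag g t == i then vl g t else 0))%R.

Definition bval (own : nat -> nat) (i j : nat) : R :=
  (\sum_(0 <= g < m) (if own g == j + 1 then sval' i g else 0))%R.

(** The low digits of [z] say whose bundle each agent receives, the high ones give an order. For
    [t < t'] the term tests that both maps are injective and that the later agent does not envy the
    earlier one; for [t = t'], that the agent does not lose by the exchange. *)
Definition viol own e z (t t' : nat) : nat :=
  let K := sz e in
  let j := dig K (z %/ K ^ K) t in
  let i := dig K (z %/ K ^ K) t' in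
  let si := dig K z i in
  let sj := dig K z j in
  if t < t' then
    if j == i then 1 else if si == sj then 1 else
    if (bval own (ag e i) (ag e sj) <= bval own (ag e i) (ag e si))%R then 0 else 1
  else if t == t' then
    if (bval own (ag e i) (ag e i) <= bval own (ag e i) (ag e si))%R then 0 else 1
  else 0.

Definition ncode e := sz e ^ sz e * sz e ^ sz e.

Definition best own e := firstn (ncode e) (fun z =>
  0 == \sum_(0 <= t < sz e) \sum_(0 <= t' < sz e) viol own e z t t').

Section Phases.
Context (col : nat -> nat).

Definition active c e : bool := (rep e == e) && ((0 < sz e) && (col e == c)).

(** Owners are shifted by one, 0 meaning none. The result is the new owner of the bundle of [u], or
    0 if that bundle is not exchanged in the phase. *)
Definition moved c (bst : nat -> nat) u :=
  \max_(0 <= e < m) (if active c e then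
    \max_(0 <= a < sz e) (if ag e (dig (sz e) (bst e) a) + 1 == u then ag e a + 1 else 0)
    else 0).

Definition ownstep c (bst own : nat -> nat) g :=
  if active c (rep g) then
    ag g (rr g (bst (rep g) %/ sz g ^ sz g)) + 1
  else if moved c bst (own g) == 0 then own g else moved c bst (own g).

Fixpoint ow c : nat -> nat :=
  if c is c'.+1 then ownstep c' (best (ow c')) (ow c') else fun=> 0.

End Phases.

End Spec.

(** * Parallel goods *)

Lemma firstnP N (p : nat -> bool) :
  [/\ firstn N p <= N, firstn N p < N -> p (firstn N p) &
      forall x, x < firstn N p -> ~~ p x].
Proof.
rewrite /firstn; set M := \max_(0 <= x < N) _.
have attain : M = 0 \/ exists2 x, x < N /\ p x & M = N - x.
  rewrite /M big_nat_cond; elim/big_ind: _ => [|u v hu hv|x]; first by left.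
    by case: (leqP u v).
  by rewrite andbT => /= h; case: ifP => px; [right; exists x|left].
have ge x : x < N -> p x -> N - x <= M.
  move=> h px; have -> : N - x = if p x then N - x else 0 by rewrite px.
  by apply: (leq_bigmax_seq (F := fun x => if p x then N - x else 0)); rewrite ?mem_index_iota.
split; first exact: leq_subr.
  case: attain => [->|[x [hx px] ->]]; first by rewrite subn0 ltnn.
  by rewrite subKn // ltnW.
move=> x hx; apply/negP => px; have := ge x ltac:(lia) px; lia.
Qed.

Lemma firstn_le N (p : nat -> bool) x : x < N -> p x -> firstn N p <= x.
Proof.
move=> hx px; case: leqP => // lt.
by have [_ _ /(_ _ lt)] := firstnP N p; rewrite px.
Qed.

Lemma firstn_lt N (p : nat -> bool) x : x < N -> p x -> firstn N p < N.
Proof. by move=> hx px; apply: leq_ltn_trans (firstn_le hx px) hx. Qed.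

Lemma firstn_p N (p : nat -> bool) x : x < N -> p x -> p (firstn N p).
Proof. by move=> hx px; have [_ h _] := firstnP N p; apply: h; apply: firstn_lt px. Qed.

Lemma sum_nat0 N (F : nat -> nat) :
  (0 == \sum_(0 <= i < N) F i) <-> (forall i, i < N -> F i = 0).
Proof.
rewrite eq_sym sum_nat_seq_eq0; split=> [/allP h i hi|h].
  by apply/eqP; apply: h; rewrite mem_index_iota.
by apply/allP => i; rewrite mem_index_iota => /h ->.
Qed.

Lemma sum_nat_gt0 N (F : nat -> nat) :
  (0 < \sum_(0 <= i < N) F i) <-> (exists2 i, i < N & 0 < F i).
Proof.
rewrite lt0n sum_nat_seq_neq0; split=> [/hasP[i]|[i hi Fi]].
  by rewrite mem_index_iota /= -lt0n => hi Fi; exists i.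
by apply/hasP; exists i; rewrite ?mem_index_iota // -lt0n.
Qed.

Lemma max_nat_unique N (F : nat -> nat) i0 : i0 < N ->
  (forall i, i < N -> i != i0 -> F i = 0) -> \max_(0 <= i < N) F i = F i0.
Proof.
move=> hi h; apply/eqP; rewrite eqn_leq; apply/andP; split.
  apply/bigmax_leqP_seq => i; rewrite mem_index_iota => /= hin _.
  by have [->//|/(h _ hin) ->] := eqVneq i i0.
by apply: leq_bigmax_seq => //; rewrite mem_index_iota.
Qed.

Lemma max_nat_ex N (F : nat -> nat) : 0 < \max_(0 <= i < N) F i ->
  exists2 i, i < N & \max_(0 <= i < N) F i = F i.
Proof.
set M := \max_(_ <= _ < _) _.
have : M = 0 \/ exists2 i, i < N & M = F i.
  rewrite /M big_nat_cond; elim/big_ind: _ => [|u v hu hv|x]; first by left.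
    by case: (leqP u v).
  by rewrite andbT => /= h; right; exists x.
by move=> [->|].
Qed.

Lemma dig_lt b d a : 0 < b -> dig b d a < b.
Proof. by move=> hb; rewrite ltn_mod. Qed.

Record wf_inst (R : realType) (I : inst R) : Prop := WfInst {
  wi_ag : forall g a, g < nG I -> a < sz I g -> ag I g a < nA I;
  wi_inc : forall g a b, g < nG I -> a < b -> b < sz I g -> ag I g a < ag I g b;
  wi_pos : forall g a, g < nG I -> a < sz I g -> (0 < vl I g a)%R }.

Section Classes.
Context (R : realType) (I : inst R).
Hypothesis wfI : wf_inst I.
Notation m := (nG I).
Notation sz := (sz I).
Notation ag := (ag I).
Notation vl := (vl I).
Notation same := (same I).
Notation rep := (rep I).
Notation cnt := (cnt I).
Notation place := (place I).
Notation sl := (sl I).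

Lemma ag_inj g a b : g < m -> a < sz g -> b < sz g -> ag g a = ag g b -> a = b.
Proof.
move=> hg ha hb E; case: (ltngtP a b) => // h.
  by have := wi_inc wfI hg h hb; rewrite E ltnn.
by have := wi_inc wfI hg h ha; rewrite E ltnn.
Qed.

Lemma sameP g h : same g h <-> sz g = sz h /\ forall a, a < sz g -> ag g a = ag h a.
Proof.
rewrite /same; split.
  case: eqP => // -> /sum_nat0 E; split=> // a /E /eqP.
  by rewrite subn_eq0; case: eqP.
by move=> [E1 E2]; rewrite E1 eqxx; apply/sum_nat0 => a; rewrite -E1 => /E2 ->; rewrite eqxx.
Qed.

Lemma same_refl g : same g g.
Proof. exact/sameP. Qed.

Lemma same_sym g h : same g h = same h g.
Proof.
by apply/idP/idP => /sameP[E1 E2]; apply/sameP; split=> // a ha; rewrite E2 // E1.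
Qed.

Lemma same_trans g h k : same g h -> same h k -> same g k.
Proof.
move=> /sameP[E1 E2] /sameP[E3 E4]; apply/sameP; split; first by rewrite E1.
by move=> a ha; rewrite E2 // E4 // -E1.
Qed.

Lemma rep_lt g : g < m -> rep g < m.
Proof. by move=> hg; apply: firstn_lt (same_refl g). Qed.

Lemma rep_same g : g < m -> same g (rep g).
Proof. by move=> hg; apply: firstn_p (same_refl g). Qed.

Lemma rep_eq g h : g < m -> h < m -> (rep g == rep h) = same g h.
Proof.
move=> hg hh; apply/eqP/idP => [E|s].
  by apply: same_trans (rep_same hg) _; rewrite E same_sym rep_same.
rewrite /rep /firstn; congr (_ - _); apply: eq_bigr => x _.
suff -> : same g x = same h x by [].
by apply/idP/idP; apply: same_trans; rewrite // same_sym.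
Qed.

Lemma rep_rep g : g < m -> rep (rep g) = rep g.
Proof. by move=> hg; apply/eqP; rewrite eq_sym rep_eq ?rep_lt ?rep_same. Qed.

Lemma sz_rep g : g < m -> sz (rep g) = sz g.
Proof. by move=> /rep_same/sameP[]. Qed.

Lemma ag_rep g a : g < m -> a < sz g -> ag (rep g) a = ag g a.
Proof. by move=> hg; have /sameP[_ h] := rep_same hg; move=> /h. Qed.

Lemma cnt_rep g : g < m -> cnt (rep g) = cnt g.
Proof. by move=> hg; rewrite /cnt rep_rep. Qed.

Definition cls e := [seq h <- index_iota 0 m | rep h == e].

Lemma mem_cls e h : (h \in cls e) = (h < m) && (rep h == e).
Proof. by rewrite mem_filter mem_index_iota andbC. Qed.

Lemma uniq_cls e : uniq (cls e).
Proof. by rewrite filter_uniq ?iota_uniq. Qed.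

Lemma size_cls e : size (cls (rep e)) = cnt e.
Proof. by rewrite size_filter -sum1_count /cnt big_mkcond. Qed.

Lemma cnt_gt0 g : g < m -> 0 < cnt g.
Proof.
by move=> hg; rewrite -size_cls -has_predT; apply/hasP; exists g; rewrite ?mem_cls ?hg ?eqxx.
Qed.

Lemma cnt_le g : cnt g <= m.
Proof.
by rewrite -size_cls size_filter; apply: leq_trans (count_size _ _) _; rewrite size_iota subn0.
Qed.

(** [before a h g]: position [a] prefers [h] to [g]. *)
Definition before a h g : bool :=
  ~~ (vl h a <= vl g a)%R || ((vl g a <= vl h a)%R && (h < g)).

Lemma before_irr a g : before a g g = false.
Proof. by rewrite /before lexx ltnn andbF. Qed.

Lemma before_trans a : transitive (before a).
Proof.
move=> y x z; rewrite /before -!ltNge.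
case: (ltgtP (vl x a) (vl y a)) => h1 //=; case: (ltgtP (vl y a) (vl z a)) => h2 //=.
- by rewrite (lt_trans h2 h1).
- by rewrite -h2 h1.
- by rewrite h1 h2.
- by rewrite h1 h2 ltxx lexx /=; apply: ltn_trans.
Qed.

Lemma before_total a g h : g != h -> before a g h || before a h g.
Proof. by rewrite /before -!ltNge => ne; case: (ltgtP (vl g a) (vl h a)) => //= _; lia. Qed.

Lemma before_le a g h : before a g h -> (vl h a <= vl g a)%R.
Proof. by rewrite /before -ltNge => /orP[/ltW|/andP[]]. Qed.

Lemma placeE g a : place g a = count (fun h => before a h g) (cls (rep g)).
Proof.
rewrite count_filter -sum1_count [RHS]big_mkcond /=; apply: eq_bigr => h _.
rewrite /place_term /before andbC; case: (rep h == rep g) => //=.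
case: (leP (vl h a) (vl g a)) => //= _.
by case: (vl g a <= vl h a)%R => //=; case: ltnP.
Qed.

(** A position counts predecessors in a strict order: the predecessors of [g] together with [g]
    itself are among those of [h]. Totality gives the converse. *)
Lemma place_lt_before a g h : g < m -> h < m -> rep g = rep h ->
  (place g a < place h a) = before a g h.
Proof.
move=> hg hh E.
have mono x y : x < m -> rep x = rep y -> before a x y -> place x a < place y a.
  move=> hx Exy b; rewrite !placeE Exy.
  have xin : x \in cls (rep y) by rewrite mem_cls hx Exy eqxx.
  have sub : subpred (fun k => (k == x) || before a k x) (fun k => before a k y).
    by move=> k /orP[/eqP ->//|]; move/before_trans; apply.
  apply: leq_trans (sub_count sub _).
  have := count_predUI (pred1 x) (fun k => before a k x) (cls (rep y)).
  rewrite (count_uniq_mem x (uniq_cls _)) xin.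
  have -> : count (predI (pred1 x) (fun k => before a k x)) (cls (rep y)) = 0.
    by apply/eqP; rewrite -leqn0 leqNgt -has_count; apply/hasPn => k _ /=;
      case: eqP => // ->; rewrite before_irr.
  by rewrite addn0 add1n => <-.
apply/idP/idP => [lt|b]; last exact: mono.
have [gh|ne] := eqVneq g h; first by rewrite gh ltnn in lt.
case/orP: (before_total a ne) => // b.
by have := mono h g hh (esym E) b; rewrite ltnNge (ltnW lt).
Qed.

Lemma place_inj a g h : g < m -> h < m -> rep g = rep h -> place g a = place h a -> g = h.
Proof.
move=> hg hh E Er; apply/eqP; apply/negPn/negP => ne.
by case/orP: (before_total a ne); rewrite -place_lt_before ?Er ?ltnn.
Qed.

Lemma place_lt g a : g < m -> place g a < cnt g.
Proof.
move=> hg; rewrite placeE -size_cls -(count_predC (fun h => before a h g)).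
rewrite -[X in X < _]addn0 ltn_add2l -has_count; apply/hasP; exists g.
  by rewrite mem_cls hg eqxx.
by rewrite /= before_irr.
Qed.

(** Positions are distinct and below [cnt e], the size of the class, so by counting all of them
    occur. *)
Lemma place_surj e a p : e < m -> rep e = e -> p < cnt e ->
  exists2 g, g \in cls e & place g a = p.
Proof.
move=> he re hp; pose s := [seq place g a | g <- cls e].
have us : uniq s.
  rewrite map_inj_in_uniq ?uniq_cls // => g h; rewrite !mem_cls.
  by move=> /andP[hg /eqP rg] /andP[hh /eqP rh]; apply: place_inj; rewrite ?rg.
have sub : {subset s <= iota 0 (cnt e)}.
  move=> q /mapP[g]; rewrite mem_cls => /andP[hg /eqP rg] ->.
  by rewrite mem_iota /= add0n; have := place_lt a hg; rewrite -(cnt_rep hg) rg.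
have ss : size (iota 0 (cnt e)) <= size s by rewrite size_iota size_map; have := size_cls e; rewrite re => ->.
have [_ eqs] := uniq_min_size us sub ss.
have : p \in s by rewrite eqs mem_iota.
by move=> /mapP[g gin ->]; exists g.
Qed.

Lemma sl_rank g a : g < m -> sl (rep g) a (place g a) = g.
Proof.
move=> hg; rewrite /sl (max_nat_unique hg) ?eqxx // => h hh ne.
case: eqP => // Er; case: eqP => // E.
by move: ne; rewrite (place_inj hh hg Er E) eqxx.
Qed.

Lemma slP e a p : e < m -> rep e = e -> p < cnt e ->
  sl e a p < m /\ rep (sl e a p) = e /\ place (sl e a p) a = p.
Proof.
move=> he re hp; have [g] := place_surj a he re hp.
rewrite mem_cls => /andP[hg /eqP rg] <-.
by have := sl_rank a hg; rewrite rg => ->.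
Qed.

Lemma place_le_vl a g h : g < m -> h < m -> rep g = rep h ->
  place g a <= place h a -> (vl h a <= vl g a)%R.
Proof.
move=> hg hh E; rewrite leq_eqVlt => /orP[/eqP/(place_inj hg hh E) -> //|].
by rewrite place_lt_before // => /before_le.
Qed.

End Classes.

(** * Round robin *)

(** Split [d] into the part above the digit [a], the digit, and the part below; only the middle
    changes. As the addition comes first, the subtraction is never truncated. *)
Lemma dig_set b d a p : 0 < b -> p < b ->
  let d' := d + p * b ^ a - dig b d a * b ^ a in
  [/\ dig b d' a = p, forall j, j != a -> dig b d' j = dig b d j &
      forall K, a < K -> d < b ^ K -> d' < b ^ K].
Proof.
move=> b0 hp d'.
have ba0 j : 0 < b ^ j by rewrite expn_gt0 b0.
pose hi := d %/ b ^ a.+1; pose lo := d %% b ^ a.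
have hlo : lo < b ^ a by rewrite ltn_mod.
have dE : d = hi * b ^ a.+1 + dig b d a * b ^ a + lo.
  by rewrite /hi /lo /dig expnSr divnMA (mulnC (b ^ a)) mulnA -mulnDl -!divn_eq.
have d'E : d' = hi * b ^ a.+1 + p * b ^ a + lo.
  by rewrite /d' {1}dE; move: (dig b d a * _) (p * _) (hi * _); clear; lia.
have digE x : x < b -> let y := hi * b ^ a.+1 + x * b ^ a + lo in
    [/\ dig b y a = x, y %/ b ^ a.+1 = hi & y %% b ^ a = lo].
  move=> hx y; have yE : y = (hi * b + x) * b ^ a + lo by rewrite mulnDl -mulnA -expnS.
  have y1 : y %/ b ^ a = hi * b + x by rewrite yE divnMDl // divn_small // addn0.
  split; last by rewrite yE modnMDl modn_small.
    by rewrite /dig y1 modnMDl modn_small.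
  by rewrite expnSr divnMA y1 divnMDl // divn_small // addn0.
have low y z j : j < a -> y %% b ^ a = z %% b ^ a -> dig b y j = dig b z j.
  move=> hj E; suff h w : dig b w j = dig b (w %% b ^ a) j by rewrite h E -h.
  rewrite /dig {1}(divn_eq w (b ^ a)).
  have -> : b ^ a = b ^ (a - j.+1) * b * b ^ j by rewrite -!expnSr -?expnD; congr expn; lia.
  by rewrite mulnA divnMDl // mulnA modnMDl.
have high y z j : a < j -> y %/ b ^ a.+1 = z %/ b ^ a.+1 -> dig b y j = dig b z j.
  by move=> hj E; rewrite /dig -(subnKC hj) expnD !divnMA E.
have [D1 D2 D3] := digE p hp; have [_ E2 E3] := digE _ (dig_lt d a b0).
rewrite -dE in E2 E3; rewrite -d'E in D1 D2 D3.
split=> //.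
  move=> j ne; case: (ltngtP j a) => [h|h|E]; last by rewrite E eqxx in ne.
    by apply: low; rewrite // D3 E3.
  by apply: high; rewrite // D2 E2.
move=> K ha hd; rewrite -(subnKC ha) expnD mulnC -ltn_divLR ?ba0 // D2.
by rewrite -E2 ltn_divLR ?ba0 // mulnC -expnD subnKC.
Qed.

Section RoundRobin.
Context (R : realType) (I : inst R).
Hypothesis wfI : wf_inst I.
Notation m := (nG I).
Notation vl := (vl I).
Notation place := (place I).
Notation sl := (sl I).
Notation taken := (taken I).
Notation nxt := (nxt I).
Notation cls := (cls I).
Notation rep := (rep I).

Context (e o : nat).
Hypothesis he : e < m.
Hypothesis re : rep e = e.
Let K := sz I e.
Let k := cnt I e.
Let b := base I e.
Hypothesis K0 : 0 < K.

Lemma takenP d g : taken e d g <-> exists2 j, j < K & place g j < dig b d j.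
Proof.
rewrite /taken; split=> [/sum_nat_gt0[j hj]|[j hj lt]].
  by rewrite lt0b => lt; exists j.
by apply/sum_nat_gt0; exists j => //; move: lt; rewrite /b => ->.
Qed.

Lemma base_gt0 : 0 < b.
Proof. by rewrite /b /base addn2. Qed.

Lemma pick_lt d a : pick I e d a < b.
Proof.
by rewrite /pick /b /base; have [h _ _] := firstnP (cnt I e) (fun p => 0 == taken e d (sl e a p)); lia.
Qed.

Lemma nxt_div c : nxt e o c %/ K =
  c %/ K + pick I e (c %/ K) (dig K o (c %% K)) * b ^ dig K o (c %% K)
  - dig b (c %/ K) (dig K o (c %% K)) * b ^ dig K o (c %% K).
Proof.
rewrite /nxt -/K -/b addnC mulnC divnMDl // [X in _ + X]divn_small ?addn0 //.
by rewrite ltn_mod.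
Qed.

Lemma nxt_mod c : nxt e o c %% K = (c %% K + 1) %% K.
Proof. by rewrite /nxt -/K addnC mulnC modnMDl modn_mod. Qed.

Lemma nxt_lt c : c < K * b ^ K -> nxt e o c < K * b ^ K.
Proof.
move=> hc; rewrite mulnC -ltn_divLR // nxt_div.
have [_ _] := dig_set (c %/ K) (dig K o (c %% K)) base_gt0 (pick_lt (c %/ K) (dig K o (c %% K))).
by apply; [exact: dig_lt|rewrite ltn_divLR // mulnC].
Qed.

Lemma iter_nxt_lt s c : c < K * b ^ K -> iter s (nxt e o) c < K * b ^ K.
Proof. by move=> hc; elim: s => //= s IH; exact: nxt_lt. Qed.

Let turn s := dig K o (s %% K).
Let st s := iter s (nxt e o) 0 %/ K.
Let pos s := firstn k (fun p => 0 == taken e (st s) (sl e (turn s) p)).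
Let pk s := sl e (turn s) (pos s).

Lemma turn_lt s : turn s < K.
Proof. exact: dig_lt. Qed.

Lemma iter_mod s : iter s (nxt e o) 0 %% K = s %% K.
Proof.
elim: s => [|s IH]; first by rewrite /= !mod0n.
by rewrite iterS nxt_mod IH modnDml addn1.
Qed.

Lemma st_succ s : dig b (st s.+1) (turn s) = pos s + 1 /\
  forall j, j != turn s -> dig b (st s.+1) j = dig b (st s) j.
Proof.
rewrite {1 2}/st iterS nxt_div iter_mod -/(st s) -/(turn s).
by have [-> h _] := dig_set (st s) (turn s) base_gt0 (pick_lt (st s) (turn s)).
Qed.

(** An agent takes the first untaken good of his list, so everything before it has been taken
    already. Hence the union of the prefixes is exactly the set of picked goods, and the prefix
    lengths are all that a state has to record. *)
Lemma round_robin s : s <= k ->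
  [/\ forall g, g \in cls e -> taken e (st s) g = (g \in [seq pk i | i <- iota 0 s]),
      uniq [seq pk i | i <- iota 0 s] &
      {subset [seq pk i | i <- iota 0 s] <= cls e}].
Proof.
have inj a g h : g \in cls e -> h \in cls e -> place g a = place h a -> g = h.
  rewrite !mem_cls => /andP[hg /eqP rg] /andP[hh /eqP rh]; apply: place_inj => //.
  by rewrite rg.
have slK a g : g \in cls e -> sl e a (place g a) = g.
  by rewrite mem_cls => /andP[hg /eqP rg]; have := sl_rank a hg; rewrite rg.
have rlt a g : g \in cls e -> place g a < k.
  by rewrite mem_cls => /andP[hg /eqP rg]; have := place_lt a hg; rewrite -(cnt_rep hg) rg.
have sck : size (cls e) = k by rewrite -[in LHS]re size_cls.
elim: s => [|s IH] hs.
  split=> // g gin; apply/negP => /takenP[j hj].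
  by rewrite /st /= div0n /dig div0n mod0n ltn0.
have [IH1 IH2 IH3] := IH (ltnW hs).
(* Fewer than [k] picks cannot exhaust a class of [k] goods. *)
have [g gin gnt] : exists2 g, g \in cls e & ~~ taken e (st s) g.
  apply/hasP; apply/negPn/negP => /hasPn h.
  have sub : {subset cls e <= [seq pk i | i <- iota 0 s]}.
    by move=> g gin; rewrite -IH1 //; have := h g gin; rewrite negbK.
  have := uniq_leq_size (uniq_cls I e) sub.
  by rewrite size_map size_iota sck leqNgt hs.
have p0lt : pos s < k.
  by apply: (firstn_lt (rlt (turn s) g gin)); rewrite slK // (negPf gnt).
have [sl_m [sl_rep sl_rk]] := slP (turn s) he re p0lt.
have pin : pk s \in cls e by rewrite mem_cls sl_m sl_rep eqxx.
have pnt : ~~ taken e (st s) (pk s).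
  have : 0 == taken e (st s) (sl e (turn s) (pos s)).
    by apply: (firstn_p (rlt (turn s) g gin) (p := fun p => 0 == taken e (st s) (sl e (turn s) p)));
      rewrite slK // (negPf gnt).
  by rewrite -/(pk s); case: taken.
have [s1 s2] := st_succ s.
have tk h : h \in cls e -> taken e (st s.+1) h = taken e (st s) h || (h == pk s).
  move=> hin; apply/idP/orP.
    move=> /takenP[j hj]; have [->|ne] := eqVneq j (turn s).
      rewrite s1 addn1 ltnS leq_eqVlt => /orP[/eqP E|lt].
        by right; apply/eqP; apply: (inj (turn s)); rewrite // E sl_rk.
      left; have [_ _ /(_ _ lt)] := firstnP k (fun p => 0 == taken e (st s) (sl e (turn s) p)).
      by rewrite slK //; case: taken.
    by rewrite s2 // => lt; left; apply/takenP; exists j.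
  move=> [/takenP[j hj lt]|/eqP ->]; apply/takenP; last first.
    by exists (turn s); [exact: turn_lt|rewrite s1 sl_rk addn1].
  exists j => //; have [E|ne] := eqVneq j (turn s); last by rewrite s2.
  rewrite E s1 addn1 ltnS; move: lt; rewrite E => lt.
  (* Prefixes never shrink: if the new one ended inside the old one, the good just picked would have
     been taken before. *)
  apply: leq_trans (ltnW lt) _; rewrite leqNgt; apply/negP => lt2.
  by move/negP: pnt; apply; apply/takenP; exists (turn s); [exact: turn_lt|rewrite sl_rk].
rewrite -addn1 iotaD map_cat add0n /=; split.
- by move=> h hin; rewrite addn1 tk // IH1 // mem_cat mem_seq1.
- by rewrite cat_uniq IH2 /= orbF andbT -IH1.
- by move=> h; rewrite mem_cat mem_seq1 => /orP[/IH3 //|/eqP ->].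
Qed.

(** [pi] enumerates the class in the order of the picks. A good picked at a later turn was still
    untaken at turn [s], hence comes no earlier in the list of the agent who picked then. *)
Lemma rr_greedy : exists pi : nat -> nat,
  [/\ perm_eq [seq pi s | s <- iota 0 k] (cls e),
      forall s, s < k -> rr I (pi s) o = dig K o (s %% K) &
      forall s s', s <= s' -> s' < k ->
        (vl (pi s') (dig K o (s %% K)) <= vl (pi s) (dig K o (s %% K)))%R].
Proof.
have sck : size (cls e) = k by rewrite -[in LHS]re size_cls.
have [_ u sub] := round_robin (leqnn k).
have pe : perm_eq [seq pk s | s <- iota 0 k] (cls e).
  apply: uniq_perm; rewrite ?uniq_cls //.
  have sz_le : size (cls e) <= size [seq pk s | s <- iota 0 k] by rewrite size_map size_iota sck.
  by have [_] := uniq_min_size u sub sz_le.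
have pin s : s < k -> pk s \in cls e.
  by move=> hs; rewrite -(perm_mem pe); apply: map_f; rewrite mem_iota.
have pclt s : s < k -> pk s < m /\ rep (pk s) = e.
  by move=> /pin; rewrite mem_cls => /andP[? /eqP].
have pkinj s s' : s < k -> s' < k -> pk s = pk s' -> s = s'.
  by have /mkseq_uniqP inj := u; move=> h h'; apply: inj.
have rlt a g : g \in cls e -> place g a < k.
  by rewrite mem_cls => /andP[hg /eqP rg]; have := place_lt a hg; rewrite -(cnt_rep hg) rg.
have slK a g : g \in cls e -> sl e a (place g a) = g.
  by rewrite mem_cls => /andP[hg /eqP rg]; have := sl_rank a hg; rewrite rg.
have untaken s s' : s <= s' -> s' < k -> ~~ taken e (st s) (pk s').
  move=> ss hs'; have [T _ _] := round_robin (ltnW (leq_ltn_trans ss hs')).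
  rewrite T ?pin //.
  apply/mapP => -[i]; rewrite mem_iota /= add0n => hi E.
  have := pkinj _ _ hs' (ltn_trans hi (leq_ltn_trans ss hs')) E; lia.
have pos_le s s' : s <= s' -> s' < k -> pos s <= place (pk s') (turn s).
  move=> ss hs'; apply: firstn_le; first exact: rlt (pin _ hs').
  by rewrite slK ?pin // (negPf (untaken _ _ ss hs')).
have posE s : s < k -> place (pk s) (turn s) = pos s.
  move=> hs; have lt : pos s < k by apply: leq_ltn_trans (pos_le _ _ (leqnn s) hs) (rlt _ _ (pin s hs)).
  by have [_ [_]] := slP (turn s) he re lt.
exists pk; split; first exact: pe.
  move=> s hs; have [gm rg] := pclt s hs.
  rewrite /rr -(cnt_rep gm) rg -/k.
  (* After turn [s'] the picker's prefix ends at the good of that turn, so the test succeeds on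
     [pk s] only for [s' = s]. *)
  have term s' : s' < k -> rr_term I (pk s) o s' = if s' == s then turn s else 0.
    move=> hs'; rewrite /rr_term rg -(sz_rep gm) rg -/K.
    have -> : base I (pk s) = b by rewrite /base -(cnt_rep gm) rg.
    have [s1 _] := st_succ s'; rewrite /st iterS in s1.
    rewrite -/(turn s') s1 -(posE _ hs') eqn_add2r.
    have [E|ne] := eqVneq s' s; first by rewrite E eqxx.
    case: eqP => [E|_]; last by [].
    case/eqP: ne; apply: (pkinj _ _ hs' hs).
    have [gm' rg'] := pclt s' hs'.
    exact: esym (place_inj gm gm' (etrans rg (esym rg')) E).
  rewrite (max_nat_unique hs); first by rewrite (term _ hs) eqxx.
  by move=> i hi ne; rewrite (term _ hi) (negPf ne).
move=> s s' ss hs'; have hs := leq_ltn_trans ss hs'.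
have [gm rg] := pclt s hs; have [gm' rg'] := pclt s' hs'.
have le := leq_trans (eq_leq (posE _ hs)) (pos_le _ _ ss hs').
exact: (place_le_vl gm gm' (etrans rg (esym rg')) le).
Qed.

End RoundRobin.

(** Each turn of [t2] from [d] on is matched with the turn of [t1] that comes [d] earlier, which is
    worth at least as much; unmatched turns of [t1] only help. *)
Lemma ler_sum_shift (R : realType) (f : nat -> R) k K t1 t2 d :
  (forall s, 0 <= f s)%R -> (t1 + d) %% K = t2 %% K -> t1 < K -> t2 < K ->
  (forall s, s + d < k -> s %% K = t1 -> (f (s + d)%N <= f s)%R) ->
  (\sum_(d <= s < k | (s %% K)%N == t2) f s <= \sum_(0 <= s < k | (s %% K)%N == t1) f s)%R.
Proof.
move=> f0 E ht1 ht2 hf.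
have [kd|dk] := leqP k d.
  by rewrite big_geq // sumr_ge0.
have shift s : ((s + d) %% K == t2) = (s %% K == t1).
  rewrite -(modn_small ht2) -E eqn_modDr; congr (_ == _).
  by rewrite modn_small.
rewrite -{1}(add0n d) big_addn (eq_bigl (fun s => s %% K == t1)) //.
rewrite [leRHS](big_cat_nat (leq0n _) (leq_subr d k)) /=.
rewrite -[leLHS]addr0 lerD //; last by rewrite sumr_ge0.
rewrite big_nat_cond [leRHS]big_nat_cond; apply: ler_sum => s.
by move=> /andP[/andP[_ hs] /eqP hK]; apply: hf => //; move: hs; clear; lia.
Qed.

Section RoundRobinFair.
Context (R : realType) (I : inst R).
Hypothesis wfI : wf_inst I.
Notation m := (nG I).
Notation vl := (vl I).
Notation rep := (rep I).
Notation rr := (rr I).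

Context (e o : nat).
Hypothesis he : e < m.
Hypothesis re : rep e = e.
Let K := sz I e.
Hypothesis K0 : 0 < K.
Hypothesis o_inj : forall t t', t < K -> t' < K -> dig K o t = dig K o t' -> t = t'.

Definition share j g := (rep g == e) && (rr g o == j).

Lemma vl_ge0 g a : g < m -> a < sz I g -> (0 <= vl g a)%R.
Proof. by move=> hg ha; apply/ltW/(wi_pos wfI). Qed.

(** If [i] picks before [j], each good of [j] is matched with the one that [i] took just before it.
    If [i] picks after [j], the same matching covers all goods of [j] but the first. *)
Lemma round_robin_fair t t' : t < K -> t' < K ->
  let i := dig K o t in let j := dig K o t' in
  [/\ t < t' -> (\sum_(0 <= g < m | share j g) vl g i <=
                 \sum_(0 <= g < m | share i g) vl g i)%R
    & t' < t -> (exists2 g, g < m & share j g) ->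
        exists s, [/\ s < m, share j s &
          (\sum_(0 <= g < m | share j g && (g != s)) vl g i <=
           \sum_(0 <= g < m | share i g) vl g i)%R]].
Proof.
move=> ht ht' i j.
have [pi [pe prr pgreedy]] := rr_greedy o he re K0.
set k := cnt I e in pe prr pgreedy.
have sumE (p : pred nat) t1 : t1 < K -> (\sum_(0 <= g < m | share (dig K o t1) g && p g) vl g i =
    \sum_(0 <= s < k | ((s %% K)%N == t1) && p (pi s)) vl (pi s) i)%R.
  move=> ht1.
  transitivity (\sum_(g <- cls I e | (rr g o == dig K o t1) && p g) vl g i)%R.
    by rewrite big_filter_cond; apply: eq_bigl => g; rewrite /share andbA.
  rewrite -(perm_big _ pe) /= big_map /index_iota subn0 big_seq_cond [RHS]big_seq_cond.
  apply: eq_bigl => s; rewrite mem_iota /= add0n; case: ltnP => //= hs.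
  congr (_ && _); rewrite prr //; apply/eqP/eqP => [E|->//].
  by apply: o_inj; rewrite ?ltn_mod.
have sumT t1 : t1 < K -> (\sum_(0 <= g < m | share (dig K o t1) g) vl g i =
    \sum_(0 <= s < k | (s %% K)%N == t1) vl (pi s) i)%R.
  move=> ht1; rewrite (eq_bigl (fun g => share (dig K o t1) g && predT g)); last first.
    by move=> g; rewrite andbT.
  by rewrite sumE //; apply: eq_bigl => s; rewrite andbT.
have piin s : s < k -> pi s < m /\ rep (pi s) = e.
  move=> hs; have : pi s \in cls I e by rewrite -(perm_mem pe) map_f // mem_iota.
  by rewrite mem_cls => /andP[? /eqP].
pose f s := if s < k then vl (pi s) i else 0%R.
have f0 s : (0 <= f s)%R.
  rewrite /f; case: ltnP => // hs; have [gm rg] := piin s hs.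
  by apply: vl_ge0 => //; rewrite -(sz_rep gm) rg dig_lt.
have fE (p : pred nat) lo : (\sum_(lo <= s < k | p s) vl (pi s) i = \sum_(lo <= s < k | p s) f s)%R.
  rewrite big_nat_cond [RHS]big_nat_cond; apply: eq_bigr => s /andP[/andP[_ hs] _].
  by rewrite /f hs.
have fgreedy s d : s + d < k -> s %% K = t -> (f (s + d)%N <= f s)%R.
  move=> hs E; rewrite /f hs (leq_ltn_trans (leq_addr d s) hs).
  by have := pgreedy s (s + d) (leq_addr d s) hs; rewrite E.
split=> [lt|lt [g0 hg0 sg0]].
  rewrite !sumT // !fE.
  pose d := t' - t.
  have td : t + d = t' by rewrite subnKC // ltnW.
  apply: le_trans (_ : \sum_(d <= s < k | (s %% K)%N == t') f s <= _)%R; last first.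
    apply: ler_sum_shift => //; first by rewrite td.
    by move=> s; apply: fgreedy.
  have [kd|dk] := leqP k d.
    rewrite [leRHS]big_geq // big_nat_cond big1 // => s /andP[/andP[_ hs] /eqP E].
    have hsd : s < K by apply: leq_trans hs (leq_trans kd (leq_trans (leq_subr _ _) (ltnW ht'))).
    rewrite modn_small // in E; move: hs kd; rewrite E /d; clear; lia.
  (* Before [d] there is no turn of [j], whose first turn [t'] is at least [d]. *)
  rewrite (big_cat_nat (leq0n d) (ltnW dk)) /= -[leRHS]add0r lerD //.
  rewrite big_nat_cond big1 // => s /andP[/andP[_ hs] /eqP E].
  have hsd : s < K by apply: leq_trans hs (leq_trans (leq_subr _ _) (ltnW ht')).
  by move: E hs; rewrite modn_small // => ->; rewrite /d ltnNge leq_subr.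
have [s0 hs0 Es0] : exists2 s, s < k & s %% K = t'.
  have : g0 \in [seq pi s | s <- iota 0 k].
    by rewrite (perm_mem pe) mem_cls hg0; case/andP: sg0.
  move=> /mapP[s]; rewrite mem_iota /= add0n => hs E; exists s => //.
  case/andP: sg0 => _ /eqP; rewrite E prr // => E'.
  by apply: o_inj E'; rewrite ?ltn_mod.
have t'k : t' < k by rewrite -Es0; apply: leq_ltn_trans (leq_mod _ _) hs0.
have [gm rg] := piin t' t'k.
(* The removed good is the first pick of [j], made at turn [t']. *)
exists (pi t'); split=> //.
  by rewrite /share rg eqxx prr // modn_small //= eqxx.
rewrite sumE // sumT // !fE.
(* The delay from a turn of [i] to the next one of [j]. The only turn of [j] before [d] is [t'],
   whose good has been removed. *)
pose d := K - (t - t').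
have d_t' : t' < d by rewrite /d; move: ht; clear -lt; lia.
have tdE : t + d = K + t' by rewrite /d; move: ht lt; clear; lia.
have dK : d <= K by rewrite leq_subr.
apply: le_trans (_ : \sum_(d <= s < k | (s %% K)%N == t') f s <= _)%R; last first.
  apply: ler_sum_shift => //; first by rewrite tdE modnDl.
  by move=> s; apply: fgreedy.
have small (s : nat) : s < d -> (s %% K == t') && (pi s != pi t') -> false.
  move=> hs /andP[/eqP E]; rewrite modn_small in E; first by rewrite E eqxx.
  exact: leq_trans hs dK.
have [kd|dk] := leqP k d.
  rewrite [leRHS]big_geq // big_nat_cond big1 // => s /andP[/andP[_ hs] hp].
  by have := small s (leq_trans hs kd) hp.
rewrite (big_cat_nat (leq0n d) (ltnW dk)) /= -[leRHS]add0r lerD //.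
  by rewrite big_nat_cond big1 // => s /andP[/andP[_ hs] hp]; have := small s hs hp.
by rewrite big_mkcondr /=; apply: ler_sum => s _; case: ifP.
Qed.

End RoundRobinFair.

(** * Exchange of bundles *)

Section Exchange.
Context (R : realType) (T : finType) (V : T -> T -> R).

Let welfare (s : {perm T}) := (\sum_a V a (s a))%R.
Let rational (s : {perm T}) := [forall a, (V a a <= V a (s a))%R].

Lemma best_exchange : exists s : {perm T},
  (forall a, V a a <= V a (s a))%R /\
  forall s' : {perm T}, (forall a, V a a <= V a (s' a))%R -> (welfare s' <= welfare s)%R.
Proof.
have r1 : rational 1%g by apply/forallP => a; rewrite perm1.
case: (Order.TotalTheory.arg_maxP welfare r1) => s /forallP rs max_s.
by exists s; split=> // s' rs'; apply: max_s; apply/forallP.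
Qed.

(* If every agent of [S] envied another one, the bundles could be rotated
   along a cycle of envy, which would increase the welfare. *)
Lemma unenvious (s : {perm T}) (S : {set T}) :
  (forall a, V a a <= V a (s a))%R ->
  (forall s' : {perm T}, (forall a, V a a <= V a (s' a))%R -> (welfare s' <= welfare s)%R) ->
  S != set0 ->
  exists2 a, a \in S & forall b, b \in S -> (V a (s b) <= V a (s a))%R.
Proof.
move=> rs max_s /set0Pn[x0 x0S].
case: (boolP [exists a in S, [forall b in S, (V a (s b) <= V a (s a))%R]]).
  move=> /exists_inP[a aS /forall_inP h]; by exists a.
rewrite negb_exists => /forallP no; exfalso.
pose f a := odflt a [pick b in S | (V a (s a) < V a (s b))%R].
have fS a : a \in S -> f a \in S /\ (V a (s a) < V a (s (f a)))%R.
  move=> aS; have := no a; rewrite aS /= negb_forall => /existsP[b].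
  rewrite negb_imply -ltNge => /andP[bS lt].
  by rewrite /f; case: pickP => [c /andP[cS ltc]|/(_ b)]; rewrite ?bS ?lt.
have itS t : iter t f x0 \in S by elim: t => //= t IH; case: (fS _ IH).
(* In a finite set, following [f] from [x0] must revisit a point; [y] lies on the resulting cycle of
   envy. *)
have [i [p ipE]] : exists i p, iter p.+1 f (iter i f x0) = iter i f x0.
  have : ~~ uniq (traject f x0 #|T|.+1).
    by apply/negP => /card_uniqP E; have := max_card [in traject f x0 #|T|.+1]; rewrite E size_traject ltnn.
  rewrite looping_uniq negbK => /trajectP[j lt E].
  exists j, (#|T| - j).-1; rewrite -iterD -[RHS]E; congr (iter _ f x0).
  by move: lt; clear; lia.
set y := iter i f x0 in ipE.
have yS t : iter t f y \in S by rewrite /y -iterD.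
have oS z : z \in orbit f y -> z \in S by move=> /trajectP[t _ ->].
(* From the equivalent properties in [orbitPcycle]: if the iteration returns to [y], then [f] is
   injective on the orbit of [y]. *)
have finj : {in orbit f y &, injective f} := (orbitPcycle 3 5).1 (ex_intro _ p ipE).
(* Rotates the cycle and fixes everybody else, so that it is a permutation. *)
pose g a := if a \in orbit f y then f a else a.
have ginj : injective g.
  move=> a b; rewrite /g; case: ifP => ha; case: ifP => hb //.
  - exact: finj.
  - by move=> E; move: hb; rewrite -E (mem_orbit ha).
  - by move=> E; move: ha; rewrite E (mem_orbit hb).
pose s' := (perm ginj * s)%g.
have s'E a : s' a = s (g a) by rewrite permM permE.
have le a : (V a (s a) <= V a (s' a))%R.
  by rewrite s'E /g; case: ifP => // /oS/fS[_ /ltW].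
have := max_s s' (fun a => le_trans (rs a) (le a)).
apply/negP; rewrite -ltNge /welfare (bigD1 y) //= [ltRHS](bigD1 y) //=.
apply: ltr_leD; last by apply: ler_sum.
by rewrite s'E /g in_orbit; case: (fS y (yS 0)).
Qed.

(** An agent who envies nobody in the remaining set is placed last in it, and the construction is
    repeated on the others. Maximality of the welfare was proved once and for all, so it serves for
    every subset. *)
Lemma exchange_order : exists (s : {perm T}) (l : seq T),
  [/\ forall a, (V a a <= V a (s a))%R, perm_eq l (enum T) &
      pairwise (fun x y => (V y (s x) <= V y (s y))%R) l].
Proof.
have [s [rs max_s]] := best_exchange.
suff H k (S : {set T}) : #|S| = k -> exists l, perm_eq l (enum S) /\
    pairwise (fun x y => (V y (s x) <= V y (s y))%R) l.
  have [l [pl hl]] := H _ setT erefl; exists s, l; split=> //.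
  by apply: perm_trans pl _; rewrite enum_setT enumT.
elim: k S => [|k IH] S hS.
  by exists [::]; move/eqP: hS; rewrite cards_eq0 => /eqP ->; rewrite enum_set0.
have S0 : S != set0 by rewrite -card_gt0 hS.
have [a aS ha] := unenvious rs max_s S0.
have [|l [pl hl]] := IH (S :\ a).
  by move: hS; rewrite (cardsD1 a S) aS add1n => -[].
have inl x : x \in l -> x \in S.
  by rewrite (perm_mem pl) mem_enum => /setD1P[].
exists (rcons l a); split.
  apply: uniq_perm; rewrite ?enum_uniq // ?rcons_uniq.
    rewrite (perm_uniq pl) enum_uniq andbT (perm_mem pl) mem_enum.
    by rewrite in_setD1 eqxx.
  move=> x; rewrite mem_rcons in_cons (perm_mem pl) !mem_enum in_setD1.
  by case: eqP => // ->.
by rewrite pairwise_rcons hl andbT; apply/allP => x /inl /ha.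
Qed.

End Exchange.

Lemma digits_ex K N (h : nat -> nat) : (forall a, a < N -> h a < K) ->
  exists2 c, c < K ^ N & forall a, a < N -> dig K c a = h a.
Proof.
elim: N => [|N IH] hh; first by exists 0.
have K0 : 0 < K by apply: leq_ltn_trans (hh N (ltnSn N)).
have [c hc digc] := IH (fun a lt => hh a (leqW lt)).
have [d1 d2 d3] := dig_set c N K0 (hh N (ltnSn N)).
exists (c + h N * K ^ N - dig K c N * K ^ N).
  by apply: d3 => //; apply: leq_trans hc _; rewrite leq_pexp2l.
move=> a; rewrite ltnS leq_eqVlt => /orP[/eqP -> //|lt].
by rewrite d2 ?digc // neq_ltn lt.
Qed.

Lemma dig_low K N c d a : 0 < K -> a < N -> dig K (d * K ^ N + c) a = dig K c a.
Proof.
move=> K0 lt; rewrite /dig.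
have -> : K ^ N = K ^ (N - a.+1) * K * K ^ a by rewrite -expnSr -expnD; congr expn; lia.
by rewrite mulnA divnMDl ?expn_gt0 ?K0 // mulnA modnMDl.
Qed.

Lemma inj_surj N (h : nat -> nat) : (forall a, a < N -> h a < N) ->
  (forall a b, a < N -> b < N -> h a = h b -> a = b) ->
  forall b, b < N -> exists2 a, a < N & h a = b.
Proof.
move=> hN hinj b hb.
have u : uniq (mkseq h N) by apply/mkseq_uniqP => x y; apply: hinj.
have sub : {subset mkseq h N <= iota 0 N}.
  by move=> x /mapP[y]; rewrite !mem_iota /= !add0n => /hN ? ->.
have le : size (iota 0 N) <= size (mkseq h N) by rewrite size_iota size_mkseq.
have [_ E] := uniq_min_size u sub le.
have : b \in mkseq h N by rewrite E mem_iota.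
by move=> /mapP[a]; rewrite mem_iota /= add0n => ha ->; exists a.
Qed.

Section BestCode.
Context (R : realType) (I : inst R).
Notation bval := (bval I).
Notation ag := (ag I).

Context (own : nat -> nat) (e : nat).
Let K := sz I e.
Hypothesis K0 : 0 < K.
Let z := best I own e.
Let ord t := dig K (z %/ K ^ K) t.
Let sg a := dig K z a.
Let U i j : R := bval own (ag e i) (ag e j).

(** Maximal welfare is only used to prove that the search succeeds. The program tests the pairwise
    conditions of [viol] and takes the first code that satisfies them, whatever its welfare. *)
Lemma good_code_ex : exists2 z0, z0 < ncode I e &
  forall t t', t < K -> t' < K -> viol I own e z0 t t' = 0.
Proof.
have [s [l [rs pl hl]]] := @exchange_order R 'I_K (fun i j => U i j).
pose x0 : 'I_K := Ordinal K0.
have [c1 hc1 d1] : exists2 c, c < K ^ K & forall a, a < K -> dig K c a = s (insubd x0 a).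
  by apply: digits_ex => a _; exact: ltn_ord.
have [c2 hc2 d2] : exists2 c, c < K ^ K & forall t, t < K -> dig K c t = nth x0 l t.
  by apply: digits_ex => a _; exact: ltn_ord.
have KK : 0 < K ^ K by rewrite expn_gt0 K0.
(* The order goes to the high digits, the permutation to the low ones. *)
exists (c2 * K ^ K + c1).
  by rewrite /ncode -/K; apply: leq_trans (_ : c2.+1 * K ^ K <= _);
    [rewrite mulSn addnC ltn_add2r|rewrite leq_mul2r hc2 orbT].
move=> t t' ht ht'; rewrite /viol -/K divnMDl // (divn_small hc1) addn0.
rewrite !d2 // !dig_low // !d1 // !valKd -/U.
have sl : size l = K by rewrite (perm_size pl) size_enum_ord.
have ul : uniq l by rewrite (perm_uniq pl) enum_uniq.
case: ltngtP => // [lt|_]; last by rewrite (rs (nth x0 l t')).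
rewrite !val_eqE nth_uniq ?sl // ltn_eqF //.
rewrite (inj_eq perm_inj) nth_uniq ?sl // gtn_eqF //.
have /(pairwiseP x0) h := hl.
by have := h t t'; rewrite !inE sl => /(_ ht ht' lt) ->.
Qed.

Lemma best_lt : z < ncode I e.
Proof.
have [z0 hz0 v0] := good_code_ex; apply: firstn_lt hz0 _.
by apply/sum_nat0 => t ht; apply/eqP; rewrite eq_sym; apply/sum_nat0 => t' ht'; exact: v0.
Qed.

Lemma best_viol t t' : t < K -> t' < K -> viol I own e z t t' = 0.
Proof.
move=> ht ht'; have [z0 hz0 v0] := good_code_ex.
have : 0 == \sum_(0 <= t < K) \sum_(0 <= t' < K) viol I own e z t t'.
  apply: (firstn_p hz0 (p := fun z => 0 == \sum_(0 <= t < K) \sum_(0 <= t' < K) viol I own e z t t')).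
  by apply/sum_nat0 => u hu; apply/eqP; rewrite eq_sym; apply/sum_nat0 => t1 ht1; exact: v0.
by move/sum_nat0 => /(_ t ht)/esym/eqP/sum_nat0; apply.
Qed.

Lemma best_rational t : t < K -> (U (ord t) (ord t) <= U (ord t) (sg (ord t)))%R.
Proof.
by move=> ht; have := best_viol ht ht; rewrite /viol ltnn eqxx -/K; case: ifP.
Qed.

Lemma best_order t t' : t < t' -> t' < K ->
  [/\ ord t != ord t', sg (ord t) != sg (ord t') &
      (U (ord t') (sg (ord t)) <= U (ord t') (sg (ord t')))%R].
Proof.
move=> lt ht'; have := best_viol (ltn_trans lt ht') ht'; rewrite /viol lt -/K -/z.
rewrite -/(ord t) -/(ord t') -/(sg (ord t)) -/(sg (ord t')).
by case: eqP => // _; rewrite eq_sym; case: eqP => // _; case: ifP.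
Qed.

Lemma ord_inj t t' : t < K -> t' < K -> ord t = ord t' -> t = t'.
Proof.
move=> ht ht' E; case: (ltngtP t t') => // lt.
  by have [] := best_order lt ht'; rewrite E eqxx.
by have [] := best_order lt ht; rewrite E eqxx.
Qed.

Lemma ord_surj i : i < K -> exists2 t, t < K & ord t = i.
Proof. by apply: inj_surj; [move=> t _; exact: dig_lt|exact: ord_inj]. Qed.

Lemma sg_inj i j : i < K -> j < K -> sg i = sg j -> i = j.
Proof.
move=> /ord_surj[t ht <-] /ord_surj[t' ht' <-] E.
case: (ltngtP t t') => [lt|lt|-> //].
  by have [] := best_order lt ht'; rewrite E eqxx.
by have [] := best_order lt ht; rewrite E eqxx.
Qed.

Lemma sg_surj j : j < K -> exists2 i, i < K & sg i = j.
Proof. by apply: inj_surj; [move=> t _; exact: dig_lt|exact: sg_inj]. Qed.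

End BestCode.

(** * One phase preserves EF1 *)

Section EFPair.
Context (R : realType) (m : nat) (u : nat -> R).
Hypothesis u0 : forall g, g < m -> (0 <= u g)%R.
Implicit Types p q : pred nat.

Definition tot p : R := (\sum_(0 <= g < m | p g) u g)%R.

(* An agent with the bundle [q] and the valuation [u] does not envy [p] up to
   one good. *)
Definition efpair p q : Prop := (exists2 g, g < m & p g) ->
  exists s, [/\ s < m, p s & (tot (fun g => p g && (g != s)) <= tot q)%R].

Lemma eq_tot p q : (forall g, g < m -> p g = q g) -> tot p = tot q.
Proof.
move=> h; rewrite /tot big_nat_cond [RHS]big_nat_cond; apply: eq_bigl => g.
by case: ltnP => //= hg; rewrite h.
Qed.

Lemma tot_ge0 p : (0 <= tot p)%R.
Proof. by rewrite /tot big_nat_cond sumr_ge0 // => g /andP[/andP[_ hg] _]; exact: u0. Qed.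

Lemma tot_sub p q : (forall g, g < m -> p g -> q g) -> (tot p <= tot q)%R.
Proof.
move=> h; rewrite /tot [leLHS]big_mkcond [leRHS]big_mkcond /=.
rewrite big_nat_cond [leRHS]big_nat_cond.
apply: ler_sum => g /andP[/andP[_ hg] _].
by case: ifP => [/(h _ hg) ->//|_]; case: ifP => // _; exact: u0.
Qed.

Lemma tot_or p q : (forall g, g < m -> p g -> ~~ q g) ->
  tot (fun g => p g || q g) = (tot p + tot q)%R.
Proof.
move=> h; rewrite /tot big_mkcond [in RHS]big_mkcond [X in (_ + X)%R]big_mkcond /=.
rewrite -big_split big_nat_cond [RHS]big_nat_cond; apply: eq_bigr => g /andP[/andP[_ hg] _].
case: (boolP (p g)) => [/(h g hg)/negPf -> |_] /=; first by rewrite addr0.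
by rewrite add0r.
Qed.

Lemma efpair_self p : efpair p p.
Proof. by move=> [g hg pg]; exists g; split=> //; apply: tot_sub => h _ /andP[]. Qed.

Lemma efpair_eq p p' q q' : (forall g, g < m -> p g = p' g) ->
  (forall g, g < m -> q g = q' g) -> efpair p' q' -> efpair p q.
Proof.
move=> hp hq ef [g hg pg].
have [|s [hs ps le]] := ef; first by exists g => //; rewrite -hp.
exists s; split=> //; first by rewrite hp.
rewrite (eq_tot hq); apply: le_trans le; rewrite le_eqVlt; apply/orP; left; apply/eqP.
by apply: eq_tot => h hh; rewrite hp.
Qed.

(* Old bundles are EF1, new ones are envy-free. *)
Lemma efpair_old p q0 q pN qN :
  (forall g, g < m -> p g -> ~~ pN g) -> (forall g, g < m -> q g -> ~~ qN g) ->
  efpair p q0 -> (tot q0 <= tot q)%R -> (tot pN <= tot qN)%R ->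
  efpair (fun g => p g || pN g) (fun g => q g || qN g).
Proof.
move=> dp dq ef le leN [g hg pg]; rewrite tot_or //.
case: (boolP (has p (index_iota 0 m))) => [/hasP[h]|/hasPn no].
  rewrite mem_index_iota /= => hh ph.
  have [|s [hs ps les]] := ef; first by exists h.
  exists s; split=> //; first by rewrite ps.
  apply: le_trans (_ : tot (fun g => p g && (g != s)) + tot pN <= _)%R; last first.
    by apply: lerD => //; apply: le_trans le.
  rewrite -tot_or; last by move=> x hx /andP[px _]; exact: dp.
  by apply: tot_sub => x hx /andP[/orP[-> ->|->]]; rewrite ?orbT.
(* Without old goods, whatever good is removed, the rest is contained in the new part, which is not
   envied. *)
have np x : x < m -> p x = false by move=> hx; apply/negbTE/no; rewrite mem_index_iota.
exists g; split=> //.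
apply: le_trans (_ : tot pN <= _)%R.
  by apply: tot_sub => x hx /andP[]; rewrite np.
by apply: le_trans leN _; rewrite lerDr tot_ge0.
Qed.

(* Old bundles are envy-free, new ones are EF1. *)
Lemma efpair_new p q pN qN :
  (forall g, g < m -> p g -> ~~ pN g) -> (forall g, g < m -> q g -> ~~ qN g) ->
  (tot p <= tot q)%R -> efpair pN qN ->
  efpair (fun g => p g || pN g) (fun g => q g || qN g).
Proof.
move=> dp dq le ef [g hg pg]; rewrite tot_or //.
case: (boolP (has pN (index_iota 0 m))) => [/hasP[h]|/hasPn no].
  rewrite mem_index_iota /= => hh ph.
  have [|s [hs ps les]] := ef; first by exists h.
  exists s; split=> //; first by rewrite ps orbT.
  apply: le_trans (lerD le les).
  rewrite -tot_or; last by move=> x hx px; rewrite negb_and (dp x hx px).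
  by apply: tot_sub => x hx /andP[/orP[->//|-> ->]]; rewrite orbT.
have np x : x < m -> pN x = false by move=> hx; apply/negbTE/no; rewrite mem_index_iota.
exists g; split=> //.
apply: le_trans (_ : tot p <= _)%R.
  by apply: tot_sub => x hx /andP[]; rewrite np // orbF.
by apply: le_trans le _; rewrite lerDl tot_ge0.
Qed.

End EFPair.

Section Phase.
Context (R : realType) (I : inst R).
Hypothesis wfI : wf_inst I.
Notation n := (nA I).
Notation m := (nG I).
Notation sz := (sz I).
Notation ag := (ag I).
Notation vl := (vl I).
Notation rep := (rep I).
Notation u := (sval' I).

Context (col : nat -> nat).
Notation active := (active I col).
Hypothesis col_proper : forall e f, e < m -> f < m -> adj I e f -> col e != col f.

Definition holds_own (own : nat -> nat) i : pred nat := fun g => own g == i + 1.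

Lemma bvalE own i j : bval I own i j = tot m (u i) (holds_own own j).
Proof. by rewrite /bval /tot [RHS]big_mkcond. Qed.

Lemma u_ge0 i g : g < m -> (0 <= u i g)%R.
Proof.
move=> hg; rewrite /sval' big_nat_cond; apply: sumr_ge0 => t /andP[/andP[_ ht] _].
by case: ifP => // _; apply: ltW; apply: wi_pos.
Qed.

Lemma u_in g a : g < m -> a < sz g -> u (ag g a) g = vl g a.
Proof.
move=> hg ha; rewrite /sval' (bigD1_seq a) ?mem_index_iota ?iota_uniq //= eqxx.
rewrite big_nat_cond big1 ?addr0 // => t /andP[/andP[_ ht] ne].
by case: eqP => // /(ag_inj wfI hg ht ha) E; rewrite E eqxx in ne.
Qed.

Lemma u_out i g : g < m -> (forall a, a < sz g -> ag g a != i) -> u i g = 0%R.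
Proof.
move=> hg h; rewrite /sval' big_nat_cond big1 // => t /andP[/andP[_ ht] _].
by rewrite (negPf (h t ht)).
Qed.

Definition in_phase c e a i := [/\ e < m, active c e, a < sz e & ag e a = i].

Lemma activeE c e : active c e -> [/\ rep e = e, 0 < sz e & col e = c].
Proof. by move=> /and3P[/eqP ? ? /eqP]. Qed.

(** Two active hyperedges sharing an agent would be adjacent, while having the same colour. *)
Lemma in_phase_unique c e f a b i : in_phase c e a i -> in_phase c f b i -> e = f /\ a = b.
Proof.
move=> [he /activeE[re e0 ce] ha ai] [hf /activeE[rf f0 cf] hb bi].
have [E|ne] := eqVneq e f.
  by subst f; split=> //; apply: (ag_inj wfI he ha hb); rewrite ai bi.
have : adj I e f.
  rewrite /adj (negPf ne) re rf !eqxx; apply/sum_nat_gt0; exists a => //.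
  by apply/sum_nat_gt0; exists b => //; rewrite ai bi eqxx.
by move/(col_proper he hf); rewrite ce cf eqxx.
Qed.

Section Step.
Context (c : nat) (own : nat -> nat).
Hypothesis own_active : forall g, g < m -> active c (rep g) -> own g = 0.
Let bst := best I own.
Let own' := ownstep I col c bst own.
Let sg e a := dig (sz e) (bst e) a.

(** An agent belongs to at most one active hyperedge, and the map [sg e] is injective there, so each
    bundle that moves is moved by a single term of the double maximum. *)
Lemma moved_in e a i g : g < m -> in_phase c e a i -> ~~ active c (rep g) ->
  (own' g == i + 1) = (own g == ag e (sg e a) + 1).
Proof.
move=> hg ph na; rewrite /own' /ownstep (negPf na).
have [he acte ha ai] := ph; have [re e0 ce] := activeE acte.
have sga : sg e a < sz e by apply: dig_lt.
have mv w : moved I col c bst w = 0 \/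
    exists f b, in_phase c f b (ag f b) /\ ag f (sg f b) + 1 = w /\ moved I col c bst w = ag f b + 1.
  have [|h0] := posnP (moved I col c bst w); first by left.
  have [f hf Ef] := max_nat_ex h0.
  have {h0} h0 := h0; rewrite {1}/moved Ef in h0.
  rewrite /moved Ef; move: h0; case: ifP => // actf h0.
  have [b hb Eb] := max_nat_ex h0; rewrite Eb; move: h0; rewrite Eb.
  by case: eqP => // E _; right; exists f, b.
have mvE f b : in_phase c f b (ag f b) -> moved I col c bst (ag f (sg f b) + 1) = ag f b + 1.
  move=> [hf actf hb _]; have [rf f0 cf] := activeE actf.
  have sgb : sg f b < sz f by apply: dig_lt.
  rewrite /moved (max_nat_unique hf).
    rewrite actf (max_nat_unique hb) ?eqxx // => b' hb' ne.
    rewrite eqn_add2r; case: eqP => // E; case/eqP: ne.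
    apply: (sg_inj (own := own) f0) => //.
    by apply: (ag_inj wfI hf) E => //; exact: dig_lt.
  move=> f' hf' ne; case: ifP => // actf'; have [rf' f0' cf'] := activeE actf'.
  apply/eqP; rewrite -leqn0; apply/bigmax_leqP_seq => b'; rewrite mem_index_iota /= => hb' _.
  rewrite eqn_add2r; case: eqP => // E.
  have p1 : in_phase c f' (dig (sz f') (bst f') b') (ag f (sg f b)) by split=> //; exact: dig_lt.
  have p2 : in_phase c f (sg f b) (ag f (sg f b)) by split.
  by have [E' _] := in_phase_unique p1 p2; rewrite E' eqxx in ne.
rewrite -ai; case: (mv (own g)) => [E0|[f [b [pf [Ew Em]]]]].
  rewrite E0 eqxx; apply/eqP/eqP => E.
    have [b hb Eb] := sg_surj own e0 ha.
    have := mvE e b (And4 he acte hb erefl); rewrite /sg /bst Eb -E E0; lia.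
  by have := mvE e a (And4 he acte ha erefl); rewrite -E E0; lia.
rewrite Em addn1 /= -addn1 eqn_add2r -Ew eqn_add2r; apply/eqP/eqP => E.
  rewrite E in pf; have [E1 E2] := in_phase_unique pf (And4 he acte ha erefl).
  by rewrite E1 E2.
have [hf actf hb _] := pf; have [rf f0 cf] := activeE actf.
have p1 : in_phase c f (sg f b) (ag e (sg e a)) by split=> //; exact: dig_lt.
have p2 : in_phase c e (sg e a) (ag e (sg e a)) by split.
have [E1 E2] := in_phase_unique p1 p2; subst f.
by rewrite (sg_inj (own := own) f0 hb ha E2).
Qed.

Lemma moved_out i g : g < m -> (forall e a, ~ in_phase c e a i) -> ~~ active c (rep g) ->
  (own' g == i + 1) = (own g == i + 1).
Proof.
move=> hg out na; rewrite /own' /ownstep (negPf na).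
have [//|h0] := posnP (moved I col c bst (own g)).
have [f hf Ef] := max_nat_ex h0.
rewrite /moved Ef; rewrite {1}/moved Ef in h0.
move: h0; case: ifP => // actf h0; have [rf f0 cf] := activeE actf.
have [b hb Eb] := max_nat_ex h0; rewrite Eb; move: h0; rewrite Eb.
case: eqP => // Ew _; rewrite addn1 /= -addn1 -Ew !eqn_add2r.
apply/eqP/eqP => Ei; exfalso; first by apply: (out f b).
by apply: (out f (sg f b)); split=> //; exact: dig_lt.
Qed.

Hypothesis own_le : forall g, g < m -> own g <= n.
Hypothesis own_neq0 : forall g, g < m -> (own g != 0) = (0 < sz g) && (col (rep g) < c).
Hypothesis own_fair : forall i j, efpair m (u i) (holds_own own j) (holds_own own i).

Let ordc e := bst e %/ sz e ^ sz e.

Lemma rr_lt g o : 0 < sz g -> rr I g o < sz g.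
Proof.
move=> s0; rewrite -(prednK s0) ltnS; apply/bigmax_leqP_seq => s _ _.
rewrite /rr_term; case: ifP => // _; rewrite -ltnS (prednK s0); exact: dig_lt.
Qed.

Lemma step_active g : g < m -> active c (rep g) ->
  own' g = ag (rep g) (rr I g (ordc (rep g))) + 1 /\
  in_phase c (rep g) (rr I g (ordc (rep g))) (ag (rep g) (rr I g (ordc (rep g)))).
Proof.
move=> hg act; have [_ s0 _] := activeE act; rewrite sz_rep // in s0.
have lt := rr_lt (ordc (rep g)) s0.
split; first by rewrite /own' /ownstep act ag_rep // /ordc sz_rep.
by split; [exact: rep_lt|exact: act|rewrite sz_rep|].
Qed.

(** Before the phase the goods of active classes have no owner, so the received bundle and the new
    share are disjoint, and their values can be compared separately. *)
Lemma bundle_in e a i g : g < m -> in_phase c e a i ->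
  (own' g == i + 1) = (own g == ag e (sg e a) + 1) || share I e (ordc e) a g.
Proof.
move=> hg ph; have [he acte ha ai] := ph; have [re e0 ce] := activeE acte.
case: (boolP (active c (rep g))) => act; last first.
  rewrite (moved_in hg ph act) /share; case: (rep g =P e) => E; last by rewrite orbF.
  by rewrite E acte in act.
have [-> ph'] := step_active hg act.
have E0 x : (0 == x + 1) = false by rewrite addn1.
rewrite own_active // E0 eqn_add2r /share /=.
apply/eqP/andP => [E|[/eqP E1 /eqP E2]].
  rewrite E in ph'; have [E1 E2] := in_phase_unique ph' ph.
  by rewrite -E1 E2 !eqxx.
by rewrite E1 E2.
Qed.

Lemma bundle_in_disj e a g : g < m -> active c e ->
  own g == ag e (sg e a) + 1 -> ~~ share I e (ordc e) a g.
Proof.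
move=> hg acte /eqP E; apply/negP => /andP[/eqP re _].
by have := own_active hg; rewrite re => /(_ acte); rewrite E addn1.
Qed.

Lemma bundle_out i g : g < m -> (forall e a, ~ in_phase c e a i) ->
  (own' g == i + 1) = (own g == i + 1) || false.
Proof.
move=> hg out; rewrite orbF.
case: (boolP (active c (rep g))) => act; last exact: moved_out.
have [-> ph'] := step_active hg act.
have E0 x : (0 == x + 1) = false by rewrite addn1.
rewrite own_active // E0 eqn_add2r.
by apply/eqP => E; rewrite E in ph'; case: (out _ _ ph').
Qed.

Lemma in_phase_dec i : (exists e a, in_phase c e a i) \/ (forall e a, ~ in_phase c e a i).
Proof.
case: (boolP (has (fun e => active c e && has (fun a => ag e a == i) (iota 0 (sz e))) (iota 0 m))).
  move=> /hasP[e]; rewrite mem_iota /= => he /andP[acte /hasP[a]].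
  by rewrite mem_iota /= => ha /eqP ai; left; exists e, a.
move=> /hasPn no; right => e a [he acte ha ai].
have := no e; rewrite mem_iota /= => /(_ he); rewrite acte /= => /hasPn no2.
by have := no2 a; rewrite mem_iota /= => /(_ ha); rewrite ai eqxx.
Qed.

(** The goods handed out belong to the class of [e], and an agent who is not in a hyperedge gives
    value 0 to its goods. *)
Lemma share_out e a i g : g < m -> active c e -> e < m ->
  (forall b, ~ in_phase c e b i) -> share I e (ordc e) a g -> u i g = 0%R.
Proof.
move=> hg acte he out /andP[/eqP re _]; apply: u_out => // b hb.
apply/negP => /eqP E; apply: (out b); split=> //; first by rewrite -re sz_rep.
by rewrite -re ag_rep.
Qed.

Lemma tot0 (i : nat) (p : pred nat) : (forall g, g < m -> p g -> u i g = 0%R) ->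
  tot m (u i) p = 0%R.
Proof. by move=> h; rewrite /tot big_nat_cond big1 // => g /andP[/andP[_ hg]]; exact: h. Qed.

(** The old part of every bundle is a whole bundle from before the phase, and the old part of [i] is
    worth no less to [i] than before. New goods count for [i] only if they come from the hyperedge
    of [i], so the only delicate case is that of two agents of the same hyperedge. *)
Lemma step_fair i j : efpair m (u i) (holds_own own' j) (holds_own own' i).
Proof.
have ui0 g : g < m -> (0 <= u i g)%R by apply: u_ge0.
(* the bundle of [i], with the old part improved *)
have [q [qN [qE qd qle qNi]]] : exists q qN : pred nat, [/\
    forall g, g < m -> holds_own own' i g = q g || qN g,
    forall g, g < m -> q g -> ~~ qN g,
    (tot m (u i) (holds_own own i) <= tot m (u i) q)%R &
    forall e a, in_phase c e a i -> q = holds_own own (ag e (sg e a)) /\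
      qN = share I e (ordc e) a].
  case: (in_phase_dec i) => [[e [a ph]]|out]; last first.
    exists (holds_own own i), pred0; split=> // [g hg|e a /out//].
    by rewrite /holds_own bundle_out.
  have [he acte ha ai] := ph; have [re e0 ce] := activeE acte.
  exists (holds_own own (ag e (sg e a))), (share I e (ordc e) a); split.
  - by move=> g hg; rewrite /holds_own (bundle_in hg ph).
  - by move=> g hg; exact: bundle_in_disj.
  - have [t ht Et] := ord_surj own e0 ha.
    have := best_rational own e0 ht; rewrite Et !bvalE ai.
    by rewrite /sg /bst.
  - by move=> f b ph'; have [-> ->] := in_phase_unique ph' ph.
case: (in_phase_dec j) => [[e [b phj]]|out]; last first.
  apply: (efpair_eq (p' := fun g => holds_own own j g || pred0 g) (q' := fun g => q g || qN g)).
  - by move=> g hg; rewrite /holds_own bundle_out.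
  - by [].
  - apply: (@efpair_old _ _ _ ui0 _ (holds_own own i)) => //.
    by rewrite [leLHS]tot0 // tot_ge0.
have [he acte hb bj] := phj; have [re e0 ce] := activeE acte.
apply: (efpair_eq (p' := fun g => holds_own own (ag e (sg e b)) g || share I e (ordc e) b g)
   (q' := fun g => q g || qN g)); [|by []|].
  by move=> g hg; rewrite /holds_own (bundle_in hg phj).
case: (in_phase_dec i) => [[f [a phi]]|out]; last first.
  apply: (@efpair_old _ _ _ ui0 _ (holds_own own i)) => //.
    by move=> g hg; exact: bundle_in_disj.
  by rewrite [leLHS]tot0 ?tot_ge0 // => g hg; apply: share_out.
have [hf actf ha ai] := phi.
(* In different active hyperedges, [i] gives value 0 to the new goods of [j]. *)
have [fe|ne] := eqVneq f e; last first.
  apply: (@efpair_old _ _ _ ui0 _ (holds_own own i)) => //.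
    by move=> g hg; exact: bundle_in_disj.
  rewrite [leLHS]tot0 ?tot_ge0 // => g hg; apply: share_out => // b' ph.
  by have [E _] := in_phase_unique phi ph; rewrite E eqxx in ne.
subst f; have [qE1 qE2] := qNi _ _ phi; subst q qN.
have [t ht Et] := ord_surj own e0 ha; have [t' ht' Et'] := ord_surj own e0 hb.
have uE g : g < m -> rep g = e -> u i g = vl g a.
  by move=> hg rg; rewrite -ai -rg ag_rep ?u_in // -(sz_rep hg) rg.
have [ef1 ef2] := round_robin_fair wfI he re e0 (ord_inj (own := own) e0) ht ht'.
have totE (p : pred nat) : (forall g, g < m -> p g -> rep g = e) ->
    tot m (u i) p = (\sum_(0 <= g < m | p g) vl g a)%R.
  move=> hp; rewrite /tot big_nat_cond [RHS]big_nat_cond; apply: eq_bigr.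
  by move=> g /andP[/andP[_ hg] pg]; apply: uE; rewrite // hp.
have shE x g : g < m -> share I e (ordc e) x g -> rep g = e by move=> _ /andP[/eqP].
rewrite Et Et' in ef1 ef2.
case: (ltngtP t t') => [lt|lt|E]; last first.
- have E' : a = b by rewrite -Et -Et' E.
  by rewrite E'; apply: efpair_self.
(* Here [i] picks after [j]: the order excludes envy for the old part, and the round robin is EF1
   for the new part. *)
- apply: efpair_new => //; first by move=> g hg; exact: bundle_in_disj.
    have [_ _] := best_order own e0 lt ht.
    by rewrite Et Et' !bvalE ai.
  move=> exN; have [s [hs ss le]] := ef2 lt exN; exists s; split=> //.
  rewrite totE; last by move=> g hg /andP[/(shE _ _ hg)].
  by rewrite totE //; exact: shE.
(* Here [i] picks before [j]: the new part is not envied, and EF1 of the old part is inherited. *)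
- apply: (@efpair_old _ _ _ ui0 _ (holds_own own i)) => //.
    by move=> g hg; exact: bundle_in_disj.
  by rewrite !totE; [exact: ef1|exact: shE|exact: shE].
Qed.

Lemma moved_cases w : moved I col c bst w = 0 \/
  exists f b, in_phase c f b (ag f b) /\ ag f (sg f b) + 1 = w /\
    moved I col c bst w = ag f b + 1.
Proof.
have [|h0] := posnP (moved I col c bst w); first by left.
have [f hf Ef] := max_nat_ex h0.
rewrite {1}/moved Ef in h0.
rewrite /moved Ef; move: h0; case: ifP => // actf h0.
have [b hb Eb] := max_nat_ex h0; rewrite Eb; move: h0; rewrite Eb.
by case: eqP => // E _; right; exists f, b.
Qed.

Lemma step_le g : g < m -> own' g <= n.
Proof.
move=> hg; case: (boolP (active c (rep g))) => act.
  by have [-> [hf _ ha _]] := step_active hg act; rewrite addn1; apply: (wi_ag wfI).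
rewrite /own' /ownstep (negPf act); case: (moved_cases (own g)) => [->|]; first exact: own_le.
move=> [f [b [[hf _ hb _] [_ ->]]]]; rewrite addn1 /= ; exact: (wi_ag wfI).
Qed.

Lemma step_neq0 g : g < m -> (own' g != 0) = (0 < sz g) && (col (rep g) < c.+1).
Proof.
move=> hg; case: (boolP (active c (rep g))) => act.
  have [-> _] := step_active hg act; have [_ s0 ->] := activeE act.
  by rewrite addn1 ltnSn andbT -(sz_rep hg) s0.
have -> : (own' g != 0) = (own g != 0).
  rewrite /own' /ownstep (negPf act); case: (moved_cases (own g)) => [->//|].
  by move=> [f [b [_ [<- ->]]]]; rewrite !addn1.
rewrite own_neq0 // ltnS [col _ <= _]leq_eqVlt; move: act; rewrite /active rep_rep // eqxx sz_rep //=.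
by case: (0 < sz g) => //= /negPf ->.
Qed.

End Step.

Record fair c own : Prop := Fair {
  fair_le : forall g, g < m -> own g <= n;
  fair_neq0 : forall g, g < m -> (own g != 0) = (0 < sz g) && (col (rep g) < c);
  fair_ef : forall i j, efpair m (u i) (holds_own own j) (holds_own own i) }.

Lemma ow_fair c : fair c (ow I col c).
Proof.
elim: c => [|c [h1 h2 h3]].
  split=> // [g hg|i j [g hg]]; first by rewrite ltn0 andbF.
  by rewrite /holds_own /= eq_sym addn1.
have h4 g : g < m -> active c (rep g) -> ow I col c g = 0.
  move=> hg /activeE[_ s0 E]; apply/eqP; rewrite -[_ == 0]negbK h2 // E ltnn andbF //.
split=> /=.
- exact: step_le.
- exact: step_neq0.
- exact: step_fair.
Qed.

End Phase.

(** * Colouring of the hyperedges *)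

Section Colouring.
Context (R : realType) (I : inst R).
Notation m := (nG I).
Notation adj := (adj I).
Notation D1 := (D1 I).

Lemma adj_sym e f : adj e f = adj f e.
Proof.
rewrite /adj eq_sym; case: eqP => // _; rewrite {1}/meet exchange_big /=.
have -> : \sum_(0 <= j < sz I f) \sum_(0 <= i < sz I e) (ag I e i == ag I f j) = meet I f e.
  by apply: eq_bigr => a _; apply: eq_bigr => b _; rewrite eq_sym.
by case: eqP => //; case: eqP.
Qed.

Lemma adj_irr e : adj e e = false.
Proof. by rewrite /adj eqxx. Qed.

Lemma D1_gt0 : 0 < D1.
Proof. by []. Qed.

Lemma degree_lt e : e < m -> \sum_(0 <= f < m) adj e f < D1.
Proof.
move=> he; rewrite /D1 add1n ltnS.
by apply: (leq_bigmax_seq (F := fun e => \sum_(0 <= f < m) adj e f)); rewrite ?mem_index_iota.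
Qed.

(** * Merging two blocks of coloured hyperedges *)

Section Level.
Context (t : nat) (old : nat -> nat).
Hypothesis old_lt : forall e, e < m -> old e < D1.
Hypothesis old_proper : forall e f, e < m -> f < m -> adj e f ->
  e %/ 2 ^ t = f %/ 2 ^ t -> old e != old f.
Let pw := 2 ^ t.

Definition settled c e := ~~ (odd (e %/ pw) && (c <= old e)).

(** A colour is only excluded by a neighbour that bears it, and there are fewer than [D1]
    neighbours. *)
Lemma free_colour c (cur : nat -> nat) e : e < m ->
  exists2 x, x < D1 & 0 == \sum_(0 <= y < 2 * pw) conf I pw c old cur e x y.
Proof.
move=> he; pose nb := [seq f <- index_iota 0 m | adj e f].
case: (boolP (has (fun x => 0 == \sum_(0 <= y < 2 * pw) conf I pw c old cur e x y) (iota 0 D1))).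
  by move=> /hasP[x]; rewrite mem_iota /= add0n => hx h; exists x.
move=> /hasPn no; exfalso.
have sub : {subset iota 0 D1 <= [seq cur f | f <- nb]}.
  move=> x /no; rewrite eq_sym -lt0n => /sum_nat_gt0[y hy]; rewrite /conf.
  case: ifP => // hf; case: eqP => // <-; case: ifP => // _.
  rewrite lt0b => ad; apply: map_f; rewrite mem_filter ad mem_index_iota //.
have := uniq_leq_size (iota_uniq 0 D1) sub.
rewrite size_iota size_map size_filter -sum1_count leqNgt.
by rewrite big_mkcond /= degree_lt.
Qed.

Lemma conf_block c (cur : nat -> nat) e f x : e < m -> f < m ->
  0 == \sum_(0 <= y < 2 * pw) conf I pw c old cur e x y ->
  e %/ (2 * pw) = f %/ (2 * pw) -> settled c f -> adj e f -> cur f != x.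
Proof.
move=> he hf /sum_nat0 h E st ad.
have p0 : 0 < 2 * pw by rewrite muln_gt0 expn_gt0.
have := h (f %% (2 * pw)); rewrite ltn_mod p0 => /(_ isT).
rewrite /conf E -divn_eq hf; case: eqP => // _.
have -> : 0 == odd (f %/ pw) * (c <= old f).
  by move: st; rewrite /settled; case: odd; case: leqP.
by rewrite ad.
Qed.

(** Invariant over the rounds: the colouring is proper on the settled vertices of each merged block.
    Initially these are the vertices of the even block; in the end, old colours being below [D1],
    all vertices. *)
Lemma level_proper c : (forall e, e < m -> collev I t c old e < D1) /\
  forall e f, e < m -> f < m -> adj e f -> e %/ (2 * pw) = f %/ (2 * pw) ->
    settled c e -> settled c f -> collev I t c old e != collev I t c old f.
Proof.
have block g : g %/ (2 * pw) = (g %/ pw) %/ 2 by rewrite mulnC divnMA.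
elim: c => [|c [IH1 IH2]].
  (* Settled vertices of a merged block are at first all in its even half, where the old colouring
     is proper. *)
  split=> //= e f he hf ad E; rewrite /settled !leq0n !andbT => o1 o2.
  apply: old_proper => //; move: E; rewrite !block -/pw => E.
  by rewrite [LHS](divn_eq _ 2) [RHS](divn_eq _ 2) E !modn2 (negPf o1) (negPf o2).
set cur := collev I t c old.
pose proc e := odd (e %/ pw) && (old e == c).
have stepE e : collev I t c.+1 old e = if proc e then
    firstn D1 (fun x => 0 == \sum_(0 <= y < 2 * pw) conf I pw c old cur e x y) else cur e.
  by rewrite /= /colstep -/pw /proc; case: (odd (e %/ pw)); case: (old e == c).
have settleE e : settled c.+1 e = settled c e || proc e.
  by rewrite /settled /proc; case: odd => //=; clear; case: (ltngtP c (old e)).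
have newP e f : e < m -> f < m -> adj e f -> e %/ (2 * pw) = f %/ (2 * pw) ->
    proc e -> ~~ proc f -> settled c f -> collev I t c.+1 old e != collev I t c.+1 old f.
  move=> he hf ad E pe pf sf; rewrite !stepE pe (negPf pf) eq_sym.
  have [x hx h] := free_colour c cur he.
  apply: (conf_block he hf _ E sf ad).
  by apply: (firstn_p hx (p := fun x => 0 == \sum_(0 <= y < 2 * pw) conf I pw c old cur e x y)).
split.
  move=> e he; rewrite stepE; case: ifP => _; last exact: IH1.
  have [x hx h] := free_colour c cur he.
  exact: (firstn_lt hx h).
move=> e f he hf ad E; rewrite !settleE.
case: (boolP (proc e)) => pe; case: (boolP (proc f)) => pf; rewrite ?orbF ?orbT.
(* Two vertices recoloured at the same time share an old block and an old colour, so they are not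
   adjacent. *)
- move=> _ _; exfalso; move: pe pf => /andP[oe /eqP ce] /andP[of2 /eqP cf].
  have := old_proper he hf ad; rewrite ce cf eqxx => /(_ _)/negP; apply=> //.
  move: E; rewrite !block -/pw => E.
  by rewrite [LHS](divn_eq _ 2) [RHS](divn_eq _ 2) E !modn2 oe of2.
- by move=> _ sf; apply: newP.
- by move=> se _; rewrite eq_sym; apply: newP; rewrite // adj_sym.
- by rewrite !stepE (negPf pe) (negPf pf); apply: IH2.
Qed.

End Level.

Lemma colt_proper t : (forall e, e < m -> colt I t e < D1) /\
  forall e f, e < m -> f < m -> adj e f -> e %/ 2 ^ t = f %/ 2 ^ t -> colt I t e != colt I t f.
Proof.
elim: t => [|t [IH1 IH2]].
  split=> //= e f _ _ ad; rewrite !divn1 => E.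
  by rewrite E adj_irr in ad.
have [h1 h2] := level_proper IH1 IH2 D1; split=> //= e f he hf ad E.
apply: h2 => //; first by rewrite -expnS.
  by rewrite /settled leqNgt IH1 ?andbF.
by rewrite /settled leqNgt IH1 ?andbF.
Qed.

Lemma colt_final t e f : m <= 2 ^ t -> e < m -> f < m -> adj e f -> colt I t e != colt I t f.
Proof.
move=> le he hf ad; have [_ h] := colt_proper t; apply: h => //.
by rewrite !divn_small // (leq_trans _ le).
Qed.

End Colouring.

(** * The program *)

Definition vn := 2.
Definition vm := 3.
Definition vr := 4.
Definition vt := 6.
Definition vp := 7.
Definition vD := 8.
Definition vc := 9.
Definition vq := 10.
Definition vres := 11.
Definition vone := 12.
Definition vtot := 13.

Notation V := EVar.
Notation Cst := ECst.

(** With truncated subtraction, [(a - b) + (b - a)] vanishes exactly when the operands are equal. *)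
Definition EEq a b := ESub (Cst 1) (EAdd (ESub a b) (ESub b a)).
Definition ELtb a b := ESub (Cst 1) (ESub (EAdd a (Cst 1)) b).
Definition EIf s (c : exp false) (a b : exp s) := ELt (Cst 0) c a b.
Definition EPow b a := ERed Prod 0 a 60 b.
Definition EDig b d a := EMod (EDiv d (EPow b a)) b.
Definition EFirst g N x c := ESub N (ERed Max g N x (EIf c (ESub N (V x)) (Cst 0))).

Definition EOff g := ELd (EAdd (Cst 2) g).
Definition ESz g := ESub (EOff (EAdd g (Cst 1))) (EOff g).
Definition EAg g a := ELd (EAdd (EAdd (EAdd (V vm) (Cst 3)) (EOff g)) a).
Definition EVl g a := ERd (EAdd (EOff g) a).

(** Region of version [t] of the family [id]: families are numbered below 16, so the pair can be
    recovered and versions never overlap. *)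
Definition EReg id t := EAdd (Cst id) (EMul (Cst 16) t).
Definition ETab id t x y z := ELd (EAddr (EReg id t) x y z).
Definition ERep g := ETab 1 (Cst 0) g (Cst 0) (Cst 0).
Definition ECnt g := ETab 2 (Cst 0) g (Cst 0) (Cst 0).
Definition ERank g a := ETab 3 (Cst 0) g a (Cst 0).
Definition ESl e a p := ETab 4 (Cst 0) e a p.
Definition EJump t e o c := ETab 5 t e o c.
Definition EStep t e o s := ETab 6 t e o s.
Definition ERr g o := ETab 7 (Cst 0) g o (Cst 0).
Definition ECol q e := ETab 8 q e (Cst 0) (Cst 0).
Definition EBest c e := ETab 9 c e (Cst 0) (Cst 0).
Definition EOwn c g := ETab 10 c g (Cst 0) (Cst 0).

Definition repE :=
  EFirst 1 (V vm) 20 (EIf (EEq (ESz (V 16)) (ESz (V 20)))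
    (EEq (Cst 0) (ERed Sum 0 (ESz (V 16)) 21
       (ESub (Cst 1) (EEq (EAg (V 16) (V 21)) (EAg (V 20) (V 21))))))
    (Cst 0)).

Definition cntE := ERed Sum 1 (V vm) 20 (EEq (ERep (V 20)) (ERep (V 16))).

Definition placeE' :=
  ERed Sum 1 (V vm) 20 (EIf (EEq (ERep (V 20)) (ERep (V 16)))
    (ELe (EVl (V 20) (V 17)) (EVl (V 16) (V 17))
      (ELe (EVl (V 16) (V 17)) (EVl (V 20) (V 17)) (ELtb (V 20) (V 16)) (Cst 0))
      (Cst 1))
    (Cst 0)).

Definition slE :=
  ERed Max 1 (V vm) 20 (EIf (EEq (ERep (V 20)) (V 16))
    (EIf (EEq (ERank (V 20) (V 17)) (V 18)) (V 20) (Cst 0)) (Cst 0)).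

Definition isrepE := EEq (ERep (V 16)) (V 16).
Definition classE := EIf isrepE (ELtb (Cst 0) (ESz (V 16))) (Cst 0).
Definition ordersE := EPow (ESz (V 16)) (ESz (V 16)).

(* Registers: 20 the number of agents, 21 of goods, 22 the base, 23 the turn,
   24 the state, 25 the picking agent, 26 its new prefix. *)
Definition nxtE :=
  ELet 20 (ESz (V 16)) (ELet 21 (ECnt (V 16)) (ELet 22 (EAdd (V 21) (Cst 2))
  (ELet 23 (EMod (V 18) (V 20)) (ELet 24 (EDiv (V 18) (V 20))
  (ELet 25 (EDig (V 20) (V 17) (V 23))
  (ELet 26 (EAdd (EFirst 1 (V 21) 30 (EEq (Cst 0)
      (ELet 31 (ESl (V 16) (V 25) (V 30)) (ELtb (Cst 0)
        (ERed Sum 0 (V 20) 32 (ELtb (ERank (V 31) (V 32))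
           (EDig (V 22) (V 24) (V 32)))))))) (Cst 1))
  (EAdd (EMod (EAdd (V 23) (Cst 1)) (V 20))
     (EMul (V 20) (ESub (EAdd (V 24) (EMul (V 26) (EPow (V 22) (V 25))))
       (EMul (EDig (V 22) (V 24) (V 25)) (EPow (V 22) (V 25)))))))))))).

Definition jumpE := EJump (V vt) (V 16) (V 17) (EJump (V vt) (V 16) (V 17) (V 18)).

(** Bit [t] of the number of turns decides whether a jump of length [2 ^ t] is appended; after level
    [t] the state after [z mod 2 ^ (t + 1)] turns is known. *)
Definition stepE :=
  EIf (EMod (EDiv (V 18) (V vp)) (Cst 2))
    (EJump (V vt) (V 16) (V 17) (EStep (V vt) (V 16) (V 17) (V 18)))
    (EStep (V vt) (V 16) (V 17) (V 18)).

Definition rrE :=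
  ELet 19 (ERep (V 16)) (ELet 20 (ESz (V 16)) (ELet 21 (ECnt (V 16))
  (ERed Max 1 (V 21) 30
    (ELet 32 (EDig (V 20) (V 17) (EMod (V 30) (V 20)))
    (EIf (EEq (EAdd (ERank (V 16) (V 32)) (Cst 1))
           (EDig (EAdd (V 21) (Cst 2))
              (EDiv (EJump (Cst 0) (V 19) (V 17) (EStep (V vt) (V 19) (V 17) (V 30))) (V 20))
              (V 32)))
       (V 32) (Cst 0)))))).

(* Whether the hyperedges in the registers 20 and 21 are adjacent. *)
Definition adjE :=
  EIf (EEq (V 20) (V 21)) (Cst 0)
    (EIf (EEq (ERep (V 20)) (V 20)) (EIf (EEq (ERep (V 21)) (V 21))
       (ELtb (Cst 0) (ERed Sum 0 (ESz (V 20)) 22 (ERed Sum 0 (ESz (V 21)) 23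
          (EEq (EAg (V 20) (V 22)) (EAg (V 21) (V 23)))))) (Cst 0)) (Cst 0)).

Definition degE := EAdd (Cst 1) (ERed Max 1 (V vm) 20 (ERed Sum 2 (V vm) 21 adjE)).

Definition oddE pw g := EMod (EDiv g pw) (Cst 2).

(** Version [t * D1 + c] holds the colours of level [t] once [c] old colours are processed. As [vq]
    contains [t * D1], the version [vq] is the old colouring and [vq + vc] the current one. *)
Definition colE :=
  EIf (EEq (EMul (oddE (V vp) (V 16)) (EEq (ECol (V vq) (V 16)) (V vc))) (Cst 1))
    (ELet 20 (V 16) (EFirst 1 (V vD) 24 (EEq (Cst 0)
      (ERed Sum 2 (EMul (Cst 2) (V vp)) 25
        (ELet 21 (EAdd (EMul (EDiv (V 20) (EMul (Cst 2) (V vp))) (EMul (Cst 2) (V vp))) (V 25))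
        (EIf (ELtb (V 21) (V vm))
          (EIf (EEq (ECol (EAdd (V vq) (V vc)) (V 21)) (V 24))
            (EIf (EEq (Cst 0) (EMul (oddE (V vp) (V 21)) (ELtb (V vc) (EAdd (ECol (V vq) (V 21)) (Cst 1)))))
               adjE (Cst 0)) (Cst 0)) (Cst 0)))))))
    (ECol (EAdd (V vq) (V vc)) (V 16)).

Definition activeE' x :=
  EMul (EEq (ERep (V x)) (V x)) (EMul (ELtb (Cst 0) (ESz (V x))) (EEq (ECol (V vq) (V x)) (V vc))).

(* The value for the agent in position [i] of the bundle of the one in [j]. *)
Definition bvalE' i j :=
  ERed RSum 1 (V vm) 33 (EIf (EEq (EOwn (V vc) (V 33)) (EAdd (EAg (V 16) (V j)) (Cst 1)))
    (ERed RSum 0 (ESz (V 33)) 34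
       (EIf (EEq (EAg (V 33) (V 34)) (EAg (V 16) (V i))) (EVl (V 33) (V 34)) ERz))
    ERz).

(* Registers: 20 the number of agents, 24 the code, 25 and 26 two turns, 27 and
   28 the agents whose turns they are, 29 and 30 the bundles they receive. *)
Definition violE :=
  ELet 27 (EDig (V 20) (EDiv (V 24) (EPow (V 20) (V 20))) (V 25))
  (ELet 28 (EDig (V 20) (EDiv (V 24) (EPow (V 20) (V 20))) (V 26))
  (ELet 29 (EDig (V 20) (V 24) (V 28))
  (ELet 30 (EDig (V 20) (V 24) (V 27))
  (ELt (V 25) (V 26)
    (EIf (EEq (V 27) (V 28)) (Cst 1) (EIf (EEq (V 29) (V 30)) (Cst 1)
       (ELe (bvalE' 28 30) (bvalE' 28 29) (Cst 0) (Cst 1))))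
    (EIf (EEq (V 25) (V 26)) (ELe (bvalE' 28 28) (bvalE' 28 29) (Cst 0) (Cst 1)) (Cst 0)))))).

Definition bestE :=
  ELet 20 (ESz (V 16)) (ELet 21 (EMul (EPow (V 20) (V 20)) (EPow (V 20) (V 20)))
  (EFirst 0 (V 21) 24 (EEq (Cst 0)
    (ERed Sum 0 (V 20) 25 (ERed Sum 0 (V 20) 26 violE))))).

Definition movedE :=
  ERed Max 1 (V vm) 21 (EIf (activeE' 21)
    (ERed Max 0 (ESz (V 21)) 22
      (EIf (EEq (EAdd (EAg (V 21) (EDig (ESz (V 21)) (EBest (V vc) (V 21)) (V 22))) (Cst 1)) (V 23))
         (EAdd (EAg (V 21) (V 22)) (Cst 1)) (Cst 0)))
    (Cst 0)).

Definition ownE :=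
  ELet 20 (ERep (V 16)) (EIf (activeE' 20)
    (EAdd (EAg (V 16) (ERr (V 16) (EDiv (EBest (V vc) (V 20)) (EPow (ESz (V 16)) (ESz (V 16)))))) (Cst 1))
    (ELet 23 (EOwn (V vc) (V 16)) (ELet 24 movedE
      (EIf (EEq (V 24) (Cst 0)) (V 23) (V 24))))).

Definition outE := ESub (EOwn (V vD) (V 18)) (Cst 1).

Definition STab reg N1 g N2 N3 E := SDo (tabE reg N1 g N2 N3 E).

Definition repS := STab (EReg 1 (Cst 0)) (V vm) (Cst 1) (Cst 1) (Cst 1) repE.
Definition cntS := STab (EReg 2 (Cst 0)) (V vm) (Cst 1) (Cst 1) (Cst 1) cntE.
Definition placeS := STab (EReg 3 (Cst 0)) (V vm) (Cst 1) (ESz (V 16)) (Cst 1) placeE'.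
Definition slS := STab (EReg 4 (Cst 0)) (V vm) isrepE (ESz (V 16)) (ECnt (V 16)) slE.
Definition statesE :=
  EMul (ESz (V 16)) (EPow (EAdd (ECnt (V 16)) (Cst 2)) (ESz (V 16))).
Definition nxtS := STab (EReg 5 (Cst 0)) (V vm) classE ordersE statesE nxtE.
Definition jumpS := STab (EReg 5 (EAdd (V vt) (Cst 1))) (V vm) classE ordersE statesE jumpE.
Definition stepS :=
  STab (EReg 6 (EAdd (V vt) (Cst 1))) (V vm) classE ordersE (ECnt (V 16)) stepE.
Definition rrS := STab (EReg 7 (Cst 0)) (V vm) (ELtb (Cst 0) (ESz (V 16))) ordersE (Cst 1) rrE.
Definition colS :=
  STab (EReg 8 (EAdd (EAdd (V vq) (V vc)) (Cst 1))) (V vm) (Cst 1) (Cst 1) (Cst 1) colE.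
Definition bestS := STab (EReg 9 (V vc)) (V vm) (activeE' 16) (Cst 1) (Cst 1) bestE.
Definition ownS := STab (EReg 10 (EAdd (V vc) (Cst 1))) (V vm) (Cst 1) (Cst 1) (Cst 1) ownE.
Definition outS := STab (EReg 11 (Cst 0)) (Cst 1) (Cst 1) (Cst 1) (V vm) outE.

Definition incS x := SLet x (EAdd (V x) (Cst 1)).
Definition SFor x N body := SSeq (SLet x (Cst 0)) (SWhile x N (SSeq body (incS x))).

(* [body] is run with [vt] and [vp] equal to [t] and [2 ^ t], until the latter
   reaches the number of goods. *)
Definition SLevels body :=
  SSeq (SLet vt (Cst 0)) (SSeq (SLet vp (Cst 1)) (SWhile vp vm
    (SSeq body (SSeq (SLet vp (EAdd (V vp) (V vp))) (incS vt))))).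

Definition tablesS :=
  SSeq repS (SSeq cntS (SSeq placeS (SSeq slS (SSeq nxtS
  (SSeq (SLevels (SSeq stepS jumpS)) rrS))))).

Definition colourS :=
  SSeq (SLet vD degE) (SSeq (SLet vq (Cst 0))
    (SLevels (SSeq (SFor vc vD colS) (SLet vq (EAdd (V vq) (V vD)))))).

Definition phasesS := SSeq (SFor vc vD (SSeq bestS ownS)) outS.

(** The program is the same for all ranks, so it has to compute the rank, on which the radix of the
    addresses depends. *)
Definition sizeS :=
  SSeq (SLet vr (ERed Max 1 (V vm) 20 (ESz (V 20))))
       (SLet vH (ERed Prod 0 (EAdd (V vr) (Cst 2)) 60 (EAdd (EAdd (V vn) (V vm)) (Cst 2)))).

(** If no good is valued, the result points just behind the input, to cells that are still 0: agent
    0 receives everything. This also covers instances without goods. *)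
Definition mainS :=
  SSeq (SLet vn (ELd (Cst 0))) (SSeq (SLet vm (ELd (Cst 1)))
  (SSeq (SLet vtot (EOff (V vm))) (SSeq (SLet vone (Cst 1))
  (SIf vtot vone (SLet vres (EAdd (V vm) (Cst 3)))
    (SSeq sizeS (SSeq tablesS (SSeq colourS (SSeq phasesS
       (SLet vres (EAddr (EReg 11 (Cst 0)) (Cst 0) (Cst 0) (Cst 0))))))))))).

Definition main_prog : program :=
  Seq (scode mainS 1) (mov 0 vres) :: sprocs mainS 1.

Lemma tables_wf :
  [/\ tab_wf (EReg 1 (Cst 0)) (V vm) (Cst 1) (Cst 1) (Cst 1) repE,
      tab_wf (EReg 2 (Cst 0)) (V vm) (Cst 1) (Cst 1) (Cst 1) cntE,
      tab_wf (EReg 3 (Cst 0)) (V vm) (Cst 1) (ESz (V 16)) (Cst 1) placeE',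
      tab_wf (EReg 4 (Cst 0)) (V vm) isrepE (ESz (V 16)) (ECnt (V 16)) slE &
      tab_wf (EReg 5 (Cst 0)) (V vm) classE ordersE statesE nxtE] /\
  [/\ tab_wf (EReg 5 (EAdd (V vt) (Cst 1))) (V vm) classE ordersE statesE jumpE,
      tab_wf (EReg 6 (EAdd (V vt) (Cst 1))) (V vm) classE ordersE (ECnt (V 16)) stepE,
      tab_wf (EReg 7 (Cst 0)) (V vm) (ELtb (Cst 0) (ESz (V 16))) ordersE (Cst 1) rrE &
      tab_wf (EReg 8 (EAdd (EAdd (V vq) (V vc)) (Cst 1))) (V vm) (Cst 1) (Cst 1) (Cst 1) colE] /\
  [/\ tab_wf (EReg 9 (V vc)) (V vm) (activeE' 16) (Cst 1) (Cst 1) bestE,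
      tab_wf (EReg 10 (EAdd (V vc) (Cst 1))) (V vm) (Cst 1) (Cst 1) (Cst 1) ownE &
      tab_wf (EReg 11 (Cst 0)) (Cst 1) (Cst 1) (Cst 1) (V vm) outE].
Proof. by []. Qed.

(** * Evaluation of the program *)

Section Contents.
Context (R : realType) (I : inst R) (L : nat).
Notation m := (nG I).

Definition fcol := colt I L.

(** Table number [t] of the family [id]; its domain is [dom id t]. *)
Definition G id t x y z : nat :=
  match id with
  | 1 => rep I x
  | 2 => cnt I x
  | 3 => place I x y
  | 4 => sl I x y z
  | 5 => iter (2 ^ t) (nxt I x y) z
  | 6 => iter (z %% 2 ^ t) (nxt I x y) 0
  | 7 => rr I x y
  | 8 => collev I (t %/ D1 I) (t %% D1 I) (colt I (t %/ D1 I)) x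
  | 9 => best I (ow I fcol t) x
  | 10 => ow I fcol t x
  | _ => ow I fcol (D1 I) z - 1
  end.

Definition isclass x := (rep I x == x) && (0 < sz I x).

Definition dom id t x y z : bool :=
  match id with
  | 1 | 2 | 8 | 10 => [&& x < m, y == 0 & z == 0]
  | 3 => [&& x < m, y < sz I x & z == 0]
  | 4 => [&& x < m, rep I x == x, y < sz I x & z < cnt I x]
  | 5 => [&& x < m, isclass x, y < sz I x ^ sz I x & z < sz I x * base I x ^ sz I x]
  | 6 => [&& x < m, isclass x, y < sz I x ^ sz I x & z < cnt I x]
  | 7 => [&& x < m, 0 < sz I x, y < sz I x ^ sz I x & z == 0]
  | 9 => [&& x < m, active I fcol t x, y == 0 & z == 0]
  | _ => [&& x == 0, y == 0 & z < m]
  end.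

(** The memory when the tables [t < lim id] have been computed. *)
Record contents X dm H (lim mem : nat -> nat) : Prop := Contents {
  ct_off : forall k, k <= m -> mem (2 + k) = off I k /\ 2 + k < H;
  ct_ag : forall g a, g < m -> a < sz I g ->
    mem (m + 3 + off I g + a) = ag I g a /\ m + 3 + off I g + a < H;
  ct_small : forall a, a < H -> mem a < X ^ dm;
  ct_tab : forall id t x y z, 0 < id < 16 -> t < lim id -> dom id t x y z ->
    mem (addr H (id + 16 * t) x y z) = G id t x y z }.

End Contents.

Section Evaluations.
Context (R : realType) (I : inst R) (L : nat).
Hypothesis wfI : wf_inst I.
Notation m := (nG I).
Notation sz := (sz I).
Notation ag := (ag I).
Notation vl := (vl I).
Notation G := (G I L).
Notation dom := (dom I L).
Notation fcol := (fcol I L).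
Notation D1 := (D1 I).

Context (X dm r0 H : nat) (rm : nat -> R).
Hypothesis H_gt0 : 0 < H.
Hypothesis rm_vl : forall g a, g < m -> a < sz g -> rm (off I g + a) = vl g a.
Hypothesis dom_lt : forall id t x y z, dom id t x y z -> [/\ x < H, y < H & z < H].
Hypothesis G_lt : forall id t x y z, dom id t x y z -> G id t x y z < X ^ dm.
Hypothesis r0_sz : forall g, g < m -> sz g <= r0.
Hypothesis r0_ncode : forall g, g < m -> ncode I g <= r0.

Context (lim mem : nat -> nat) (reg0 : nat).
Hypothesis ctm : contents I L X dm H lim mem.
Hypothesis fresh : forall id t, 0 < id < 16 -> t < lim id -> id + 16 * t != reg0.
Hypothesis reg0_gt0 : 0 < reg0.

Let F a := region H a != reg0.
Notation Ev := (Ev mem rm X dm F).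

Definition genv (rho : nat -> nat) := rho vm = m /\ rho vH = H.

Lemma Ev_if q rho s (c : exp false) (e1 e2 : exp s) (b : bool) w1 w2 :
  Ev q rho c (b : nat) -> (b -> Ev q rho e1 w1) -> (~~ b -> Ev q rho e2 w2) ->
  Ev q rho (EIf c e1 e2) (if b then w1 else w2).
Proof.
move=> hc h1 h2; apply: Ev_eq.
  apply: Ev_lt; [exact: Ev_cst|exact: hc| |].
    by rewrite lt0b => hb; exact: h1.
  by rewrite leqNgt lt0b => hb; exact: h2.
by rewrite lt0b.
Qed.

Lemma Ev_ifb q rho (c e1 e2 : exp false) (b w1 w2 : bool) :
  Ev q rho c (b : nat) -> (b -> Ev q rho e1 (w1 : nat)) -> (~~ b -> Ev q rho e2 (w2 : nat)) ->
  Ev q rho (EIf c e1 e2) ((if b then w1 else w2) : nat).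
Proof. by move=> hc h1 h2; apply: Ev_eq (Ev_if hc h1 h2) _; case: b {hc h1 h2}. Qed.

Lemma Ev_eqb q rho (a b : exp false) (u v : nat) :
  Ev q rho a u -> Ev q rho b v -> Ev q rho (EEq a b) (u == v : nat).
Proof.
move=> ha hb; apply: Ev_eq.
  by apply: Ev_sub; [exact: Ev_cst|apply: Ev_add; apply: Ev_sub; eassumption].
by clear; case: eqP; lia.
Qed.

Lemma Ev_ltb q rho (a b : exp false) (u v : nat) :
  Ev q rho a u -> Ev q rho b v -> Ev q rho (ELtb a b) (u < v : nat).
Proof.
move=> ha hb; apply: Ev_eq.
  apply: Ev_sub; [exact: Ev_cst|apply: Ev_sub; [|exact: hb]].
  by apply: Ev_add; [exact: ha|exact: Ev_cst].
by clear; case: ltnP; lia.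
Qed.

Lemma Ev_pow q rho (b a : exp false) (u v : nat) :
  (forall i, Ev q (upd rho 60 i) b u) -> Ev q rho a v -> v <= q 0 ->
  Ev q rho (EPow b a) (u ^ v).
Proof.
move=> hb ha le; apply: Ev_eq; first by apply: Ev_red; [exact: ha|exact: le|move=> i _; exact: hb].
by rewrite /= prod_nat_const_nat subn0.
Qed.

Lemma Ev_dig q rho (b d a : exp false) (u v w : nat) :
  (forall i, Ev q (upd rho 60 i) b u) -> Ev q rho b u -> Ev q rho d v ->
  Ev q rho a w -> w <= q 0 -> Ev q rho (EDig b d a) (dig u v w).
Proof.
by move=> hb hb' hd ha le; apply: Ev_mod => //; apply: Ev_div => //; apply: Ev_pow.
Qed.

Lemma Ev_first q rho g x (N c : exp false) (n : nat) (p : nat -> bool) :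
  Ev q rho N n -> n <= q g -> (forall i, Ev q (upd rho x i) N n) ->
  (forall i, i < n -> Ev q (upd rho x i) c (p i : nat)) ->
  Ev q rho (EFirst g N x c) (firstn n p).
Proof.
move=> hN le hN' hc; apply: Ev_sub => //; apply: Ev_red => // i hi.
apply: Ev_if; [exact: hc|move=> _|move=> _; exact: Ev_cst].
by apply: Ev_sub => //; apply: Ev_var; rewrite /upd eqxx.
Qed.

Lemma F_low a : a < H -> F a.
Proof. by move=> ha; rewrite /F /region (divn_small ha) !div0n eq_sym -lt0n. Qed.

Lemma Ev_off q rho (g : exp false) (u : nat) :
  Ev q rho g u -> u <= m -> Ev q rho (EOff g) (off I u).
Proof.
move=> hg hu; have [E lt] := ct_off ctm hu.
apply: Ev_ld; [by apply: Ev_add; [exact: Ev_cst|exact: hg]|exact: E|exact: F_low|].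
by rewrite -E; apply: (ct_small ctm).
Qed.

Lemma Ev_sz q rho (g : exp false) (u : nat) :
  Ev q rho g u -> u < m -> Ev q rho (ESz g) (sz u).
Proof.
move=> hg hu.
have h : Ev q rho (EAdd g (Cst 1)) (u + 1).
  by apply: Ev_add; [exact: hg|exact: Ev_cst].
rewrite addn1 in h.
apply: Ev_eq; first by apply: Ev_sub; apply: Ev_off; [exact: h|exact: hu|exact: hg|exact: ltnW].
by rewrite /off big_nat_recr //= addKn.
Qed.

Lemma Ev_ag q rho (g a : exp false) (u v : nat) : genv rho ->
  Ev q rho g u -> Ev q rho a v -> u < m -> v < sz u -> Ev q rho (EAg g a) (ag u v).
Proof.
move=> [gm gH] hg ha hu hv; have [E lt] := ct_ag ctm hu hv.
apply: Ev_ld; [|exact: E|exact: F_low|by rewrite -E; apply: (ct_small ctm)].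
apply: Ev_add => //; apply: Ev_add; last by apply: Ev_off => //; exact: ltnW.
by apply: Ev_add; [exact: Ev_var|exact: Ev_cst].
Qed.

Lemma Ev_vl q rho (g a : exp false) (u v : nat) :
  Ev q rho g u -> Ev q rho a v -> u < m -> v < sz u -> Ev q rho (EVl g a) (vl u v).
Proof.
move=> hg ha hu hv; apply: Ev_rd; last exact: rm_vl.
by apply: Ev_add => //; apply: Ev_off => //; exact: ltnW.
Qed.

Lemma Ev_reg q rho id (tE : exp false) t : Ev q rho tE t -> Ev q rho (EReg id tE) (id + 16 * t).
Proof. by move=> h; apply: Ev_add; [exact: Ev_cst|apply: Ev_mul => //; exact: Ev_cst]. Qed.

Lemma Ev_tab q rho id (tE xE yE zE : exp false) (t x y z : nat) : genv rho ->
  Ev q rho tE t -> Ev q rho xE x -> Ev q rho yE y -> Ev q rho zE z ->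
  0 < id < 16 -> t < lim id -> dom id t x y z -> Ev q rho (ETab id tE xE yE zE) (G id t x y z).
Proof.
move=> [gm gH] ht hx hy hz hid lt hd.
have [x1 y1 z1] := dom_lt hd.
apply: Ev_ld; last exact: G_lt hd.
- have hv : Ev q rho (EVar vH) H by exact: Ev_var.
  exact: Ev_add (Ev_mul (Ev_add (Ev_mul (Ev_add (Ev_mul (Ev_reg id ht) hv) hx) hv) hy) hv) hz.
- by rewrite -(ct_tab ctm hid lt hd).
- by rewrite /F region_addr // fresh.
Qed.

Lemma Ev_rep q rho (g : exp false) (u : nat) : genv rho ->
  Ev q rho g u -> u < m -> 0 < lim 1 -> Ev q rho (ERep g) (rep I u).
Proof.
move=> gv hg hu hl.
by apply: (@Ev_tab q rho 1 _ _ _ _ 0 u 0 0); rewrite //= ?hu ?eqxx //; exact: Ev_cst.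
Qed.

Lemma Ev_cnt q rho (g : exp false) (u : nat) : genv rho ->
  Ev q rho g u -> u < m -> 0 < lim 2 -> Ev q rho (ECnt g) (cnt I u).
Proof.
move=> gv hg hu hl.
by apply: (@Ev_tab q rho 2 _ _ _ _ 0 u 0 0); rewrite //= ?hu ?eqxx //; exact: Ev_cst.
Qed.

Lemma Ev_rank q rho (g a : exp false) (u v : nat) : genv rho ->
  Ev q rho g u -> Ev q rho a v -> u < m -> v < sz u -> 0 < lim 3 ->
  Ev q rho (ERank g a) (place I u v).
Proof.
move=> gv hg ha hu hv hl.
by apply: (@Ev_tab q rho 3 _ _ _ _ 0 u v 0); rewrite //= ?hu ?hv ?eqxx //; exact: Ev_cst.
Qed.

Lemma Ev_sl q rho (e a p : exp false) (u v w : nat) : genv rho ->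
  Ev q rho e u -> Ev q rho a v -> Ev q rho p w -> u < m -> rep I u = u ->
  v < sz u -> w < cnt I u -> 0 < lim 4 -> Ev q rho (ESl e a p) (sl I u v w).
Proof.
move=> gv he ha hp hu ru hv hw hl.
by apply: (@Ev_tab q rho 4 _ _ _ _ 0 u v w); rewrite //= ?hu ?ru ?hv ?hw ?eqxx //; exact: Ev_cst.
Qed.

Lemma Ev_jump q rho (t e o c : exp false) (t' e' o' c' : nat) : genv rho ->
  Ev q rho t t' -> Ev q rho e e' -> Ev q rho o o' -> Ev q rho c c' ->
  e' < m -> isclass I e' -> o' < sz e' ^ sz e' -> c' < sz e' * base I e' ^ sz e' ->
  t' < lim 5 -> Ev q rho (EJump t e o c) (iter (2 ^ t') (nxt I e' o') c').
Proof.
move=> gv ht he ho hc e1 e2 o1 c1 hl.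
by apply: (@Ev_tab q rho 5 _ _ _ _ t' e' o' c'); rewrite //= e1 e2 o1 c1.
Qed.

Lemma Ev_step q rho (t e o c : exp false) (t' e' o' c' : nat) : genv rho ->
  Ev q rho t t' -> Ev q rho e e' -> Ev q rho o o' -> Ev q rho c c' ->
  e' < m -> isclass I e' -> o' < sz e' ^ sz e' -> c' < cnt I e' ->
  t' < lim 6 -> Ev q rho (EStep t e o c) (iter (c' %% 2 ^ t') (nxt I e' o') 0).
Proof.
move=> gv ht he ho hc e1 e2 o1 c1 hl.
by apply: (@Ev_tab q rho 6 _ _ _ _ t' e' o' c'); rewrite //= e1 e2 o1 c1.
Qed.

Lemma Ev_rr q rho (g o : exp false) (u v : nat) : genv rho ->
  Ev q rho g u -> Ev q rho o v -> u < m -> 0 < sz u -> v < sz u ^ sz u -> 0 < lim 7 ->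
  Ev q rho (ERr g o) (rr I u v).
Proof.
move=> gv hg ho hu s0 hv hl.
by apply: (@Ev_tab q rho 7 _ _ _ _ 0 u v 0); rewrite //= ?hu ?s0 ?hv ?eqxx //; exact: Ev_cst.
Qed.

Lemma Ev_col q rho (t e : exp false) (t' u : nat) : genv rho ->
  Ev q rho t t' -> Ev q rho e u -> u < m -> t' < lim 8 ->
  Ev q rho (ECol t e) (collev I (t' %/ D1) (t' %% D1) (colt I (t' %/ D1)) u).
Proof.
move=> gv ht he hu hl.
by apply: (@Ev_tab q rho 8 _ _ _ _ t' u 0 0); rewrite //= ?hu ?eqxx //; exact: Ev_cst.
Qed.

Lemma Ev_best q rho (c e : exp false) (c' u : nat) : genv rho ->
  Ev q rho c c' -> Ev q rho e u -> u < m -> active I fcol c' u -> c' < lim 9 ->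
  Ev q rho (EBest c e) (best I (ow I fcol c') u).
Proof.
move=> gv hc he hu ha hl.
by apply: (@Ev_tab q rho 9 _ _ _ _ c' u 0 0); rewrite //= ?hu ?ha ?eqxx //; exact: Ev_cst.
Qed.

Lemma Ev_own q rho (c g : exp false) (c' u : nat) : genv rho ->
  Ev q rho c c' -> Ev q rho g u -> u < m -> c' < lim 10 ->
  Ev q rho (EOwn c g) (ow I fcol c' u).
Proof.
move=> gv hc hg hu hl.
by apply: (@Ev_tab q rho 10 _ _ _ _ c' u 0 0); rewrite //= ?hu ?eqxx //; exact: Ev_cst.
Qed.

Lemma Ev_v q rho x v : rho x = v -> Ev q rho (V x) v.
Proof. exact: Ev_var. Qed.

Lemma Ev_sum q rho g (N : exp false) x (b : exp false) (n : nat) (f : nat -> nat) :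
  Ev q rho N n -> n <= q g -> (forall i, i < n -> Ev q (upd rho x i) b (f i)) ->
  Ev q rho (ERed Sum g N x b) (\sum_(0 <= i < n) f i).
Proof. exact: Ev_red. Qed.

Lemma Ev_max q rho g (N : exp false) x (b : exp false) (n : nat) (f : nat -> nat) :
  Ev q rho N n -> n <= q g -> (forall i, i < n -> Ev q (upd rho x i) b (f i)) ->
  Ev q rho (ERed Max g N x b) (\max_(0 <= i < n) f i).
Proof. exact: Ev_red. Qed.

Lemma Ev_rsum q rho g (N : exp false) x (b : exp true) (n : nat) (f : nat -> R) :
  Ev q rho N n -> n <= q g -> (forall i, i < n -> Ev q (upd rho x i) b (f i)) ->
  Ev q rho (ERed RSum g N x b) (\sum_(0 <= i < n) f i)%R.
Proof. exact: Ev_red. Qed.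

Ltac ev_var := by apply: Ev_v.

Section Bodies.
Context (q : nat -> nat) (rho : nat -> nat).
Hypothesis gv : genv rho.
Hypothesis q0 : q 0 = r0.

Lemma q0_sz g : g < m -> sz g <= q 0.
Proof. by rewrite q0; exact: r0_sz. Qed.

Lemma Ev_vm rho' : genv rho' -> Ev q rho' (V vm) m.
Proof. by case=> h _; apply: Ev_v. Qed.

Lemma Ev_repE x : rho 16 = x -> x < m -> m <= q 1 -> Ev q rho repE (rep I x).
Proof.
move=> x16 hx hq.
apply: Ev_first => [||i|i hi]; [exact: Ev_vm|exact: hq|exact: Ev_vm|].
have ex : Ev q (upd rho 20 i) (V 16) x by ev_var.
have ei : Ev q (upd rho 20 i) (V 20) i by ev_var.
apply: Ev_ifb => [|E|_]; last exact: Ev_cst.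
  by apply: Ev_eqb; apply: Ev_sz.
apply: Ev_eqb; first exact: Ev_cst.
apply: Ev_sum => [||a ha]; [exact: Ev_sz|exact: q0_sz|].
apply: Ev_sub; first exact: Ev_cst.
by apply: Ev_eqb; apply: Ev_ag; rewrite -?(eqP E) //; ev_var.
Qed.

Lemma Ev_cntE x : rho 16 = x -> x < m -> m <= q 1 -> 0 < lim 1 -> Ev q rho cntE (cnt I x).
Proof.
move=> x16 hx hq hl; apply: Ev_sum => [||i hi]; [exact: Ev_vm|exact: hq|].
by apply: Ev_eqb; apply: Ev_rep => //; ev_var.
Qed.

Lemma same_sz_rep g h : g < m -> h < m -> rep I h = rep I g -> sz h = sz g.
Proof. by move=> hg hh E; rewrite -(sz_rep hg) -(sz_rep hh) E. Qed.

Lemma Ev_rankE x y : rho 16 = x -> rho 17 = y -> x < m -> y < sz x -> m <= q 1 ->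
  0 < lim 1 -> Ev q rho placeE' (place I x y).
Proof.
move=> x16 y17 hx hy hq hl; apply: Ev_sum => [||i hi]; [exact: Ev_vm|exact: hq|].
have ex : Ev q (upd rho 20 i) (V 16) x by ev_var.
have ey : Ev q (upd rho 20 i) (V 17) y by ev_var.
have ei : Ev q (upd rho 20 i) (V 20) i by ev_var.
apply: Ev_if => [|/eqP E|_]; last exact: Ev_cst.
  by apply: Ev_eqb; apply: Ev_rep.
have hy' : y < sz i by rewrite (same_sz_rep hx hi E).
apply: Ev_le => [||_|_]; [exact: Ev_vl|exact: Ev_vl| |exact: Ev_cst].
apply: Ev_le => [||_|_]; [exact: Ev_vl|exact: Ev_vl| |exact: Ev_cst].
exact: Ev_ltb.
Qed.

Lemma Ev_slE x y z : rho 16 = x -> rho 17 = y -> rho 18 = z -> x < m -> y < sz x ->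
  m <= q 1 -> 0 < lim 1 -> 0 < lim 3 -> Ev q rho slE (sl I x y z).
Proof.
move=> x16 y17 z18 hx hy hq hl hl3; apply: Ev_max => [||i hi]; [exact: Ev_vm|exact: hq|].
apply: Ev_if => [|/eqP E|_]; last exact: Ev_cst.
  by apply: Ev_eqb; [apply: Ev_rep => //|]; ev_var.
have hy' : y < sz i by rewrite -(sz_rep hi) E.
apply: Ev_if => [|_|_]; [|ev_var|exact: Ev_cst].
by apply: Ev_eqb; [apply: Ev_rank => //|]; ev_var.
Qed.

Lemma Ev_isrepE x : rho 16 = x -> x < m -> 0 < lim 1 ->
  Ev q rho isrepE (rep I x == x : nat).
Proof. by move=> x16 hx hl; apply: Ev_eqb; [apply: Ev_rep|]; rewrite //; ev_var. Qed.

Lemma Ev_classE x : rho 16 = x -> x < m -> 0 < lim 1 ->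
  Ev q rho classE (isclass I x : nat).
Proof.
move=> x16 hx hl; rewrite /isclass; apply: Ev_eq.
  apply: (@Ev_ifb _ _ _ _ _ (rep I x == x) (0 < sz x) false) => [|_|_].
  - exact: Ev_isrepE.
  - by apply: Ev_ltb; [exact: Ev_cst|apply: Ev_sz => //; ev_var].
  - exact: Ev_cst.
by case: eqP.
Qed.

Lemma Ev_ordersE x : rho 16 = x -> x < m -> Ev q rho ordersE (sz x ^ sz x).
Proof.
move=> x16 hx; apply: Ev_pow => [i||]; [| |exact: q0_sz]; apply: Ev_sz => //; ev_var.
Qed.

Lemma Ev_statesE x : rho 16 = x -> x < m -> 0 < lim 2 ->
  Ev q rho statesE (sz x * base I x ^ sz x).
Proof.
move=> x16 hx hl; apply: Ev_mul; first by apply: Ev_sz => //; ev_var.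
apply: Ev_pow => [i||]; [|by apply: Ev_sz => //; ev_var|exact: q0_sz].
by apply: Ev_add; [apply: Ev_cnt => //; ev_var|exact: Ev_cst].
Qed.

Lemma Ev_nxtE x y z : rho 16 = x -> rho 17 = y -> rho 18 = z -> x < m ->
  isclass I x -> cnt I x <= q 1 -> 0 < lim 2 -> 0 < lim 3 -> 0 < lim 4 ->
  Ev q rho nxtE (nxt I x y z).
Proof.
move=> x16 y17 z18 hx /andP[/eqP rx K0] hq hl2 hl3 hl4.
pose K := sz x; pose d := z %/ K; pose a := dig K y (z %% K).
have aK : a < K by exact: dig_lt.
have KX : K <= q 0 by exact: q0_sz.
apply: (Ev_let (u := K)); first by apply: Ev_sz => //; ev_var.
apply: (Ev_let (u := cnt I x)); first by apply: Ev_cnt => //; ev_var.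
apply: (Ev_let (u := base I x)); first by apply: Ev_add; [ev_var|exact: Ev_cst].
apply: (Ev_let (u := z %% K)); first by apply: Ev_mod; ev_var.
apply: (Ev_let (u := d)); first by apply: Ev_div; ev_var.
apply: (Ev_let (u := a)).
  apply: Ev_dig => [i||||]; [ev_var|ev_var|ev_var|ev_var|].
  by apply: leq_trans KX; apply/ltnW; rewrite ltn_mod.
apply: (Ev_let (u := pick I x d a)).
  apply: Ev_add; last exact: Ev_cst.
  apply: Ev_first => [||i|p hp]; [ev_var|exact: hq|ev_var|].
  apply: Ev_eqb; first exact: Ev_cst.
  have [slm [slr _]] := slP a hx rx hp.
  apply: (Ev_let (u := sl I x a p)); first by apply: Ev_sl => //; ev_var.
  apply: Ev_ltb; first exact: Ev_cst.
  apply: Ev_sum => [||j hj]; [ev_var|exact: KX|].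
  apply: Ev_ltb.
    by apply: Ev_rank => //; rewrite -(sz_rep slm) slr.
  apply: Ev_dig => [i||||]; [ev_var|ev_var|ev_var|ev_var|].
  by apply: leq_trans KX; exact: ltnW.
have aX : a <= q 0 by apply: leq_trans KX; exact: ltnW.
apply: Ev_add; first by apply: Ev_mod; [apply: Ev_add; [ev_var|exact: Ev_cst]|ev_var].
apply: Ev_mul; first ev_var.
apply: Ev_sub.
  apply: Ev_add; first ev_var.
  by apply: Ev_mul; [ev_var|apply: Ev_pow => [i||]; [ev_var|ev_var|exact: aX]].
apply: Ev_mul; first by apply: Ev_dig => [i||||]; [ev_var|ev_var|ev_var|ev_var|exact: aX].
by apply: Ev_pow => [i||]; [ev_var|ev_var|exact: aX].
Qed.

Lemma Ev_jumpE x y z t : rho 16 = x -> rho 17 = y -> rho 18 = z -> rho vt = t -> x < m ->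
  isclass I x -> y < sz x ^ sz x -> z < sz x * base I x ^ sz x -> t < lim 5 ->
  Ev q rho jumpE (iter (2 ^ t.+1) (nxt I x y) z).
Proof.
move=> x16 y17 z18 t6 hx cx hy hz hl.
have [/eqP rx K0] := andP cx.
rewrite expnS mul2n -addnn iterD.
have lt := iter_nxt_lt y hx rx K0 (2 ^ t) hz.
apply: Ev_jump => //.
by apply: Ev_jump.
Qed.

Lemma Ev_stepE x y z t : rho 16 = x -> rho 17 = y -> rho 18 = z -> rho vt = t ->
  rho vp = 2 ^ t -> x < m ->
  isclass I x -> y < sz x ^ sz x -> z < cnt I x -> t < lim 5 -> t < lim 6 ->
  Ev q rho stepE (iter (z %% 2 ^ t.+1) (nxt I x y) 0).
Proof.
move=> x16 y17 z18 t6 t7 hx cx hy hz hl5 hl6.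
have [/eqP rx K0] := andP cx.
have b0 : 0 < sz x * base I x ^ sz x by rewrite muln_gt0 K0 expn_gt0 /base addn2.
have es : Ev q rho (EStep (V vt) (V 16) (V 17) (V 18)) (iter (z %% 2 ^ t) (nxt I x y) 0).
  by apply: Ev_step => //; ev_var.
have Ez : z %% 2 ^ t.+1 = odd (z %/ 2 ^ t) * 2 ^ t + z %% 2 ^ t.
  have {1}-> : z = (z %/ 2 ^ t)./2 * 2 ^ t.+1 + (odd (z %/ 2 ^ t) * 2 ^ t + z %% 2 ^ t).
    rewrite {1}(divn_eq z (2 ^ t)) -{1}(odd_double_half (z %/ 2 ^ t)) mulnDl -muln2.
    by rewrite -mulnA -expnS [_ * 2 ^ t + _]addnC -addnA.
  rewrite modnMDl modn_small // expnS.
  have : z %% 2 ^ t < 2 ^ t by rewrite ltn_mod expn_gt0.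
  by clear; case: odd; lia.
have h : Ev q rho stepE (if odd (z %/ 2 ^ t)
    then iter (2 ^ t) (nxt I x y) (iter (z %% 2 ^ t) (nxt I x y) 0)
    else iter (z %% 2 ^ t) (nxt I x y) 0).
  apply: Ev_if.
  - apply: Ev_eq; last exact: modn2.
    by apply: Ev_mod; [apply: Ev_div; ev_var|exact: Ev_cst].
  - by move=> _; apply: (Ev_jump _ _ _ _ es) => //; exact: iter_nxt_lt.
  - by move=> _; exact: es.
by apply: Ev_eq h _; rewrite Ez; case: odd; rewrite ?mul1n ?iterD ?mul0n.
Qed.

Lemma isclass_rep x : x < m -> 0 < sz x -> isclass I (rep I x).
Proof. by move=> hx s0; rewrite /isclass rep_rep // eqxx sz_rep. Qed.

Lemma Ev_rrE x y t : rho 16 = x -> rho 17 = y -> rho vt = t -> x < m -> 0 < sz x ->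
  y < sz x ^ sz x -> m <= 2 ^ t -> cnt I x <= q 1 ->
  0 < lim 1 -> 0 < lim 2 -> 0 < lim 3 -> 0 < lim 5 -> t < lim 6 ->
  Ev q rho rrE (rr I x y).
Proof.
move=> x16 y17 t6 hx s0 hy ht hq hl1 hl2 hl3 hl5 hl6.
have sX : sz x <= q 0 by exact: q0_sz.
have rl := rep_lt hx; have cr := isclass_rep hx s0.
have [/eqP rr_ K0] := andP cr.
have hy' : y < sz (rep I x) ^ sz (rep I x) by rewrite sz_rep.
apply: (Ev_let (u := rep I x)); first by apply: Ev_rep => //; ev_var.
apply: (Ev_let (u := sz x)); first by apply: Ev_sz => //; ev_var.
apply: (Ev_let (u := cnt I x)); first by apply: Ev_cnt => //; ev_var.
apply: Ev_max => [||s hs]; [ev_var|exact: hq|].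
have aK : dig (sz x) y (s %% sz x) < sz x by exact: dig_lt.
apply: (Ev_let (u := dig (sz x) y (s %% sz x))).
  apply: Ev_dig => [i||||]; [ev_var|ev_var|ev_var|by apply: Ev_mod; ev_var|].
  by apply: leq_trans sX; apply/ltnW; rewrite ltn_mod.
(* The table of steps at the last level is indexed modulo a power of 2 that exceeds the number of
   turns. *)
have sE : s %% 2 ^ t = s.
  by rewrite modn_small //; apply: leq_trans hs (leq_trans (cnt_le I x) ht).
apply: Ev_if => [|_|_]; [|ev_var|exact: Ev_cst].
apply: Ev_eqb.
  by apply: Ev_add; [apply: Ev_rank => //; ev_var|exact: Ev_cst].
apply: Ev_dig => [i||||].
- by apply: Ev_add; [ev_var|exact: Ev_cst].
- by apply: Ev_add; [ev_var|exact: Ev_cst].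
- apply: Ev_div; last ev_var.
  have b0 : 0 < sz (rep I x) * base I (rep I x) ^ sz (rep I x).
    by rewrite muln_gt0 K0 expn_gt0 /base addn2.
  apply: (@Ev_jump _ _ _ _ _ _ 0 (rep I x) y (iter s (nxt I (rep I x) y) 0)) => //.
    rewrite (_ : iter s _ 0 = iter (s %% 2 ^ t) (nxt I (rep I x) y) 0); last by rewrite sE.
    by apply: Ev_step => //; rewrite cnt_rep.
  exact: iter_nxt_lt.
- ev_var.
- by apply: leq_trans sX; exact: ltnW.
Qed.

Lemma Ev_adjE e f : rho 20 = e -> rho 21 = f -> e < m -> f < m -> 0 < lim 1 ->
  Ev q rho adjE (adj I e f : nat).
Proof.
move=> e20 f21 he hf hl.
have ee : Ev q rho (V 20) e by ev_var.
have ef : Ev q rho (V 21) f by ev_var.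
rewrite /adj; apply: Ev_ifb => [|_|_]; [exact: Ev_eqb|exact: Ev_cst|].
apply: Ev_ifb => [|_|_]; [by apply: Ev_eqb => //; apply: Ev_rep| |exact: Ev_cst].
apply: Ev_ifb => [|_|_]; [by apply: Ev_eqb => //; apply: Ev_rep| |exact: Ev_cst].
apply: Ev_ltb; first exact: Ev_cst.
apply: Ev_sum => [||a ha]; [exact: Ev_sz|exact: q0_sz|].
apply: Ev_sum => [||b hb]; [by apply: Ev_sz => //; ev_var|exact: q0_sz|].
by apply: Ev_eqb; apply: Ev_ag => //; ev_var.
Qed.

Lemma Ev_oddE (pw g : exp false) (u v : nat) : Ev q rho pw u -> Ev q rho g v ->
  Ev q rho (oddE pw g) (odd (v %/ u) : nat).
Proof.
move=> hp hg; rewrite -modn2.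
by apply: Ev_mod; [exact: Ev_div|exact: Ev_cst].
Qed.

End Bodies.

Lemma Ev_degE q rho : genv rho -> q 0 = r0 -> m <= q 1 -> m <= q 2 -> 0 < lim 1 ->
  Ev q rho degE D1.
Proof.
move=> gv q0 hq1 hq2 hl; apply: Ev_add; first exact: Ev_cst.
apply: Ev_max => [||e he]; [exact: Ev_vm|exact: hq1|].
apply: Ev_sum => [||f hf]; [exact: Ev_vm|exact: hq2|].
exact: Ev_adjE.
Qed.

(** The bounds on the ranges are only required in rows that are recoloured; any other row copies its
    colour, and may be charged a constant. *)
Lemma Ev_colE q rho x t c : genv rho -> q 0 = r0 ->
  rho 16 = x -> rho vp = 2 ^ t -> rho vq = t * D1 -> rho vc = c -> rho vD = D1 ->
  x < m -> c < D1 -> 0 < lim 1 -> t * D1 + c < lim 8 ->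
  (odd (x %/ 2 ^ t) && (colt I t x == c) -> D1 <= q 1 /\ 2 * 2 ^ t <= q 2) ->
  Ev q rho colE (collev I t c.+1 (colt I t) x).
Proof.
move=> gv q0 x16 p7 q10 c9 D8 hx hc hl hl8 hq.
have D0 : 0 < D1 by exact: D1_gt0.
have old rho' (g : exp false) (u : nat) : genv rho' -> rho' vq = t * D1 ->
    Ev q rho' g u -> u < m -> Ev q rho' (ECol (V vq) g) (colt I t u).
  move=> gv' q' hg hu.
  have -> : colt I t u = collev I (t * D1 %/ D1) (t * D1 %% D1) (colt I (t * D1 %/ D1)) u.
    by rewrite mulnK // modnMl.
  by apply: Ev_col => //; apply: leq_ltn_trans hl8; exact: leq_addr.
have cur rho' (g : exp false) (u : nat) : genv rho' -> rho' vq = t * D1 -> rho' vc = c ->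
    Ev q rho' g u -> u < m ->
    Ev q rho' (ECol (EAdd (V vq) (V vc)) g) (collev I t c (colt I t) u).
  move=> gv' q' c' hg hu.
  have -> : collev I t c (colt I t) u =
      collev I ((t * D1 + c) %/ D1) ((t * D1 + c) %% D1) (colt I ((t * D1 + c) %/ D1)) u.
    by rewrite divnMDl // modnMDl divn_small // addn0 modn_small.
  by apply: Ev_col => //; apply: Ev_add; ev_var.
have ex : Ev q rho (V 16) x by ev_var.
rewrite /= /colstep; apply: Ev_if => [|pr|_]; last exact: cur.
  apply: Ev_eqb; last exact: Ev_cst.
  apply: Ev_mul; first by apply: Ev_oddE => //; ev_var.
  by apply: Ev_eqb; [exact: old|ev_var].
have [hq1 hq2] : D1 <= q 1 /\ 2 * 2 ^ t <= q 2.
  by apply: hq; move: pr; case: (odd (x %/ 2 ^ t)); case: (colt I t x == c).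
apply: (Ev_let (u := x)); first exact: ex.
apply: Ev_first => [||i|z hz]; [ev_var|exact: hq1|ev_var|].
apply: Ev_eqb; first exact: Ev_cst.
apply: Ev_sum => [||y hy]; [by apply: Ev_mul; [exact: Ev_cst|ev_var]|exact: hq2|].
have pw2 rho' : rho' vp = 2 ^ t -> Ev q rho' (EMul (Cst 2) (V vp)) (2 * 2 ^ t).
  by move=> h; apply: Ev_mul; [exact: Ev_cst|ev_var].
rewrite /conf; set f := x %/ _ * _ + y.
apply: (Ev_let (u := f)).
  apply: Ev_add; last ev_var.
  by apply: Ev_mul; [apply: Ev_div; [ev_var|]|]; exact: pw2.
apply: Ev_if => [|hf|_]; [by apply: Ev_ltb; [ev_var|exact: Ev_vm]| |exact: Ev_cst].
apply: Ev_if => [|_|_]; [by apply: Ev_eqb; [apply: cur => //|]; ev_var| |exact: Ev_cst].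
apply: Ev_if => [|_|_]; [|by apply: Ev_adjE|exact: Ev_cst].
apply: Ev_eqb; first exact: Ev_cst.
apply: Ev_mul; first by apply: Ev_oddE; ev_var.
have -> : (c <= colt I t f) = (c < colt I t f + 1) by rewrite addn1 ltnS.
apply: Ev_ltb; first ev_var.
by apply: Ev_add; [apply: old => //; ev_var|exact: Ev_cst].
Qed.

Section Phase.
Context (q : nat -> nat) (c : nat).
Hypothesis q0 : q 0 = r0.
Hypothesis m_q1 : m <= q 1.
Hypothesis lim1 : 0 < lim 1.
Hypothesis lim8 : L * D1 < lim 8.
Hypothesis lim10 : c < lim 10.
Notation own := (ow I fcol c).

Definition phase_env rho := [/\ genv rho, rho vq = L * D1 & rho vc = c].

Lemma Ev_activeE rho v x : phase_env rho -> rho v = x -> x < m ->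
  Ev q rho (activeE' v) (active I fcol c x : nat).
Proof.
move=> [gv q10 c9] vx hx.
have ex : Ev q rho (V v) x by ev_var.
have -> : (active I fcol c x : nat) = (rep I x == x) * ((0 < sz x) * (fcol x == c)).
  by rewrite /active !mulnb.
apply: Ev_mul; first by apply: Ev_eqb => //; apply: Ev_rep.
apply: Ev_mul; first by apply: Ev_ltb; [exact: Ev_cst|exact: Ev_sz].
apply: Ev_eqb; last ev_var.
have -> : fcol x = collev I (L * D1 %/ D1) (L * D1 %% D1) (colt I (L * D1 %/ D1)) x.
  by rewrite mulnK // modnMl.
by apply: Ev_col => //; ev_var.
Qed.

Lemma Ev_bvalE rho x i j i' j' : phase_env rho -> rho 16 = x -> rho i = i' -> rho j = j' ->
  i \in [:: 27; 28; 29; 30] -> j \in [:: 27; 28; 29; 30] ->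
  x < m -> i' < sz x -> j' < sz x ->
  Ev q rho (bvalE' i j) (bval I own (ag x i') (ag x j')).
Proof.
move=> [gv q10 c9] x16 ei ej hi hj hx hi' hj'.
have upd1 u v w : w \in [:: 27; 28; 29; 30] -> upd (upd rho 33 u) 34 v w = rho w.
  by rewrite !inE => /or4P[] /eqP ->.
have upd0 u w : w \in [:: 27; 28; 29; 30] -> upd rho 33 u w = rho w.
  by rewrite !inE => /or4P[] /eqP ->.
apply: Ev_rsum => [||g hg]; [exact: Ev_vm|exact: m_q1|].
apply: Ev_if => [|_|_]; last exact: Ev_rz.
  apply: Ev_eqb; first by apply: Ev_own => //; ev_var.
  apply: Ev_add; last exact: Ev_cst.
  by apply: Ev_ag => //; apply: Ev_v => //; rewrite upd0.
apply: Ev_rsum => [||t ht]; [by apply: Ev_sz => //; ev_var|exact: q0_sz|].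
apply: Ev_if => [|_|_]; [|by apply: Ev_vl => //; ev_var|exact: Ev_rz].
by apply: Ev_eqb; apply: Ev_ag => //; apply: Ev_v => //; rewrite upd1.
Qed.

Lemma Ev_violE rho x z t t' : phase_env rho -> rho 16 = x -> rho 20 = sz x -> rho 24 = z ->
  rho 25 = t -> rho 26 = t' -> x < m -> 0 < sz x -> t < sz x -> t' < sz x ->
  Ev q rho violE (viol I own x z t t').
Proof.
move=> pe x16 K20 z24 t25 t26 hx K0 ht ht'; rewrite /viol.
set K := sz x; have KX : K <= q 0 by exact: q0_sz.
have dK d a : dig K d a < K by exact: dig_lt.
have edig rho' v w (d a : exp false) : rho' 20 = K -> Ev q rho' d v -> Ev q rho' a w -> w < K ->
    Ev q rho' (EDig (V 20) d a) (dig K v w).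
  move=> h hd ha hw; apply: Ev_dig => [i||||] //.
  by apply: leq_trans KX; exact: ltnW.
have eord rho' : rho' 20 = K -> rho' 24 = z ->
    Ev q rho' (EDiv (V 24) (EPow (V 20) (V 20))) (z %/ K ^ K).
  by move=> h1 h2; apply: Ev_div; [ev_var|apply: Ev_pow => [i||]; [ev_var|ev_var|]].
apply: (Ev_let (u := dig K (z %/ K ^ K) t)); first by apply: edig => //; exact: eord.
apply: (Ev_let (u := dig K (z %/ K ^ K) t')); first by apply: edig => //; exact: eord.
apply: (Ev_let (u := dig K z (dig K (z %/ K ^ K) t'))); first by apply: edig => //; ev_var.
apply: (Ev_let (u := dig K z (dig K (z %/ K ^ K) t))); first by apply: edig => //; ev_var.
apply: Ev_lt => [||_|_]; [ev_var|ev_var| |].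
  apply: Ev_if => [|_|_]; [by apply: Ev_eqb; ev_var|exact: Ev_cst|].
  apply: Ev_if => [|_|_]; [by apply: Ev_eqb; ev_var|exact: Ev_cst|].
  by apply: Ev_le => [||_|_]; [exact: Ev_bvalE|exact: Ev_bvalE|exact: Ev_cst|exact: Ev_cst].
apply: Ev_if => [|_|_]; [by apply: Ev_eqb; ev_var| |exact: Ev_cst].
by apply: Ev_le => [||_|_]; [exact: Ev_bvalE|exact: Ev_bvalE|exact: Ev_cst|exact: Ev_cst].
Qed.

Lemma Ev_bestE rho x : phase_env rho -> rho 16 = x -> x < m -> 0 < sz x ->
  Ev q rho bestE (best I own x).
Proof.
move=> pe x16 hx K0; have KX : sz x <= q 0 by exact: q0_sz.
apply: (Ev_let (u := sz x)); first by apply: Ev_sz => //; ev_var.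
apply: (Ev_let (u := ncode I x)).
  by apply: Ev_mul; apply: Ev_pow => [i||] //; ev_var.
apply: Ev_first => [||i|z hz]; [ev_var|by rewrite q0 r0_ncode|ev_var|].
apply: Ev_eqb; first exact: Ev_cst.
apply: Ev_sum => [||t ht]; [ev_var|exact: KX|].
apply: Ev_sum => [||t' ht']; [ev_var|exact: KX|].
exact: Ev_violE.
Qed.

Hypothesis lim9 : c < lim 9.

Lemma Ev_movedE rho u : phase_env rho -> rho 23 = u ->
  Ev q rho movedE (moved I fcol c (best I own) u).
Proof.
move=> pe u23; have [gv q10 c9] := pe.
apply: Ev_max => [||e he]; [exact: Ev_vm|exact: m_q1|].
apply: Ev_if => [|act|_]; [by apply: Ev_activeE| |exact: Ev_cst].
have [_ s0 _] := activeE act.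
apply: Ev_max => [||a ha]; [by apply: Ev_sz => //; ev_var|exact: q0_sz|].
apply: Ev_if => [|_|_]; last exact: Ev_cst.
  apply: Ev_eqb; last ev_var; apply: Ev_add; last exact: Ev_cst.
  apply: Ev_ag => //; last exact: dig_lt.
  apply: Ev_dig => [i||||]; [by apply: Ev_sz => //; ev_var|by apply: Ev_sz => //; ev_var| |ev_var|].
    by apply: Ev_best => //; ev_var.
  by apply: ltnW; apply: leq_trans ha _; exact: q0_sz.
by apply: Ev_add; [apply: Ev_ag => //; ev_var|exact: Ev_cst].
Qed.

Lemma Ev_ownE rho x : phase_env rho -> rho 16 = x -> x < m -> 0 < lim 7 ->
  Ev q rho ownE (ow I fcol c.+1 x).
Proof.
move=> pe x16 hx hl7; have [gv q10 c9] := pe; rewrite /= /ownstep.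
have rl := rep_lt hx; have xX : sz x <= q 0 by exact: q0_sz.
apply: (Ev_let (u := rep I x)); first by apply: Ev_rep => //; ev_var.
apply: Ev_if => [|act|_]; first by apply: Ev_activeE.
  have [rr_ s0 _] := activeE act; have s0' : 0 < sz x by rewrite -(sz_rep hx).
  apply: Ev_add; last exact: Ev_cst.
  have ex : Ev q (upd rho 20 (rep I x)) (V 16) x by ev_var.
  apply: Ev_ag => //; last exact: rr_lt.
  apply: Ev_rr => //.
    apply: Ev_div; first by apply: Ev_best => //; ev_var.
    by apply: Ev_pow => [i||] //; apply: Ev_sz => //; ev_var.
  rewrite ltn_divLR ?expn_gt0 ?s0' //.
  by have := best_lt own s0; rewrite /ncode sz_rep.
apply: (Ev_let (u := own x)); first by apply: Ev_own => //; ev_var.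
apply: (Ev_let (u := moved I fcol c (best I own) (own x))); first by apply: Ev_movedE.
by apply: Ev_if => [|_|_]; [apply: Ev_eqb; [|exact: Ev_cst]| |]; ev_var.
Qed.

End Phase.

Lemma Ev_outE q rho z : genv rho -> rho 18 = z -> rho vD = D1 -> z < m -> D1 < lim 10 ->
  Ev q rho outE (ow I fcol D1 z - 1).
Proof.
by move=> gv z18 D8 hz hl; apply: Ev_sub; [apply: Ev_own => //; ev_var|exact: Ev_cst].
Qed.

End Evaluations.

(** * Running the program *)

Fixpoint smax (f : exp false -> nat) (st : stmt) : nat :=
  match st with
  | SLet _ e | SDo e => f e
  | SSeq a b | SIf _ _ a b => maxn (smax f a) (smax f b)
  | SWhile _ _ a => smax f a
  end.

(** * Sizes of the tables, of their entries and of the constant ranges *)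

Section Bounds.
Context (R : realType) (I : inst R).
Hypothesis wfI : wf_inst I.
Notation m := (nG I).
Notation n := (nA I).
Notation D1 := (D1 I).
Context (r : nat).
Hypothesis sz_le : forall g, g < m -> sz I g <= r.
Hypothesis r_gt0 : 0 < r.
Hypothesis r_n : r <= n.
Hypothesis m_gt0 : 0 < m.

Definition L := up_log 2 m.
Definition X := n + m + 2.
(** Exceeds the number of states of a round robin, at most [r * (m + 2) ^ r], and all the addresses
    of the input, which are below [X ^ 2]. *)
Definition H := X ^ (r + 2).
(** Exponent for stored words: exchange codes are below [r ^ (2 * r)], states below [H], and the
    words of the input below [X ^ 2]. *)
Definition dm := 2 * r + 2.
(** Bounds the ranges with the tag 0: the exchange codes, the agents of a hyperedge, and the [r + 2]
    factors of [H]. *)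
Definition r0 := r ^ r * r ^ r + r + 2.
Notation fcol := (colt I L).

Lemma X_gt1 : 1 < X.
Proof. by rewrite /X addn2. Qed.

Lemma leX a b : a <= b -> X ^ a <= X ^ b.
Proof. by move=> h; rewrite leq_pexp2l // ltnW // X_gt1. Qed.

Lemma ltX1 a b : a < X -> 0 < b -> a < X ^ b.
Proof. by move=> h b0; apply: leq_trans h _; rewrite -{1}(expn1 X); apply: leX. Qed.

Lemma H_gt0 : 0 < H.
Proof. by rewrite expn_gt0 ltnW // X_gt1. Qed.

Lemma leq_expl a b c : a <= b -> a ^ c <= b ^ c.
Proof. by move=> h; case: c => // c; rewrite leq_exp2r. Qed.

Lemma pow_mono a b c d : 0 < b -> a <= b -> c <= d -> a ^ c <= b ^ d.
Proof.
move=> b0 ab cd; apply: leq_trans (leq_expl c ab) _; exact: leq_pexp2l.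
Qed.

Lemma m_2L : m <= 2 ^ L.
Proof. by rewrite /L up_logP. Qed.

Lemma D1_le : D1 <= m.
Proof.
rewrite /Submission.D1 add1n -(prednK m_gt0) ltnS; apply/bigmax_leqP_seq => e.
rewrite mem_index_iota prednK //= => he _.
rewrite (bigD1_seq e) ?mem_index_iota ?iota_uniq //= adj_irr add0n.
apply: (@leq_trans (\sum_(0 <= f < m | f != e) 1)); first by apply: leq_sum => f _; case: adj.
rewrite sum1_count; have := count_predC (pred1 e) (index_iota 0 m).
rewrite count_uniq_mem ?iota_uniq // mem_index_iota he size_iota subn0 /=.
by rewrite (eq_count (a2 := fun f => f != e)) //; clear; lia.
Qed.

Lemma states_le x : x < m -> sz I x * base I x ^ sz I x <= r * (m + 2) ^ r.
Proof.
move=> hx; apply: leq_mul; first exact: sz_le.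
by apply: pow_mono; rewrite ?sz_le ?addn2 // /base addn2 !ltnS cnt_le.
Qed.

Lemma orders_le x : x < m -> sz I x ^ sz I x <= r ^ r.
Proof. by move=> hx; apply: pow_mono => //; exact: sz_le. Qed.

Lemma states_H : r * (m + 2) ^ r < H.
Proof.
rewrite /H (addn2 r) !expnS; have rX : r < X by rewrite /X; move: r_n; clear; lia.
have p : 0 < X ^ r by rewrite expn_gt0 ltnW // X_gt1.
apply: (@leq_trans (X * X ^ r)); last by rewrite leq_pmull // ltnW // X_gt1.
apply: (@leq_ltn_trans (r * X ^ r)); last by rewrite ltn_mul2r p.
by rewrite leq_mul2l; apply/orP; right; apply: leq_expl; rewrite /X; clear; lia.
Qed.

Lemma orders_X : r ^ r < X ^ r.
Proof. by rewrite ltn_exp2r // /X; move: r_n; clear; lia. Qed.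

Lemma m_H : m < H.
Proof. by apply: ltX1; rewrite /X; clear; lia. Qed.

Lemma rr_states : r ^ r < H.
Proof. by apply: leq_trans orders_X _; apply: leX; clear; lia. Qed.

Lemma r0_sz g : g < m -> sz I g <= r0.
Proof. by move=> hg; apply: leq_trans (sz_le hg) _; rewrite /r0; clear; lia. Qed.

Lemma ncode_le g : g < m -> ncode I g <= r ^ r * r ^ r.
Proof. by move=> hg; apply: leq_mul; exact: orders_le. Qed.

Lemma r0_ncode g : g < m -> ncode I g <= r0.
Proof. by move=> hg; apply: leq_trans (ncode_le hg) _; rewrite /r0; clear; lia. Qed.

Lemma r0_orders : r ^ r <= r0.
Proof.
have : 0 < r ^ r by rewrite expn_gt0 r_gt0.
by rewrite /r0; clear; nia.
Qed.

Lemma dom_lt id t x y z : dom I L id t x y z -> [/\ x < H, y < H & z < H].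
Proof.
have H0 := H_gt0; have mH := m_H; have rH := rr_states; have sH := states_H.
have oH a : a < m -> sz I a ^ sz I a < H by move=> /orders_le h; exact: leq_ltn_trans h rH.
have szH a : a < m -> sz I a < H.
  move=> ha; apply: leq_ltn_trans rH; apply: leq_trans (sz_le ha) _.
  by rewrite -{1}(expn1 r) leq_pexp2l.
have stH a : a < m -> sz I a * base I a ^ sz I a < H.
  by move=> /states_le h; exact: leq_ltn_trans h sH.
have cH a : a < m -> cnt I a < H by move=> _; apply: leq_ltn_trans (cnt_le I a) mH.
move: id => [|[|[|[|[|[|[|[|[|[|[|id]]]]]]]]]]] /=.
- by move=> /and3P[/eqP-> /eqP-> h]; split=> //; exact: ltn_trans h mH.
- by move=> /and3P[h /eqP-> /eqP->]; split=> //; exact: ltn_trans h mH.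
- by move=> /and3P[h /eqP-> /eqP->]; split=> //; exact: ltn_trans h mH.
- move=> /and3P[h h2 /eqP->]; split=> //; first exact: ltn_trans h mH.
  exact: ltn_trans h2 (szH _ h).
- move=> /and4P[h _ h2 h3]; split; first exact: ltn_trans h mH.
    exact: ltn_trans h2 (szH _ h).
  exact: ltn_trans h3 (cH _ h).
- move=> /and4P[h _ h2 h3]; split; first exact: ltn_trans h mH.
    exact: ltn_trans h2 (oH _ h).
  exact: ltn_trans h3 (stH _ h).
- move=> /and4P[h _ h2 h3]; split; first exact: ltn_trans h mH.
    exact: ltn_trans h2 (oH _ h).
  exact: ltn_trans h3 (cH _ h).
- move=> /and4P[h _ h2 /eqP->]; split=> //; first exact: ltn_trans h mH.
  exact: ltn_trans h2 (oH _ h).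
- by move=> /and3P[h /eqP-> /eqP->]; split=> //; exact: ltn_trans h mH.
- by move=> /and4P[h _ /eqP-> /eqP->]; split=> //; exact: ltn_trans h mH.
- by move=> /and3P[h /eqP-> /eqP->]; split=> //; exact: ltn_trans h mH.
by move=> /and3P[/eqP-> /eqP-> h]; split=> //; exact: ltn_trans h mH.
Qed.

Lemma collev_lt t c x : x < m -> collev I t c (colt I t) x < D1.
Proof.
by move=> hx; have [h1 h2] := colt_proper I t; have [h _] := level_proper h1 h2 c; exact: h.
Qed.

Lemma col_fair c : fair I fcol c (ow I fcol c).
Proof.
apply: ow_fair => // e f he hf ad; exact: colt_final m_2L he hf ad.
Qed.

Lemma G_lt id t x y z : dom I L id t x y z -> G I L id t x y z < X ^ dm.
Proof.
have mX : m < X ^ dm by apply: ltX1; rewrite /X /dm; clear; lia.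
have nX : n < X ^ dm by apply: ltX1; rewrite /X /dm; clear; lia.
have stX a : a < m -> sz I a * base I a ^ sz I a <= X ^ dm.
  move=> /states_le h; apply: leq_trans h _; apply: leq_trans (ltnW states_H) _.
  by apply: leX; rewrite /dm; clear; lia.
have b0 a : 0 < base I a by rewrite /base addn2.
have own c g : g < m -> ow I fcol c g < X ^ dm.
  by move=> hg; apply: leq_ltn_trans nX; have [h _ _] := col_fair c; exact: h.
have nxt_ok k a o s : isclass I a -> a < m -> s < sz I a * base I a ^ sz I a ->
    iter k (nxt I a o) s < X ^ dm.
  move=> /andP[/eqP ra s0] ha hs; apply: leq_trans (stX _ ha).
  exact: (iter_nxt_lt o ha ra s0).
move: id => [|[|[|[|[|[|[|[|[|[|[|id]]]]]]]]]]] /=.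
- by move=> /and3P[_ _ h]; apply: (@leq_ltn_trans (ow I fcol D1 z)); [exact: leq_subr|exact: own].
- by move=> /and3P[h _ _]; apply: ltn_trans (rep_lt h) mX.
- by move=> _; exact: leq_ltn_trans (cnt_le I x) mX.
- move=> /and3P[h _ _]; apply: ltn_trans mX.
  exact: leq_trans (place_lt y h) (cnt_le I x).
- by move=> /and4P[h /eqP rx _ hz]; apply: ltn_trans mX; have [] := slP y h rx hz.
- by move=> /and4P[h cl _ hz]; exact: nxt_ok.
- move=> /and4P[h cl _ _]; apply: nxt_ok => //.
  by case/andP: cl => _ s0; rewrite muln_gt0 s0 expn_gt0 b0.
- move=> /and4P[h s0 _ _]; apply: ltn_trans (rr_lt y s0) _.
  apply: leq_ltn_trans (sz_le h) _; exact: leq_ltn_trans r_n nX.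
- by move=> /and3P[h _ _]; apply: ltn_trans mX; apply: leq_trans D1_le; exact: collev_lt.
- move=> /and4P[h act _ _]; have [_ s0 _] := activeE act; apply: leq_trans (best_lt _ s0) _.
  apply: leq_trans (ncode_le h) _; rewrite -expnD.
  apply: leq_trans (_ : X ^ (r + r) <= _); last by apply: leX; rewrite /dm; clear; lia.
  by apply: leq_expl; rewrite /X; move: r_n; clear; lia.
- by move=> /and3P[h _ _]; exact: own.
by move=> /and3P[_ _ h]; apply: (@leq_ltn_trans (ow I fcol D1 z)); [exact: leq_subr|exact: own].
Qed.

End Bounds.

(** * Triples of the tables and of the loops *)

Section Running.
Context (R : realType) (P : program) (I : inst R).
Hypothesis wfI : wf_inst I.
Notation m := (nG I).
Notation n := (nA I).
Notation D1 := (D1 I).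
Notation sz := (sz I).
Context (r : nat).
Hypothesis sz_le : forall g, g < m -> sz g <= r.
Hypothesis r_gt0 : 0 < r.
Hypothesis r_n : r <= n.
Hypothesis m_gt0 : 0 < m.
Notation L := (L I).
Notation X := (X I).
Notation H := (H I r).
Notation dm := (dm r).
Notation r0 := (r0 r).
Notation G := (G I L).
Notation dom := (dom I L).
Notation fcol := (fcol I L).

Context (rm : nat -> R).
Hypothesis rm_vl : forall g a, g < m -> a < sz g -> rm (off I g + a) = vl I g a.
Context (lm W Kc Dc : nat).
Hypothesis lm_r0 : r0 <= 2 ^ lm.
Hypothesis lm_m : 4 * m <= 2 ^ lm.
Hypothesis lm_states : r * (m + 2) ^ r <= 2 ^ lm.

(** The largest value of a variable is the address [11 * H ^ 3] of the output, where [11 < X ^ 4]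
    and [H ^ 3 = X ^ (3 * r + 6)]. *)
Definition dvc := 3 * r + 10.
Definition dv (x : nat) := dvc.

Definition fits st := [/\ X ^ smax (@mdeg dm r0 dv false) st <= W,
  r0.+1 * (smax (@wkb r0 false) st + 200) <= Kc & smax (@dpb 1 false) st * lm.+1 + 2 <= Dc].

Let X1 : 1 < X := X_gt1 I.
Notation tr := (triple P W rm).
Notation contents := (contents I L X dm H).
Notation genv := (genv I H).

Lemma fits_max a b st : smax^~ st =1 (fun f => maxn (smax f a) (smax f b)) ->
  fits st -> fits a /\ fits b.
Proof.
move=> E [h1 h2 h3]; rewrite !E in h1 h2 h3.
have l1 f : smax f a <= maxn (smax f a) (smax f b) by exact: leq_maxl.
have l2 f : smax f b <= maxn (smax f a) (smax f b) by exact: leq_maxr.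
split; split.
- by apply: leq_trans h1; apply: leX.
- by apply: leq_trans h2; rewrite leq_mul2l leq_add2r l1 orbT.
- by apply: leq_trans h3; rewrite leq_add2r leq_mul2r l1 orbT.
- by apply: leq_trans h1; apply: leX.
- by apply: leq_trans h2; rewrite leq_mul2l leq_add2r l2 orbT.
- by apply: leq_trans h3; rewrite leq_add2r leq_mul2r l2 orbT.
Qed.

Lemma fits_seq a b : fits (SSeq a b) -> fits a /\ fits b.
Proof. exact: fits_max. Qed.

Lemma fits_if x y a b : fits (SIf x y a b) -> fits a /\ fits b.
Proof. exact: fits_max. Qed.

Definition bnd (rho : nat -> nat) := forall x, rho x < X ^ dvc.

Lemma bnd_upd rho x v : bnd rho -> v < X ^ dvc -> bnd (upd rho x v).
Proof. by move=> b hv y; rewrite /upd; case: eqP. Qed.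

Lemma t_letq x e F b1 b2 v rho mem (Q : _ -> _ -> Prop) : isvar x -> wf e -> pure e ->
  0 < b1 <= 2 ^ lm -> 0 < b2 <= 2 ^ lm ->
  fits (SLet x e) -> bnd rho -> Ev mem rm X dm F (qv r0 b1 b2) rho e v ->
  Q (upd rho x v) mem ->
  tr (SLet x e) rho mem Q (Kc * (b1 ^ nest 1 e * b2 ^ nest 2 e)) Dc.
Proof.
move=> vx we pe /andP[b10 b1l] /andP[b20 b2l] [/= f1 f2 f3] bd [ev o] q.
have pr : pre_exp W X dm r0 lm rm dv F e rho mem.
  split=> //.
  - by apply: ok_mono o => -[|[|[|g]]]; rewrite /qmax //= ?expn_gt0.
  - by rewrite (wr_pure _ _ _ pe).
  - by rewrite (wr_pure _ _ _ pe).
apply: t_weaken (t_let (P := P) (Q := Q) X1 lm_r0 vx pe pr _) _ _ _ => //.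
- by rewrite ev.
- have := @wk_wkb _ _ _ _ _ _ (qv r0 b1 b2) rho _ e b10 b20 we (@qv_other _ _ _) o.
  rewrite /=; set q' := b1 ^ _ * _; have : 0 < q' by rewrite muln_gt0 !expn_gt0 b10 b20.
  move: f2; clear; nia.
- by apply: leq_trans f3; rewrite leq_add2r dpb_linear.
Qed.

Lemma t_set x e F v rho mem (Q : _ -> _ -> Prop) : isvar x -> flat e ->
  fits (SLet x e) -> bnd rho -> Ev mem rm X dm F (qv r0 1 1) rho e v ->
  Q (upd rho x v) mem -> tr (SLet x e) rho mem Q Kc Dc.
Proof.
move=> vx /and4P[we pe /eqP n1 /eqP n2] f bd ev q.
have p1 : 0 < 1 <= 2 ^ lm by rewrite expn_gt0.
by have := t_letq vx we pe p1 p1 f bd ev q; rewrite n1 n2 !muln1.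
Qed.

Lemma fresh_reg id0 (lim : nat -> nat) : 0 < id0 < 16 -> forall id t, 0 < id < 16 -> t < lim id ->
  id + 16 * t != id0 + 16 * lim id0.
Proof.
move=> h0 id t h lt; apply/eqP => E.
have Ei : id = id0 by move: h h0 E; clear; lia.
by move: E lt; rewrite Ei; clear; lia.
Qed.

Lemma reg_gt0 id0 t : 0 < id0 < 16 -> 0 < id0 + 16 * t.
Proof. by clear; lia. Qed.

(** Fills the next version [lim id] of the family [id]. Its region is fresh, so all the tables known
    so far stay readable and remain valid afterwards. *)
Lemma t_table id tE N1 g N2 N3 E rho mem lim (n1 : nat) (gx : nat -> bool)
    (n2 n3 b1 b2 : nat -> nat) (Q : _ -> _ -> Prop) :
  let q x := qv r0 (b1 x) (b2 x) in
  let F a := region H a != id + 16 * lim id in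
  let T := tabE (EReg id tE) N1 g N2 N3 E in
  let rho3 x y z := upd (upd (upd rho 16 x) 17 y) 18 z in
  tab_wf (EReg id tE) N1 g N2 N3 E -> fits (SDo T) -> bnd rho -> genv rho ->
  contents lim mem -> 0 < id < 16 ->
  (forall x, 0 < b1 x <= 2 ^ lm) -> (forall x, 0 < b2 x <= 2 ^ lm) ->
  Ev mem rm X dm F (q 0) rho N1 n1 -> n1 <= m ->
  (forall x, x < n1 -> Ev mem rm X dm F (q x) (upd rho 16 x) g (gx x : nat)) ->
  (forall x, x < n1 -> gx x ->
     Ev mem rm X dm F (q x) (upd rho 16 x) N2 (n2 x) /\ n2 x <= r ^ r) ->
  (forall x y, x < n1 -> gx x -> y < n2 x ->
     Ev mem rm X dm F (q x) (upd (upd rho 16 x) 17 y) N3 (n3 x) /\ n3 x <= r * (m + 2) ^ r) ->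
  (forall x y z, x < n1 -> gx x -> y < n2 x -> z < n3 x ->
     Ev mem rm X dm F (q x) (rho3 x y z) tE (lim id) /\
     Ev mem rm X dm F (q x) (rho3 x y z) E (G id (lim id) x y z)) ->
  (forall x y z, dom id (lim id) x y z -> [/\ x < n1, gx x, y < n2 x & z < n3 x]) ->
  (forall mem', contents (upd lim id (lim id).+1) mem' -> Q rho mem') ->
  tr (SDo T) rho mem Q
    (Kc * (\sum_(0 <= x < n1)
       (1 + gx x * (n3 x * (b1 x ^ nest 1 E * b2 x ^ nest 2 E))) + 1)) Dc.
Proof.
move=> q F T rho3 twf [/= f1 f2 f3] bd [rm_ rH] ct id16 hb1 hb2 EN1 n1m Eg EN2 EN3 EE hd hQ.
have mH := m_H I r.
have rH' := @rr_states R I r r_gt0 r_n.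
have sH := @states_H R I r r_n.
have := @t_tab R P W X dm r0 lm rm dv H X1 lm_r0 (id + 16 * lim id) (EReg id tE)
  N1 g N2 N3 E rho mem n1 (fun x => gx x : nat) n2 n3 b1 b2 (G id (lim id)) Q twf.
move=> /(_ _ bd rH hb1 hb2 EN1) tt; apply: t_weaken (tt _ _ _ _ _ _ _) _ _ _ => //.
- by apply: leq_trans n1m (leq_trans _ lm_m); rewrite leq_pmull.
- move=> x hx; split; last exact: Eg.
  by apply: leq_ltn_trans mH; apply: leq_trans n1m; exact: ltnW.
- move=> x hx; rewrite lt0b => hg; have [h h'] := EN2 x hx hg; split=> //.
  by apply: leq_trans h' _; exact: r0_orders.
- move=> x y hx; rewrite lt0b => hg hy; have [h h'] := EN3 x y hx hg hy; split.
    by apply: leq_trans hy _; have [_ h2] := EN2 x hx hg; apply: leq_trans h2 (ltnW rH').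
  by split=> //; apply: leq_trans h' lm_states.
- move=> x y z hx; rewrite lt0b => hg hy hz; have [h h'] := EE x y z hx hg hy hz; split.
    by apply: leq_trans hz _; have [_ h3] := EN3 x y hx hg hy; apply: leq_trans h3 (ltnW sH).
  by split=> //; exact: Ev_reg.
- move=> mem' fr cells; apply: hQ; case: ct => c1 c2 c3 c4.
  have reg0 a : a < H -> region H a != id + 16 * lim id.
    by move=> ha; rewrite /region (divn_small ha) !div0n eq_sym -lt0n reg_gt0.
  split.
  - by move=> k hk; have [<- lt] := c1 k hk; split=> //; apply: fr; exact: reg0.
  - by move=> h a hh ha; have [<- lt] := c2 h a hh ha; split=> //; apply: fr; exact: reg0.
  - by move=> a ha; rewrite fr ?c3 //; exact: reg0.
  move=> id' t' x y z id'16 ht' hdom.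
  have [l1 l2 l3] := dom_lt sz_le r_gt0 r_n hdom.
  (* Equal region numbers force equal families and versions, both families being below 16. *)
  case: (eqVneq (id' + 16 * t') (id + 16 * lim id)) => [E0|ne]; last first.
    rewrite fr ?region_addr // c4 //.
    move: ht' ne; rewrite /upd; case: eqP => // -> lt ne.
    by move: lt ne; rewrite ltnS leq_eqVlt => /orP[/eqP -> /eqP|].
  have Ei : id' = id by move: id16 id'16 E0; clear; lia.
  have Et : t' = lim id by move: E0; rewrite Ei; clear; lia.
  move: hdom; rewrite Ei Et => /hd[h1 h2 h3 h4]; apply: cells => //.
  by rewrite lt0b.
- rewrite (eq_bigr (fun x => 1 + gx x * (n3 x * (b1 x ^ nest 1 E * b2 x ^ nest 2 E)))); last first.
    by move=> x _; rewrite lt0b.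
  rewrite leq_mul2r; apply/orP; right; apply: leq_trans f2.
  rewrite /tab_cost leq_mul2l; apply/orP; right.
  by rewrite /T /tabE /=; clear; lia.
- apply: leq_trans f3; apply: leq_trans (dpb_linear _ _) _.
  exact: leq_addr.
Qed.

Lemma ct_weaken lim lim' mem : contents lim mem -> (forall id, lim' id <= lim id) ->
  contents lim' mem.
Proof.
move=> [c1 c2 c3 c4] le; split=> // id t x y z h ht; apply: c4 => //.
exact: leq_trans ht (le id).
Qed.


Let dl := dom_lt sz_le r_gt0 r_n.
Let gl := G_lt wfI sz_le r_gt0 r_n m_gt0.
Let h0 : 0 < H := H_gt0 I r.
Let rs := r0_sz sz_le.
Let rc : forall g, g < m -> ncode I g <= r0.
Proof. by apply: r0_ncode. Qed.
Let one_lm : 0 < 1 <= 2 ^ lm.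
Proof. by rewrite expn_gt0. Qed.
Let m_lm : 0 < m <= 2 ^ lm.
Proof. by rewrite m_gt0 (leq_trans _ lm_m) // leq_pmull. Qed.
Let one_orders : 1 <= r ^ r.
Proof. by rewrite expn_gt0 r_gt0. Qed.
Let one_states : 1 <= r * (m + 2) ^ r.
Proof. by rewrite muln_gt0 r_gt0 expn_gt0 addn2. Qed.

Lemma fresh_gt0 id0 lim : 0 < id0 < 16 ->
  (forall id t, 0 < id < 16 -> t < lim id -> id + 16 * t != id0 + 16 * lim id0) /\
  0 < id0 + 16 * lim id0.
Proof. by move=> h; split; [exact: fresh_reg|exact: reg_gt0]. Qed.

Let Evm q rho mem F : genv rho -> Ev mem rm X dm F q rho (V vm) m.
Proof. by case=> + _; exact: Ev_var. Qed.



Let m_states : m <= r * (m + 2) ^ r.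
Proof.
apply: leq_trans (leq_pmull _ r_gt0); apply: leq_trans (leq_addr 2 m) _.
by rewrite -{1}(expn1 (m + 2)) leq_pexp2l // addn2.
Qed.

Definition wtab (f : nat -> nat) := Kc * (\sum_(0 <= x < m) (1 + f x) + 1).

Lemma wtab_le (g f : nat -> nat) : (forall x, x < m -> g x <= f x) ->
  Kc * (\sum_(0 <= x < m) (1 + g x) + 1) <= wtab f.
Proof.
move=> h; rewrite leq_mul2l leq_add2r; apply/orP; right.
rewrite big_nat_cond [leqRHS]big_nat_cond; apply: leq_sum => x.
by rewrite andbT => /= hx; rewrite leq_add2l h.
Qed.

Lemma t_rep rho mem lim (Q : _ -> _ -> Prop) : fits repS -> bnd rho -> genv rho ->
  contents lim mem -> lim 1 = 0 ->
  (forall mem', contents (upd lim 1 1) mem' -> Q rho mem') ->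
  tr repS rho mem Q (wtab (fun=> m)) Dc.
Proof.
move=> f bd gv ct l1 q; have id16 : 0 < 1 < 16 by [].
have [fr rg] := fresh_gt0 lim id16; have [[twf _ _ _ _] _] := tables_wf.
apply: t_weaken (t_table (Q := Q) (n1 := m) (gx := xpredT) (n2 := fun=> 1) (n3 := fun=> 1)
  (b1 := fun=> m) (b2 := fun=> 1) twf f bd gv ct id16 (fun=> m_lm) (fun=> one_lm) (Evm _ _ _ gv) (leqnn m)
  _ _ _ _ _ _) (fun _ _ h => h) _ (leqnn _).
- by move=> x _; exact: Ev_cst.
- by move=> x _ _; split=> //; exact: Ev_cst.
- by move=> x y _ _ _; split=> //; exact: Ev_cst.
- move=> x y z hx _ _ _; split; first by rewrite l1; exact: Ev_cst.
  by apply: Ev_repE; try exact: ct; first [done | exact: rs | exact: Ev_var].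
- by move=> x y z /and3P[hx /eqP-> /eqP->].
- by move: q; rewrite l1.
- by apply: wtab_le => x _; rewrite !mul1n muln1 expn1.
Qed.

Lemma t_cnt rho mem lim (Q : _ -> _ -> Prop) : fits cntS -> bnd rho -> genv rho ->
  contents lim mem -> lim 2 = 0 -> 0 < lim 1 ->
  (forall mem', contents (upd lim 2 1) mem' -> Q rho mem') ->
  tr cntS rho mem Q (wtab (fun=> m)) Dc.
Proof.
move=> f bd gv ct l2 l1 q; have id16 : 0 < 2 < 16 by [].
have [fr rg] := fresh_gt0 lim id16; have [[_ twf _ _ _] _] := tables_wf.
apply: t_weaken (t_table (Q := Q) (n1 := m) (gx := xpredT) (n2 := fun=> 1) (n3 := fun=> 1)
  (b1 := fun=> m) (b2 := fun=> 1) twf f bd gv ct id16 (fun=> m_lm) (fun=> one_lm) (Evm _ _ _ gv) (leqnn m)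
  _ _ _ _ _ _) (fun _ _ h => h) _ (leqnn _).
- by move=> x _; exact: Ev_cst.
- by move=> x _ _; split=> //; exact: Ev_cst.
- by move=> x y _ _ _; split=> //; exact: Ev_cst.
- move=> x y z hx _ _ _; split; first by rewrite l2; exact: Ev_cst.
  by apply: Ev_cntE; try exact: ct; first [done | exact: rs | exact: Ev_var].
- by move=> x y z /and3P[hx /eqP-> /eqP->].
- by move: q; rewrite l2.
- by apply: wtab_le => x _; rewrite !mul1n muln1 expn1.
Qed.

Lemma t_rank rho mem lim (Q : _ -> _ -> Prop) : fits placeS -> bnd rho -> genv rho ->
  contents lim mem -> lim 3 = 0 -> 0 < lim 1 ->
  (forall mem', contents (upd lim 3 1) mem' -> Q rho mem') ->
  tr placeS rho mem Q (wtab (fun=> m)) Dc.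
Proof.
move=> f bd gv ct l3 l1 q; have id16 : 0 < 3 < 16 by [].
have [fr rg] := fresh_gt0 lim id16; have [[_ _ twf _ _] _] := tables_wf.
apply: t_weaken (t_table (Q := Q) (n1 := m) (gx := xpredT) (n2 := sz) (n3 := fun=> 1)
  (b1 := fun=> m) (b2 := fun=> 1) twf f bd gv ct id16 (fun=> m_lm) (fun=> one_lm) (Evm _ _ _ gv) (leqnn m)
  _ _ _ _ _ _) (fun _ _ h => h) _ (leqnn _).
- by move=> x _; exact: Ev_cst.
- move=> x hx _; split; first by apply: Ev_sz; try exact: ct; first [done | exact: rs | exact: Ev_var].
  by apply: leq_trans (sz_le hx) _; rewrite -{1}(expn1 r); exact: leq_pexp2l.
- by move=> x y _ _ _; split=> //; exact: Ev_cst.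
- move=> x y z hx _ hy _; split; first by rewrite l3; exact: Ev_cst.
  by apply: Ev_rankE; try exact: ct; first [done | exact: rs | exact: Ev_var].
- by move=> x y z /and3P[hx hy /eqP->].
- by move: q; rewrite l3.
- by apply: wtab_le => x _; rewrite !mul1n muln1 expn1.
Qed.

Lemma t_sl rho mem lim (Q : _ -> _ -> Prop) : fits slS -> bnd rho -> genv rho ->
  contents lim mem -> lim 4 = 0 -> 0 < lim 1 -> 0 < lim 2 -> 0 < lim 3 ->
  (forall mem', contents (upd lim 4 1) mem' -> Q rho mem') ->
  tr slS rho mem Q (wtab (fun x => (rep I x == x) * (cnt I x * m))) Dc.
Proof.
move=> f bd gv ct l4 l1 l2 l3 q; have id16 : 0 < 4 < 16 by [].
have [fr rg] := fresh_gt0 lim id16; have [[_ _ _ twf _] _] := tables_wf.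
apply: t_weaken (t_table (Q := Q) (n1 := m) (gx := fun x => rep I x == x) (n2 := sz) (n3 := cnt I)
  (b1 := fun=> m) (b2 := fun=> 1) twf f bd gv ct id16 (fun=> m_lm) (fun=> one_lm) (Evm _ _ _ gv) (leqnn m)
  _ _ _ _ _ _) (fun _ _ h => h) _ (leqnn _).
- by move=> x hx; apply: Ev_isrepE; try exact: ct; first [done | exact: rs | exact: Ev_var].
- move=> x hx _; split; first by apply: Ev_sz; try exact: ct; first [done | exact: rs | exact: Ev_var].
  by apply: leq_trans (sz_le hx) _; rewrite -{1}(expn1 r); exact: leq_pexp2l.
- move=> x y hx _ hy; split; first by apply: Ev_cnt; try exact: ct; first [done | exact: rs | exact: Ev_var].
  by apply: leq_trans (cnt_le I x) _; exact: m_states.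
- move=> x y z hx /eqP rx hy hz; split; first by rewrite l4; exact: Ev_cst.
  by apply: Ev_slE; try exact: ct; first [done | exact: rs | exact: Ev_var].
- by move=> x y z /and4P[hx /eqP rx hy hz]; rewrite rx eqxx.
- by move: q; rewrite l4.
- by apply: wtab_le => x _; rewrite muln1 expn1.
Qed.

(** The most expensive table: every state of every class searches for the first untaken good, whence
    a factor [m] on top of the number of states. The later doublings compose entries in constant
    work. *)
Lemma t_nxt rho mem lim (Q : _ -> _ -> Prop) : fits nxtS -> bnd rho -> genv rho ->
  contents lim mem -> lim 5 = 0 -> 0 < lim 1 -> 0 < lim 2 -> 0 < lim 3 -> 0 < lim 4 ->
  (forall mem', contents (upd lim 5 1) mem' -> Q rho mem') ->
  tr nxtS rho mem Q (wtab (fun x => isclass I x * (sz x * base I x ^ sz x * m))) Dc.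
Proof.
move=> f bd gv ct l5 l1 l2 l3 l4 q; have id16 : 0 < 5 < 16 by [].
have [fr rg] := fresh_gt0 lim id16; have [[_ _ _ _ twf] _] := tables_wf.
apply: t_weaken (t_table (Q := Q) (n1 := m) (gx := isclass I) (n2 := fun x => sz x ^ sz x) (n3 := fun x => sz x * base I x ^ sz x)
  (b1 := fun=> m) (b2 := fun=> 1) twf f bd gv ct id16 (fun=> m_lm) (fun=> one_lm) (Evm _ _ _ gv) (leqnn m)
  _ _ _ _ _ _) (fun _ _ h => h) _ (leqnn _).
- by move=> x hx; apply: Ev_classE; try exact: ct; first [done | exact: rs | exact: Ev_var].
- move=> x hx _; split; last exact: orders_le.
  by apply: Ev_ordersE; try exact: ct; first [done | exact: rs | exact: Ev_var].
- move=> x y hx _ hy; split; last exact: states_le.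
  by apply: Ev_statesE; try exact: ct; first [done | exact: rs | exact: Ev_var].
- move=> x y z hx cl hy hz; split; first by rewrite l5; exact: Ev_cst.
  have -> : G 5 (lim 5) x y z = nxt I x y z by rewrite l5.
  have cm := cnt_le I x; by apply: Ev_nxtE; try exact: ct; first [done | exact: rs | exact: Ev_var].
- by move=> x y z /and4P[hx cl hy hz].
- by move: q; rewrite l5.
- by apply: wtab_le => x _; rewrite muln1 expn1.
Qed.

Lemma t_jump rho mem lim t (Q : _ -> _ -> Prop) : fits jumpS -> bnd rho -> genv rho ->
  contents lim mem -> lim 5 = t.+1 -> rho vt = t -> 0 < lim 1 -> 0 < lim 2 ->
  (forall mem', contents (upd lim 5 t.+2) mem' -> Q rho mem') ->
  tr jumpS rho mem Q (wtab (fun x => isclass I x * (sz x * base I x ^ sz x))) Dc.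
Proof.
move=> f bd gv ct l5 vtE l1 l2 q; have id16 : 0 < 5 < 16 by [].
have [fr rg] := fresh_gt0 lim id16; have [_ [[twf _ _ _] _]] := tables_wf.
apply: t_weaken (t_table (Q := Q) (n1 := m) (gx := isclass I) (n2 := fun x => sz x ^ sz x) (n3 := fun x => sz x * base I x ^ sz x)
  (b1 := fun=> 1) (b2 := fun=> 1) twf f bd gv ct id16 (fun=> one_lm) (fun=> one_lm) (Evm _ _ _ gv) (leqnn m)
  _ _ _ _ _ _) (fun _ _ h => h) _ (leqnn _).
- by move=> x hx; apply: Ev_classE; try exact: ct; first [done | exact: rs | exact: Ev_var].
- move=> x hx _; split; last exact: orders_le.
  by apply: Ev_ordersE; try exact: ct; first [done | exact: rs | exact: Ev_var].
- move=> x y hx _ hy; split; last exact: states_le.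
  by apply: Ev_statesE; try exact: ct; first [done | exact: rs | exact: Ev_var].
- move=> x y z hx cl hy hz; have tv : t + 1 = lim 5 by rewrite l5 addn1.
  split; first by rewrite -tv; apply: Ev_add; [exact: Ev_var|exact: Ev_cst].
  have -> : G 5 (lim 5) x y z = iter (2 ^ t.+1) (nxt I x y) z by rewrite l5.
  have t5 : t < lim 5 by rewrite l5.
  by apply: Ev_jumpE; try exact: ct; first [done | exact: rs | exact: Ev_var].
- by move=> x y z /and4P[hx cl hy hz].
- by move: q; rewrite l5.
- by apply: wtab_le => x _; rewrite !exp1n !muln1.
Qed.

Lemma t_step rho mem lim t (Q : _ -> _ -> Prop) : fits stepS -> bnd rho -> genv rho ->
  contents lim mem -> lim 6 = t.+1 -> t < lim 5 -> rho vt = t -> rho vp = 2 ^ t -> 0 < lim 1 -> 0 < lim 2 ->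
  (forall mem', contents (upd lim 6 t.+2) mem' -> Q rho mem') ->
  tr stepS rho mem Q (wtab (fun x => isclass I x * cnt I x)) Dc.
Proof.
move=> f bd gv ct l6 l5 vtE vpE l1 l2 q; have id16 : 0 < 6 < 16 by [].
have [fr rg] := fresh_gt0 lim id16; have [_ [[_ twf _ _] _]] := tables_wf.
apply: t_weaken (t_table (Q := Q) (n1 := m) (gx := isclass I) (n2 := fun x => sz x ^ sz x) (n3 := cnt I)
  (b1 := fun=> 1) (b2 := fun=> 1) twf f bd gv ct id16 (fun=> one_lm) (fun=> one_lm) (Evm _ _ _ gv) (leqnn m)
  _ _ _ _ _ _) (fun _ _ h => h) _ (leqnn _).
- by move=> x hx; apply: Ev_classE; try exact: ct; first [done | exact: rs | exact: Ev_var].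
- move=> x hx _; split; last exact: orders_le.
  by apply: Ev_ordersE; try exact: ct; first [done | exact: rs | exact: Ev_var].
- move=> x y hx _ hy; split; last by apply: leq_trans (cnt_le I x) _; exact: m_states.
  by apply: Ev_cnt; try exact: ct; first [done | exact: rs | exact: Ev_var].
- move=> x y z hx cl hy hz; have tv : t + 1 = lim 6 by rewrite l6 addn1.
  split; first by rewrite -tv; apply: Ev_add; [exact: Ev_var|exact: Ev_cst].
  have -> : G 6 (lim 6) x y z = iter (z %% 2 ^ t.+1) (nxt I x y) 0 by rewrite l6.
  have t6 : t < lim 6 by rewrite l6.
  by apply: Ev_stepE; try exact: ct; first [done | exact: rs | exact: Ev_var].
- by move=> x y z /and4P[hx cl hy hz].
- by move: q; rewrite l6.
- by apply: wtab_le => x _; rewrite !exp1n !muln1.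
Qed.

Lemma t_rr rho mem lim t (Q : _ -> _ -> Prop) : fits rrS -> bnd rho -> genv rho ->
  contents lim mem -> lim 7 = 0 -> rho vt = t -> m <= 2 ^ t -> t < lim 6 ->
  0 < lim 1 -> 0 < lim 2 -> 0 < lim 3 -> 0 < lim 5 ->
  (forall mem', contents (upd lim 7 1) mem' -> Q rho mem') ->
  tr rrS rho mem Q (wtab (fun=> m)) Dc.
Proof.
move=> f bd gv ct l7 vtE mt l6 l1 l2 l3 l5 q; have id16 : 0 < 7 < 16 by [].
have [fr rg] := fresh_gt0 lim id16; have [_ [[_ _ twf _] _]] := tables_wf.
apply: t_weaken (t_table (Q := Q) (n1 := m) (gx := fun x => 0 < sz x) (n2 := fun x => sz x ^ sz x) (n3 := fun=> 1)
  (b1 := fun=> m) (b2 := fun=> 1) twf f bd gv ct id16 (fun=> m_lm) (fun=> one_lm) (Evm _ _ _ gv) (leqnn m)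
  _ _ _ _ _ _) (fun _ _ h => h) _ (leqnn _).
- move=> x hx; apply: Ev_ltb; first exact: Ev_cst.
  by apply: Ev_sz; try exact: ct; first [done | exact: rs | exact: Ev_var].
- move=> x hx _; split; last exact: orders_le.
  by apply: Ev_ordersE; try exact: ct; first [done | exact: rs | exact: Ev_var].
- by move=> x y _ _ _; split=> //; exact: Ev_cst.
- move=> x y z hx s0 hy _; split; first by rewrite l7; exact: Ev_cst.
  have cm := cnt_le I x; by apply: Ev_rrE; try exact: ct; try exact: vtE; first [done | exact: rs].
- by move=> x y z /and4P[hx s0 hy /eqP->].
- by move: q; rewrite l7.
- by apply: wtab_le => x _; rewrite mul1n muln1 expn1; case: (0 < sz x); rewrite ?mul1n.
Qed.

Lemma t_col rho mem lim t c (Q : _ -> _ -> Prop) : fits colS -> bnd rho -> genv rho ->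
  contents lim mem -> lim 8 = (t * D1 + c).+1 -> c < D1 -> 2 ^ t <= 2 * m ->
  rho vp = 2 ^ t -> rho vq = t * D1 -> rho vc = c -> rho vD = D1 -> 0 < lim 1 ->
  (forall mem', contents (upd lim 8 (t * D1 + c).+2) mem' -> Q rho mem') ->
  tr colS rho mem Q (wtab (fun x => if odd (x %/ 2 ^ t) && (colt I t x == c) then D1 * (2 * 2 ^ t) else 1)) Dc.
Proof.
move=> f bd gv ct l8 cD t2 vpE vqE vcE vDE l1 q; have id16 : 0 < 8 < 16 by [].
have [fr rg] := fresh_gt0 lim id16; have [_ [[_ _ _ twf] _]] := tables_wf.
apply: t_weaken (t_table (Q := Q) (n1 := m) (gx := xpredT) (n2 := fun=> 1) (n3 := fun=> 1)
  (b1 := fun x => if odd (x %/ 2 ^ t) && (colt I t x == c) then D1 else 1) (b2 := fun x => if odd (x %/ 2 ^ t) && (colt I t x == c) then 2 * 2 ^ t else 1) twf f bd gv ct id16 _ _ (Evm _ _ _ gv) (leqnn m)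
  _ _ _ _ _ _) (fun _ _ h => h) _ (leqnn _).
- by move=> x; case: ifP => _ //; rewrite D1_gt0 (leq_trans (D1_le m_gt0)) //; case/andP: m_lm.
- move=> x; case: ifP => _ //; rewrite muln_gt0 expn_gt0 /=; apply: leq_trans lm_m.
  by rewrite -[4]/(2 * 2) -mulnA leq_mul2l.
- by move=> x _; exact: Ev_cst.
- by move=> x _ _; split=> //; exact: Ev_cst.
- by move=> x y _ _ _; split=> //; exact: Ev_cst.
- move=> x y z hx _ _ _; split.
    have tv : t * D1 + c + 1 = lim 8 by rewrite l8 addn1.
    by rewrite -tv; apply: Ev_add; [apply: Ev_add; exact: Ev_var|exact: Ev_cst].
  have -> : G 8 (lim 8) x y z = collev I t c.+1 (colt I t) x.
    (* When the last colour is processed, the new version number is [(t + 1) * D1]: the end of one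
       level is read as the start of the next. *)
    rewrite l8 /Submission.G -addnS divnMDl ?D1_gt0 // modnMDl; move: cD; rewrite leq_eqVlt => /orP[/eqP E|lt].
      by rewrite E modnn divnn D1_gt0 addn1.
    by rewrite modn_small // divn_small // addn0.
  have t8 : t * D1 + c < lim 8 by rewrite l8.
  apply: Ev_colE; try exact: ct; try exact: vcE; try exact: vpE; try done; try exact: rs.
  by rewrite /= => ->.
- by move=> x y z /and3P[hx /eqP-> /eqP->].
- by move: q; rewrite l8.
- by apply: wtab_le => x _; case: ifP => _; rewrite ?mul1n ?expn1 ?exp1n.
Qed.

Lemma t_best rho mem lim c (Q : _ -> _ -> Prop) : fits bestS -> bnd rho -> genv rho ->
  contents lim mem -> lim 9 = c -> L * D1 < lim 8 -> c < lim 10 -> rho vq = L * D1 -> rho vc = c -> 0 < lim 1 ->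
  (forall mem', contents (upd lim 9 c.+1) mem' -> Q rho mem') ->
  tr bestS rho mem Q (wtab (fun x => active I fcol c x * m)) Dc.
Proof.
move=> f bd gv ct l9 l8 l10 vqE vcE l1 q; have id16 : 0 < 9 < 16 by [].
have [fr rg] := fresh_gt0 lim id16; have [_ [_ [twf _ _]]] := tables_wf.
apply: t_weaken (t_table (Q := Q) (n1 := m) (gx := active I fcol c) (n2 := fun=> 1) (n3 := fun=> 1)
  (b1 := fun=> m) (b2 := fun=> 1) twf f bd gv ct id16 (fun=> m_lm) (fun=> one_lm) (Evm _ _ _ gv) (leqnn m)
  _ _ _ _ _ _) (fun _ _ h => h) _ (leqnn _).
- move=> x hx; have pe : phase_env I L H c (upd rho 16 x) by split.
  by apply: Ev_activeE; try exact: ct; try exact: pe; first [done | exact: rs | exact: rc | exact: Ev_var].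
- by move=> x _ _; split=> //; exact: Ev_cst.
- by move=> x y _ _ _; split=> //; exact: Ev_cst.
- move=> x y z hx act _ _; split; first by rewrite l9; exact: Ev_var.
  have -> : G 9 (lim 9) x y z = best I (ow I fcol c) x by rewrite l9.
  have pe : phase_env I L H c (upd (upd (upd rho 16 x) 17 y) 18 z) by split.
  have [_ s0 _] := activeE act.
  by apply: Ev_bestE; try exact: ct; try exact: pe; first [done | exact: rs | exact: rc | exact: Ev_var].
- by move=> x y z /and4P[hx act /eqP-> /eqP->]; move: act; rewrite l9.
- by move: q; rewrite l9.
- by apply: wtab_le => x _; rewrite mul1n muln1 expn1.
Qed.

Lemma t_own rho mem lim c (Q : _ -> _ -> Prop) : fits ownS -> bnd rho -> genv rho ->
  contents lim mem -> lim 10 = c.+1 -> c < lim 9 -> L * D1 < lim 8 -> rho vq = L * D1 -> rho vc = c -> 0 < lim 1 -> 0 < lim 7 ->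
  (forall mem', contents (upd lim 10 c.+2) mem' -> Q rho mem') ->
  tr ownS rho mem Q (wtab (fun=> m)) Dc.
Proof.
move=> f bd gv ct l10 l9 l8 vqE vcE l1 l7 q; have id16 : 0 < 10 < 16 by [].
have [fr rg] := fresh_gt0 lim id16; have [_ [_ [_ twf _]]] := tables_wf.
apply: t_weaken (t_table (Q := Q) (n1 := m) (gx := xpredT) (n2 := fun=> 1) (n3 := fun=> 1)
  (b1 := fun=> m) (b2 := fun=> 1) twf f bd gv ct id16 (fun=> m_lm) (fun=> one_lm) (Evm _ _ _ gv) (leqnn m)
  _ _ _ _ _ _) (fun _ _ h => h) _ (leqnn _).
- by move=> x _; exact: Ev_cst.
- by move=> x _ _; split=> //; exact: Ev_cst.
- by move=> x y _ _ _; split=> //; exact: Ev_cst.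
- move=> x y z hx _ _ _; have tv : c + 1 = lim 10 by rewrite l10 addn1.
  split; first by rewrite -tv; apply: Ev_add; [exact: Ev_var|exact: Ev_cst].
  have -> : G 10 (lim 10) x y z = ow I fcol c.+1 x by rewrite l10.
  have pe : phase_env I L H c (upd (upd (upd rho 16 x) 17 y) 18 z) by split.
  have c10 : c < lim 10 by rewrite l10.
  by apply: Ev_ownE; try exact: ct; try exact: pe; first [done | exact: rs | exact: rc | exact: Ev_var].
- by move=> x y z /and3P[hx /eqP-> /eqP->].
- by move: q; rewrite l10.
- by apply: wtab_le => x _; rewrite !mul1n muln1 expn1.
Qed.

Lemma t_out rho mem lim (Q : _ -> _ -> Prop) : fits outS -> bnd rho -> genv rho ->
  contents lim mem -> lim 11 = 0 -> D1 < lim 10 -> rho vD = D1 ->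
  (forall mem', contents (upd lim 11 1) mem' -> Q rho mem') ->
  tr outS rho mem Q (Kc * (\sum_(0 <= x < 1) (1 + m) + 1)) Dc.
Proof.
move=> f bd gv ct l11 l10 vDE q; have id16 : 0 < 11 < 16 by [].
have [fr rg] := fresh_gt0 lim id16; have [_ [_ [_ _ twf]]] := tables_wf.
apply: t_weaken (t_table (Q := Q) (n1 := 1) (gx := xpredT) (n2 := fun=> 1) (n3 := fun=> m)
  (b1 := fun=> 1) (b2 := fun=> 1) twf f bd gv ct id16 (fun=> one_lm) (fun=> one_lm) _ m_gt0
  _ _ _ _ _ _) (fun _ _ h => h) _ (leqnn _).
- exact: Ev_cst.
- by move=> x _; exact: Ev_cst.
- by move=> x _ _; split=> //; exact: Ev_cst.
- by move=> x y _ _ _; split; [exact: Evm|exact: m_states].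
- move=> x y z _ _ _ hz; split; first by rewrite l11; exact: Ev_cst.
  by apply: Ev_outE; try exact: ct; try exact: vDE; first [done | exact: rs | exact: rc | exact: Ev_var].
- by move=> x y z /and3P[/eqP-> /eqP-> hz].
- by move: q; rewrite l11.
- by rewrite !big_nat1 mul1n !exp1n !muln1.
Qed.

Lemma level_lt t : t < L -> 2 ^ t < m.
Proof.
by move=> lt; rewrite ltnNge; apply/negP => /(@up_log_min 2 m t isT); rewrite leqNgt lt.
Qed.

Lemma L_le : L <= m.
Proof. by apply: up_log_min => //; apply: ltnW; exact: ltn_expl. Qed.

Lemma pow_L : 2 ^ L <= 2 * m.
Proof.
case E : L => [|l]; first by rewrite mul2n -addnn ltn_addr.
by rewrite expnS leq_mul2l /=; apply: ltnW; apply: level_lt; rewrite E.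
Qed.

Lemma lt_dvc a : a < X ^ 3 -> a < X ^ dvc.
Proof. by move=> h; apply: leq_trans h _; apply: leX; rewrite /dvc; clear; lia. Qed.

Lemma small_dvc a b c : a <= 2 -> b <= m -> c <= m -> a + b * c < X ^ dvc.
Proof.
move=> ha hb hc; apply: lt_dvc; rewrite /Submission.X !expnS expn0 muln1.
by move: ha hb hc; clear; nia.
Qed.

Lemma t_incr x v rho mem (Q : _ -> _ -> Prop) : isvar x -> fits (incS x) -> bnd rho ->
  rho x = v -> Q (upd rho x v.+1) mem -> tr (incS x) rho mem Q Kc Dc.
Proof.
move=> vx f bd xv q; apply: (t_set (v := v.+1) (F := predT) _ _ f bd _ q) => //.
  by rewrite /flat /= vx.
by rewrite -[v.+1]addn1; apply: Ev_add; [exact: Ev_var|exact: Ev_cst].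
Qed.

Lemma t_for x N body n0 (Inv : nat -> (nat -> nat) -> (nat -> nat) -> Prop)
    (w : nat -> nat) d rho mem (Q : _ -> _ -> Prop) :
  isvar x -> isvar N -> N != x -> fits (SFor x N body) -> n0 <= m ->
  (forall i rho mem, i < n0 -> bnd rho -> rho x = i -> rho N = n0 -> Inv i rho mem ->
     tr body rho mem (fun rho' mem' => [/\ bnd rho', rho' x = i, rho' N = n0 &
       Inv i.+1 (upd rho' x i.+1) mem']) (w i) d) ->
  bnd rho -> rho N = n0 -> Inv 0 (upd rho x 0) mem ->
  (forall rho' mem', bnd rho' -> rho' N = n0 -> Inv n0 rho' mem' -> Q rho' mem') ->
  tr (SFor x N body) rho mem Q
    (Kc + (\sum_(0 <= i < n0) (w i + Kc).+1 + 2)) (Dc + (n0 * (d + Dc).+1 + 2)).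
Proof.
move=> vx vN Nx f n0m hb bd rN I0 hQ.
have [f0 f1] := fits_seq f; have [fb fi] := fits_seq (f1 : fits (SSeq body (incS x))).
have bv i : i <= n0 -> i < X ^ dvc.
  by move=> hi; have := @small_dvc 0 i 1 isT (leq_trans hi n0m) m_gt0; rewrite muln1.
apply: t_seq; apply: (t_set (v := 0) (F := predT) _ _ f0 bd _ _) => //.
pose J i rho mem := [/\ bnd rho, rho x = i, rho N = n0 & Inv i rho mem].
apply: t_weaken (t_while (I := J) (w := fun i => w i + Kc) (d := d + Dc) vx vN _ _ _) _ _ _ => //.
- move=> i rho1 mem1 hi [b1 x1 N1 i1]; rewrite x1 N1; split=> //.
  apply: t_seq; apply: t_weaken (hb i _ _ hi b1 x1 N1 i1) _ _ _ => //.
  move=> rho2 mem2 [b2 x2 N2 i2]; apply: (t_incr _ _ _ x2) => //.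
  split=> //; first exact: bnd_upd (bv _ hi).
    by rewrite /upd eqxx.
  by rewrite /upd (negPf Nx).
- by move=> rho1 mem1 [_ -> -> _]; rewrite ltnn.
- split=> //; first exact: bnd_upd bd (bv 0 isT).
    by rewrite /upd eqxx.
  by rewrite /upd (negPf Nx).
by move=> rho1 mem1 [b1 _ N1 i1]; exact: hQ.
Qed.

Lemma t_levels body (Inv : nat -> (nat -> nat) -> (nat -> nat) -> Prop)
    (w : nat -> nat) d rho mem (Q : _ -> _ -> Prop) : fits (SLevels body) ->
  (forall t rho mem, t < L -> bnd rho -> rho vt = t -> rho vp = 2 ^ t -> rho vm = m ->
     Inv t rho mem -> tr body rho mem (fun rho' mem' =>
       [/\ bnd rho', rho' vt = t /\ rho' vp = 2 ^ t, rho' vm = m &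
       Inv t.+1 (upd (upd rho' vp (2 ^ t.+1)) vt t.+1) mem']) (w t) d) ->
  bnd rho -> rho vm = m -> Inv 0 (upd (upd rho vt 0) vp 1) mem ->
  (forall rho' mem', bnd rho' -> rho' vt = L -> rho' vp = 2 ^ L -> rho' vm = m ->
     Inv L rho' mem' -> Q rho' mem') ->
  tr (SLevels body) rho mem Q
    (Kc + (Kc + (\sum_(0 <= t < L) (w t + (Kc + Kc)).+1 + 2)))
    (Dc + (Dc + (L * (d + (Dc + Dc)).+1 + 2))).
Proof.
move=> f hb bd rm_ I0 hQ.
have [f0 f1] := fits_seq f; have [f2 f3] := fits_seq f1.
have [fb fl] := fits_seq (f3 : fits (SSeq body (SSeq (SLet vp (EAdd (V vp) (V vp))) (incS vt)))); have [fp ft] := fits_seq fl.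
have bv i : i <= m -> i < X ^ dvc.
  by move=> hi; have := @small_dvc 0 i 1 isT hi m_gt0; rewrite muln1.
have bp i : i <= L -> 2 ^ i < X ^ dvc.
  move=> hi; apply: (@leq_ltn_trans (2 * m)).
    by apply: leq_trans pow_L; exact: leq_pexp2l.
  apply: lt_dvc; rewrite /Submission.X !expnS expn0 muln1; clear; nia.
apply: t_seq; apply: (t_set (v := 0) (F := predT) _ _ f0 bd _ _) => //.
have b0 : bnd (upd rho vt 0) by apply: bnd_upd => //; exact: bv.
apply: t_seq; apply: (t_set (v := 1) (F := predT) _ _ f2 b0 _ _) => //.
pose J t rho mem := [/\ bnd rho, rho vt = t /\ rho vp = 2 ^ t, rho vm = m & Inv t rho mem].
apply: t_weaken (t_while (I := J) (w := fun t => w t + (Kc + Kc)) (d := d + (Dc + Dc))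
  (isT : isvar vp) (isT : isvar vm) _ _ _) _ _ _ => //.
- move=> t rho1 mem1 ht [b1 [t1 p1] m1 i1]; rewrite p1 m1; split; first exact: level_lt.
  apply: t_seq; apply: t_weaken (hb t _ _ ht b1 t1 p1 m1 i1) _ _ _ => //.
  move=> rho2 mem2 [b2 [t2 p2] m2 i2].
  apply: t_seq; apply: (t_set (v := 2 ^ t.+1) (F := predT) _ _ fp b2 _ _) => //.
    by rewrite expnS mul2n -addnn; apply: Ev_add; exact: Ev_var.
  apply: (t_incr (v := t) _ ft) => //; first by apply: bnd_upd => //; exact: bp.
  split=> //; apply: bnd_upd; last by apply: bv; apply: leq_trans L_le.
  by apply: bnd_upd => //; exact: bp.
- by move=> rho1 mem1 [_ [_ ->] -> _]; rewrite -leqNgt; exact: m_2L.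
- by split=> //; apply: bnd_upd => //; exact: (bp 0).
by move=> rho1 mem1 [b1 [t1 p1] m1 i1]; exact: hQ.
Qed.

(** The families 6, 8 and 10 start with version 0 already present: no turn taken, all colours 0 and
    no owners, which is what untouched memory contains. *)
Definition lim0 id := match id with 6 | 8 | 10 => 1 | _ => 0 end.
Definition limT t id := match id with 5 | 6 => t.+1 | 1 | 2 | 3 | 4 | 8 | 10 => 1 | _ => 0 end.
Definition limC k id := match id with 8 => k | 1 | 7 | 10 => 1 | _ => 0 end.
Definition limO c id := match id with 1 | 7 => 1 | 8 => (L * D1).+1 | 9 => c | 10 => c.+1 | _ => 0 end.

Definition w_one := wtab (fun=> m).
Definition w_sl := wtab (fun x => (rep I x == x) * (cnt I x * m)).
Definition w_nxt := wtab (fun x => isclass I x * (sz x * base I x ^ sz x * m)).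
Definition w_jump := wtab (fun x => isclass I x * (sz x * base I x ^ sz x)).
Definition w_step := wtab (fun x => isclass I x * cnt I x).
Definition w_tables := w_one + (w_one + (w_one + (w_sl + (w_nxt +
  ((Kc + (Kc + (\sum_(0 <= t < L) (w_step + w_jump + (Kc + Kc)).+1 + 2))) + w_one))))).
Definition d_tables := Dc + (Dc + (Dc + (Dc + (Dc +
  ((Dc + (Dc + (L * (Dc + Dc + (Dc + Dc)).+1 + 2))) + Dc))))).

Lemma t_tables rho mem (Q : _ -> _ -> Prop) : fits tablesS -> bnd rho -> genv rho ->
  contents lim0 mem ->
  (forall rho' mem', bnd rho' -> genv rho' -> contents (limC 1) mem' -> Q rho' mem') ->
  tr tablesS rho mem Q w_tables d_tables.
Proof.
move=> f bd gv ct hQ.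
have [f1 g1] := fits_seq f; have [f2 g2] := fits_seq g1; have [f3 g3] := fits_seq g2.
have [f4 g4] := fits_seq g3; have [f5 g5] := fits_seq g4; have [f6 f7] := fits_seq g5.
have fb : fits (SSeq stepS jumpS).
  have [_ h1] := fits_seq f6; have [_ h2] := fits_seq h1.
  by case: (fits_seq (h2 : fits (SSeq (SSeq stepS jumpS) (SSeq (SLet vp (EAdd (V vp) (V vp))) (incS vt))))).
have [fs fj] := fits_seq fb.
apply: t_seq; apply: (t_rep f1 bd gv ct) => // mem1 c1.
apply: t_seq; apply: (t_cnt f2 bd gv c1) => // mem2 c2.
apply: t_seq; apply: (t_rank f3 bd gv c2) => // mem3 c3.
apply: t_seq; apply: (t_sl f4 bd gv c3) => // mem4 c4.
apply: t_seq; apply: (t_nxt f5 bd gv c4) => // mem5 c5.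
apply: t_seq.
pose Inv t rho mem := genv rho /\ contents (limT t) mem.
apply: (t_levels (Inv := Inv) (w := fun=> w_step + w_jump) f6) => //.
- move=> t rho1 memt ht b1 t1 p1 m1 [v1 cc]; apply: t_seq.
  apply: (t_step (t := t) fs b1 v1 cc) => // mem6 c6.
  apply: (t_jump (t := t) fj b1 v1 c6) => // mem7 c7; split=> //; split=> //.
  by apply: ct_weaken c7 _ => id; do 11?[case: id => // id].
- by case: gv.
- split=> //; apply: ct_weaken c5 _ => id; by do 11?[case: id => // id].
move=> rho6 mem6 b6 t6 _ _ [v6 c6].
apply: (t_rr (t := L) f7 b6 v6 c6) => //; first exact: m_2L.
move=> mem7 c7; apply: hQ => //; apply: ct_weaken c7 _ => id.
by do 11?[case: id => // id].
Qed.

Definition w_col t c := wtab (fun x =>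
  if odd (x %/ 2 ^ t) && (colt I t x == c) then D1 * (2 * 2 ^ t) else 1).
Definition w_level t := Kc + (\sum_(0 <= c < D1) (w_col t c + Kc).+1 + 2) + Kc.
Definition w_colour := Kc * (m ^ nest 1 degE * m ^ nest 2 degE) + (Kc +
  (Kc + (Kc + (\sum_(0 <= t < L) (w_level t + (Kc + Kc)).+1 + 2)))).
Definition d_level := Dc + (D1 * (Dc + Dc).+1 + 2) + Dc.
Definition d_colour := Dc + (Dc + (Dc + (Dc + (L * (d_level + (Dc + Dc)).+1 + 2)))).

Lemma t_colour rho mem (Q : _ -> _ -> Prop) : fits colourS -> bnd rho -> genv rho ->
  contents (limC 1) mem ->
  (forall rho' mem', bnd rho' -> genv rho' -> rho' vD = D1 -> rho' vq = L * D1 ->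
     contents (limO 0) mem' -> Q rho' mem') ->
  tr colourS rho mem Q w_colour d_colour.
Proof.
move=> f bd gv ct hQ.
have [f1 g1] := fits_seq f; have [f2 f3] := fits_seq g1.
have [f4 f5] : fits (SFor vc vD colS) /\ fits (SLet vq (EAdd (V vq) (V vD))).
  have [_ h1] := fits_seq f3; have [_ h2] := fits_seq h1.
  have [h3 _] := fits_seq (h2 : fits (SSeq (SSeq (SFor vc vD colS) (SLet vq (EAdd (V vq) (V vD))))
    (SSeq (SLet vp (EAdd (V vp) (V vp))) (incS vt)))).
  exact: fits_seq h3.
have [f6 _] : fits colS /\ fits (incS vc).
  have [_ h] := fits_seq f4; exact: fits_seq (h : fits (SSeq colS (incS vc))).
have Dm := D1_le m_gt0.
have bD : D1 < X ^ dvc by have := @small_dvc 0 _ 1 isT Dm m_gt0; rewrite muln1.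
have bq t : t <= L -> t * D1 < X ^ dvc.
  by move=> ht; apply: (@small_dvc 0 t D1) => //; apply: leq_trans ht L_le.
apply: t_seq.
have id16 : forall id t, 0 < id < 16 -> t < limC 1 id -> id + 16 * t != 16.
  by move=> id t; clear; lia.
have pE : pure degE by [].
have wE : wf degE by [].
apply: (t_letq (v := D1) (F := fun a => region H a != 16) _ wE pE m_lm m_lm f1 bd) => //.
  by apply: Ev_degE; try exact: ct; first [done | exact: rs].
apply: t_seq; apply: (t_set (v := 0) (F := predT) _ _ f2 _ _ _) => //.
    by apply: bnd_upd.
  pose Inv t rho mem := [/\ genv rho, rho vD = D1, rho vq = t * D1 &
    contents (limC (t * D1).+1) mem].
  apply: (t_levels (Inv := Inv) (w := w_level) (d := d_level) f3).
  + move=> t rho1 mem1 ht b1 t1 p1 m1 [v1 D_1 q1 c1]; apply: t_seq.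
    pose Inv2 c rho mem := [/\ genv rho, rho vt = t /\ rho vp = 2 ^ t, rho vq = t * D1 &
      contents (limC (t * D1 + c).+1) mem].
    apply: (t_for (Inv := Inv2) (w := w_col t) _ _ _ f4 Dm) => //.
    * move=> c rho2 mem2 hc b2 vc2 D2 [v2 [t2 p2] q2 c2].
      apply: (t_col (t := t) (c := c) f6 b2 v2 c2) => //.
        by apply: ltnW; apply: leq_trans (level_lt ht) _; rewrite leq_pmull.
      move=> mem3 c3; split=> //; split=> //.
      by rewrite addnS; apply: ct_weaken c3 _ => id; do 11?[case: id => // id].
    * by split=> //; rewrite addn0.
    move=> rho2 mem2 b2 D2 [v2 [t2 p2] q2 c2].
    apply: (t_set (v := t.+1 * D1) (F := predT) _ _ f5 b2) => //.
      by rewrite mulSnr; apply: Ev_add; apply: Ev_var.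
    split=> //; first by apply: bnd_upd => //; exact: bq.
      by case: v2.
    by split=> //; rewrite mulSnr.
  + by apply: bnd_upd; [exact: bnd_upd|exact: (bq 0)].
  + by case: gv.
  + by split=> //; rewrite mul0n.
  move=> rho1 mem1 b1 _ _ _ [v1 D_1 q1 c1]; exact: hQ.
Qed.

Definition w_best c := wtab (fun x => active I fcol c x * m).
Definition w_phases := Kc + (\sum_(0 <= c < D1) (w_best c + w_one + Kc).+1 + 2) +
  Kc * (\sum_(0 <= x < 1) (1 + m) + 1).
Definition d_phases := Dc + (D1 * (Dc + Dc + Dc).+1 + 2) + Dc.

Lemma t_phases rho mem (Q : _ -> _ -> Prop) : fits phasesS -> bnd rho -> genv rho ->
  rho vD = D1 -> rho vq = L * D1 -> contents (limO 0) mem ->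
  (forall rho' mem', bnd rho' -> genv rho' -> contents (limO 0) mem' ->
     (forall g, g < m -> mem' (addr H 11 0 0 g) = ow I fcol D1 g - 1) -> Q rho' mem') ->
  tr phasesS rho mem Q w_phases d_phases.
Proof.
move=> f bd gv D_ q_ ct hQ.
have [f1 f2] := fits_seq f.
have [fb fo] : fits bestS /\ fits ownS.
  have [_ h] := fits_seq f1.
  by have [h1 _] := fits_seq (h : fits (SSeq (SSeq bestS ownS) (incS vc))); exact: fits_seq h1.
pose Inv c rho mem := [/\ genv rho, rho vq = L * D1 & contents (limO c) mem].
apply: t_seq; apply: (t_for (Inv := Inv) (w := fun c => w_best c + w_one) (d := Dc + Dc)
  _ _ _ f1 (D1_le m_gt0)) => //.
  move=> c rho1 mem1 hc b1 c1 D_1 [v1 q1 cc]; apply: t_seq.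
  apply: (t_best (c := c) fb b1 v1 cc) => // mem2 c2.
  apply: (t_own (c := c) fo b1 v1 c2) => //=; rewrite ?addn1 //.
  by move=> mem3 c3; split=> //; split=> //; apply: ct_weaken c3 _ => id; do 11?[case: id => // id].
move=> rho1 mem1 b1 D_1 [v1 q1 c1].
apply: (t_out f2 b1 v1 c1) => // mem2 c2; apply: hQ => //.
  by apply: ct_weaken c2 _ => id; do 11?[case: id => // id].
by move=> g hg; rewrite (ct_tab c2 (id := 11) (t := 0)) //=; exact: hg.
Qed.

Definition allocS := SSeq sizeS (SSeq tablesS (SSeq colourS (SSeq phasesS
  (SLet vres (EAddr (EReg 11 (Cst 0)) (Cst 0) (Cst 0) (Cst 0)))))).

Lemma t_prologue mem (Q : _ -> _ -> Prop) w d : fits mainS -> mem 0 = n -> mem 1 = m ->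
  contents lim0 mem ->
  (forall rho, bnd rho -> rho vn = n -> rho vm = m ->
     if off I m < 1 then tr (SLet vres (EAdd (V vm) (Cst 3))) rho mem Q w d
     else tr allocS rho mem Q w d) ->
  tr mainS (fun=> 0) mem Q (Kc + (Kc + (Kc + (Kc + w.+1)))) (Dc + (Dc + (Dc + (Dc + d.+1)))).
Proof.
move=> f mn mm ct hQ.
have [f1 g1] := fits_seq f; have [f2 g2] := fits_seq g1; have [f3 g3] := fits_seq g2.
have [f4 _] := fits_seq g3.
have b0 : bnd (fun=> 0) by move=> x; rewrite expn_gt0 ltnW.
have ltX a : a < X -> a < X ^ dvc.
  by move=> h; apply: leq_trans h _; rewrite -{1}(expn1 X); apply: leX; rewrite addn_gt0 orbT.
have nX : n < X by rewrite /Submission.X; clear; lia.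
have mX : m < X by rewrite /Submission.X; clear; lia.
have dmX a : a < X -> a < X ^ dm.
  by move=> h; apply: leq_trans h _; rewrite -{1}(expn1 X); apply: leX; rewrite /Submission.dm addn2.
have oX : off I m < X ^ dvc.
  have [<- lt] := ct_off ct (leqnn m); apply: leq_trans (ct_small ct lt) _.
  by apply: leX; rewrite /dvc /Submission.dm; clear; lia.
apply: t_seq; apply: (t_set (v := n) (F := predT) _ _ f1 b0) => //.
  by apply: Ev_ld; [exact: Ev_cst|exact: mn|by []|exact: dmX].
have b1 := bnd_upd vn b0 (ltX _ nX).
apply: t_seq; apply: (t_set (v := m) (F := predT) _ _ f2 b1) => //.
  by apply: Ev_ld; [exact: Ev_cst|exact: mm|by []|exact: dmX].
have b2 := bnd_upd vm b1 (ltX _ mX).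
apply: t_seq; apply: (t_set (v := off I m) (F := fun a => region H a != 16) _ _ f3 b2) => //.
  by apply: Ev_off; try exact: ct; try done; exact: Ev_var.
have b3 := bnd_upd vtot b2 oX.
apply: t_seq; apply: (t_set (v := 1) (F := predT) _ _ f4 b3) => //.
have b4 := bnd_upd vone b3 (ltX _ X1).
by apply: t_if => //; apply: hQ.
Qed.

Lemma t_size rho mem (Q : _ -> _ -> Prop) : fits sizeS -> bnd rho -> rho vn = n -> rho vm = m ->
  contents lim0 mem -> \max_(0 <= g < m) sz g = r ->
  (forall rho', bnd rho' -> genv rho' -> Q rho' mem) ->
  tr sizeS rho mem Q (Kc * (m ^ 1 * 1) + Kc) (Dc + Dc).
Proof.
move=> f bd rn rm_ ct hr hQ; have [f1 f2] := fits_seq f.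
pose e := ERed Max 1 (V vm) 20 (ESz (V 20)).
have er : Ev mem rm X dm (fun a => region H a != 16) (qv r0 m 1) rho e r.
  suff h : Ev mem rm X dm (fun a => region H a != 16) (qv r0 m 1) rho e (\max_(0 <= g < m) sz g).
    exact: Ev_eq h hr.
  apply: Ev_max => //.
  by move=> g hg; apply: Ev_sz; try exact: ct; try done; exact: Ev_var.
have we : wf e by [].
have pe : pure e by [].
have rX : r < X ^ dvc.
  by apply: leq_ltn_trans r_n _; apply: lt_dvc; rewrite /Submission.X !expnS expn0 muln1; clear; nia.
apply: t_seq; have := t_letq (b1 := m) (b2 := 1) (x := vr) isT we pe m_lm one_lm f1 bd er.
rewrite exp1n; apply.
have b1 : bnd (upd rho vr r) := bnd_upd vr bd rX.
pose e2 := ERed Prod 0 (EAdd (V vr) (Cst 2)) 60 (EAdd (EAdd (V vn) (V vm)) (Cst 2)).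
have eh : Ev mem rm X dm predT (qv r0 1 1) (upd rho vr r) e2 H.
  suff h : Ev mem rm X dm predT (qv r0 1 1) (upd rho vr r) e2 (\prod_(0 <= i < r + 2) X)%N.
    by apply: Ev_eq h _; rewrite prod_nat_const_nat subn0.
  apply: Ev_red => [||i hi].
  - by apply: Ev_add; [exact: Ev_var|exact: Ev_cst].
  - by rewrite /= /Submission.r0 -addnA leq_addl.
  by apply: Ev_add; [apply: Ev_add; exact: Ev_var|exact: Ev_cst].
apply: (t_set (x := vH) _ _ f2 b1 eh) => //; apply: hQ; last by split.
apply: bnd_upd => //; rewrite /Submission.H ltn_exp2l //; rewrite /dvc; clear; lia.
Qed.

Lemma off_gt0 : \max_(0 <= g < m) sz g = r -> 0 < off I m.
Proof.
move=> hr; have [g hg E] : exists2 g, g < m & \max_(0 <= g < m) sz g = sz g.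
  by apply: max_nat_ex; rewrite hr.
by rewrite lt0n; apply/negP => /eqP/esym/eqP/sum_nat0/(_ g hg) sg0; move: r_gt0; rewrite -hr E sg0.
Qed.

Definition w_alloc := Kc * (m ^ 1 * 1) + Kc + (w_tables + (w_colour + (w_phases + Kc))).
Definition d_alloc := Dc + Dc + (d_tables + (d_colour + (d_phases + Dc))).

Lemma t_alloc mem : fits mainS -> mem 0 = n -> mem 1 = m -> contents lim0 mem ->
  \max_(0 <= g < m) sz g = r ->
  tr mainS (fun=> 0) mem (fun rho' mem' => bnd rho' /\
      forall g, g < m -> mem' (rho' vres + g) = ow I fcol D1 g - 1)
    (Kc + (Kc + (Kc + (Kc + w_alloc.+1)))) (Dc + (Dc + (Dc + (Dc + d_alloc.+1)))).
Proof.
move=> f mn mm ct hr.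
have fA : fits allocS.
  have [_ g1] := fits_seq f; have [_ g2] := fits_seq g1; have [_ g3] := fits_seq g2.
  by have [_ g4] := fits_seq g3; have [] := fits_if g4.
have [f1 g1] := fits_seq fA; have [f2 g2] := fits_seq g1; have [f3 g3] := fits_seq g2.
have [f4 f5] := fits_seq g3.
apply: t_prologue => // rho bd rn rm_.
rewrite ltnNge (off_gt0 hr) /=.
apply: t_seq; apply: t_size => // rho1 b1 v1.
apply: t_seq; apply: t_tables => // rho2 mem2 b2 v2 c2.
apply: t_seq; apply: t_colour => // rho3 mem3 b3 v3 D3 q3 c3.
apply: t_seq; apply: t_phases => // rho4 mem4 b4 v4 c4 h4.
apply: (t_set (v := addr H 11 0 0 0) (F := predT) _ _ f5 b4) => //.
  by case: v4 => _ vH4; do 3!(apply: Ev_add; last exact: Ev_cst; apply: Ev_mul; last exact: Ev_var).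
split; last first.
  move=> g hg; rewrite /upd eqxx -h4 //; congr (mem4 _); rewrite /addr; clear; lia.
apply: bnd_upd => //; rewrite /addr !addn0.
have lt11 : 11 < X ^ 4 by apply: (@leq_trans (2 ^ 4)); [by []|exact: leq_expl].
apply: (@leq_trans (X ^ 4 * H * H * H)).
  by rewrite !(ltn_pmul2r h0).
rewrite /Submission.H -!expnD; apply: leX; rewrite /dvc; clear; lia.
Qed.

Lemma t_empty mem : fits mainS -> mem 0 = n -> mem 1 = m -> contents lim0 mem ->
  off I m = 0 ->
  tr mainS (fun=> 0) mem (fun rho' mem' => [/\ bnd rho', rho' vres = m + 3 & mem' = mem])
    (Kc + (Kc + (Kc + (Kc + Kc.+1)))) (Dc + (Dc + (Dc + (Dc + Dc.+1)))).
Proof.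
move=> f mn mm ct hr.
have fA : fits (SLet vres (EAdd (V vm) (Cst 3))).
  have [_ g1] := fits_seq f; have [_ g2] := fits_seq g1; have [_ g3] := fits_seq g2.
  by have [_ g4] := fits_seq g3; have [] := fits_if g4.
apply: t_prologue => // rho bd rn rm_; rewrite hr /=.
apply: (t_set (v := m + 3) (F := predT) _ _ fA bd) => //.
  by apply: Ev_add; [exact: Ev_var|exact: Ev_cst].
split=> //; apply: bnd_upd => //; apply: lt_dvc.
by rewrite /Submission.X !expnS expn0 muln1; clear; nia.
Qed.

End Running.

(** * Summation of the work and of the depth *)

Lemma sum_eq_le1 N y : \sum_(0 <= c < N) (y == c) <= 1.
Proof.
case: (ltnP y N) => h; last first.
  rewrite big_nat_cond big1 // => c; rewrite andbT => /= hc.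
  by rewrite gtn_eqF // (leq_trans hc h).
rewrite (bigD1_seq y) ?mem_index_iota ?iota_uniq //= eqxx big1 // => c /negPf.
by rewrite eq_sym => ->.
Qed.

Lemma leq_sum_nat N (F F' : nat -> nat) : (forall x, x < N -> F x <= F' x) ->
  \sum_(0 <= x < N) F x <= \sum_(0 <= x < N) F' x.
Proof.
by move=> h; rewrite big_nat_cond [leqRHS]big_nat_cond; apply: leq_sum => x /andP[/h].
Qed.

Section Costs.
Context (R : realType) (I : inst R).
Hypothesis wfI : wf_inst I.
Notation m := (nG I).
Notation n := (nA I).
Notation D1 := (D1 I).
Notation sz := (sz I).
Notation cnt := (cnt I).
Notation L := (L I).
Context (r : nat).
Hypothesis sz_le : forall g, g < m -> sz g <= r.
Hypothesis r_gt0 : 0 < r.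
Hypothesis m_gt0 : 0 < m.
Context (Kc Dc : nat).
Hypothesis Kc_gt0 : 0 < Kc.
Hypothesis Dc_gt0 : 0 < Dc.

Let M := m ^ r.+1.
Let A := r * 3 ^ r.

(** The classes of representatives are disjoint: exchange the sums, each good having a single
    representative. *)
Lemma sum_cnt : \sum_(0 <= x < m) (rep I x == x) * cnt x <= m.
Proof.
apply: (@leq_trans (\sum_(0 <= x < m) \sum_(0 <= h < m) (rep I h == x))).
  apply: leq_sum_nat => x _; case: eqP => [E|]; last by rewrite mul0n.
  by rewrite mul1n /Submission.cnt E.
rewrite exchange_big /=; apply: (@leq_trans (\sum_(0 <= h < m) 1)).
  by apply: leq_sum_nat => h _; exact: sum_eq_le1.
by rewrite sum_nat_const_nat subn0 muln1.
Qed.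

(** A nonempty class satisfies [cnt x + 2 <= 3 * cnt x], which explains [3 ^ r]. One factor [cnt x]
    is kept for the sum over the classes, the other [r - 1] are bounded by [m]. *)
Lemma sum_states : \sum_(0 <= x < m) isclass I x * (sz x * base I x ^ sz x) <= A * m ^ r.
Proof.
apply: (@leq_trans (\sum_(0 <= x < m) A * m ^ r.-1 * ((rep I x == x) * cnt x))).
  apply: leq_sum_nat => x hx; rewrite /isclass; case: eqP => //= _.
  case: (0 < sz x) => //; rewrite !mul1n; have c0 := cnt_gt0 hx.
  apply: (@leq_trans (r * (3 * cnt x) ^ r)).
    apply: leq_mul; first exact: sz_le.
    by apply: pow_mono; [rewrite muln_gt0|rewrite /base; move: c0; clear; lia|exact: sz_le].
  rewrite expnMn /A mulnA -!mulnA !leq_mul2l; apply/orP; right; apply/orP; right.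
  by rewrite -{1}(prednK r_gt0) expnSr leq_mul2r leq_expl ?orbT // cnt_le.
rewrite -big_distrr /= -mulnA leq_mul2l; apply/orP; right.
by rewrite -{2}(prednK r_gt0) expnSr leq_mul2l sum_cnt orbT.
Qed.

(** For [r > 1] the trivial bound [m] suffices. For [r = 1], meeting hyperedges are equal
    singletons, so distinct representatives are never adjacent and one colour is enough. *)
Lemma D1_pow : D1 <= m ^ r.-1.
Proof.
case: (ltnP 1 r) => r1.
  apply: leq_trans (D1_le m_gt0) _; rewrite -{1}(expn1 m) leq_pexp2l //.
  by rewrite -ltnS prednK.
have {r1} r1 : r = 1 by apply/eqP; rewrite eqn_leq r1 r_gt0.
rewrite r1 /= /Submission.D1 add1n ltnS; apply/bigmax_leqP_seq => e.
rewrite mem_index_iota /= => he _; rewrite leqn0 eq_sym; apply/sum_nat0 => f hf.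
rewrite /adj; case: eqP => // ne; case: eqP => // re; case: eqP => // rf.
apply/eqP; rewrite eqb0 -leqNgt leqn0 eq_sym; apply/sum_nat0 => a ha.
apply/eqP; rewrite eq_sym; apply/sum_nat0 => b hb; apply/eqP; rewrite eqb0; apply/eqP => E.
have := sz_le he; have := sz_le hf; rewrite r1 => sf se.
have a0 : a = 0 by move: ha se; clear; lia.
have b0 : b = 0 by move: hb sf; clear; lia.
case: ne; rewrite -re -rf; apply/eqP; rewrite rep_eq //; apply/sameP.
have s1 : sz e = 1 by move: ha se; clear; lia.
have s2 : sz f = 1 by move: hb sf; clear; lia.
rewrite s1 s2; split=> // -[|//] _; by rewrite -{1}a0 E b0.
Qed.

Lemma D1_M : D1 * (m * m) <= M.
Proof.
rewrite /M !expnSr -(prednK r_gt0) expnSr -mulnA leq_mul2r; apply/orP; right.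
exact: D1_pow.
Qed.

Lemma mr_M : m * m ^ r = M.
Proof. by rewrite /M expnS. Qed.

Lemma m_mr : m <= m ^ r.
Proof. by rewrite -{1}(expn1 m) leq_pexp2l. Qed.

Lemma wtabE f : wtab I Kc f = Kc * (m + \sum_(0 <= x < m) f x + 1).
Proof. by rewrite /wtab big_split /= sum_nat_const_nat subn0 muln1. Qed.

Lemma w_one_le : w_one I Kc <= Kc * (3 * (m * m)).
Proof.
rewrite /w_one wtabE leq_mul2l; apply/orP; right.
by rewrite sum_nat_const_nat subn0; move: m_gt0; clear; nia.
Qed.

Lemma sum_sl_le : \sum_(0 <= x < m) (rep I x == x) * (cnt x * m) <= m * m.
Proof.
rewrite (eq_bigr (fun x => (rep I x == x) * cnt x * m)); last by move=> x _; rewrite mulnA.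
by rewrite -big_distrl /= leq_mul2r sum_cnt orbT.
Qed.

Lemma w_sl_le : w_sl I Kc <= Kc * (3 * (m * m)).
Proof.
rewrite /w_sl wtabE leq_mul2l; apply/orP; right.
by have := sum_sl_le; move: m_gt0; clear; nia.
Qed.

Lemma w_nxt_le : w_nxt I Kc <= Kc * ((A + 2) * M).
Proof.
rewrite /w_nxt wtabE leq_mul2l; apply/orP; right.
rewrite (eq_bigr (fun x => isclass I x * (sz x * base I x ^ sz x) * m)); last first.
  by move=> x _; rewrite mulnA.
rewrite -big_distrl /=; have := sum_states; have := m_mr; rewrite -mr_M.
by move: m_gt0; clear; nia.
Qed.

Lemma w_jump_le : w_jump I Kc <= Kc * ((A + 2) * m ^ r).
Proof.
rewrite /w_jump wtabE leq_mul2l; apply/orP; right.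
by have := sum_states; have := m_mr; move: m_gt0; clear; nia.
Qed.

Lemma w_step_le : w_step I Kc <= Kc * (3 * m ^ r).
Proof.
rewrite /w_step wtabE leq_mul2l; apply/orP; right.
have : \sum_(0 <= x < m) isclass I x * cnt x <= m.
  apply: leq_trans sum_cnt; apply: leq_sum_nat => x _; rewrite /isclass.
  by case: eqP => //= _; case: (0 < sz x); rewrite ?mul0n.
by have := m_mr; move: m_gt0; clear; nia.
Qed.

Lemma sq_M : m * m <= M.
Proof. by rewrite -mr_M leq_mul2l m_mr orbT. Qed.

(** A level of pointer jumping costs O(m^r), so even the crude bound [m] on the number of levels
    keeps the total within [m ^ (r + 1)]. *)
Lemma w_tables_le : w_tables I Kc <= Kc * ((2 * A + 40) * M).
Proof.
rewrite /w_tables.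
have : \sum_(0 <= t < L) (w_step I Kc + w_jump I Kc + (Kc + Kc)).+1 <= Kc * ((A + 8) * M).
  rewrite sum_nat_const_nat subn0.
  apply: leq_trans (leq_mul (L_le I) (leqnn _)) _; rewrite -mr_M.
  have := w_jump_le; have := w_step_le; have := m_mr; move: m_gt0 Kc_gt0.
  move: (w_step I Kc) (w_jump I Kc) (m ^ r); clear => s j p m0 K0 mp hs hj.
  apply: (@leq_trans (m * (Kc * ((A + 8) * p)))); last by rewrite (mulnCA m Kc) (mulnCA m (A + 8)).
  rewrite leq_mul2l; apply/orP; right; nia.
have := w_one_le; have := w_sl_le; have := w_nxt_le; have := sq_M; have M0 : 0 < M by rewrite expn_gt0 m_gt0.
move: (w_one I Kc) (w_sl I Kc) (w_nxt I Kc) (\sum_(0 <= t < L) _) M0 Kc_gt0.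
move: M A (m * m) => M' A' q; clear=> o s x S M0 K0 qM hx hs ho hS.
have KM : Kc * q <= Kc * M' by rewrite leq_mul2l qM orbT.
nia.
Qed.

Lemma M_gt0 : 0 < M.
Proof. by rewrite expn_gt0 m_gt0. Qed.

Lemma sum_pow2 N : \sum_(0 <= t < N) 2 ^ t <= 2 ^ N.
Proof.
elim: N => [|N IH]; first by rewrite big_geq.
by rewrite big_nat_recr //= expnS mul2n -addnn leq_add2r.
Qed.

(** In one level, a hyperedge is recoloured in at most one round, that of its old colour, and pays
    there [D1] candidates times [2 * 2 ^ t] members of the block. The constant cost of all the rows
    in each round is of no larger order. *)
Lemma sum_col_le t : \sum_(0 <= c < D1) (w_col I Kc t c + Kc).+1 <= Kc * (D1 * (m * (7 * 2 ^ t))).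
Proof.
have colE c : w_col I Kc t c <= Kc * (3 * m + D1 * (2 * 2 ^ t) * \sum_(0 <= x < m) (colt I t x == c)).
  rewrite /w_col wtabE leq_mul2l; apply/orP; right.
  set S := \sum_(0 <= x < m) (if _ then _ else _).
  have : S <= m + D1 * (2 * 2 ^ t) * \sum_(0 <= x < m) (colt I t x == c).
    rewrite big_distrr -[X in X + _]muln1 -[X in X * 1]subn0 -sum_nat_const_nat -big_split /=.
    apply: leq_sum_nat => x _; case: (odd _); case: (_ == c) => //=.
    by rewrite muln1 leq_addl.
  by move: m_gt0; clear; nia.
apply: (@leq_trans (\sum_(0 <= c < D1) (Kc * (5 * m) +
    Kc * (D1 * (2 * 2 ^ t)) * \sum_(0 <= x < m) (colt I t x == c)))).
  apply: leq_sum_nat => c _; move: (colE c); rewrite mulnDr mulnA.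
  by move: m_gt0 Kc_gt0; clear; nia.
rewrite big_split /= sum_nat_const_nat subn0 -big_distrr /= exchange_big /=.
have : \sum_(0 <= x < m) \sum_(0 <= c < D1) (colt I t x == c) <= m.
  apply: (@leq_trans (\sum_(0 <= h < m) 1)).
    by apply: leq_sum_nat => h _; exact: sum_eq_le1.
  by rewrite sum_nat_const_nat subn0 muln1.
have p0 : 0 < 2 ^ t by rewrite expn_gt0.
set S := \sum_(0 <= x < m) _ => hS.
apply: (@leq_trans (D1 * (Kc * (5 * m)) + Kc * (D1 * (2 * 2 ^ t)) * m)).
  by rewrite leq_add2l leq_mul2l hS orbT.
rewrite (_ : D1 * (Kc * (5 * m)) = Kc * (D1 * (m * 5))); last by clear; lia.
rewrite (_ : Kc * (D1 * (2 * 2 ^ t)) * m = Kc * (D1 * (m * (2 * 2 ^ t)))); last by clear; lia.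
rewrite -!mulnDr !leq_mul2l; do 3!(apply/orP; right).
by move: p0; clear; lia.
Qed.

(** The costs of the levels form a geometric sum, dominated by the last block size, which is
    O(m). *)
Lemma w_colour_le : w_colour I Kc <= Kc * (34 * M).
Proof.
rewrite /w_colour (_ : nest 1 degE = 1) // (_ : nest 2 degE = 1) // expn1.
have : \sum_(0 <= t < L) (w_level I Kc t + (Kc + Kc)).+1 <= Kc * (28 * M).
  apply: (@leq_trans (\sum_(0 <= t < L) Kc * (14 * (D1 * m)) * 2 ^ t)).
    apply: leq_sum_nat => t _; rewrite /w_level; have := sum_col_le t.
    have p0 : 0 < 2 ^ t by rewrite expn_gt0.
    set S := \sum_(0 <= c < D1) _.
    rewrite (_ : Kc * (D1 * (m * (7 * 2 ^ t))) = 7 * (Kc * (D1 * m * 2 ^ t))); last by clear; nia.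
    rewrite (_ : Kc * (14 * (D1 * m)) * 2 ^ t = 14 * (Kc * (D1 * m * 2 ^ t))); last by clear; nia.
    have : Kc <= Kc * (D1 * m * 2 ^ t) by rewrite leq_pmulr // !muln_gt0 D1_gt0 m_gt0.
    by move: Kc_gt0; clear; lia.
  rewrite -big_distrr /=.
  apply: (@leq_trans (Kc * (14 * (D1 * m)) * (2 * m))).
    rewrite leq_mul2l; apply/orP; right; apply: leq_trans (sum_pow2 L) _; exact: pow_L.
  rewrite -mulnA leq_mul2l; apply/orP; right; have := D1_M; clear; nia.
have := sq_M; have := M_gt0; move: (\sum_(0 <= t < L) _) Kc_gt0.
move: M (m * m) => M' q; clear=> S K0 M0 qM hS.
have KM : Kc * q <= Kc * M' by rewrite leq_mul2l qM orbT.
nia.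
Qed.

(** Updating the owners costs O(m^2) per phase and there are [D1] phases; the search for an exchange
    costs O(m) per active hyperedge, and a hyperedge is active in at most one phase. *)
Lemma w_phases_le : w_phases I Kc <= Kc * (16 * M).
Proof.
rewrite /w_phases big_nat1.
have : \sum_(0 <= c < D1) (w_best I Kc c + w_one I Kc + Kc).+1 <= Kc * (9 * M).
  apply: (@leq_trans (\sum_(0 <= c < D1) (Kc * (7 * (m * m)) +
      Kc * m * \sum_(0 <= x < m) active I (colt I L) c x))).
    apply: leq_sum_nat => c _; rewrite /w_best wtabE -big_distrl /=.
    have := w_one_le; move: m_gt0 Kc_gt0; set S := \sum_(0 <= x < m) _.
    by clear; nia.
  rewrite big_split /= sum_nat_const_nat subn0 -big_distrr /= exchange_big /=.
  have : \sum_(0 <= x < m) \sum_(0 <= c < D1) active I (colt I L) c x <= m.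
    apply: (@leq_trans (\sum_(0 <= h < m) 1)); last by rewrite sum_nat_const_nat subn0 muln1.
    apply: leq_sum_nat => h _; apply: leq_trans (sum_eq_le1 D1 (colt I L h)).
    by apply: leq_sum_nat => c _; rewrite /active; case: (_ == h); case: (0 < _).
  set S := \sum_(0 <= x < m) _ => hS.
  apply: (@leq_trans (7 * (Kc * (D1 * (m * m))) + Kc * (m * m))).
    apply: leq_add; first by rewrite eq_leq //; clear; lia.
    by rewrite -mulnA !leq_mul2l hS !orbT.
  have h1 : Kc * (D1 * (m * m)) <= Kc * M by rewrite leq_mul2l D1_M orbT.
  have h2 : Kc * (m * m) <= Kc * M by rewrite leq_mul2l sq_M orbT.
  by move: h1 h2; clear; lia.
have mM : m <= M by apply: leq_trans sq_M; rewrite leq_pmulr.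
have := M_gt0; move: (\sum_(0 <= c < D1) _) Kc_gt0 mM.
move: M m => M' m'; clear=> S K0 mM M0 hS.
have KM : Kc * m' <= Kc * M' by rewrite leq_mul2l mM orbT.
nia.
Qed.

Lemma w_alloc_le :
  Kc + (Kc + (Kc + (Kc + (w_alloc I Kc).+1))) <= Kc * ((2 * A + 120) * M).
Proof.
rewrite /w_alloc expn1 muln1.
have mM : m <= M by apply: leq_trans sq_M; rewrite leq_pmulr.
have := w_tables_le; have := w_colour_le; have := w_phases_le; have := M_gt0.
move: (w_tables I Kc) (w_colour I Kc) (w_phases I Kc) Kc_gt0 mM.
move: M A m => M' A' m'; clear=> x y z K0 mM M0 h1 h2 h3.
have KM : Kc * m' <= Kc * M' by rewrite leq_mul2l mM orbT.
nia.
Qed.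

(** All loops have at most [L] times [D1] rounds, and each round has a bounded number of statements
    of depth at most [Dc], itself O(log m). *)
Lemma d_alloc_le :
  Dc + (Dc + (Dc + (Dc + (d_alloc I Dc).+1))) <= Dc * (60 * (L.+1 * D1.+1)).
Proof.
rewrite /d_alloc /d_tables /d_colour /d_level /d_phases.
by move: (L) D1 Dc_gt0; clear; nia.
Qed.

End Costs.

(** * The instance given by the input *)

Lemma leq_sum_widen (F : nat -> nat) a b : a <= b ->
  \sum_(0 <= i < a) F i <= \sum_(0 <= i < b) F i.
Proof.
elim: b => [|b IH]; first by rewrite leqn0 => /eqP ->.
rewrite leq_eqVlt => /orP[/eqP -> //|/IH h].
by apply: leq_trans h _; rewrite [leqRHS]big_nat_recr //= leq_addr.
Qed.

Lemma size_flatten_iota (T : Type) (F : nat -> seq T) N :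
  size (flatten [seq F g | g <- iota 0 N]) = \sum_(0 <= g < N) size (F g).
Proof.
elim: N => [|N IH]; first by rewrite big_geq.
by rewrite -addn1 iotaD map_cat flatten_cat size_cat IH addn1 big_nat_recr //= cats0.
Qed.

Lemma nth_flatten_iota (T : Type) x (F : nat -> seq T) N g a : g < N -> a < size (F g) ->
  nth x (flatten [seq F g | g <- iota 0 N]) (\sum_(0 <= h < g) size (F h) + a) = nth x (F g) a.
Proof.
elim: N => [//|N IH] hg ha.
rewrite -addn1 iotaD map_cat flatten_cat nth_cat size_flatten_iota /= cats0.
move: hg; rewrite ltnS leq_eqVlt => /orP[/eqP <-|hg].
  by rewrite ltnNge leq_addr /= addKn.
rewrite IH // (leq_trans (_ : _ < \sum_(0 <= h < g.+1) size (F h))) //.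
  by rewrite big_nat_recr //= ltn_add2l.
exact: leq_sum_widen.
Qed.

Section Input.
Context (R : realType) (n m : nat) (v : 'I_n -> 'I_m -> R).
Hypothesis v_ge0 : forall i g, (0 <= v i g)%R.

Definition row T (F : 'I_m -> 'I_n -> T) (g : nat) : seq T :=
  if insub g is Some g' then [seq F g' i | i <- enum (hyperedge v g')] else [::].

Lemma rowE T (F : 'I_m -> 'I_n -> T) (g : 'I_m) :
  row F g = [seq F g i | i <- enum (hyperedge v g)].
Proof. by rewrite /row valK. Qed.

Definition agents := row (fun _ i => val i).

Definition input_inst : inst R := Inst n m (fun g => size (agents g))
  (fun g a => nth 0 (agents g) a) (fun g a => nth 0%R (row (fun g' i => v i g') g) a).
Notation I := input_inst.

Lemma size_row T (F : 'I_m -> 'I_n -> T) g : size (row F g) = sz I g.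
Proof. by rewrite /= /agents /row; case: insubP => // g' _ _; rewrite !size_map. Qed.

Lemma sz_input (g : 'I_m) : sz I g = #|hyperedge v g|.
Proof. by rewrite /= /agents rowE size_map cardE. Qed.

Lemma ag_input (g : 'I_m) a : a < sz I g ->
  exists i : 'I_n, [/\ i \in hyperedge v g, ag I g a = i & vl I g a = v i g].
Proof.
rewrite /= /agents !rowE size_map => ha.
have /card_gt0P[i0 _] : 0 < #|hyperedge v g| by rewrite cardE; exact: leq_ltn_trans ha.
by exists (nth i0 (enum (hyperedge v g)) a); rewrite -mem_enum mem_nth // !(nth_map i0).
Qed.

Lemma input_wf : wf_inst I.
Proof.
split=> [g a hg|g a b hg|g a hg].
- by move=> /(ag_input (g := Ordinal hg))[i [_ -> _]] /=.
- rewrite /=; have -> : agents g = [seq val i | i <- enum (hyperedge v (Ordinal hg))].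
    exact: (rowE _ (Ordinal hg)).
  set s := map _ _ => ab hb; have st : sorted ltn s.
    apply: (subseq_sorted ltn_trans _ (iota_ltn_sorted 0 n)).
    by rewrite -val_enum_ord; apply: map_subseq; rewrite [enum 'I_n]enumT; exact: filter_subseq.
  by apply: (sorted_ltn_nth ltn_trans 0 st) => //; rewrite inE //; exact: ltn_trans ab hb.
by move=> /(ag_input (g := Ordinal hg))[i [+ _ ->]] /=; rewrite inE.
Qed.

Lemma same_input (g h : 'I_m) : hyperedge v g = hyperedge v h -> same I g h.
Proof. by move=> E; apply/sameP; rewrite /= /agents !rowE E. Qed.

Lemma off_input k : k <= m -> offset v k = off I k.
Proof.
move=> hk; rewrite /off big_mkord (big_ord_widen m (fun g => sz I g) hk) /offset.
by apply: eq_bigr => g _; rewrite sz_input.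
Qed.

Lemma incidences_input T (F : 'I_m -> 'I_n -> T) :
  [seq F p.2 p.1 | p <- incidences v] = flatten [seq row F g | g <- iota 0 m].
Proof.
rewrite /incidences map_flatten -map_comp -val_enum_ord -map_comp; congr flatten.
by apply: eq_map => g /=; rewrite rowE -map_comp.
Qed.

Lemma off_le : off I m <= n * m.
Proof.
rewrite mulnC /off -[X in _ <= X * n]subn0 -sum_nat_const_nat.
apply: leq_sum_nat => g hg.
by rewrite (sz_input (Ordinal hg)); have := max_card (hyperedge v (Ordinal hg)); rewrite card_ord.
Qed.

Lemma vl_input g a : g < m -> a < sz I g -> rmem (input v) (off I g + a) = vl I g a.
Proof.
move=> hg ha; rewrite /= (incidences_input (fun g i => v i g)).
rewrite (_ : off I g = \sum_(0 <= h < g) size (row (fun g i => v i g) h)); last first.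
  by apply: eq_bigr => h _; rewrite size_row.
by rewrite nth_flatten_iota // size_row.
Qed.

Let tail := [seq offset v k | k <- iota 0 m.+1] ++ [seq val p.1 | p <- incidences v].
Let cells := n :: m :: tail.

Let cellsE : [seq val p.1 | p <- incidences v] = flatten [seq agents g | g <- iota 0 m].
Proof. exact: (incidences_input (fun _ i => val i)). Qed.

Lemma size_cells : size cells = m + 3 + off I m.
Proof.
rewrite /= size_cat size_map size_iota cellsE size_flatten_iota -/(off I m).
by rewrite -/(off I m); clear; lia.
Qed.

Lemma input_offsets k : k <= m -> imem (input v) (2 + k) = off I k.
Proof.
move=> hk; rewrite -[LHS]/(nth 0 tail k) nth_cat size_map size_iota ltnS hk (nth_map 0) ?size_iota //.
by rewrite nth_iota // off_input.
Qed.

Lemma input_agents g a : g < m -> a < sz I g -> imem (input v) (m + 3 + off I g + a) = ag I g a.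
Proof.
move=> hg ha; rewrite /input /imem -/cells (_ : m + 3 + off I g + a = (m.+1 + (off I g + a)).+2); last first.
  by clear; lia.
rewrite -[LHS]/(nth 0 tail (m.+1 + (off I g + a))) nth_cat size_map size_iota ltnNge leq_addr /= addKn cellsE.
exact: nth_flatten_iota.
Qed.

Lemma input_end a : m + 3 + off I m <= a -> imem (input v) a = 0.
Proof. by move=> h; rewrite -[LHS]/(nth 0 cells a) nth_default // size_cells. Qed.

Lemma input_small a : imem (input v) a < X I ^ 2.
Proof.
have X2 : n < X I ^ 2 /\ m < X I ^ 2 /\ n * m < X I ^ 2.
  by rewrite /X /= expnS expn1; clear; nia.
have [nX [mX nmX]] := X2.
case: (ltnP a (size cells)) => h; last first.
  by rewrite /input /imem -/cells nth_default // expn_gt0 ltnW // X_gt1.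
rewrite /input /imem -/cells; move: (mem_nth 0 h); set c := nth _ _ _.
rewrite 2!in_cons mem_cat => /or4P[/eqP -> //|/eqP -> //||].
  move=> /mapP[k]; rewrite mem_iota ltnS /= => hk ->; rewrite off_input //.
  apply: leq_ltn_trans nmX; apply: leq_trans off_le.
  exact: leq_sum_widen.
by move=> /mapP[p _ ->]; exact: ltn_trans (ltn_ord _) nX.
Qed.

Lemma input_contents r : contents I (L I) (X I) (dm r) (H I r) lim0 (imem (input v)).
Proof.
have X1 := X_gt1 I.
have XH : X I ^ 2 <= H I r by rewrite leX // addn2.
have sX : m + 3 + off I m < X I ^ 2.
  by move: (off I m) off_le => o; rewrite /X /= expnS expn1; clear; nia.
split.
- move=> k hk; split; first exact: input_offsets.
  apply: leq_trans XH; apply: leq_trans sX; move: (off I m) hk => o /=; clear; lia.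
- move=> g a hg ha; split; first exact: input_agents.
  apply: leq_trans XH; apply: leq_trans sX; rewrite ltnS -addnA leq_add2l.
  apply: (@leq_trans (off I g.+1)); first by rewrite /off big_nat_recr //= leq_add2l ltnW.
  exact: leq_sum_widen.
- move=> a _; apply: leq_trans (input_small a) _.
  by apply: leX; rewrite /dm addn2.
move=> id t x y z id16 tl _.
have l1 : lim0 id <= 1 by clear; do 11?[case: id => [|id] //].
have t0 : t = 0 by move: tl l1; clear; lia.
have ge : H I r <= addr (H I r) (id + 16 * t) x y z.
  have [i0 _] := andP id16; apply: leq_trans (leq_addr z _); rewrite leq_pmull //.
  by rewrite addn_gt0 muln_gt0 addn_gt0 muln_gt0 addn_gt0 i0 H_gt0.
(* The regions of the tables lie behind the input, hence contain 0; it remains to check that version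
   0 of the families 6, 8 and 10 is null. *)
rewrite input_end; last by apply: leq_trans ge; apply: leq_trans (ltnW sX) XH.
move: tl; rewrite t0 {id16 l1 ge t0}; do 6?[case: id => // id].
case: id => [|id]; first by rewrite /G expn0 modn1.
case: id => // id; case: id => [|id]; first by rewrite /G div0n mod0n.
by case: id => // id; case: id.
Qed.

Lemma rank_input : \max_(0 <= g < m) sz I g = rank v.
Proof.
apply/eqP; rewrite eqn_leq; apply/andP; split.
  apply/bigmax_leqP_seq => g; rewrite mem_index_iota /= => hg _.
  apply: (@leq_trans #|hyperedge v (Ordinal hg)|); first by rewrite -sz_input.
  by apply: (leq_bigmax_cond (F := fun e : {set 'I_n} => #|e|)); exact: imset_f.
apply/bigmax_leqP => e /imsetP[g _ ->]; rewrite -sz_input.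
by apply: (leq_bigmax_seq (F := fun g => sz I g)); rewrite ?mem_index_iota /=.
Qed.

(** Distinct representatives have distinct hyperedges, so the neighbours of a representative inject
    into the hyperedges that meet its own. *)
Lemma degree_input : D1 I <= (edge_degree v).+1.
Proof.
rewrite /D1 add1n ltnS; apply/bigmax_leqP_seq => e; rewrite mem_index_iota /= => he _.
pose e' : 'I_m := Ordinal he.
apply: (@leq_trans #|[set f in hyperedges v |
    (f != hyperedge v e') && (hyperedge v e' :&: f != set0)]|); last first.
  apply: (leq_bigmax_cond
    (F := fun e => #|[set f in hyperedges v | (f != e) && (e :&: f != set0)]|)).
  exact: imset_f.
have inj (f g : 'I_m) : rep I f = f -> rep I g = g -> hyperedge v f = hyperedge v g -> f = g.
  move=> rf rg /same_input; rewrite -rep_eq // rf rg => /eqP; exact: val_inj.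
have adjP (f : 'I_m) : adj I e f -> [/\ rep I e = e, rep I f = f, e != f & 0 < meet I e f].
  by rewrite /adj; case: eqP => // /eqP ne; case: eqP => // re; case: eqP.
have -> : \sum_(0 <= f < m) adj I e f = #|[set f : 'I_m | adj I e f]|.
  rewrite big_mkord -sum1_card big_mkcond [RHS]big_mkcond; apply: eq_bigr => f _.
  by rewrite !inE; case: (adj I e f).
rewrite -(card_in_imset (f := hyperedge v)); last first.
  by move=> f g; rewrite !inE => /adjP[_ rf _ _] /adjP[_ rg _ _]; exact: inj.
apply/subset_leq_card/subsetP => E /imsetP[f]; rewrite inE => /adjP[re rf ne me] ->.
rewrite inE imset_f //=; apply/andP; split.
  by apply: contraNneq ne => /(inj f e' rf re) -> /=.
move: me => /sum_nat_gt0[a ha /sum_nat_gt0[b hb]]; rewrite lt0b => /eqP E2.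
have [i [ie ai _]] := ag_input (g := e') ha; have [j [jf aj _]] := ag_input (g := f) hb.
apply/set0Pn; exists i; rewrite inE ie /=.
have -> : i = j by apply: val_inj; rewrite /= -ai -aj.
exact: jf.
Qed.

Lemma value_input (i : 'I_n) (g : 'I_m) : sval' I i g = v i g.
Proof.
rewrite /sval'; case: (boolP (i \in hyperedge v g)) => [ig|].
  have [a ha E] : exists2 a, a < sz I g & ag I g a = i.
    exists (index i (enum (hyperedge v g))); first by rewrite sz_input cardE index_mem mem_enum.
    rewrite /= /agents rowE (nth_map i) ?nth_index ?index_mem ?mem_enum //.
  have [j [jg aj vj]] := ag_input ha.
  have ij : j = i by apply: val_inj; rewrite /= -aj.
  rewrite (bigD1_seq a) ?iota_uniq //; last by rewrite mem_index_iota.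
  rewrite E eqxx vj ij.
  rewrite big_nat_cond big1 => [|b]; first exact: addr0.
  move=> /andP[/andP[_ hb] ba].
  case: eqP => // E2; case/eqP: ba; apply: (ag_inj input_wf (ltn_ord g)) => //.
  by rewrite E.
rewrite inE lt_neqAle v_ge0 andbT negbK => /eqP v0.
rewrite big_nat_cond big1 -?v0 // => a /andP[/andP[_ ha] _].
have [j [_ aj vj]] := ag_input ha.
by case: eqP => // E; rewrite vj (_ : j = i) //; apply: val_inj; rewrite /= -aj.
Qed.

End Input.

(** * From the table of owners to an EF1 allocation *)

Section Output.
Context (R : realType) (n m : nat) (v : 'I_n -> 'I_m -> R).
Hypothesis n_gt0 : 0 < n.
Hypothesis v_ge0 : forall i g, (0 <= v i g)%R.
Notation I := (input_inst v).
Context (own : nat -> nat).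
Hypothesis own_le : forall g : 'I_m, own g <= n.
Hypothesis own_0 : forall g : 'I_m, own g = 0 -> forall i, v i g = 0%R.
Hypothesis own_ef : forall i j, efpair m (sval' I i) (holds_own own j) (holds_own own i).

Definition alloc : {ffun 'I_m -> 'I_n} :=
  [ffun g : 'I_m => insubd (Ordinal n_gt0) (own g - 1)].

Lemma allocE (g : 'I_m) : alloc g = own g - 1 :> nat.
Proof.
rewrite ffunE val_insubd ifT //; move: (own_le g) n_gt0; clear; lia.
Qed.

(* The goods that nobody values have no owner; they all go to the agent 0. *)
Lemma value_bundle (i j : 'I_n) (p : pred 'I_m) :
  value v i [set g | (alloc g == j) && p g] =
  tot m (sval' I i) (fun g => holds_own own j g && oapp p false (insub g)).
Proof.
rewrite /value /tot big_mkord big_mkcond [RHS]big_mkcond; apply: eq_bigr => g _.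
rewrite inE /holds_own valK /= value_input // -val_eqE /= allocE.
case: (posnP (own g)) => [g0|gp]; last by rewrite addn1 -[in RHS](prednK gp) subn1 eqSS.
by rewrite own_0 //; case: ifP; case: ifP.
Qed.

Lemma alloc_EF1 : EF1 v alloc.
Proof.
move=> i j /set0Pn[s0 s0j].
have bE k : bundle alloc k = [set g | (alloc g == k) && predT g].
  by apply/setP => g; rewrite !inE andbT.
have bD s : bundle alloc j :\ s = [set g | (alloc g == j) && (g != s)].
  by apply/setP => g; rewrite !inE andbC.
have ge0 k : (0 <= value v i (bundle alloc k))%R by apply: sumr_ge0 => g _.
case: (boolP [exists g : 'I_m, own g == j + 1]) => [/existsP[g og]|].
  have [|s [sm sj le]] := @own_ef i j; first by exists (g : nat); [exact: ltn_ord|exact: og].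
  pose s' := Ordinal sm; exists s'.
    rewrite inE -val_eqE /= allocE /=; move: sj; rewrite /holds_own => /eqP ->.
    by rewrite addnK.
  rewrite bD bE !value_bundle; apply: le_trans (le_trans le _).
    rewrite le_eqVlt; apply/orP; left; apply/eqP; apply: eq_tot => h hh.
    by rewrite (insubT (fun h => h < m) hh) /= -val_eqE.
  rewrite le_eqVlt; apply/orP; left; apply/eqP; apply: eq_tot => h hh.
  by rewrite (insubT (fun h => h < m) hh) /= andbT.
(* The bundle of [j] consists of unowned goods only, which are worth 0 to everybody, so any of them
   may be removed. *)
rewrite negb_exists => /forallP no; exists s0 => //.
rewrite bD value_bundle /tot big_nat_cond big1 // => h /andP[/andP[_ hh] /andP[]].
by rewrite /holds_own (negPf (no (Ordinal hh))).
Qed.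

End Output.

(** The extra cost 3 is the initial call and the copy of the result pointer to register 0. *)
Lemma run_main (R : realType) W (n m : nat) (v : 'I_n -> 'I_m -> R) w d
    (Q : (nat -> nat) -> (nat -> nat) -> Prop) (A : {ffun 'I_m -> 'I_n}) :
  triple main_prog W (rmem (input v)) mainS (fun=> 0) (imem (input v)) Q w d ->
  (forall rho mem, Q rho mem -> rho vres < W /\
     forall g : 'I_m, mem (rho vres + g) = A g) ->
  exists2 k, computes main_prog W v A k & work k <= w + 3 /\ depth k <= d + 3.
Proof.
move=> t hQ.
have sb : subproc main_prog 1 (sprocs mainS 1) by move=> i _; rewrite add1n.
have ag : agree predT (fun=> 0) (imem (input v)) (rmem (input v)) (input v) by split.
have [s1 [k1 [rho [mem [E1 w1 d1 [a1 a2 a3] /hQ[rW out]]]]]] := t _ _ sb ag.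
have rv : ireg s1 vres = rho vres by exact: a1.
have hW : ireg s1 vres < W by rewrite rv.
have [s2 [k2 E2 p2] [i2 _ m2 _]] :=
  @Run_mov R main_prog W predT 0 vres 2 s1 isT isT hW.
exists (seq_cost tick (seq_cost k1 k2)); last first.
  by case: p2 => _ _ _ _ h1 h2 _ _ /=; move: w1 d1 h1 h2; clear; lia.
exists (after_call (input v) s2).
  by apply: exec_call; apply: exec_seq E1 E2.
by move=> g; rewrite /= m2 i2 eqxx rv a2.
Qed.

(** * Constants that depend on the rank only *)

Definition logm m := trunc_log 2 m.
(** A common bound for the logarithms of all ranges: constant ranges at most [r0 r], ranges at most
    [4 * m], and [r * (m + 2) ^ r] states. *)
Definition lmc r m := r0 r + r + 3 + (logm m + 2) * r.+1.

Lemma lmc_bounds r m :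
  [/\ r0 r <= 2 ^ lmc r m, 4 * m <= 2 ^ lmc r m & r * (m + 2) ^ r <= 2 ^ lmc r m].
Proof.
have hm : m < 2 ^ (logm m).+1 by exact: trunc_log_ltn.
have le2 a b : a <= b -> 2 ^ a <= 2 ^ b by move=> h; rewrite leq_pexp2l.
split.
- by apply: leq_trans (ltnW (ltn_expl _ (isT : 1 < 2))) _; apply: le2; rewrite /lmc; clear; lia.
- apply: (@leq_trans (2 ^ (logm m + 3))).
    rewrite (_ : logm m + 3 = 2 + (logm m).+1); last by clear; lia.
    by rewrite expnD; apply: leq_mul => //; exact: ltnW.
  by apply: le2; rewrite /lmc; clear; nia.
apply: (@leq_trans (2 ^ (r + (logm m + 2) * r))).
  rewrite expnD expnM; apply: leq_mul; first exact: ltnW (ltn_expl _ _).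
  apply: leq_expl; rewrite (addn2 (logm m)) expnS.
  have : 1 < 2 ^ (logm m).+1 by rewrite -{1}(expn0 2) ltn_exp2l.
  move: hm; clear; lia.
by apply: le2; rewrite /lmc; clear; nia.
Qed.

Definition degc r := smax (@mdeg (dm r) (r0 r) (dv r) false) mainS.
Definition workc r := (r0 r).+1 * (smax (@wkb (r0 r) false) mainS + 200).
Definition depthc r := (smax (@dpb 1 false) mainS + 2) * (r0 r + r + 4 + 3 * r.+1).
Definition Kdepth r m := smax (@dpb 1 false) mainS * (lmc r m).+1 + 2.

Lemma Kdepth_le r m : 1 < m -> Kdepth r m <= depthc r * logm m.
Proof.
move=> m1; have l0 : 0 < logm m by rewrite trunc_log_gt0.
apply: (@leq_trans ((smax (@dpb 1 false) mainS + 2) * (lmc r m).+1)).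
  by rewrite /Kdepth; move: (smax _ _) => a; clear; nia.
rewrite /depthc -mulnA leq_mul2l; apply/orP; right; rewrite /lmc.
by move: (r0 r) l0; clear; nia.
Qed.

(** The three factors are O(l), O(l) and O(d), so the depth is in fact O(d l^2); since [l] is
    positive, [l ^ 4] is a weaker bound. The constant is 540 = 60 * 3 * 3. *)
Lemma depth_final a l K N D d : 0 < l -> 0 < d -> K <= a * l -> N.+1 <= 3 * l ->
  D.+1 <= 3 * d -> K * (60 * (N.+1 * D.+1)) + 3 <= (540 * a + 3) * (d * l ^ 4).
Proof.
move=> l0 d0 hK hN hD.
have h : K * (60 * (N.+1 * D.+1)) <= a * l * (60 * (3 * l * (3 * d))).
  by apply: leq_mul => //; rewrite leq_mul2l; apply: leq_mul.
apply: leq_trans (_ : a * l * (60 * (3 * l * (3 * d))) + 3 <= _); first by rewrite leq_add2r.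
have E : a * l * (60 * (3 * l * (3 * d))) = 540 * a * (d * (l * l)) by clear; lia.
rewrite E mulnDl; apply: leq_add.
  by apply: leq_mul => //; apply: leq_mul => //; rewrite mulnn leq_pexp2l.
by rewrite leq_pmulr // muln_gt0 d0 expn_gt0 l0.
Qed.

Lemma leq_pow4 l d : 0 < l -> 0 < d -> l <= d * l ^ 4.
Proof.
by move=> l0 d0; rewrite expnS mulnCA leq_pmulr // muln_gt0 d0 expn_gt0 l0.
Qed.

Lemma work_final K A M : 0 < M -> K * (A * M) + 3 <= (K * A + 3) * M.
Proof. by move=> M0; rewrite mulnDl mulnA leq_add2l leq_pmulr. Qed.

Lemma unvalued (R : realType) (n m : nat) (v : 'I_n -> 'I_m -> R) (g : 'I_m) i :
  (forall i g, (0 <= v i g)%R) -> sz (input_inst v) g = 0 -> v i g = 0%R.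
Proof.
move=> v0 /eqP; rewrite sz_input cards_eq0 => /eqP E.
apply/eqP; rewrite -[_ == _]negbK; apply/negP => ne.
have : i \in hyperedge v g by rewrite inE lt_neqAle eq_sym ne v0.
by rewrite E inE.
Qed.

Lemma rank_le (R : realType) (n m : nat) (v : 'I_n -> 'I_m -> R) : rank v <= n.
Proof. by apply/bigmax_leqP => e _; apply: leq_trans (max_card _) _; rewrite card_ord. Qed.

Lemma leq_sum_term (F : nat -> nat) N g : g < N -> F g <= \sum_(0 <= h < N) F h.
Proof.
move=> h; apply: leq_trans (leq_sum_widen F h).
by rewrite big_nat_recr //= leq_addl.
Qed.

Lemma leq_sum4 a b c d : [/\ a <= a + b + c + d, b <= a + b + c + d,
  c <= a + b + c + d & d <= a + b + c + d].
Proof. by split; clear; lia. Qed.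

Lemma off_pos (R : realType) (I : inst R) N : 0 < off I N -> 0 < N.
Proof. by case: N => //; rewrite /off big_geq. Qed.

Lemma L_logm (R : realType) (I : inst R) : 1 < nG I -> (L I).+1 <= 3 * logm (nG I).
Proof.
move=> m1; have l0 : 0 < logm (nG I) by rewrite trunc_log_gt0.
have : L I <= (logm (nG I)).+1.
  by rewrite /L up_log_trunc_log // ltnS; apply: leq_trunc_log; exact: leq_pred.
by move: l0; clear; lia.
Qed.

Lemma fits_main (R : realType) (I : inst R) r m W : X I ^ degc r <= W ->
  fits I r (lmc r m) W (workc r) (Kdepth r m) mainS.
Proof. by move=> h; split; [exact: h|exact: leqnn|exact: leqnn]. Qed.

Lemma workc_gt0 r : 0 < workc r.
Proof. by rewrite /workc muln_gt0 ltn_addl. Qed.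

Lemma depthc_gt0 r : 0 < depthc r.
Proof. by rewrite /depthc; move: (smax _ _) (r0 r); clear; nia. Qed.

Lemma Kdepth_gt0 r m : 0 < Kdepth r m.
Proof. by rewrite /Kdepth ltn_addl. Qed.

(* The maximum over the expressions of the program must not be computed. *)
Opaque degc workc depthc Kdepth.

Theorem theorem32 (R : realType) :
  exists P : program,
  forall r : nat,
  exists C : nat,
  forall (n m Delta : nat) (v : 'I_n -> 'I_m -> R),
    0 < n ->
    (forall i g, (0 <= v i g)%R) ->
    rank v = r ->
    edge_degree v <= Delta ->
    exists (A : {ffun 'I_m -> 'I_n}) (k : cost),
      [/\ EF1 v A,
          computes P ((n + m + 2) ^ C) v A k
        & 1 < m -> 0 < Delta ->
          depth k <= C * (Delta * trunc_log 2 m ^ 4) /\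
          work k <= C * m ^ r.+1].
Proof.
exists main_prog => r.
pose Cw := workc r * (2 * (r * 3 ^ r) + 120) + 3; pose Cd := 540 * depthc r + 3.
(* A single [C] serves as the exponent of the word size and as the constant of both bounds, hence
   the sum. *)
exists (degc r + dvc r + Cw + Cd) => n m Delta v n0 v0 rv dv_.
have [C1 C2 C3 C4] := leq_sum4 (degc r) (dvc r) Cw Cd.
move: (degc r + dvc r + Cw + Cd) C1 C2 C3 C4 => C C1 C2 C3 C4; set W := (n + m + 2) ^ C.
pose I := input_inst v; have wfI : wf_inst I := input_wf v.
have [lm1 lm2 lm3] := lmc_bounds r m.
have ft : fits I r (lmc r m) W (workc r) (Kdepth r m) mainS.
  by apply: fits_main; exact: (leX I).
have dW a : a < X I ^ dvc r -> a < W.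
  move=> h; apply: leq_trans h _; exact: (leX I).
have ct := input_contents v r.
have mn : imem (input v) 0 = n by [].
have mm : imem (input v) 1 = m by [].
have K0 := workc_gt0 r.
have d0 := depthc_gt0 r.
case: (posnP (off I m)) => [o0|o0].
  have own0 (g : 'I_m) : (fun=> 0 : nat) g = 0 :> nat -> forall i, v i g = 0%R.
    move=> _ i; apply: unvalued v0 _; apply/eqP; rewrite -leqn0.
    by have := leq_sum_term (sz I) (ltn_ord g); rewrite -/(off I m) o0.
  have t := t_empty (P := main_prog) (rm := rmem (input v)) lm1 ft mn mm ct o0.
  have [|k Ck [wk_ dk]] := run_main (A := alloc m n0 (fun=> 0)) t.
    move=> rho mem [b vr ->]; split; first exact: dW.
    move=> g; have -> : alloc m n0 (fun=> 0) g = 0 :> nat by exact: allocE.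
    by rewrite vr; apply: input_end; rewrite o0 addn0; exact: leq_addr.
  exists (alloc m n0 (fun=> 0)), k; split; [|exact: Ck|move=> m1 D0].
    apply: alloc_EF1; [exact: v0|by []|exact: own0|].
    by move=> i j [g _]; rewrite /holds_own addn1.
  have l0 : 0 < logm m by rewrite trunc_log_gt0.
  have hK := Kdepth_le r m1; split.
    apply: leq_trans dk _; apply: (@leq_trans (Cd * (Delta * logm m ^ 4))); last first.
      by rewrite leq_mul2r C4 orbT.
    apply: (@leq_trans (Cd * logm m)).
      by rewrite /Cd; move: (Kdepth r m) (depthc r) (logm m) hK l0 d0; clear; nia.
    by apply: leq_mul; [exact: leqnn|exact: leq_pow4].
  apply: leq_trans wk_ _; apply: (@leq_trans (Cw * m ^ r.+1)); last first.
    by rewrite leq_mul2r C3 orbT.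
  apply: (@leq_trans Cw); last by apply: leq_pmulr; rewrite expn_gt0 (ltnW m1).
  by rewrite /Cw; move: (workc r) (r * 3 ^ r) K0; clear; nia.
have m0 : 0 < m := off_pos o0.
have hr : \max_(0 <= g < m) sz I g = r by rewrite rank_input.
have szr g : g < m -> sz I g <= r.
  by move=> hg; rewrite -hr; apply: (leq_bigmax_seq (F := sz I)); rewrite ?mem_index_iota.
have r0_ : 0 < r.
  move: o0 => /sum_nat_gt0[g hg s0]; exact: leq_trans s0 (szr g hg).
have rn : r <= n by rewrite -rv rank_le.
pose own := ow I (colt I (L I)) (D1 I).
have fr : fair I (colt I (L I)) (D1 I) own := col_fair wfI (D1 I).
have t := t_alloc (P := main_prog) wfI szr r0_ rn m0 (vl_input (v := v)) lm1 lm2 lm3 ft mn mm ct hr.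
have own_le (g : 'I_m) : own g <= n by case: fr => h _ _; exact: h (ltn_ord g).
have [|k Ck [wk_ dk]] := run_main (A := alloc m n0 own) t.
  move=> rho mem [b out]; split; first exact: dW.
  by move=> g; rewrite (allocE n0 own_le g); exact: out (ltn_ord g).
exists (alloc m n0 own), k; split; [|exact: Ck|move=> m1 D0].
  apply: alloc_EF1; [exact: v0|exact: own_le| |].
    move=> g og i; apply: (unvalued _ v0); case: fr => _ h _.
    (* After [D1] phases every colour has been processed, so a good without owner belongs to no
       agent's positive values. *)
    have := h g (ltn_ord g); rewrite og eqxx => /esym/negbT; rewrite negb_and => /orP[|/negP[]].
      by rewrite lt0n negbK => /eqP.
    by case: (colt_proper I (L I)) => hc _; apply: hc; apply: rep_lt; exact: ltn_ord.
  by case: fr.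
have l0 : 0 < logm m by rewrite trunc_log_gt0.
have hK := Kdepth_le r m1; have Kd0 := Kdepth_gt0 r m.
split.
  apply: leq_trans dk _; apply: (@leq_trans (Cd * (Delta * logm m ^ 4))); last first.
    by rewrite leq_mul2r C4 orbT.
  apply: leq_trans (_ : Kdepth r m * (60 * ((L I).+1 * (D1 I).+1)) + 3 <= _).
    by rewrite leq_add2r; exact: d_alloc_le.
  apply: depth_final; [exact: l0|exact: D0|exact: hK| |].
    exact: (L_logm (I := I) m1).
  (* [D1] is at most [Delta + 1], and [Delta + 2 <= 3 * Delta] as [Delta] is positive. *)
  have := degree_input v; move: dv_ D0; rewrite -/I; clear; lia.
apply: leq_trans wk_ _; apply: (@leq_trans (Cw * m ^ r.+1)); last first.
  by rewrite leq_mul2r C3 orbT.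
apply: (@leq_trans (workc r * ((2 * (r * 3 ^ r) + 120) * m ^ r.+1) + 3)); last first.
  by apply: work_final; rewrite expn_gt0 m0.
by rewrite leq_add2r; apply: w_alloc_le.
Qed.
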